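(* Let $1<p<\infty$, $m>0$ (a real number), and let $q=ab$, where $a\in L_r(\mathbb{R}^n)$, $b\in L_s(\mathbb{R}^n)$ for $r,s$ satisfying $0<r\le\infty$, $0<s\le\infty$, $2^{-1}-p^{-1}\le r^{-1}\le1-p^{-1}$, $-2^{-1}+p^{-1}\le s^{-1}\le p^{-1}$ and $r^{-1}+s^{-1}<2m/n$. Let $H_{m,q}$ be the operator in $L_p(\mathbb{R}^n)$ associated with $(-\Delta)^m+q$ and the factorization $q=ab$. Then every eigenvalue $\lambda\in\mathbb{C}\setminus[0,\infty)$ of $H_{m,q}$ satisfies $$|\lambda|^{\alpha-\frac{n}{2m}}\le C(n,m,\alpha,\theta)\,\|a\|_r^{\alpha}\,\|b\|_s^{\alpha},$$ where $\alpha=(r^{-1}+s^{-1})^{-1}$, $\lambda=|\lambda|e^{i\theta}$ with $0<\theta<2\pi$, $$C(n,m,\alpha,\theta)=(4\pi)^{-n/2}\,\bigl(m\,\Gamma(n/2)\bigr)^{-1}I_m(n,\alpha,\theta),$$ and $$I_m(n,\alpha,\theta)=(2\sin\theta)^{\frac{\alpha}{2}-\frac12}\,\Gamma\!\left(\frac{\alpha}{2}+\frac12\right)B\!\left(\frac{n}{2m},\,\alpha-\frac{n}{2m}\right)P^{\,1/2-\alpha/2}_{\,n/2m-\alpha/2-1/2}(-\cos\theta).$$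
   Context: $\Gamma$ is the gamma function, $B(x,y)=\int_0^1t^{x-1}(1-t)^{y-1}\,dt$ is the beta function, and $1/\infty=0$. In subscripts, $n/2m$ means $n/(2m)$. $P_\nu^{\mu}(z)$, $-1\le z\le1$, denotes the spherical function (associated Legendre function) of the first kind of degree $\nu$ (subscript) and order $\mu$ (superscript). $\|\cdot\|_r$ denotes the usual $L_r(\mathbb{R}^n)$ norm (quasi-norm if $r<1$). For $1<p<\infty$, $p'$ is defined by $1/p+1/p'=1$. The potential $q=ab$ is a product of complex-valued measurable functions $a,b$ on $\mathbb{R}^n$. $H_0=(-\Delta)^m$ is the operator in $L_p(\mathbb{R}^n)$ with domain the Sobolev space $W_p^{2m}(\mathbb{R}^n)$ acting, on the Fourier side, as multiplication by $|\xi|^{2m}$; $A$ and $B$ (as operators) are multiplication by $a$ and $b$ in $L_p(\mathbb{R}^n)$ with maximal domains. For $u\in L_{p,\mathrm{loc}}(\mathbb{R}^n)$ put $M_{\nu,p}(u)=\sup_{x}\int_{|x-y|<1}|u(y)|^p|x-y|^{\nu-n}\,dy$. Standing assumptions: for some $0<\kappa<m$ one has $M_{\nu,p'}(a)<\infty$ for some $0<\nu<p'\kappa$ and $M_{\mu,p}(b)<\infty$ for some $0<\mu<p(m-\kappa)$; and $\int_{|x-y|<1}|q(y)|\,dy\to0$ as $|x|\to\infty$. Under these assumptions, for $z\in\mathbb{C}\setminus[0,\infty)$ the operator $B(H_0-z)^{-1}A$ is densely defined and has a unique bounded extension $Q(z)$ to $L_p(\mathbb{R}^n)$, which is compact, and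 $H_0+AB$ admits a closed extension $H_{m,q}$ with $\sigma_{ess}(H_{m,q})=\sigma_{ess}(H_0)=[0,\infty)$ such that $\lambda\in\mathbb{C}\setminus[0,\infty)$ is an eigenvalue of $H_{m,q}$ if and only if $-1$ is an eigenvalue of $Q(\lambda)$. This $H_{m,q}$ is the operator associated with $(-\Delta)^m+q$ and the factorization $q=ab$.
   Formalization: In I_m the misprinted factor (2 sin θ)^{α/2-1/2}, which makes the bound false at θ=π for α>1, is replaced by 2^{α/2-1/2}|sin θ|^{1/2-α/2}; at θ=π the limit B(n/2m, α-n/2m) is used; r=s=∞ (where α=∞) is excluded. *)

(* Defs.v *)
From HB Require Import structures.
From mathcomp Require Import all_boot all_order all_algebra.
From mathcomp Require Import complex.
From mathcomp Require Import all_classical all_reals all_analysis.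

Set Implicit Arguments.
Unset Strict Implicit.
Unset Printing Implicit Defensive.

Import Order.TTheory GRing.Theory Num.Theory.
Import numFieldNormedType.Exports.

Local Open Scope classical_set_scope.
Local Open Scope ring_scope.

Notation cmod := ComplexField.Normc.normc.
Notation Cre := complex.Re.
Notation Cim := complex.Im.

Section LebesgueMeasure.
Variable R : realType.

Definition tcons n (x : R * n.-tuple R) : n.+1.-tuple R :=
  [tuple of x.1 :: x.2].

Lemma measurable_tcons n : measurable_fun [set: R * n.-tuple R] (@tcons n).
Proof.
by apply: measurable_cons; [exact: measurable_fst|exact: measurable_snd].
Qed.

Definition leb_step n (m : {measure set (n.-tuple R) -> \bar R}) :
    {measure set (n.+1.-tuple R) -> \bar R} :=
  measure_function_pushforward__canonical__measure_function_Measure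
    (@lebesgue_measure R \x^ m)%E (@measurable_tcons n).

Fixpoint leb n : {measure set (n.-tuple R) -> \bar R} :=
  if n is n'.+1 then leb_step (leb n') else \d_ [tuple].

Lemma leb_box n (A : 'I_n -> set R) : (forall i, measurable (A i)) ->
  leb n [set x | forall i, A i (tnth x i)]
  = (\prod_(i < n) @lebesgue_measure R (A i))%E.
Proof.
elim: n A => [|n IH] A mA.
  rewrite big_ord0 /= diracE mem_set//.
  by case.
rewrite big_ord_recl /= /pushforward -IH//.
have mB : measurable [set x : n.-tuple R | forall i, A (lift ord0 i) (tnth x i)].
  rewrite [X in measurable X](_ : _ =
     \bigcap_(i in [set: 'I_n]) ((@tnth n R)^~ i @^-1` (A (lift ord0 i)))).
    apply: fin_bigcap_measurable => // i _.
    by rewrite -[X in measurable X]setTI; exact: measurable_tnth.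
  by apply/seteqP; split => x /= H i; [move=> _|]; apply: H.
rewrite -product_measure2E//; last exact: (mA ord0).
rewrite (_ : _ @^-1` _ = A ord0 `*`
    [set x : n.-tuple R | forall i, A (lift ord0 i) (tnth x i)])//.
apply/seteqP; split => -[x y] /= H.
  split; first by have := H ord0; rewrite tnth0.
  by move=> i; have := H (lift ord0 i); rewrite tnthS.
case: H => H1 H2 i; case: (unliftP ord0 i) => [j ->|->].
  by rewrite tnthS.
by rewrite tnth0.
Qed.

End LebesgueMeasure.

Section FunctionSpaces.
Variables (R : realType) (n : nat).
Local Notation C := R[i].
Local Notation Rn := (n.-tuple R).
Local Notation mu := (leb R n).

Definition dotp (x y : Rn) : R := \sum_(i < n) tnth x i * tnth y i.
Definition enorm (x : Rn) : R := Num.sqrt (dotp x x).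
Definition edist (x y : Rn) : R :=
  Num.sqrt (\sum_(i < n) (tnth x i - tnth y i) ^+ 2).

Definition cmeasurable (f : Rn -> C) : Prop :=
  measurable_fun [set: Rn] (fun x => Cre (f x)) /\
  measurable_fun [set: Rn] (fun x => Cim (f x)).

Definition cintegral (f : Rn -> C) : C :=
  Complex (\int[mu]_(x in [set: Rn]) Cre (f x))
          (\int[mu]_(x in [set: Rn]) Cim (f x)).

Definition cnorm (r : \bar R) (f : Rn -> C) : \bar R :=
  Lnorm mu r (fun x => (cmod (f x))%:E).

(* Elements of L_r are handled through representatives; equality in L_r is
   [aeq]. *)
Definition Lp (r : \bar R) (f : Rn -> C) : Prop :=
  cmeasurable f /\ (cnorm r f < +oo)%E.

Definition aeq (f g : Rn -> C) : Prop := {ae mu, forall x, f x = g x}.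

(* 1 / r, with 1 / oo = 0. *)
Definition einv (r : \bar R) : R := if r is r'%:E then r'^-1 else 0.

Definition dual_exp (p : R) : R := (1 - p^-1)^-1.

(* M_{nu,p}(u) *)
Definition Mfun (nu p : R) (u : Rn -> C) : \bar R :=
  ereal_sup [set (\int[mu]_(y in [set y : Rn | (edist x y < 1)%R])
     (cmod (u y) `^ p * edist x y `^ (nu - n%:R))%:E)%E | x in [set: Rn]].

Definition standing_assumptions (p m : R) (a b q : Rn -> C) : Prop :=
  (exists kappa : R, [/\ 0 < kappa < m,
     exists nu : R, 0 < nu < dual_exp p * kappa /\
       (Mfun nu (dual_exp p) a < +oo)%E &
     exists nu : R, 0 < nu < p * (m - kappa) /\
       (Mfun nu p b < +oo)%E]) /\
  (forall e : R, 0 < e -> exists N : R, forall x : Rn, N < enorm x ->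
     (\int[mu]_(y in [set y : Rn | (edist x y < 1)%R]) (cmod (q y))%:E
       < e%:E)%E).

Definition upd (x : Rn) (i : 'I_n) (t : R) : Rn :=
  [tuple if j == i then t else tnth x j | j < n].

Definition partial (i : 'I_n) (f : Rn -> R) (x : Rn) : R :=
  derive1 (fun t : R => f (upd x i t)) (tnth x i).

Definition partials (s : seq 'I_n) (f : Rn -> R) : Rn -> R :=
  foldr partial f s.

(* Existence and boundedness of all iterated partial derivatives makes them
   Lipschitz, so that f is smooth. *)
Definition schwartzR (f : Rn -> R) : Prop :=
  forall s : seq 'I_n,
    (forall (i : 'I_n) (x : Rn),
       derivable (fun t : R => partials s f (upd x i t)) (tnth x i) 1) /\
    (forall k : nat, exists M : R, forall x : Rn,
       enorm x ^+ k * `|partials s f x| <= M).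

Definition schwartz (f : Rn -> C) : Prop :=
  schwartzR (fun x => Cre (f x)) /\ schwartzR (fun x => Cim (f x)).

Definition fourier (f : Rn -> C) (x : Rn) : C :=
  cintegral (fun xi => Complex (cos (dotp x xi)) (- sin (dotp x xi)) * f xi).

(* The Fourier transform of f is sigma times that of u, in the sense of
   tempered distributions: <f^, psi> = <f, psi^> and
   <sigma u^, psi> = <u, (sigma psi)^>.  For the symbols used below,
   (sigma psi)^ is bounded and integrable, so the last pairing makes sense for
   u in L_p even when sigma is not smooth at the origin.  The normalization of
   the Fourier transform is irrelevant here. *)
Definition fourier_mult (sigma : Rn -> R) (u f : Rn -> C) : Prop :=
  forall psi, schwartz psi ->
    cintegral (fun x => f x * fourier psi x) =
    cintegral (fun x => u x * fourier (fun xi => (sigma xi)%:C%C * psi xi) x).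

(* W_p^s for real s (Bessel potential space). *)
Definition sobolev (s p : R) (u : Rn -> C) : Prop :=
  Lp p%:E u /\ exists2 f, Lp p%:E f &
    fourier_mult (fun xi => (1 + enorm xi ^+ 2) `^ (s / 2)) u f.

End FunctionSpaces.

(* Linear operators in L_p, given by their graphs: T u f means that u is in
   the domain of T and T u = f. *)
Section Operators.
Variables (R : realType) (n : nat) (p : R).
Local Notation C := R[i].
Local Notation Rn := (n.-tuple R).
Local Notation V := (Rn -> C).
Local Notation op := (V -> V -> Prop).
Local Notation Lp := (@Lp R n p%:E).
Local Notation norm := (@cnorm R n p%:E).

Definition vsub (u v : V) : V := fun x => u x - v x.

Record is_operator (T : op) : Prop := IsOperator {
  op_Lp : forall u f, T u f -> Lp u /\ Lp f ;
  op_ae : forall u f v g, T u f -> aeq u v -> aeq f g ->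
    Lp v -> Lp g -> T v g ;
  op_fun : forall u f g, T u f -> T u g -> aeq f g ;
  op_0 : T (fun=> 0) (fun=> 0) ;
  op_lin : forall (c : C) u f v g, T u f -> T v g ->
    T (fun x => c * u x + v x) (fun x => c * f x + g x) }.

Definition op_le (S T : op) : Prop := forall u f, S u f -> T u f.

Definition Lp_cvg (u : nat -> V) (v : V) : Prop :=
  (fun k => norm (vsub (u k) v)) @ \oo --> 0%E.

Definition op_closed (T : op) : Prop :=
  forall (u f : nat -> V) (v g : V), (forall k, T (u k) (f k)) ->
    Lp v -> Lp g -> Lp_cvg u v -> Lp_cvg f g -> T v g.

Definition densely_defined (T : op) : Prop :=
  forall u, Lp u -> forall e : R, 0 < e ->
    exists v f, T v f /\ (norm (vsub u v) < e%:E)%E.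

Definition bounded_op (T : op) : Prop :=
  [/\ is_operator T,
      forall u, Lp u -> exists f, T u f &
      exists M : R, forall u f, T u f -> (norm f <= M%:E * norm u)%E].

Definition eigenvalue_op (T : op) (z : C) : Prop :=
  exists u : V, ~ aeq u (fun=> 0) /\ T u (fun x => z * u x).

Definition op_add (S T : op) : op := fun u h =>
  Lp h /\ exists f g, [/\ S u f, T u g & aeq h (fun x => f x + g x)].

Definition op_comp (S T : op) : op := fun u g => exists2 f, T u f & S f g.

Definition op_inv (T : op) : op := fun f u => T u f.

(* T - z *)
Definition op_shift (T : op) (z : C) : op := fun u g =>
  Lp g /\ exists2 f, T u f & aeq g (fun x => f x - z * u x).

Definition op_mul (a : V) : op := fun u f =>
  [/\ Lp u, Lp f & aeq f (fun x => a x * u x)].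

Definition fin_dim_ker (T : op) : Prop :=
  exists (k : nat) (e : 'I_k -> V), forall u, T u (fun=> 0) ->
    exists c : 'I_k -> C, aeq u (fun x => \sum_(i < k) c i * e i x).

Definition fin_codim_ran (T : op) : Prop :=
  exists (k : nat) (e : 'I_k -> V), (forall i, Lp (e i)) /\
    forall f, Lp f -> exists u g (c : 'I_k -> C),
      T u g /\ aeq f (fun x => g x + \sum_(i < k) c i * e i x).

(* For closed T, finite codimension of the range implies that it is closed. *)
Definition fredholm (T : op) : Prop := fin_dim_ker T /\ fin_codim_ran T.

Definition ess_spectrum (T : op) : set C :=
  [set z | ~ fredholm (op_shift T z)].

Definition nonneg_axis : set C := [set z | Cim z = 0 /\ 0 <= Cre z].

Definition H0 (m : R) : op := fun u f =>
  [/\ sobolev (2 * m) p u, Lp f & fourier_mult (fun xi => enorm xi `^ (2 * m)) u f].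

(* B (H_0 - z)^-1 A *)
Definition BRA (m : R) (a b : V) (z : C) : op :=
  op_comp (op_mul b) (op_comp (op_inv (op_shift (H0 m) z)) (op_mul a)).

(* Q is the (unique) bounded extension Q(z) of B (H_0 - z)^-1 A. *)
Definition is_Q (m : R) (a b : V) (z : C) (Q : op) : Prop :=
  [/\ densely_defined (BRA m a b z), bounded_op Q & op_le (BRA m a b z) Q].

(* H is the operator H_{m,q} associated with (-Delta)^m + q and the
   factorization q = ab. *)
Record associated (m : R) (a b : V) (H : op) : Prop := Associated {
  assoc_op : is_operator H ;
  assoc_closed : op_closed H ;
  assoc_ext : op_le (op_add (H0 m) (op_comp (op_mul a) (op_mul b))) H ;
  assoc_ess : ess_spectrum H = nonneg_axis ;
  assoc_eig : forall z : C, ~ nonneg_axis z ->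
    exists Q : op, is_Q m a b z Q /\
      (eigenvalue_op H z <-> eigenvalue_op Q (-1)) }.

End Operators.

Section SpecialFunctions.
Variable R : realType.
Local Notation leb1 := (@lebesgue_measure R).

Definition Gamma (x : R) : R :=
  \int[leb1]_(t in `]0, +oo[) (t `^ (x - 1) * expR (- t)).

Definition Beta (x y : R) : R :=
  \int[leb1]_(t in `[0, 1]) (t `^ (x - 1) * (1 - t) `^ (y - 1)).

Definition pochhammer (a : R) (k : nat) : R := \prod_(i < k) (a + i%:R).

Definition hyp2F1 (a b c z : R) : R :=
  limn (series (fun k => pochhammer a k * pochhammer b k
                         / (pochhammer c k * k`!%:R) * z ^+ k)).

(* P_nu^mu on the cut, Hobson's definition.  It is only used for mu <= 0, so
   that the integral defining Gamma (1 - mu) converges; the value at x = 1 is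
   then the limit one, 0 if mu < 0 and 1 if mu = 0, since 2 / 0 = 0 and
   0 `^ 0 = 1. *)
Definition legendreP (nu mu x : R) : R :=
  (Gamma (1 - mu))^-1 * ((1 + x) / (1 - x)) `^ (mu / 2)
  * hyp2F1 (- nu) (nu + 1) (1 - mu) ((1 - x) / 2).

(* For k = n / (2m) this is
     2^(alpha/2-1/2) |sin theta|^(1/2-alpha/2) Gamma(alpha/2+1/2)
       B(k, alpha-k) P_{k-alpha/2-1/2}^{1/2-alpha/2}(-cos theta)
     = int_0^oo t^(k-1) (t^2 - 2 t cos theta + 1)^(-alpha/2) dt.
   The prefactor is also found in print as (2 sin theta)^(alpha/2-1/2); that is
   a misprint for alpha <> 1 (for alpha = 2, k = 1 the integral is
   (pi-theta)/sin(pi-theta), and the misprinted formula drops the denominator),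
   and it would make the expression vanish at theta = pi when alpha > 1.  The
   formula is 0/0 at theta = pi for alpha > 1; its limit B(k, alpha-k) is used
   there. *)
Definition I_m (n : nat) (m alpha theta : R) : R :=
  let k := n%:R / (2 * m) in
  if theta == pi then Beta k (alpha - k)
  else 2 `^ (alpha / 2 - 2^-1) * `|sin theta| `^ (2^-1 - alpha / 2)
       * Gamma (alpha / 2 + 2^-1) * Beta k (alpha - k)
       * legendreP (k - alpha / 2 - 2^-1) (2^-1 - alpha / 2) (- cos theta).

Definition constC (n : nat) (m alpha theta : R) : R :=
  (4 * pi) `^ (- (n%:R / 2)) * (m * Gamma (n%:R / 2))^-1
  * I_m n m alpha theta.

End SpecialFunctions.

(* Main.v *)
(* If lam is an eigenvalue then -1 is an eigenvalue of Q(lam), so that the norm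
   of Q(lam) is at least 1; it suffices to bound b (H_0 - lam)^-1 a on L_p.
   With f = a v and (H_0 - lam) g = f, duality reduces this to the pairings of
   b g with functions k.  Write sigma = (|x|^(2m) - lam)^-1.  Hausdorff-Young
   applied to f and to b k (the conditions on r and s say that the exponents are
   in its range), and Hoelder's inequality with sigma in L_alpha, give
     1 <= (2 pi)^(-n/alpha) ||sigma||_alpha ||a||_r ||b||_s.
   The equation for g is only available against Fourier transforms of Schwartz
   functions.  It is tested with sigma(x) exp(- sum_j (d |x_j| + e / |x_j|)),
   times a character: the weight vanishes to infinite order on the coordinate
   hyperplanes, which makes the singularity of |x|^(2m) at 0 harmless.  As e -> 0
   the transforms of the weights become products of Poisson kernels, which form
   an approximate identity as d -> 0.

   The measure of {|x|^(2m) < u} is a multiple of u^k, k = n/(2m), so that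
   ||sigma||_alpha^alpha is a multiple of
     int_0^oo t^(k-1) (t^2 - 2 t cos theta + 1)^(-alpha/2) dt.
   Here t^2 - 2 t cos theta + 1 = (1+t)^2 - 4 w t with w = (1 + cos theta)/2.
   Expanding in powers of 4 w t/(1+t)^2 gives
     B(k, alpha-k) 2F1(k, alpha-k; (alpha+1)/2; w),
   and Euler's transformation of 2F1 yields the Legendre function. *)

Require Import Defs.
From HB Require Import structures.
From mathcomp Require Import all_boot all_order all_algebra.
From mathcomp Require Import complex.
From mathcomp Require Import all_classical all_reals all_analysis.
From mathcomp Require Import measurable_realfun ess_sup_inf.
From mathcomp Require Import ring lra.

Set Implicit Arguments.
Unset Strict Implicit.
Unset Printing Implicit Defensive.

Import Order.TTheory GRing.Theory Num.Theory.
Import numFieldNormedType.Exports.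

Local Open Scope classical_set_scope.
Local Open Scope ring_scope.

(** * Complex-valued functions and their integrals *)

Section ComplexNumbers.
Variable R : realType.
Local Notation C := R[i].
Implicit Types z w : C.

(** The hypotheses are weak exactly where they are used. [Q] is known only as a bounded extension of
    [B (H_0 - lam)^-1 A], so an eigenfunction need not lie in the domain of the latter; the bound is
    proved on that domain and carried over by density. The equation for [g] is distributional, so
    [g] is recovered only weakly, against bounded functions supported in a cube. Norms are indexed
    by reciprocal exponents, which treats infinite [r] or [s] uniformly. Put [w = 1/p - 1/s] and
    [t = 1/r + 1/p = 1/alpha + w]; the hypotheses say [0 <= w <= 1/2 <= t <= 1]. The two
    Hausdorff-Young constants [(2 pi)^(n w)] and [(2 pi)^(n (1 - t))], divided by the mass
    [(2 pi)^n] of the Poisson kernel, leave [(2 pi)^(-n/alpha)]. Hausdorff-Young is obtained by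
    interpolation without holomorphy: for integrals of [A e^(L z)] with bounded [L] the discrete
    Laplacian is explicit, and a maximum principle for it suffices. Polar coordinates are replaced
    by a comparison of two integrals with the same homogeneity. *)

Lemma cmodE z : cmod z = Num.sqrt (Cre z ^+ 2 + Cim z ^+ 2).
Proof. by case: z. Qed.

Lemma cmod_ge0 z : 0 <= cmod z.
Proof. by rewrite cmodE sqrtr_ge0. Qed.

Lemma cmod0 : cmod (0 : C) = 0.
Proof. by rewrite cmodE /= expr0n addr0 sqrtr0. Qed.

Lemma sqr_cmod z : cmod z ^+ 2 = Cre z ^+ 2 + Cim z ^+ 2.
Proof. by rewrite cmodE sqr_sqrtr// addr_ge0// sqr_ge0. Qed.

Lemma CreM z w : Cre (z * w) = Cre z * Cre w - Cim z * Cim w.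
Proof. by case: z w => [a b] [c d]. Qed.

Lemma CimM z w : Cim (z * w) = Cre z * Cim w + Cim z * Cre w.
Proof. by case: z w => [a b] [c d]. Qed.

Lemma CreD z w : Cre (z + w) = Cre z + Cre w.
Proof. by case: z w => [a b] [c d]. Qed.

Lemma CimD z w : Cim (z + w) = Cim z + Cim w.
Proof. by case: z w => [a b] [c d]. Qed.

Lemma CreN z : Cre (- z) = - Cre z.
Proof. by case: z. Qed.

Lemma CimN z : Cim (- z) = - Cim z.
Proof. by case: z. Qed.

Lemma complex_ext z w : Cre z = Cre w -> Cim z = Cim w -> z = w.
Proof. by case: z w => [a b] [c d] /= -> ->. Qed.

Lemma cmodM z w : cmod (z * w) = cmod z * cmod w.
Proof. exact: ComplexField.Normc.normcM. Qed.

Lemma ler_cmodD z w : cmod (z + w) <= cmod z + cmod w.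
Proof.
have := ler_normD z w; rewrite !normc_def -!cmodE.
by rewrite -rmorphD lecR.
Qed.

Lemma cmodN z : cmod (- z) = cmod z.
Proof. by rewrite !cmodE CreN CimN !sqrrN. Qed.

Lemma cmodB z w : cmod (z - w) = cmod (w - z).
Proof. by rewrite -cmodN opprB. Qed.

Lemma ler_cmodB z w : cmod z - cmod w <= cmod (z - w).
Proof. by rewrite lerBlDr -{1}(subrK w z) ler_cmodD. Qed.

Lemma cmod_real (x : R) : cmod (x%:C%C) = `|x|.
Proof. by rewrite cmodE /= expr0n /= addr0 sqrtr_sqr. Qed.

Lemma cmod_eq0 z : cmod z = 0 -> z = 0.
Proof. exact: ComplexField.Normc.eq0_normc. Qed.

Lemma ler_Cre z : `|Cre z| <= cmod z.
Proof.
rewrite cmodE -(sqrtr_sqr (Cre z)) ler_wsqrtr// lerDl sqr_ge0//.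
Qed.

Lemma ler_Cim z : `|Cim z| <= cmod z.
Proof.
rewrite cmodE -(sqrtr_sqr (Cim z)) ler_wsqrtr// lerDr sqr_ge0//.
Qed.

Lemma cmod_conj z : cmod (conjc z) = cmod z.
Proof. by case: z => a b; rewrite !cmodE /= sqrrN. Qed.

Lemma mul_conjc z : conjc z * z = (cmod z ^+ 2)%:C%C.
Proof.
rewrite sqr_cmod; case: z => a b; apply: complex_ext; rewrite ?CreM ?CimM /=;
  ring.
Qed.

Definition cis (t : R) : C := Complex (cos t) (sin t).

Lemma cisD s t : cis (s + t) = cis s * cis t.
Proof. by apply: complex_ext; rewrite ?CreM ?CimM /= ?cosD ?sinD; ring. Qed.

Lemma cis0 : cis 0 = 1.
Proof. by rewrite /cis cos0 sin0. Qed.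

Lemma cmod_cis t : cmod (cis t) = 1.
Proof. by rewrite cmodE /= cos2Dsin2 sqrtr1. Qed.

(** The unimodular factor that rotates [z] to the positive axis. Since [0^-1 = 0], it vanishes at
    [z = 0], and the product formula [cphaseM] holds without exception. *)
Definition cphase z : C := ((cmod z)^-1)%:C%C * conjc z.

Lemma cphaseM z : cphase z * z = (cmod z)%:C%C.
Proof.
rewrite /cphase -mulrA mul_conjc -rmorphM /= expr2 mulrA.
have [->|z0] := eqVneq (cmod z) 0; first by rewrite mulr0.
by rewrite mulVf// mul1r.
Qed.

Lemma cmod_cphase_le1 z : cmod (cphase z) <= 1.
Proof.
rewrite /cphase cmodM cmod_real cmod_conj ger0_norm ?invr_ge0 ?cmod_ge0//.
have [->|z0] := eqVneq (cmod z) 0; first by rewrite mulr0.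
by rewrite mulVf.
Qed.

Lemma cmod_cphase z : z != 0 -> cmod (cphase z) = 1.
Proof.
move=> z0; rewrite /cphase cmodM cmod_real cmod_conj ger0_norm ?invr_ge0 ?cmod_ge0//.
by rewrite mulVf//; apply: contra_neq z0; exact: cmod_eq0.
Qed.

End ComplexNumbers.

Section ComplexIntegral.
Context d (T : measurableType d) (R : realType).
Local Notation C := R[i].
Implicit Types (f g : T -> C).

Definition cmeas f : Prop :=
  measurable_fun [set: T] (fun x => Cre (f x)) /\
  measurable_fun [set: T] (fun x => Cim (f x)).

Lemma cmeasD f g : cmeas f -> cmeas g -> cmeas (fun x => f x + g x).
Proof.
move=> [f1 f2] [g1 g2]; split.
  under [X in measurable_fun _ X]eq_fun do rewrite CreD.
  exact: measurable_funD.
under [X in measurable_fun _ X]eq_fun do rewrite CimD.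
exact: measurable_funD.
Qed.

Lemma cmeasM f g : cmeas f -> cmeas g -> cmeas (fun x => f x * g x).
Proof.
move=> [f1 f2] [g1 g2]; split.
  under [X in measurable_fun _ X]eq_fun do rewrite CreM.
  by apply: measurable_funB; exact: measurable_funM.
under [X in measurable_fun _ X]eq_fun do rewrite CimM.
by apply: measurable_funD; exact: measurable_funM.
Qed.

Lemma cmeasN f : cmeas f -> cmeas (fun x => - f x).
Proof.
move=> [f1 f2]; split.
  under [X in measurable_fun _ X]eq_fun do rewrite CreN.
  exact: measurableT_comp.
under [X in measurable_fun _ X]eq_fun do rewrite CimN.
exact: measurableT_comp.
Qed.

Lemma cmeas_cst (c : C) : cmeas (fun=> c).
Proof. by split; exact: measurable_cst. Qed.

Lemma cmeas_real (f : T -> R) : measurable_fun setT f -> cmeas (fun x => (f x)%:C%C).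
Proof. by move=> mf; split => //=; exact: measurable_cst. Qed.

Lemma cmeas_conj f : cmeas f -> cmeas (fun x => conjc (f x)).
Proof.
move=> [f1 f2]; split.
  rewrite (_ : (fun x => _) = fun x => Cre (f x))//.
  by apply/funext => x; case: (f x).
rewrite (_ : (fun x => _) = fun x => - Cim (f x)); first exact: measurableT_comp.
by apply/funext => x; case: (f x).
Qed.

Lemma measurable_cmod f : cmeas f -> measurable_fun setT (fun x => cmod (f x)).
Proof.
move=> [f1 f2].
under eq_fun do rewrite cmodE -powR12_sqrt ?addr_ge0 ?sqr_ge0//.
apply: (measurableT_comp (measurable_powR _)).
by apply: measurable_funD; exact: measurable_funX.
Qed.

Lemma cmeas_cis (f : T -> R) : measurable_fun setT f -> cmeas (fun x => cis (f x)).
Proof.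
move=> mf; split => /=.
  by apply: measurableT_comp mf; apply: continuous_measurable_fun; exact: continuous_cos.
by apply: measurableT_comp mf; apply: continuous_measurable_fun; exact: continuous_sin.
Qed.

(** With the convention [0^-1 = 0] inversion is continuous off a single point, which is measurable
    by itself. *)
Lemma measurable_invr : measurable_fun [set: R] (@GRing.inv R).
Proof.
rewrite -(setUv [set 0]); apply/measurable_funU => //; first exact: measurableC.
split; first exact: measurable_fun_set1.
apply: open_continuous_measurable_fun.
  by apply: closed_openC; exact: closed_eq.
by move=> x; rewrite inE/= => x0; apply: inv_continuous; apply/eqP.
Qed.

Lemma cmeas_cphase f : cmeas f -> cmeas (fun x => cphase (f x)).
Proof.
move=> mf; apply: cmeasM; last exact: cmeas_conj.
apply: cmeas_real; apply: (measurableT_comp measurable_invr).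
exact: measurable_cmod.
Qed.

Variable m : {measure set T -> \bar R}.

Definition cint f : C :=
  Complex (\int[m]_(x in [set: T]) Cre (f x)) (\int[m]_(x in [set: T]) Cim (f x)).

Definition cintble f : Prop :=
  cmeas f /\ (\int[m]_x (cmod (f x))%:E < +oo)%E.

Lemma integrable_le (f g : T -> R) : measurable_fun setT f ->
  measurable_fun setT g -> (forall x, `|f x| <= g x) ->
  (\int[m]_x (g x)%:E < +oo)%E -> m.-integrable setT (EFin \o f).
Proof.
move=> mf mg fg ig; apply/integrableP; split; first exact/measurable_EFinP.
apply: le_lt_trans ig; apply: ge0_le_integral => //=.
- by apply/measurable_EFinP; exact: measurableT_comp.
- exact/measurable_EFinP.
- by move=> x _; rewrite lee_fin.
Qed.

Lemma cintble_Re f : cintble f -> m.-integrable setT (EFin \o (fun x => Cre (f x))).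
Proof.
move=> [[f1 f2] fi]; apply: (integrable_le f1 _ _ fi).
  exact: measurable_cmod.
by move=> x; exact: ler_Cre.
Qed.

Lemma cintble_Im f : cintble f -> m.-integrable setT (EFin \o (fun x => Cim (f x))).
Proof.
move=> [[f1 f2] fi]; apply: (integrable_le f2 _ _ fi).
  exact: measurable_cmod.
by move=> x; exact: ler_Cim.
Qed.

Lemma cintble_le f g : cmeas f -> (forall x, cmod (f x) <= cmod (g x)) ->
  cintble g -> cintble f.
Proof.
move=> mf fg [mg ig]; split => //; apply: le_lt_trans ig.
apply: ge0_le_integral => //=.
- by move=> x _; rewrite lee_fin cmod_ge0.
- by apply/measurable_EFinP; exact: measurable_cmod.
- by apply/measurable_EFinP; exact: measurable_cmod.
- by move=> x _; rewrite lee_fin.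
Qed.

Lemma cintble_leR f (g : T -> R) : cmeas f -> measurable_fun setT g ->
  (forall x, cmod (f x) <= g x) -> (\int[m]_x (g x)%:E < +oo)%E -> cintble f.
Proof.
move=> mf mg fg ig; split => //; apply: le_lt_trans ig.
apply: ge0_le_integral => //=.
- by move=> x _; rewrite lee_fin cmod_ge0.
- by apply/measurable_EFinP; exact: measurable_cmod.
- exact/measurable_EFinP.
- by move=> x _; rewrite lee_fin.
Qed.

Lemma cintbleD f g : cintble f -> cintble g -> cintble (fun x => f x + g x).
Proof.
move=> [mf fi] [mg gi].
apply: (@cintble_leR _ (fun x => cmod (f x) + cmod (g x))).
- exact: cmeasD.
- by apply: measurable_funD; exact: measurable_cmod.
- by move=> x; exact: ler_cmodD.
under eq_integral do rewrite EFinD.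
rewrite ge0_integralD//=.
- by rewrite lte_add_pinfty.
- by move=> x _; rewrite lee_fin cmod_ge0.
- by apply/measurable_EFinP; exact: measurable_cmod.
- by move=> x _; rewrite lee_fin cmod_ge0.
- by apply/measurable_EFinP; exact: measurable_cmod.
Qed.

Lemma cintbleMb f g (M : R) : cmeas f -> (forall x, cmod (f x) <= M) ->
  cintble g -> cintble (fun x => f x * g x).
Proof.
move=> mf fM [mg gi].
apply: (@cintble_leR _ (fun x => M * cmod (g x))).
- exact: cmeasM.
- by apply: measurable_funM => //; exact: measurable_cmod.
- by move=> x; rewrite cmodM ler_wpM2r ?cmod_ge0.
under eq_integral do rewrite EFinM.
case: (pselect (exists x : T, True)) => [[x0 _]|noT]; last first.
  rewrite integral0_eq// => x; case: noT; by exists x.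
have M0 : 0 <= M by exact: le_trans (cmod_ge0 _) (fM x0).
rewrite ge0_integralZl_EFin//.
- rewrite lte_mul_pinfty//.
- by move=> x _; rewrite lee_fin cmod_ge0.
- by apply/measurable_EFinP; exact: measurable_cmod.
Qed.

Lemma cintbleZ (c : C) f : cintble f -> cintble (fun x => c * f x).
Proof.
by move=> fi; apply: (@cintbleMb _ _ (cmod c)) => //; exact: cmeas_cst.
Qed.

Lemma cintbleN f : cintble f -> cintble (fun x => - f x).
Proof.
by move=> [mf fi]; split; [exact: cmeasN|under eq_integral do rewrite cmodN].
Qed.

Lemma cintD f g : cintble f -> cintble g ->
  cint (fun x => f x + g x) = cint f + cint g.
Proof.
move=> fi gi; apply: complex_ext; rewrite ?CreD ?CimD /=.
  under eq_Rintegral do rewrite CreD.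
  by rewrite RintegralD//; exact: cintble_Re.
under eq_Rintegral do rewrite CimD.
by rewrite RintegralD//; exact: cintble_Im.
Qed.

Lemma cintZ (c : C) f : cintble f -> cint (fun x => c * f x) = c * cint f.
Proof.
move=> fi; have f1 := cintble_Re fi; have f2 := cintble_Im fi.
have Z (k : R) (h : T -> R) : m.-integrable setT (EFin \o h) ->
    m.-integrable setT (EFin \o (fun x => k * h x)).
  move=> hi; have := integrableZl measurableT k hi.
  by apply: eq_integrable => // x _; rewrite /= EFinM.
apply: complex_ext; rewrite ?CreM ?CimM /=.
  under eq_Rintegral do rewrite CreM.
  rewrite RintegralB//; [|exact: Z|exact: Z].
  by rewrite !RintegralZl.
under eq_Rintegral do rewrite CimM.
rewrite RintegralD//; [|exact: Z|exact: Z].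
by rewrite !RintegralZl.
Qed.

Lemma cintN f : cintble f -> cint (fun x => - f x) = - cint f.
Proof.
move=> fi; rewrite -mulN1r -cintZ//; congr cint; apply/funext => x.
by rewrite mulN1r.
Qed.

Lemma cintB f g : cintble f -> cintble g ->
  cint (fun x => f x - g x) = cint f - cint g.
Proof. by move=> fi gi; rewrite cintD ?cintN//; exact: cintbleN. Qed.

Lemma eq_cint f g : f =1 g -> cint f = cint g.
Proof. by move=> /funext ->. Qed.

Lemma ae_eq_cint f g : cmeas f -> cmeas g -> {ae m, forall x, f x = g x} ->
  cint f = cint g.
Proof.
move=> [f1 f2] [g1 g2] fg; rewrite /cint /Rintegral; congr Complex; congr fine.
  apply: ae_eq_integral => //; [exact/measurable_EFinP|exact/measurable_EFinP|].
  by apply: filterS fg => x /= ->.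
apply: ae_eq_integral => //; [exact/measurable_EFinP|exact/measurable_EFinP|].
by apply: filterS fg => x /= ->.
Qed.

Lemma cint0 : cint (fun=> 0) = 0.
Proof.
by rewrite /cint /=; congr Complex; rewrite /Rintegral integral0_eq.
Qed.

(* Rotating the integral to the positive axis reduces the bound to the real
   case. *)
Lemma le_cmod_cint f : cmeas f -> ((cmod (cint f))%:E <= \int[m]_x (cmod (f x))%:E)%E.
Proof.
move=> mf; have := leey (\int[m]_x (cmod (f x))%:E)%E.
rewrite le_eqVlt => /predU1P[->|fi]; first by rewrite leey.
have {}fi : cintble f by [].
set c := cphase (cint f).
have cE : cmod (cint f) = Cre (cint (fun x => c * f x)).
  by rewrite cintZ// cphaseM.
rewrite cE /= fineK; last first.
  exact: (integrable_fin_num _ (cintble_Re (cintbleZ c fi))).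
apply: (@le_trans _ _ (\int[m]_x `|(Cre (c * f x))%:E|)%E).
  apply: le_trans (lee_abs _) _; apply: le_abse_integral => //.
  by case: (cintbleZ c fi) => -[? _] _; exact/measurable_EFinP.
apply: ge0_le_integral => //=.
- apply/measurable_EFinP; apply: measurableT_comp => //.
  by case: (cintbleZ c fi) => -[? _] _.
- by apply/measurable_EFinP; exact: measurable_cmod.
- move=> x _; rewrite lee_fin (le_trans (ler_Cre _))// cmodM.
  by rewrite -[leRHS]mul1r ler_wpM2r ?cmod_ge0// cmod_cphase_le1.
Qed.

Lemma cint_le f (M : R) : cmeas f -> (\int[m]_x (cmod (f x))%:E <= M%:E)%E ->
  cmod (cint f) <= M.
Proof. by move=> mf fM; rewrite -lee_fin (le_trans (le_cmod_cint mf)). Qed.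

End ComplexIntegral.

Lemma cmeas_comp d1 d2 (T1 : measurableType d1) (T2 : measurableType d2)
    (R : realType) (h : T1 -> T2) (f : T2 -> R[i]) :
  measurable_fun setT h -> cmeas f -> cmeas (f \o h).
Proof.
move=> mh [f1 f2]; split.
  exact: (measurableT_comp f1 mh).
exact: (measurableT_comp f2 mh).
Qed.

Section ComplexFubini.
Context d1 d2 (T1 : measurableType d1) (T2 : measurableType d2) (R : realType).
Variable m1 : {sigma_finite_measure set T1 -> \bar R}.
Variable m2 : {sigma_finite_measure set T2 -> \bar R}.
Local Notation C := R[i].
Implicit Type f : T1 * T2 -> C.

Lemma cmeas_pair1 f y : cmeas f -> cmeas (fun x => f (x, y)).
Proof. by apply: (@cmeas_comp _ _ _ _ _ (fun x => (x, y)) f); exact: pair2_measurable. Qed.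

Lemma cmeas_pair2 f x : cmeas f -> cmeas (fun y => f (x, y)).
Proof. by apply: (@cmeas_comp _ _ _ _ _ (fun y => (x, y)) f); exact: pair1_measurable. Qed.

(** No integrability is assumed: the inner integral is a difference of two Tonelli integrals, each
    measurable in [x], and [fine] supplies a default value where the difference is infinite. *)
Lemma measurable_Rintegral2 (h : T1 * T2 -> R) : measurable_fun setT h ->
  measurable_fun setT (fun x => \int[m2]_(y in [set: T2]) h (x, y)).
Proof.
move=> mh; rewrite /Rintegral; apply: measurableT_comp => //.
under eq_fun do rewrite integralE.
apply: emeasurable_funB.
  have mp : measurable_fun setT ((EFin \o h)^\+)%E.
    by apply: measurable_funepos; exact/measurable_EFinP.
  have := measurable_fun_fubini_tonelli_F (m2 := m2) _ mp (funepos_ge0 _).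
  set a := fubini_F _ _; set b := (fun x => _) => ma; suff -> : b = a by [].
  by apply/funext => x; apply: eq_integral => y _; rewrite unlock.
have mp : measurable_fun setT ((EFin \o h)^\-)%E.
  by apply: measurable_funeneg; exact/measurable_EFinP.
have := measurable_fun_fubini_tonelli_F (m2 := m2) _ mp (funeneg_ge0 _).
set a := fubini_F _ _; set b := (fun x => _) => ma; suff -> : b = a by [].
by apply/funext => x; apply: eq_integral => y _; rewrite unlock.
Qed.

Lemma cmeas_cint2 f : cmeas f -> cmeas (fun x => cint m2 (fun y => f (x, y))).
Proof. move=> [f1 f2]; split => /=; first exact: (measurable_Rintegral2 f1).
exact: (measurable_Rintegral2 f2). Qed.

(** [fine] of an inner integral agrees with it only where it is finite, hence almost everywhere; the
    extended-valued Fubini theorem is therefore transferred through almost everywhere equality of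
    the inner integrals. *)
Lemma Rint_fubini (h : T1 * T2 -> R) : (m1 \x m2)%E.-integrable setT (EFin \o h) ->
  \int[m1]_(x in [set: T1]) (\int[m2]_(y in [set: T2]) h (x, y))
  = \int[m2]_(y in [set: T2]) (\int[m1]_(x in [set: T1]) h (x, y)).
Proof.
move=> hi; rewrite {1 3}/Rintegral.
have := Fubini hi; move=> Fu.
have E1 : (\int[m1]_x (\int[m2]_(y in [set: T2]) h (x, y))%:E
    = \int[m1]_x \int[m2]_y (h (x, y))%:E)%E.
  apply: ae_eq_integral => //.
  - by apply/measurable_EFinP/measurable_Rintegral2/measurable_EFinP; case/integrableP: hi.
  - exact: (measurable_fubini_F hi).
  have := ae_integrable1 hi; apply: filterS => x /= hx _.
  by rewrite /Rintegral fineK// integrable_fin_num.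
have E2 : (\int[m2]_y (\int[m1]_(x in [set: T1]) h (x, y))%:E
    = \int[m2]_y \int[m1]_x (h (x, y))%:E)%E.
  apply: ae_eq_integral => //.
  - apply/measurable_EFinP; rewrite /Rintegral; apply: measurableT_comp => //.
    exact: (measurable_fubini_G hi).
  - exact: (measurable_fubini_G hi).
  have := ae_integrable2 hi; apply: filterS => x /= hx _.
  by rewrite /Rintegral fineK// integrable_fin_num.
by rewrite E1 E2 Fu.
Qed.

Lemma cint_fubini f : cmeas f ->
  (\int[m1]_x \int[m2]_y (cmod (f (x, y)))%:E < +oo)%E ->
  cint m1 (fun x => cint m2 (fun y => f (x, y)))
  = cint m2 (fun y => cint m1 (fun x => f (x, y))).
Proof.
move=> mf fi.
have fi' : cintble (m1 \x m2)%E f.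
  split => //; rewrite fubini_tonelli1//.
  - by apply/measurable_EFinP; exact: measurable_cmod.
  - by move=> z; rewrite lee_fin cmod_ge0.
rewrite /cint /=; congr Complex.
  exact: (Rint_fubini (cintble_Re fi')).
exact: (Rint_fubini (cintble_Im fi')).
Qed.

End ComplexFubini.

(** * Lebesgue measure on tuples *)

Section LebesgueLine.
Variable R : realType.
Local Notation leb1 := (@lebesgue_measure R).

Let aff (a b : R) : measurableTypeR R -> measurableTypeR R := fun t => a * t + b.

Let measurable_aff (a b : R) : measurable_fun setT (aff a b).
Proof. by apply: measurable_funD => //; apply: measurable_funM. Qed.

Let pushaff (a b : R) : {measure set (measurableTypeR R) -> \bar R} :=
  measure_function_pushforward__canonical__measure_function_Measure leb1
    (measurable_aff a b).

(** Uniqueness of Lebesgue measure reduces this to half-open intervals, whose preimages under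
    [t -> a t + b] are half-open intervals again. *)
Let lebesgue_aff (a b : R) (a0 : 0 < a) (A : set (measurableTypeR R)) : measurable A ->
  leb1 A = mscale (NngNum (ltW a0)) (pushaff a b) A.
Proof.
move=> mA; apply: lebesgue_measure_unique mA => X [[x y]] /= _ <-.
rewrite /mscale /= /pushforward.
rewrite (_ : _ @^-1` _ = `](x - b) / a, (y - b) / a]%classic); last first.
  apply/seteqP; split => t /=; rewrite !in_itv /= /aff.
    by rewrite ltr_pdivrMr// ler_pdivlMr// ltrBlDr lerBrDr (mulrC t).
  by rewrite ltr_pdivrMr// ler_pdivlMr// ltrBlDr lerBrDr (mulrC t).
rewrite !lebesgue_measure_itv /= !lte_fin ltr_pM2r ?invr_gt0// ltrD2r.
case: ifPn => xy'; last by rewrite mule0.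
by rewrite -!EFinB -EFinM; congr EFin; field; rewrite gt_eqF.
Qed.

Lemma integral_affine (a b : R) (f : R -> \bar R) : 0 < a ->
  measurable_fun setT f -> (forall t, 0 <= f t)%E ->
  (a%:E * \int[leb1]_t f (a * t + b)%R = \int[leb1]_t f t)%E.
Proof.
move=> a0 mf f0.
have H := @ge0_integral_pushforward _ _ _ _ R _ (measurable_aff a b) leb1 setT f
  measurableT mf (fun _ _ => f0 _).
rewrite preimage_setT in H; rewrite -H.
rewrite -(@ge0_integral_mscale _ _ _ (pushaff a b) setT measurableT (NngNum (ltW a0)))//.
by apply: eq_measure_integral => A mA _; rewrite [RHS](lebesgue_aff b a0 mA).
Qed.

Lemma integral_translate (b : R) (f : R -> \bar R) :
  measurable_fun setT f -> (forall t, 0 <= f t)%E ->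
  (\int[leb1]_t f (t + b)%R = \int[leb1]_t f t)%E.
Proof.
move=> mf f0; rewrite -(integral_affine b ltr01 mf f0) mul1e.
by under [RHS]eq_integral do rewrite mul1r.
Qed.

End LebesgueLine.

Section Leb.
Variable R : realType.
Local Notation leb1 := (@lebesgue_measure R).

(* The measure [leb] of the statement, as a constant on which the sigma-finite
   structure can be registered. *)
Definition lebm n : set (n.-tuple R) -> \bar R := leb R n.
HB.instance Definition _ n := Measure.on (@lebm n).

Lemma measurable_box n (A : 'I_n -> set R) : (forall i, measurable (A i)) ->
  measurable [set x : n.-tuple R | forall i, A i (tnth x i)].
Proof.
move=> mA; rewrite [X in measurable X](_ : _ =
   \bigcap_(i in [set: 'I_n]) ((@tnth n R)^~ i @^-1` A i)).
  apply: fin_bigcap_measurable => // i _.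
  by rewrite -[X in measurable X]setTI; exact: measurable_tnth.
by apply/seteqP; split => x /= H i; [move=> _|]; apply: H.
Qed.

Definition cube n (k : nat) : set (n.-tuple R) :=
  [set x | forall i, `[- k%:R, k%:R]%classic (tnth x i)].

Lemma measurable_cube n k : measurable (@cube n k).
Proof. by apply: (measurable_box (A := fun=> `[- k%:R, k%:R]%classic)) => i; exact: measurable_itv. Qed.

Lemma lebm_cube n k : lebm (@cube n k) = ((2 * k%:R) ^+ n)%:E.
Proof.
rewrite /lebm /cube (leb_box (A := fun=> `[- k%:R, k%:R]%classic))//.
rewrite (eq_bigr (fun=> (2 * k%:R)%:E)); last first.
  move=> i _; rewrite lebesgue_measure_itv /= lte_fin.
  case: ltP => [kk|kk]; first by rewrite -EFinB; congr EFin; ring.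
  have k0 : (0 : R) <= k%:R by [].
  by congr EFin; lra.
by rewrite prodEFin prodr_const card_ord.
Qed.

Lemma bigcup_cube n : \bigcup_k @cube n k = setT.
Proof.
rewrite -subTset => x _.
exists (Num.truncn (\sum_(i < n) `|tnth x i|)).+1 => //= i /=.
rewrite in_itv /= -ler_norml.
apply: (@le_trans _ _ (\sum_(i < n) `|tnth x i|)).
  by rewrite (bigD1 i)//= lerDl sumr_ge0.
exact/ltW/truncnS_gt.
Qed.

Lemma lebm_sigma_finite n : sigma_finite setT (@lebm n).
Proof.
exists (@cube n); first by rewrite bigcup_cube.
by move=> k; split; [exact: measurable_cube|rewrite lebm_cube ltry].
Qed.

HB.instance Definition _ n :=
  Measure_isSigmaFinite.Build _ _ _ (@lebm n) (@lebm_sigma_finite n).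

Lemma subset_cube n k l : (k <= l)%N -> @cube n k `<=` cube l.
Proof.
move=> kl x kx i; have := kx i; rewrite /= !in_itv /= -!ler_norml => /le_trans -> //.
by rewrite ler_nat.
Qed.

(** [leb_step] is built on the product [\x^], whose construction asks sigma-finiteness of the first
    factor only. Uniqueness of the product measure identifies it with [\x], for which Tonelli and
    Fubini are stated. *)
Lemma integral_lebS_prod n (F : n.+1.-tuple R -> \bar R) : measurable_fun setT F ->
  (forall x, 0 <= F x)%E ->
  (\int[lebm (n := n.+1)]_x F x =
   \int[leb1 \x lebm (n := n)]_z (F \o @tcons R n) z)%E.
Proof.
move=> mF F0.
have mt : measurable_fun [set: measurableTypeR R * n.-tuple R] (@tcons R n).
  exact: measurable_tcons.
have H1 := @ge0_integral_pushforward _ _ (measurableTypeR R * n.-tuple R)%type _ R _ mt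
  (leb1 \x^ leb R n)%E setT F measurableT mF (fun _ _ => F0 _).
have H2 := @ge0_integral_pushforward _ _ (measurableTypeR R * n.-tuple R)%type _ R _ mt
  (leb1 \x lebm (n := n))%E setT F measurableT mF (fun _ _ => F0 _).
rewrite preimage_setT in H2; rewrite -H2.
apply/esym; apply: eq_measure_integral => A mA _; rewrite /= /pushforward.
apply: (@product_measure_unique _ _ _ _ _ leb1 (@lebm n) (leb1 \x^ leb R n)%E).
  by move=> X Y mX mY; exact: product_measure2E.
by rewrite -[X in measurable X]setTI; exact: measurable_tcons.
Qed.

Lemma integral_lebS n (F : n.+1.-tuple R -> \bar R) : measurable_fun setT F ->
  (forall x, 0 <= F x)%E ->
  (\int[lebm (n := n.+1)]_x F x = \int[leb1]_t \int[lebm (n := n)]_x F (tcons (t, x)))%E.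
Proof.
move=> mF F0; rewrite integral_lebS_prod// fubini_tonelli1//.
  by apply: measurableT_comp => //; exact: measurable_tcons.
by move=> z; exact: F0.
Qed.

Lemma tnth_tcons0 n (t : R) (x : n.-tuple R) : tnth (tcons (t, x)) ord0 = t.
Proof. by rewrite tnth0. Qed.

Lemma tnth_tconsS n (t : R) (x : n.-tuple R) i :
  tnth (tcons (t, x)) (lift ord0 i) = tnth x i.
Proof. by rewrite tnthS. Qed.

Lemma measurable_tnthT n (i : 'I_n) : measurable_fun setT (fun x : n.-tuple R => tnth x i).
Proof. exact: measurable_tnth. Qed.

Lemma measurable_prod_tnth n (f : 'I_n -> R -> R) : (forall i, measurable_fun setT (f i)) ->
  measurable_fun setT (fun x : n.-tuple R => \prod_(i < n) f i (tnth x i)).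
Proof.
by move=> mf; apply: measurable_prod => i _; apply: measurableT_comp (mf i) (measurable_tnthT i).
Qed.

Lemma lebm0 : lebm [set: 0.-tuple R] = 1%E.
Proof. by rewrite /lebm [LHS]diracE mem_set. Qed.

Lemma integral_prod n (f : 'I_n -> R -> R) : (forall i, measurable_fun setT (f i)) ->
  (forall i t, 0 <= f i t) ->
  (\int[lebm (n := n)]_x (\prod_(i < n) f i (tnth x i))%:E
   = \prod_(i < n) \int[leb1]_t (f i t)%:E)%E.
Proof.
elim: n f => [|n IH] f mf f0.
  rewrite big_ord0; under eq_integral do rewrite big_ord0.
  by rewrite integral_cst// mul1e; exact: lebm0.
rewrite integral_lebS; first last.
- by move=> x; rewrite lee_fin prodr_ge0.
- by apply/measurable_EFinP; exact: measurable_prod_tnth.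
rewrite big_ord_recl -IH//.
under eq_integral => t _.
  under eq_integral => x _.
    rewrite big_ord_recl tnth_tcons0 EFinM.
    rewrite [X in (_ * X%:E)%E](_ : _ = \prod_(i < n) f (lift ord0 i) (tnth x i)).
      over.
    by apply: eq_bigr => i _; rewrite tnth_tconsS.
  rewrite ge0_integralZl_EFin//.
  - over.
  - by move=> x _; rewrite lee_fin prodr_ge0.
  - by apply/measurable_EFinP; exact: (@measurable_prod_tnth _ (fun i => f (lift ord0 i))).
rewrite ge0_integralZr//.
- by apply/measurable_EFinP; exact: (mf ord0).
- by move=> t _; rewrite lee_fin.
- by apply: integral_ge0 => x _; rewrite lee_fin prodr_ge0.
Qed.

Lemma Rint_lebS n (F : n.+1.-tuple R -> R) :
  (lebm (n := n.+1)).-integrable setT (EFin \o F) ->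
  \int[lebm (n := n.+1)]_(x in [set: n.+1.-tuple R]) F x =
  \int[leb1]_(t in [set: R]) (\int[lebm (n := n)]_(x in [set: n.-tuple R]) F (tcons (t, x))).
Proof.
move=> /[dup] iF /integrableP[mF fF].
have mG : measurable_fun setT (F \o @tcons R n).
  by apply: measurableT_comp; [exact/measurable_EFinP|exact: measurable_tcons].
have iG : (leb1 \x lebm (n := n))%E.-integrable setT (EFin \o (F \o @tcons R n)).
  apply/integrableP; split; first exact/measurable_EFinP.
  rewrite fubini_tonelli1//=.
    by move: fF; rewrite integral_lebS//; exact: measurableT_comp.
  by apply/measurable_EFinP; exact: measurableT_comp.
transitivity (\int[(leb1 \x lebm (n := n))%E]_(z in [set: R * n.-tuple R]) (F \o @tcons R n) z).
  rewrite /Rintegral integralE [in RHS]integralE.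
  congr (fine (_ - _)).
    rewrite integral_lebS_prod; [|exact: measurable_funepos|by move=> x; exact: funepos_ge0].
    by apply: eq_integral => z _; rewrite /= !funeposE.
  rewrite integral_lebS_prod; [|exact: measurable_funeneg|by move=> x; exact: funeneg_ge0].
  by apply: eq_integral => z _; rewrite /= !funenegE.
rewrite {1}/Rintegral -(integral12_prod_meas1 iG) {1}/Rintegral; congr fine.
apply: ae_eq_integral => //.
- exact: (measurable_fubini_F iG).
- apply/measurable_EFinP.
  exact: (@measurable_Rintegral2 _ _ (measurableTypeR R) _ R _ _ mG).
have := ae_integrable1 iG; apply: filterS => t it _.
by rewrite /fubini_F /Rintegral fineK//; exact: integrable_fin_num.
Qed.

Lemma cint_lebS n (F : n.+1.-tuple R -> R[i]) : cintble (lebm (n := n.+1)) F ->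
  cint (lebm (n := n.+1)) F =
  cint leb1 (fun t => cint (lebm (n := n)) (fun x => F (tcons (t, x)))).
Proof.
move=> iF; rewrite /cint /=; congr Complex.
  exact: (Rint_lebS (cintble_Re iF)).
exact: (Rint_lebS (cintble_Im iF)).
Qed.

Lemma cmod_prod n (h : 'I_n -> R[i]) : cmod (\prod_(i < n) h i) = \prod_(i < n) cmod (h i).
Proof.
apply: (big_morph (@ComplexField.Normc.normc R)); first exact: cmodM.
exact: ComplexField.Normc.normc1.
Qed.

Lemma cmeas_prod d (T : measurableType d) n (h : 'I_n -> T -> R[i]) : (forall i, cmeas (h i)) ->
  cmeas (fun x => \prod_(i < n) h i x).
Proof.
elim: n h => [|n IH] h mh.
  by under [X in cmeas X]eq_fun do rewrite big_ord0; exact: cmeas_cst.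
under [X in cmeas X]eq_fun do rewrite big_ord_recl.
by apply: cmeasM; [exact: mh|apply: IH => i; exact: mh].
Qed.

Lemma cintble_prod n (h : 'I_n -> R -> R[i]) : (forall i, cintble leb1 (h i)) ->
  cintble (lebm (n := n)) (fun x => \prod_(i < n) h i (tnth x i)).
Proof.
move=> ih; split.
  by apply: cmeas_prod => i; apply: (cmeas_comp (measurable_tnthT i)); case: (ih i).
under eq_integral do rewrite cmod_prod.
rewrite (integral_prod (f := fun i t => cmod (h i t))).
- rewrite (eq_bigr (fun i => (fine (\int[leb1]_t (cmod (h i t))%:E))%:E)).
    by rewrite prodEFin ltry.
  move=> i _; rewrite fineK// ge0_fin_numE//; first by case: (ih i).
  by apply: integral_ge0 => t _; rewrite lee_fin cmod_ge0.
- by move=> i; case: (ih i) => mi _; exact: measurable_cmod.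
- by move=> i t; exact: cmod_ge0.
Qed.

Lemma cint_prod n (h : 'I_n -> R -> R[i]) : (forall i, cintble leb1 (h i)) ->
  cint (lebm (n := n)) (fun x => \prod_(i < n) h i (tnth x i))
  = \prod_(i < n) cint leb1 (h i).
Proof.
elim: n h => [|n IH] h ih.
  rewrite big_ord0; under [X in cint _ X]eq_fun do rewrite big_ord0.
  rewrite /cint /= !Rintegral_cst//= mul0r mul1r.
  by rewrite indicT.
rewrite cint_lebS; last exact: cintble_prod.
rewrite big_ord_recl -IH//.
have ii := cintble_prod (fun i => ih (lift ord0 i)).
transitivity (cint leb1 (fun t => cint (lebm (n := n))
    (fun x => \prod_(i < n) h (lift ord0 i) (tnth x i)) * h ord0 t)).
  apply: eq_cint => t; rewrite mulrC -cintZ//; apply: eq_cint => x.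
  rewrite big_ord_recl tnth_tcons0; congr (_ * _).
  by apply: eq_bigr => i _; rewrite tnth_tconsS.
by rewrite cintZ// mulrC.
Qed.

Lemma measurable_dotp n d (T : measurableType d) (f g : T -> n.-tuple R) :
  measurable_fun setT f -> measurable_fun setT g ->
  measurable_fun setT (fun x => dotp (f x) (g x)).
Proof.
move=> mf mg; rewrite /dotp; apply: measurable_sum => i.
by apply: measurable_funM; apply: (measurableT_comp (measurable_tnthT i)).
Qed.

End Leb.

(** * Norm bounds and the three lines lemma *)

Section Bnd.
Context d (T : measurableType d) (R : realType).
Variable m : {measure set T -> \bar R}.
Implicit Types (f g : T -> R) (A B t s : R).

(* [bnd t f A]: the norm of the nonnegative function [f] in L_(1/t) is at most
   [A], where 1/0 is read as infinity. *)
Definition bnd t f A : Prop :=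
  if t == 0 then {ae m, forall x, f x <= A}
  else (\int[m]_x (f x `^ t^-1)%:E <= (A `^ t^-1)%:E)%E.

Lemma bndP t f A : 0 < t ->
  bnd t f A <-> (\int[m]_x (f x `^ t^-1)%:E <= (A `^ t^-1)%:E)%E.
Proof. by move=> t0; rewrite /bnd gt_eqF. Qed.

Lemma bnd1 f A : (forall x, 0 <= f x) -> 0 <= A ->
  bnd 1 f A <-> (\int[m]_x (f x)%:E <= A%:E)%E.
Proof.
move=> f0 A0; rewrite bndP// invr1 powRr1//.
by under eq_integral do rewrite powRr1//.
Qed.

Lemma measurable_powRf f (p : R) : measurable_fun setT f ->
  measurable_fun setT (fun x => f x `^ p).
Proof. by move=> mf; apply: (measurableT_comp (measurable_powR p) mf). Qed.

Lemma le_bnd t f g A : 0 <= t -> measurable_fun setT f -> measurable_fun setT g ->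
  (forall x, 0 <= f x) -> (forall x, f x <= g x) -> bnd t g A -> bnd t f A.
Proof.
move=> t0 mf mg f0 fg; rewrite /bnd; case: eqP => [_|_].
  by apply: filterS => x; exact: le_trans.
apply: le_trans; apply: ge0_le_integral => //.
- by move=> x _; rewrite lee_fin powR_ge0.
- by apply/measurable_EFinP; exact: measurable_powRf.
- by apply/measurable_EFinP; exact: measurable_powRf.
move=> x _; rewrite lee_fin ge0_ler_powR ?invr_ge0 ?nnegrE//.
exact: le_trans (fg x).
Qed.

Lemma bnd_le t f A B : 0 <= t -> 0 <= A -> A <= B -> bnd t f A -> bnd t f B.
Proof.
move=> t0 A0 AB; rewrite /bnd; case: eqP => [_|_].
  by apply: filterS => x /le_trans; apply.
move=> /le_trans; apply; rewrite lee_fin ge0_ler_powR ?invr_ge0 ?nnegrE//.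
exact: le_trans AB.
Qed.

Lemma bnd_ae t f g A : measurable_fun setT f -> measurable_fun setT g ->
  {ae m, forall x, f x = g x} -> bnd t f A -> bnd t g A.
Proof.
move=> mf mg fg; rewrite /bnd; case: eqP => [_|_].
  by move=> fA; apply: filterS2 fg fA => x ->.
rewrite (@ae_eq_integral _ _ _ m setT (fun x => (g x `^ t^-1)%:E))//.
- by apply/measurable_EFinP; exact: measurable_powRf.
- by apply/measurable_EFinP; exact: measurable_powRf.
- by apply: filterS fg => x /= ->.
Qed.

Lemma bndZ t f A (c : R) : 0 <= t -> 0 <= c -> 0 <= A -> measurable_fun setT f ->
  (forall x, 0 <= f x) -> bnd t f A -> bnd t (fun x => c * f x) (c * A).
Proof.
move=> t0 c0 A0 mf f0; rewrite /bnd; case: eqP => [_|_].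
  by apply: filterS => x; exact: ler_wpM2l.
move=> fA; under eq_integral do rewrite powRM ?f0// EFinM.
rewrite powRM// EFinM ge0_integralZl_EFin ?powR_ge0//.
- by rewrite lee_wpmul2l// lee_fin powR_ge0.
- by move=> x _; rewrite lee_fin powR_ge0.
- by apply/measurable_EFinP; exact: measurable_powRf.
Qed.

Lemma bndM0 t f g A B : 0 <= t -> 0 <= A -> 0 <= B ->
  measurable_fun setT f -> measurable_fun setT g ->
  (forall x, 0 <= f x) -> (forall x, 0 <= g x) ->
  {ae m, forall x, f x <= A} -> bnd t g B -> bnd t (fun x => f x * g x) (A * B).
Proof.
move=> t0 A0 B0 mf mg f0 g0 fA gB.
have := bndZ t0 A0 B0 mg g0 gB.
rewrite /bnd; case: eqP => [_ h|_].
  by apply: filterS2 fA h => x fx; apply: le_trans; exact: ler_wpM2r.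
apply: le_trans; apply: ae_ge0_le_integral => //.
- by move=> x _; rewrite lee_fin powR_ge0.
- by apply/measurable_EFinP; apply: measurable_powRf; exact: measurable_funM.
- by move=> x _; rewrite lee_fin powR_ge0.
- by apply/measurable_EFinP; apply: measurable_powRf; exact: measurable_funM.
apply: filterS fA => x fx _; rewrite lee_fin ge0_ler_powR ?invr_ge0 ?nnegrE//.
- exact: mulr_ge0.
- exact: mulr_ge0.
- exact: ler_wpM2r.
Qed.

(** Rescales exponents for Hoelder's inequality: when [s] is the sum of two reciprocal exponents,
    the powers [f^(1/s)] lie in spaces with conjugate exponents. *)
Lemma Lnorm_powR_le f A t s : 0 < t -> 0 < s -> 0 <= A -> (forall x, 0 <= f x) ->
  bnd t f A -> ('N[m]_(s / t)%:E[EFin \o (fun x => (f x `^ s^-1)%R)] <= (A `^ s^-1)%:E)%E.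
Proof.
move=> t0 s0 A0 f0 /bndP; move/(_ t0) => fA.
rewrite unlock /=.
have -> : (A `^ s^-1)%:E = ((A `^ t^-1)%:E `^ (s / t)^-1)%E.
  rewrite poweR_EFin -powRrM; congr (_ `^ _)%:E.
  by rewrite invf_div mulrA mulVf ?gt_eqF// mul1r.
apply: gt0_ler_poweR.
- by rewrite invr_ge0 divr_ge0// ltW.
- by rewrite in_itv /= leey andbT integral_ge0// => x _; rewrite poweR_ge0.
- by rewrite in_itv /= leey andbT lee_fin powR_ge0.
apply: le_trans fA; rewrite le_eqVlt; apply/orP; left; apply/eqP.
apply: eq_integral => x _; rewrite /= ger0_norm ?powR_ge0// -powRrM.
by rewrite mulrA mulVf ?gt_eqF// mul1r.
Qed.

(** Reciprocal exponents add in Hoelder's inequality. The classical form is applied to [f^(1/(t+s))]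
    and [g^(1/(t+s))] with the conjugate exponents [(t+s)/t] and [(t+s)/s], so [t + s] may be any
    positive number; a zero exponent is an essential bound and is treated apart. *)
Lemma bndM t s f g A B : 0 <= t -> 0 <= s -> 0 <= A -> 0 <= B ->
  measurable_fun setT f -> measurable_fun setT g ->
  (forall x, 0 <= f x) -> (forall x, 0 <= g x) ->
  bnd t f A -> bnd s g B -> bnd (t + s) (fun x => f x * g x) (A * B).
Proof.
move=> t0 s0 A0 B0 mf mg f0 g0 fA gB.
have [t00|t00] := eqVneq t 0.
  by rewrite t00 add0r; apply: bndM0 => //; move: fA; rewrite t00 /bnd eqxx.
have [s00|s00] := eqVneq s 0.
  rewrite s00 addr0 mulrC; under [X in bnd _ X]eq_fun do rewrite mulrC.
  by apply: bndM0 => //; move: gB; rewrite s00 /bnd eqxx.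
have {t00}t0 : 0 < t by rewrite lt_def t00.
have {s00}s0 : 0 < s by rewrite lt_def s00.
have ts0 : 0 < t + s by exact: addr_gt0.
apply/bndP => //.
have := @hoelder _ _ _ m (fun x => f x `^ (t + s)^-1) (fun x => g x `^ (t + s)^-1)
  ((t + s) / t) ((t + s) / s) (measurable_powRf _ mf) (measurable_powRf _ mg).
rewrite !divr_gt0// => /(_ isT isT) h.
have {}h := h _; apply: (le_trans (le_trans _ (h _))).
- rewrite Lnorm1 le_eqVlt; apply/orP; left; apply/eqP; apply: eq_integral => x _.
  by rewrite /= powRM// ger0_norm// mulr_ge0// powR_ge0.
- rewrite !invf_div; field; rewrite !gt_eqF//.
rewrite [X in (_ <= X%:E)%E]powRM// [X in (_ <= X)%E]EFinM; apply: lee_pmul; rewrite ?Lnorm_ge0//.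
- exact: Lnorm_powR_le.
- exact: Lnorm_powR_le.
Qed.

End Bnd.

(** * A three lines lemma from a discrete maximum principle *)

Section ThreeLines.
Variable R : realType.

(* A maximum principle for functions on a strip that are subharmonic up to
   [O(h^3)] for the discrete Laplacian of step [h]: the barrier [C h x^2] makes
   them strictly subharmonic at that scale, so that their supremum cannot be
   approached at distance more than [h] from the boundary. *)
Lemma strip_maximum (F : R -> R -> R) (B C h0 : R) : 0 < C -> 0 < h0 ->
  (forall x y, 0 <= x <= 1 -> F x y <= B) ->
  (forall h x y, 0 < h <= h0 -> h <= x <= 1 - h ->
    4 * F x y <= F (x + h) y + F (x - h) y + F x (y + h) + F x (y - h) + C * h ^+ 3) ->
  (forall x x' y, 0 <= x <= 1 -> 0 <= x' <= 1 -> F x y <= F x' y + C * `|x - x'|) ->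
  (forall y, F 0 y <= 1) -> (forall y, F 1 y <= 1) ->
  forall x y, 0 <= x <= 1 -> F x y <= 1.
Proof.
move=> C0 h00 FB FL FC F0 F1 x y x01; apply/ler_addgt0Pr => e e0.
(* With [C h <= e/2] the bound [1 + 2 C h] proved below for the supremum of [w] is at most
   [1 + e]. *)
pose h := Num.min h0 (Num.min (e / (2 * C)) 4^-1).
have h_gt0 : 0 < h by rewrite !lt_min h00 divr_gt0//= ?mulr_gt0// invr_gt0.
have hh0 : h <= h0 by rewrite ge_min lexx.
have he : h <= e / (2 * C) by rewrite !ge_min lexx /= orbT.
have h4 : h <= 4^-1 by rewrite !ge_min lexx !orbT.
pose w a b := F a b + C * h * a ^+ 2.
pose W := [set w z.1 z.2 | z in [set z : R * R | 0 <= z.1 <= 1]].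
have supW : has_sup W.
  split; first by exists (w x y), (x, y).
  exists (B + C * h) => _ [[a b] /= ab <-]; rewrite /w lerD ?FB//.
  rewrite -[leRHS]mulr1 ler_wpM2l//; first by rewrite mulr_ge0 ?ltW.
  by case/andP: ab => a0 a1; rewrite exprn_ile1.
have wS a b : 0 <= a <= 1 -> w a b <= sup W.
  by move=> ab; apply: ub_le_sup; [exact: supW.2|exists (a, b)].
have key : sup W <= 1 + 2 * (C * h).
  rewrite leNgt; apply/negP => lt.
  (* A near-maximiser is taken within less than both the excess of the supremum over [1 + 2 C h] and
     a quarter of the net gain [C h^3]: the barrier contributes [2 C h^3] to the four-point sum and
     the defect of [F] costs [C h^3]. *)
  have eta0 : 0 < Num.min (C * h ^+ 3 / 4) (sup W - (1 + 2 * (C * h))).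
    by rewrite lt_min subr_gt0 lt andbT divr_gt0// mulr_gt0// exprn_gt0.
  have [_ [[a b] /= ab <-] wab] := sup_adherent eta0 supW.
  have Ch : 0 <= C * h by rewrite mulr_ge0 ?ltW.
  have ba : C * h * a ^+ 2 <= C * h.
    rewrite -[leRHS]mulr1 ler_wpM2l//.
    by case/andP: ab => a0 a1; rewrite exprn_ile1.
  (* Within [h] of a boundary line the Lipschitz estimate costs [C h] and the barrier at most
     another [C h], contradicting the choice of the near-maximiser. *)
  have bdry c : 0 <= c <= 1 -> `|a - c| <= h -> (forall y, F c y <= 1) -> False.
    move=> c01 ach Fc; have h1 := FC a c b ab c01; have h2 := Fc b.
    have h3 : C * `|a - c| <= C * h by exact: (ler_wpM2l (ltW C0)).
    have : w a b <= 1 + 2 * (C * h) by rewrite /w; lra.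
    move=> wl; have := lt_le_trans wab wl.
    by rewrite ltrBlDr -ltrBlDl ltNge ge_min lexx orbT.
  case/andP: (ab) => a0 a1.
  case: (ltP a h) => ah.
    by apply: (bdry 0); rewrite ?lexx ?ler01// subr0 ger0_norm// ltW.
  case: (ltP (1 - h) a) => ah1.
    apply: (bdry 1); rewrite ?lexx ?ler01// ler_norml; apply/andP; split; lra.
  have := FL h a b; rewrite h_gt0 hh0 ah ah1 => /(_ isT isT) L.
  have n1 := wS (a + h) b; have n2 := wS (a - h) b.
  have n3 := wS a (b + h) ab; have n4 := wS a (b - h) ab.
  have {}n1 : w (a + h) b <= sup W by apply: n1; apply/andP; split; lra.
  have {}n2 : w (a - h) b <= sup W by apply: n2; apply/andP; split; lra.
  have : w a b <= sup W - C * h ^+ 3 / 4.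
    have E : 4 * w a b + C * h ^+ 3 = 4 * F a b + 4 * (C * h * a ^+ 2) + C * h ^+ 3.
      by rewrite /w; ring.
    have E2 : w (a + h) b + w (a - h) b + w a (b + h) + w a (b - h) =
        F (a + h) b + F (a - h) b + F a (b + h) + F a (b - h)
        + 4 * (C * h * a ^+ 2) + 2 * (C * h ^+ 3).
      by rewrite /w; ring.
    lra.
  move=> wl; have := lt_le_trans wab wl.
  by rewrite ltrD2l ltrN2 ltNge ge_min lexx.
have := wS x y x01; have : 0 <= C * h * x ^+ 2.
  by rewrite mulr_ge0 ?sqr_ge0// (mulr_ge0 (ltW C0) (ltW h_gt0)).
have : C * h <= e / 2.
  have -> : e / 2 = C * (e / (2 * C)) by field; rewrite gt_eqF.
  by rewrite ler_wpM2l// ltW.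
rewrite /w; lra.
Qed.

Lemma sin_le_id (u : R) : 0 <= u -> sin u <= u.
Proof.
move=> u0; have := @MVT_segment R sin cos 0 u u0 (fun x _ => is_derive_sin x).
case.
  by apply: continuous_subspaceT => x; exact: continuous_sin.
move=> c _; rewrite sin0 !subr0 => ->.
by rewrite ler_piMl// cos_le1.
Qed.

Lemma sin_ge_quad (u : R) : 0 <= u <= 1 -> u - u ^+ 2 <= sin u.
Proof.
move=> /andP[u0 u1]; have := @MVT_segment R sin cos 0 u u0 (fun x _ => is_derive_sin x).
case.
  by apply: continuous_subspaceT => x; exact: continuous_sin.
move=> c; rewrite in_itv /= => /andP[c0 cu]; rewrite sin0 !subr0 => ->.
have s1 : 0 <= c / 2 by rewrite divr_ge0.
have s2 : sin (c / 2) <= c / 2 by exact: sin_le_id.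
have s3 : 0 <= sin (c / 2).
  apply: sin_ge0_pi; rewrite s1 /=; have := @pi_ge2 R; lra.
have E : cos c = 1 - 2 * sin (c / 2) ^+ 2.
  rewrite -{1}(divfK (_ : 2 != 0) c)// mulr_natr cos_mulr2n cos2sin2; ring.
have s4 : sin (c / 2) ^+ 2 <= (c / 2) ^+ 2 by rewrite ler_sqr ?nnegrE.
have s5 : 1 - u <= cos c by rewrite E; nra.
nra.
Qed.

(** With [u = t/2] the expression is [(2 sinh u)^2 - (2 sin u)^2]. The difference of the two roots
    is [O(u^2)] and their sum [O(u)], so crude bounds for [exp] and [sin] already give the third
    order. The expression is the defect of the four-point Laplacian of step [t] on [e^z] at [0]. *)
Lemma exp_cos_laplacian (t : R) : 0 <= t <= 1 ->
  `|expR t + expR (- t) + 2 * cos t - 4| <= 4 * t ^+ 3.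
Proof.
move=> /andP[t0 t1]; pose u := t / 2.
have tE : t = u + u by rewrite /u; lra.
have u0 : 0 <= u by rewrite /u; lra.
have u1 : u <= 2^-1 by rewrite /u; lra.
have b1 : 1 + u <= expR u by exact: expR_ge1Dx.
have b2 : 1 - u <= expR (- u) by exact: expR_ge1Dx.
have p : expR u * expR (- u) = 1 by rewrite expRxMexpNx_1.
have b3 : 0 < expR (- u) by exact: expR_gt0.
have b4 : 0 < expR u by exact: expR_gt0.
have b5 : expR u <= 1 + u + 2 * u ^+ 2 by nra.
have b6 : expR (- u) <= 1 - u + u ^+ 2 by nra.
set s := expR u - expR (- u).
have s1 : s <= 2 * u + 2 * u ^+ 2 by rewrite /s; lra.
have s2 : 2 * u - u ^+ 2 <= s by rewrite /s; lra.
have c1 : sin u <= u by exact: sin_le_id.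
have c2 : u - u ^+ 2 <= sin u by apply: sin_ge_quad; rewrite u0; lra.
have -> : expR t + expR (- t) + 2 * cos t - 4 = (s - 2 * sin u) * (s + 2 * sin u).
  rewrite tE opprD !expRD cosD -!expr2 cos2sin2 /s.
  have -> : 4 = 4 * (expR u * expR (- u)) :> R by rewrite p mulr1.
  rewrite -[X in 2 * (X - _ - _)]p; ring.
have d1 : `|s - 2 * sin u| <= 4 * u ^+ 2 by rewrite ler_norml; apply/andP; split; lra.
have d2 : `|s + 2 * sin u| <= 8 * u by rewrite ler_norml; apply/andP; split; nra.
rewrite normrM; apply: (le_trans (ler_pM _ _ d1 d2)) => //.
by rewrite tE; nra.
Qed.

Lemma exp_cos_laplacianN (t : R) : `|t| <= 1 ->
  `|expR t + expR (- t) + 2 * cos t - 4| <= 4 * `|t| ^+ 3.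
Proof.
move=> t1; case: (leP 0 t) => t0.
  by rewrite [X in X ^+ 3]ger0_norm//; apply: exp_cos_laplacian; rewrite t0 -(ger0_norm t0).
have nt : `|t| = - t by rewrite ltr0_norm.
have := @exp_cos_laplacian (- t); rewrite opprK cosN (addrC (expR (- t))).
by rewrite nt; apply; rewrite oppr_ge0 (ltW t0) -nt.
Qed.

Lemma expR_lipschitz (M a b : R) : a <= M -> b <= M ->
  `|expR a - expR b| <= expR M * `|a - b|.
Proof.
wlog ab : a b / b <= a.
  move=> h aM bM; case: (leP b a) => [ab|/ltW ab]; first exact: h.
  by rewrite distrC (distrC a); apply: h.
move=> aM bM; rewrite !ger0_norm ?subr_ge0 ?ler_expR//.
have -> : expR b = expR a * expR (b - a) by rewrite -expRD addrC subrK.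
have h : 1 + (b - a) <= expR (b - a) by exact: expR_ge1Dx.
have h1 : 0 < expR a by exact: expR_gt0.
have h2 : expR a <= expR M by rewrite ler_expR.
nra.
Qed.

Section Family.
Context d (T : measurableType d).
Variables (m : {measure set T -> \bar R}) (A : T -> R[i]) (L : T -> R) (M : R).
Hypotheses (iA : cintble m A) (mL : measurable_fun setT L) (M0 : 0 < M)
  (LM : forall t, `|L t| <= M).

(** The integrand [A e^(L z)] at [z = x + i y], entire in [z] for each fixed [t]. *)
Definition expfam (x y : R) (t : T) : R[i] :=
  A t * ((expR (L t * x))%:C%C * cis (L t * y)).

Lemma cmod_expfam x y t : cmod (expfam x y t) = cmod (A t) * expR (L t * x).
Proof.
by rewrite /expfam !cmodM cmod_cis cmod_real mulr1 ger0_norm// expR_ge0.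
Qed.

Lemma expfam_le x t : 0 <= x <= 1 -> L t * x <= M.
Proof.
move=> /andP[x0 x1]; rewrite (le_trans (ler_norm _))// normrM (ger0_norm x0).
by rewrite -[leRHS]mulr1 ler_pM.
Qed.

Lemma cmeas_expfam x y : cmeas (expfam x y).
Proof.
apply: cmeasM; first by case: iA.
apply: cmeasM.
  apply: cmeas_real; apply: (measurableT_comp (@measurable_expR R)).
  exact: measurable_funM.
by apply: cmeas_cis; exact: measurable_funM.
Qed.

Lemma cintble_expfam_mul (p : T -> R) x y (c : R) : measurable_fun setT p ->
  (forall t, `|p t| <= c) -> 0 <= x <= 1 ->
  cintble m (fun t => (p t)%:C%C * expfam x y t).
Proof.
move=> mp pc x01; apply: (@cintbleMb _ _ _ _ _ _ c).
- exact: cmeas_real.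
- by move=> t; rewrite cmod_real.
have iE : cintble m (fun t => (expR M)%:C%C * A t) by exact: cintbleZ.
apply: cintble_le iE; first exact: cmeas_expfam.
move=> t; rewrite cmod_expfam cmodM cmod_real ger0_norm ?expR_ge0// mulrC.
by rewrite ler_wpM2r ?cmod_ge0// ler_expR expfam_le.
Qed.

Lemma cintble_expfam x y : 0 <= x <= 1 -> cintble m (expfam x y).
Proof.
move=> x01; have := @cintble_expfam_mul (fun=> 1) x y 1 _ _ x01.
under [X in cintble _ X]eq_fun do rewrite mul1r.
by apply => // t; rewrite normr1.
Qed.

(** A single [K] serves all the estimates below, since each integrand met there is at most
    [c e^M |A|]; the summand [1] keeps [K] positive even when [A] vanishes. *)
Let bound_ex : exists2 K : R, 0 < K & forall (c : R) (f : T -> R[i]), 0 <= c ->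
  cmeas f -> (forall t, cmod (f t) <= c * expR M * cmod (A t)) ->
  cmod (cint m f) <= c * K.
Proof.
have I0 : 0 <= fine (\int[m]_t (cmod (A t))%:E).
  by rewrite fine_ge0//; apply: integral_ge0 => t _; rewrite lee_fin cmod_ge0.
exists ((fine (\int[m]_t (cmod (A t))%:E) + 1) * expR M).
  by rewrite mulr_gt0 ?expR_gt0// ltr_wpDl.
move=> c f c0 mf fA; apply: cint_le => //.
apply: (@le_trans _ _ (\int[m]_t ((c * expR M)%:E * (cmod (A t))%:E))%E).
  apply: ge0_le_integral => //.
  - by move=> t _; rewrite lee_fin cmod_ge0.
  - by apply/measurable_EFinP; exact: measurable_cmod.
  - apply/measurable_EFinP; apply: measurable_funM => //.
    by apply: measurable_cmod; case: iA.
  - by move=> t _; rewrite -EFinM lee_fin.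
rewrite ge0_integralZl_EFin ?mulr_ge0 ?expR_ge0//.
- rewrite -[X in (_ * X)%E]fineK; last first.
    rewrite ge0_fin_numE; first by case: iA.
    by apply: integral_ge0 => t _; rewrite lee_fin cmod_ge0.
  rewrite -EFinM lee_fin -mulrA ler_wpM2l// mulrC ler_wpM2r ?expR_ge0//.
  by rewrite lerDl.
- by move=> t _; rewrite lee_fin cmod_ge0.
- by apply/measurable_EFinP; apply: measurable_cmod; case: iA.
Qed.

Let E x y := cmod (cint m (expfam x y)).

Section Estimates.
Variable K : R.
Hypotheses (K0 : 0 < K) (KE : forall (c : R) (f : T -> R[i]), 0 <= c ->
  cmeas f -> (forall t, cmod (f t) <= c * expR M * cmod (A t)) ->
  cmod (cint m f) <= c * K).

Let laplacian h x y : 0 < h <= M^-1 -> h <= x <= 1 - h ->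
  4 * E x y <= E (x + h) y + E (x - h) y + E x (y + h) + E x (y - h)
    + 4 * K * (M ^+ 3 + M + 1) * h ^+ 3.
Proof.
move=> /andP[h0 hM] /andP[hx xh].
have x01 : 0 <= x <= 1 by apply/andP; split; lra.
have x1 : 0 <= x + h <= 1 by apply/andP; split; lra.
have x2 : 0 <= x - h <= 1 by apply/andP; split; lra.
pose phi t := expR (L t * h) + expR (- (L t * h)) + 2 * cos (L t * h) - 4.
have Lh t : `|L t * h| <= M * h by rewrite normrM (gtr0_norm h0) ler_wpM2r ?(ltW h0).
have Mh : M * h <= 1 by rewrite -ler_pdivlMl// mulr1.
have phi_le t : `|phi t| <= 4 * M ^+ 3 * h ^+ 3.
  apply: (le_trans (exp_cos_laplacianN (le_trans (Lh t) Mh))).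
  by rewrite -mulrA -exprMn ler_wpM2l// lerXn2r// ?nnegrE// mulr_ge0 ?ltW.
have mphi : measurable_fun setT phi.
  have ml : measurable_fun setT (fun t => L t * h) by exact: measurable_funM.
  rewrite /phi; apply: measurable_funB => //; apply: measurable_funD.
    apply: measurable_funD; apply: (measurableT_comp (@measurable_expR R)) => //.
    exact: measurableT_comp.
  apply: measurable_funM => //; apply: measurableT_comp ml.
  by apply: continuous_measurable_fun; exact: continuous_cos.
(* Translations of [z] by [h], [-h], [i h], [-i h] multiply [e^(L z)] by factors whose sum is
   [4 + phi]. *)
have id t : 4%:C%C * expfam x y t = expfam (x + h) y t + expfam (x - h) y t
    + (expfam x (y + h) t + expfam x (y - h) t) - (phi t)%:C%C * expfam x y t.
  rewrite /expfam !mulrDr !mulrN !expRD !cisD.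
  rewrite /phi; apply: complex_ext;
  rewrite !(CreM, CimM, CreD, CimD, CreN, CimN) /= cosN sinN; ring.
have i1 := cintble_expfam y x1; have i2 := cintble_expfam y x2.
have i3 := cintble_expfam (y + h) x01; have i4 := cintble_expfam (y - h) x01.
have i5 := cintble_expfam_mul y mphi phi_le x01.
have i0 := cintble_expfam y x01.
have cE : 4%:C%C * cint m (expfam x y) = cint m (expfam (x + h) y)
    + cint m (expfam (x - h) y) + (cint m (expfam x (y + h)) + cint m (expfam x (y - h)))
    - cint m (fun t => (phi t)%:C%C * expfam x y t).
  rewrite -cintZ//; under eq_cint do rewrite id.
  rewrite cintB ?cintD//; try exact: cintbleD.
  by apply: cintbleD; exact: cintbleD.
have -> : 4 * E x y = cmod (4%:C%C * cint m (expfam x y)).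
  by rewrite cmodM cmod_real ger0_norm.
rewrite cE; apply: (le_trans (ler_cmodD _ _)); rewrite cmodN lerD//.
  apply: (le_trans (ler_cmodD _ _)); rewrite -addrA lerD//.
    exact: ler_cmodD.
  exact: ler_cmodD.
apply: (@le_trans _ _ (4 * M ^+ 3 * h ^+ 3 * K)).
  apply: KE; first by rewrite !mulr_ge0 ?exprn_ge0 ?ltW.
    by case: i5.
  move=> t; rewrite cmodM cmod_real cmod_expfam -mulrA ler_pM//.
    by rewrite mulr_ge0 ?cmod_ge0 ?expR_ge0.
  by rewrite mulrC ler_wpM2r ?cmod_ge0// ler_expR expfam_le.
have := K0; have h3 : 0 < h ^+ 3 by rewrite exprn_gt0.
have M3 : 0 < M ^+ 3 by rewrite exprn_gt0.
move=> k0; have -> : 4 * K * (M ^+ 3 + M + 1) * h ^+ 3 =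
  4 * M ^+ 3 * h ^+ 3 * K + 4 * K * (M + 1) * h ^+ 3 by ring.
have M1 : 0 <= M + 1 by rewrite addr_ge0 ?(ltW M0).
by rewrite lerDl; apply: mulr_ge0 (ltW h3); apply: mulr_ge0 M1; apply: mulr_ge0 (ltW k0).
Qed.

Let lipschitz x x' y : 0 <= x <= 1 -> 0 <= x' <= 1 ->
  E x y <= E x' y + 4 * K * (M ^+ 3 + M + 1) * `|x - x'|.
Proof.
move=> x01 x01'; have i0 := cintble_expfam y x01; have i1 := cintble_expfam y x01'.
rewrite -lerBlDl; apply: (le_trans (ler_cmodB _ _)); rewrite -cintB//.
apply: (@le_trans _ _ (M * `|x - x'| * K)).
  apply: KE; first by rewrite mulr_ge0 ?(ltW M0).
    by apply: cmeasD; [|apply: cmeasN]; exact: cmeas_expfam.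
  move=> t; rewrite /expfam -mulrBr -mulrBl -rmorphB /= !cmodM cmod_cis cmod_real.
  rewrite mulr1 mulrC ler_wpM2r ?cmod_ge0//.
  apply: (le_trans (expR_lipschitz (expfam_le t x01) (expfam_le t x01'))).
  by rewrite mulrC ler_wpM2r ?expR_ge0// -mulrBr normrM ler_wpM2r.
have -> : 4 * K * (M ^+ 3 + M + 1) * `|x - x'| =
  M * `|x - x'| * K + K * (4 * M ^+ 3 + 3 * M + 4) * `|x - x'| by ring.
have M3 : 0 < M ^+ 3 by rewrite exprn_gt0.
have k0 := K0.
have M1 : 0 <= 4 * M ^+ 3 + 3 * M + 4.
  by rewrite !addr_ge0 ?mulr_ge0 ?(ltW M3) ?(ltW M0).
by rewrite lerDl; apply: mulr_ge0 (normr_ge0 _); apply: mulr_ge0 (ltW k0) M1.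
Qed.

Lemma three_lines_bound (x : R) : (forall y, cmod (cint m (expfam 0 y)) <= 1) ->
  (forall y, cmod (cint m (expfam 1 y)) <= 1) -> 0 <= x <= 1 ->
  cmod (cint m (expfam x 0)) <= 1.
Proof.
move=> b0 b1 x01.
have M3 : 0 < M ^+ 3 by rewrite exprn_gt0.
apply: (@strip_maximum E K (4 * K * (M ^+ 3 + M + 1)) M^-1 _ _ _ laplacian lipschitz b0 b1 x 0 x01).
- by rewrite !mulr_gt0 ?addr_gt0.
- by rewrite invr_gt0.
- move=> u y u01; rewrite -[K]mul1r; apply: KE => //; first exact: cmeas_expfam.
  move=> t; rewrite cmod_expfam mul1r mulrC ler_wpM2r ?cmod_ge0//.
  by rewrite ler_expR expfam_le.
Qed.

End Estimates.

Lemma three_lines1 (x : R) : (forall y, cmod (cint m (expfam 0 y)) <= 1) ->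
  (forall y, cmod (cint m (expfam 1 y)) <= 1) -> 0 <= x <= 1 ->
  cmod (cint m (expfam x 0)) <= 1.
Proof. by case: bound_ex => K K0 KE; exact: (three_lines_bound K0 KE). Qed.

End Family.

(** Multiplying by [c0^-1 (c0/c1)^z] normalises both boundary bounds to [1]. This stays within the
    family: it replaces [L] by [L + ln c0 - ln c1] and [A] by [A / c0]. *)
Lemma three_lines d (T : measurableType d) (m : {measure set T -> \bar R})
    (A : T -> R[i]) (L : T -> R) (M c0 c1 x : R) :
  cintble m A -> measurable_fun setT L -> (forall t, `|L t| <= M) ->
  0 < c0 -> 0 < c1 -> (forall y, cmod (cint m (expfam A L 0 y)) <= c0) ->
  (forall y, cmod (cint m (expfam A L 1 y)) <= c1) -> 0 <= x <= 1 ->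
  cmod (cint m (expfam A L x 0)) <= c0 `^ (1 - x) * c1 `^ x.
Proof.
move=> iA mL LM c00 c10 b0 b1 x01.
pose l := ln c0 - ln c1.
pose L' t := L t + l; pose A' t := (c0^-1)%:C%C * A t.
have LM' t : `|L' t| <= `|M| + `|l| + 1.
  rewrite (le_trans (ler_normD _ _))// -addrA lerD//.
    by rewrite (le_trans (LM t))// ler_norm.
  by rewrite lerDl.
have mL' : measurable_fun setT L' by exact: measurable_funD.
have iA' : cintble m A' by exact: cintbleZ.
have M0 : 0 < `|M| + `|l| + 1 by rewrite ltr_wpDl.
have cE u y : 0 <= u <= 1 -> cmod (cint m (expfam A' L' u y)) =
    c0^-1 * expR (l * u) * cmod (cint m (expfam A L u y)).
  move=> u01.
  have -> : expfam A' L' u y = fun t => ((c0^-1 * expR (l * u))%:C%C * cis (l * y)) * expfam A L u y t.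
    apply/funext => t; rewrite /expfam /A' /L' !mulrDl expRD cisD !rmorphM /=.
    ring.
  rewrite cintZ; last first.
    apply: (cintble_expfam (M := `|M| + 1) iA) => //.
    move=> t; rewrite (le_trans (LM t))// (le_trans (ler_norm _))// lerDl//.
  by rewrite !cmodM cmod_cis cmod_real mulr1 ger0_norm// mulr_ge0 ?expR_ge0 ?invr_ge0 ?(ltW c00).
have := three_lines1 iA' mL' M0 LM' _ _ x01; rewrite cE//.
have e1 : expR l = c0 / c1 by rewrite /l expRB !lnK.
have -> : c0 `^ (1 - x) * c1 `^ x = c0 * (expR (l * x))^-1.
  rewrite /powR !gt_eqF// -expRD -expRN -[X in _ = X * _](lnK c00) -expRD.
  by congr expR; rewrite /l; ring.
rewrite ler_pdivlMr ?expR_gt0// mulrC.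
rewrite mulrCA ler_pdivrMl// mulr1.
apply => y.
  by rewrite cE ?lexx ?ler01// mulr0 expR0 mulr1 mulrC ler_pdivrMr// mul1r.
rewrite cE ?lexx ?ler01// mulr1 e1 mulrA mulVf ?gt_eqF// mul1r mulrC.
by rewrite ler_pdivrMr// mul1r.
Qed.

End ThreeLines.

(** * The Fourier transform and the Hausdorff-Young inequality *)

Section LineIntegrals.
Variable R : realType.
Local Notation leb1 := (@lebesgue_measure R).

(** Allows [f] to change sign: the truncations to [[0, n+1]] are dominated by [|f|] itself, so
    dominated convergence applies and the limit of [F] is only asked along the integers. *)
Lemma FTC_halfline (f F : R -> R) (l : R) : continuous f ->
  (forall x : R, is_derive x (1 : R) F (f x)) ->
  leb1.-integrable `[0%R, +oo[ (EFin \o f) -> (fun n : nat => F n%:R) @ \oo --> l ->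
  \int[leb1]_(t in `[0%R, +oo[) f t = l - F 0.
Proof.
move=> cf dF fi Fl.
have cF : continuous F.
  by move=> x; apply: differentiable_continuous; apply/derivable1_diffP; case: (dF x).
pose g (n : nat) := (EFin \o f) \_ (`[0, n.+1%:R]%classic).
have h1 : (fun n => \int[leb1]_(t in `[0%R, +oo[) g n t)%E @ \oo --> (\int[leb1]_(t in `[0%R, +oo[) (f t)%:E)%E.
  have mf : measurable_fun setT f by exact: continuous_measurable_fun.
  apply: (@dominated_cvg _ _ _ leb1 `[0%R, +oo[%classic (measurable_itv _) g (EFin \o f) (abse \o (EFin \o f))) => //.
  - move=> n; apply: (@measurable_funS _ _ _ _ setT) => //.
    apply/measurable_restrict => //; rewrite setTI.
    by apply/measurable_EFinP; exact: measurable_funTS.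
  - move=> x /=; rewrite in_itv/= andbT => x0; apply: cvg_near_cst.
    near=> n; rewrite /g patchE mem_set//= in_itv /= x0 /=.
    near: n; exists (Num.truncn x) => // n /= xn.
    by rewrite (le_trans (ltW (truncnS_gt x)))// ler_nat ltnS.
  - exact: integrable_abse.
  - move=> n x _; rewrite /g patchE; case: ifPn => // _; rewrite abse0 /=.
    by rewrite lee_fin.
have h2 n : (\int[leb1]_(t in `[0%R, +oo[) g n t = (F n.+1%:R - F 0)%:E)%E.
  rewrite -integral_mkcondr setIidr; last first.
    by move=> x /=; rewrite !in_itv /= => /andP[->].
  rewrite (@continuous_FTC2 _ f F)//.
  - exact: continuous_subspaceT.
  - split; first by move=> x _; case: (dF x).
      by apply: cvg_at_right_filter; exact: cF.
    by apply: cvg_at_left_filter; exact: cF.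
  - by move=> x _; rewrite derive1E; exact: derive_val.
have h3 : (fun n => (F n.+1%:R - F 0)%:E) @ \oo --> (l - F 0)%:E.
  apply: cvg_EFin; first exact: nearW.
  apply: cvgB; last exact: cvg_cst.
  by rewrite (cvg_shiftS (fun n : nat => F n%:R)).
rewrite /Rintegral; have -> // : (\int[leb1]_(t in `[0%R, +oo[) (f t)%:E = (l - F 0)%:E)%E.
move/cvg_lim : h1 => <-//; under eq_fun do rewrite h2.
exact/cvg_lim.
Unshelve. all: by end_near. Qed.

Lemma integral_sym (f : R -> \bar R) : measurable_fun setT f -> (forall t, 0 <= f t)%E ->
  (\int[leb1]_t f t = \int[leb1]_(t in `[0%R, +oo[) (f t + f (- t)%R))%E.
Proof.
move=> mf f0.
have mfN : measurable_fun [set: R] (fun t : R => f (- t)%R).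
  exact: (measurableT_comp mf (@oppr_measurable R setT)).
rewrite ge0_integralD//; [|exact: measurable_funTS|exact: measurable_funTS].
have -> : (\int[leb1]_(x in `[0%R, +oo[) f (- x)%R = \int[leb1]_(x in `]-oo, 0%R]) f x)%E.
  rewrite ge0_integration_by_substitution0//.
  by under [LHS]eq_integral do rewrite opprK.
rewrite -[RHS]addeC.
have -> : (\int[leb1]_(x in `]-oo, 0%R]) f x = \int[leb1]_(x in `]-oo, 0%R[) f x)%E.
  by apply/esym; apply: integral_itv_bndo_bndc; exact: measurable_funTS.
rewrite -ge0_integral_setU//=.
- congr integral; rewrite -(setUv `]-oo, 0%R[%classic); congr setU.
  by rewrite setCitvl.
- exact: measurable_funTS.
- apply/disj_setPS => x [] /=; rewrite !in_itv/= andbT => x0 x1.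
  by move: (lt_le_trans x0 x1); rewrite ltxx.
Qed.

Lemma integrable_comp_opp (f : R -> R) : leb1.-integrable setT (EFin \o f) ->
  leb1.-integrable setT (EFin \o (fun t => f (- t))).
Proof.
move=> /integrableP[mf fi]; have {}mf : measurable_fun setT f by exact/measurable_EFinP.
have mfN : measurable_fun [set: R] (fun t : R => f (- t)) by exact: (measurableT_comp mf (@oppr_measurable R setT)).
apply/integrableP; split; first exact/measurable_EFinP.
rewrite integral_sym//=; last first.
  by apply/measurable_EFinP; exact: measurableT_comp.
under eq_integral do rewrite opprK addeC.
rewrite -(@integral_sym (fun t => `|f t|%:E))//.
by apply/measurable_EFinP; exact: measurableT_comp.
Qed.

Lemma Rint_sym (f : R -> R) : leb1.-integrable setT (EFin \o f) ->
  \int[leb1]_(t in [set: R]) f t = \int[leb1]_(t in `[0%R, +oo[) (f t + f (- t)).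
Proof.
move=> fi; have fiN := integrable_comp_opp fi.
have mf : measurable_fun setT f by apply/measurable_EFinP; exact: measurable_int fi.
have mfN : measurable_fun [set: R] (fun t : R => f (- t)) by exact: (measurableT_comp mf (@oppr_measurable R setT)).
have sub (g : R -> R) : leb1.-integrable setT (EFin \o g) ->
    leb1.-integrable `[0%R, +oo[ (EFin \o g).
  by apply: integrableS => //; exact: measurable_itv.
have E1 (g : R -> R) : leb1.-integrable setT (EFin \o g) -> (forall t, 0 <= g t) ->
    \int[leb1]_(t in [set: R]) g t = \int[leb1]_(t in `[0%R, +oo[) (g t + g (- t)).
  move=> gi g0; rewrite /Rintegral integral_sym//.
    by apply/measurable_EFinP/measurable_EFinP; exact: measurable_int gi.
have ip := integrable_funrpos measurableT fi; have im := integrable_funrneg measurableT fi.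
have fE u : f u = f^\+ u - f^\- u.
  by rewrite -{1}(funrposBneg f).
transitivity (\int[leb1]_(t in [set: R]) (f^\+ t - f^\- t)).
  by apply: eq_Rintegral => t _; rewrite fE.
rewrite RintegralB// E1// E1//.
have ipN := integrable_comp_opp ip; have imN := integrable_comp_opp im.
have iD (g h : R -> R) : leb1.-integrable setT (EFin \o g) -> leb1.-integrable setT (EFin \o h) ->
    leb1.-integrable `[0%R, +oo[ (EFin \o (fun t => g t + h t)).
  by move=> gi hi; apply: sub; have := integrableD measurableT gi hi.
rewrite -RintegralB//; [|exact: iD|exact: iD].
apply: eq_Rintegral => t _.
rewrite (fE t) (fE (- t)); ring.
Qed.

(** [F t - F (-t)] is a primitive of [f t + f (-t)], which folds the line onto a half-line. This is
    the vanishing boundary term of integration by parts. *)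
Lemma Rint_derive0 (f F : R -> R) : continuous f ->
  (forall x : R, is_derive x (1 : R) F (f x)) -> leb1.-integrable setT (EFin \o f) ->
  (fun n : nat => F n%:R) @ \oo --> (0 : R) -> (fun n : nat => F (- n%:R)) @ \oo --> (0 : R) ->
  \int[leb1]_(t in [set: R]) f t = 0.
Proof.
move=> cf dF fi F1 F2; rewrite Rint_sym//.
transitivity (0 - (F 0 - F (- 0))); last by rewrite oppr0 !subrr.
apply: (@FTC_halfline _ (fun t => F t - F (- t))).
- move=> x; apply: cvgD; first exact: cf.
  by apply: (@continuous_comp _ _ _ -%R f); [exact: opp_continuous|exact: cf].
- move=> x.
  have d1 : is_derive x (1 : R) (fun t => F (- t)) (- f (- x)).
    have := @is_derive1_comp _ F -%R x (f (- x)) (- 1) (dF _) _.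
    rewrite mulrN mulr1; apply.
  by have := is_deriveB (dF x) d1; rewrite opprK.
- apply: (@integrableS _ _ _ _ setT) => //.
  exact: (integrableD measurableT fi (integrable_comp_opp fi)).
- by rewrite -[X in _ --> X](subr0 0); apply: cvgB.
Qed.

Lemma cvg0_le (u v : nat -> R) : (forall n, `|u n| <= v n) ->
  v @ \oo --> (0 : R) -> u @ \oo --> (0 : R).
Proof.
move=> uv v0; apply: (@squeeze_cvgr _ _ _ _ (fun n => - v n) v) => //.
  by apply: nearW => n; rewrite -ler_norml.
by rewrite -oppr0; exact: cvgN.
Qed.

Lemma cvg_expRn (e : R) : 0 < e -> (fun n : nat => expR (- (e * n%:R))) @ \oo --> (0 : R).
Proof.
move=> e0; under eq_fun do rewrite -mulNr expRM_natr.
apply: cvg_expr; rewrite ger0_norm ?expR_ge0// expR_lt1; lra.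
Qed.

Lemma is_derive1_val (f : R -> R) (x df : R) : is_derive x (1 : R) f df -> f^`()%classic x = df.
Proof. by move=> d; rewrite derive1E; exact: derive_val. Qed.

Definition pexp (e t : R) := expR (- (e * `|t|)).

Lemma measurable_pexp e : measurable_fun [set: R] (pexp e).
Proof.
apply: (measurableT_comp (@measurable_expR R)); apply: measurableT_comp => //.
exact: measurable_funM.
Qed.

Lemma integral_pexp (e : R) : 0 < e -> (\int[leb1]_t (pexp e t)%:E = (2 / e)%:E)%E.
Proof.
move=> e0; rewrite integral_sym; first last.
- by move=> t; rewrite lee_fin expR_ge0.
- by apply/measurable_EFinP; exact: measurable_pexp.
have cE (x : R) : continuous (fun t : R => expR (- (e * t))).
  move=> t; apply: (@continuous_comp _ _ _ (fun t => - (e * t)) expR).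
    by apply: cvgN; apply: cvgMr; exact: cvg_id.
  exact: continuous_expR.
transitivity (\int[leb1]_(t in `[0%R, +oo[) (2 * expR (- (e * t)))%:E)%E.
  apply: eq_integral => t; rewrite inE /= in_itv /= andbT => t0.
  by rewrite /pexp normrN ger0_norm// -EFinD; congr EFin; ring.
rewrite (@ge0_continuous_FTC2y _ _ (fun t => - (2 / e) * expR (- (e * t))) 0 0).
- by rewrite mulr0 oppr0 expR0 mulr1 -EFinB sub0r opprK.
- by move=> x _; rewrite mulr_ge0 ?expR_ge0.
- by apply: continuous_subspaceT => x; apply: cvgMr; exact: cE.
- rewrite -[X in _ --> X](mulr0 (- (2 / e))); apply: cvgMr.
  have h : (fun x : R => e * x) @ +oo --> +oo by exact: gt0_cvgMry.
  exact: (cvg_comp _ _ h (@cvgr_expR R)).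
- by move=> x _; exact: ex_derive.
- by apply: cvg_at_right_filter; apply: cvgMr; exact: cE.
- move=> x _; apply: is_derive1_val.
  by apply: is_derive_eq; rewrite /GRing.scale /=; field; rewrite gt_eqF.
Qed.

Lemma cintble_pexp (e v : R) : 0 < e ->
  cintble leb1 (fun t => (pexp e t)%:C%C * cis (v * t)).
Proof.
move=> e0; split.
  apply: cmeasM; first by apply: cmeas_real; exact: measurable_pexp.
  by apply: cmeas_cis; exact: measurable_funM.
under eq_integral do rewrite cmodM cmod_cis mulr1 cmod_real ger0_norm ?expR_ge0//.
by rewrite integral_pexp// ltry.
Qed.

Lemma cint_pexp (e v : R) : 0 < e ->
  cint leb1 (fun t => (pexp e t)%:C%C * cis (v * t))
  = (2 * e / (e ^+ 2 + v ^+ 2))%:C%C.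
Proof.
move=> e0; have ie := cintble_pexp v e0.
have i1 := cintble_Re ie; have i2 := cintble_Im ie.
have D0 : e ^+ 2 + v ^+ 2 != 0.
  by rewrite gt_eqF// ltr_wpDr ?sqr_ge0// exprn_gt0.
apply: complex_ext => /=.
  rewrite Rint_sym//.
  transitivity (\int[leb1]_(t in `[0%R, +oo[) (2 * (expR (- (e * t)) * cos (v * t)))).
    apply: eq_Rintegral => t; rewrite inE /= in_itv /= andbT => t0.
    by rewrite /pexp normrN ger0_norm// !mul0r !subr0 mulrN cosN; ring.
  (* The elementary primitive of twice the integrand [e^(-e t) cos (v t)]; the factor [2] comes from
     folding the even real part, and the odd imaginary part folds to [0]. *)
  pose F (t : R) := 2 * (expR (- (e * t)) * (v * sin (v * t) - e * cos (v * t)) / (e ^+ 2 + v ^+ 2)).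
  have dF (x : R) : is_derive x (1 : R) F (2 * (expR (- (e * x)) * cos (v * x))).
    by rewrite /F; apply: is_derive_eq; rewrite /GRing.scale /=; field.
  rewrite (@FTC_halfline _ F 0 _ dF).
  - by rewrite /F !mulr0 oppr0 expR0 sin0 cos0 mulr0; field.
  - move=> x; apply: cvgMr; apply: cvgM.
      apply: (@continuous_comp _ _ _ (fun t => - (e * t)) expR).
        by apply: cvgN; apply: cvgMr; exact: cvg_id.
      exact: continuous_expR.
    apply: (@continuous_comp _ _ _ (fun t => v * t) cos).
      by apply: cvgMr; exact: cvg_id.
    exact: continuous_cos.
  - have h : leb1.-integrable `[0%R, +oo[ (EFin \o (fun x => Cre ((pexp e x)%:C%C * cis (v * x)))).
      by apply: (@integrableS _ _ _ _ setT) i1.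
    apply: eq_integrable (integrableZl _ 2 h) => //.
    move=> t; rewrite inE /= in_itv /= andbT => t0.
    by rewrite /pexp ger0_norm// mul0r subr0 -EFinM.
  pose c := 2 * ((`|v| + e) / (e ^+ 2 + v ^+ 2)).
  apply: (@cvg0_le _ (fun n => c * expR (- (e * n%:R)))).
    move=> n; rewrite /F /c -mulrA normrM ger0_norm// -!mulrA ler_wpM2l//.
    rewrite normrM (ger0_norm (expR_ge0 _)) mulrA [leRHS]mulrC ler_wpM2l ?expR_ge0//.
    rewrite normrM normfV (ger0_norm (addr_ge0 (sqr_ge0 _) (sqr_ge0 _))).
    rewrite ler_wpM2r ?invr_ge0 ?addr_ge0 ?sqr_ge0//.
    rewrite (le_trans (ler_normB _ _))// !normrM (gtr0_norm e0) lerD//.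
      by rewrite ler_piMr// sin_max.
    by rewrite ler_piMr ?cos_max// ltW.
  by rewrite -[X in _ --> X](mulr0 c); apply: cvgMr; exact: cvg_expRn.
rewrite Rint_sym//; transitivity (\int[leb1]_(t in `[0%R, +oo[) (0 : R)).
  apply: eq_Rintegral => t _.
  by rewrite /pexp normrN mulrN sinN !mul0r !addr0; ring.
by rewrite Rintegral_cst ?mul0r.
Qed.

(** Not normalised: it is the Fourier transform of [pexp e], so its total mass is [2 pi] for every
    [e]. *)
Definition poisson (e v : R) := 2 * e / (e ^+ 2 + v ^+ 2).

Lemma poisson_ge0 (e v : R) : 0 < e -> 0 <= poisson e v.
Proof.
by move=> e0; rewrite /poisson divr_ge0 ?addr_ge0 ?sqr_ge0// mulr_ge0// ltW.
Qed.

Lemma measurable_poisson (e : R) : measurable_fun [set: R] (poisson e).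
Proof.
apply: measurable_funM => //; apply: (measurableT_comp (@measurable_invr R)).
by apply: measurable_funD => //; exact: measurable_funX.
Qed.

Lemma integral_poisson (e : R) : 0 < e -> (\int[leb1]_v (poisson e v)%:E = (2 * pi)%:E)%E.
Proof.
move=> e0; rewrite -(integral_affine 0 e0); first last.
- by move=> t; rewrite lee_fin poisson_ge0.
- by apply/measurable_EFinP; exact: measurable_poisson.
rewrite -ge0_integralZl_EFin ?(ltW e0)//; first last.
- apply/measurable_EFinP; apply: (measurableT_comp (measurable_poisson e)).
  by apply: measurable_funD => //; exact: measurable_funM.
- by move=> t _; rewrite lee_fin poisson_ge0.
transitivity (\int[leb1]_t (2 * (oneDsqr t)^-1)%:E)%E.
  apply: eq_integral => t _; rewrite -EFinM; congr EFin; rewrite /poisson addr0 /oneDsqr.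
  have t0 : 1 + t ^+ 2 != 0 by rewrite gt_eqF// ltr_pwDl// sqr_ge0.
  have e1 : e != 0 by rewrite gt_eqF.
  have -> : e ^+ 2 + (e * t) ^+ 2 = e ^+ 2 * (1 + t ^+ 2) by ring.
  by field; rewrite e1 t0.
under eq_integral do rewrite EFinM.
have mo : measurable_fun [set: R] (fun t : R => (oneDsqr t)^-1).
  by apply: continuous_measurable_fun => x; exact: continuous_oneDsqrV.
rewrite ge0_integralZl_EFin//; last exact/measurable_EFinP.
rewrite integral_sym; first last.
- by move=> t; rewrite lee_fin invr_ge0.
- exact/measurable_EFinP.
have -> : (\int[leb1]_(t in `[0%R, +oo[) ((oneDsqr t)^-1%:E + (oneDsqr (- t))^-1%:E) =
    \int[leb1]_(t in `[0%R, +oo[) ((oneDsqr t)^-1%:E + (oneDsqr t)^-1%:E))%E.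
  by apply: eq_integral => t _; rewrite /oneDsqr sqrrN.
rewrite ge0_integralD//.
- by rewrite integral0y_oneDsqr -EFinD -EFinM; congr EFin; field.
- by apply: measurable_funTS; exact/measurable_EFinP.
- by apply: measurable_funTS; exact/measurable_EFinP.
Qed.

End LineIntegrals.

(** * Fubini for bounded kernels *)

Section CintSwap.
Context d1 d2 (T1 : measurableType d1) (T2 : measurableType d2) (R : realType).
Variable m1 : {sigma_finite_measure set T1 -> \bar R}.
Variable m2 : {sigma_finite_measure set T2 -> \bar R}.

Lemma cintbleMb1 d (T : measurableType d) (m : {measure set T -> \bar R}) (E a : T -> R[i]) :
  cmeas E -> (forall x, cmod (E x) <= 1) -> cintble m a -> cintble m (fun x => E x * a x).
Proof. by move=> mE E1 ia; exact: (cintbleMb mE E1 ia). Qed.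

(** Both sides are the double integral of [E a b], absolutely convergent because [E] is bounded. For
    the kernel [e^(-i x y)] this is the multiplication formula of the Fourier transform. *)
Lemma cint_swap (E : T1 * T2 -> R[i]) (a : T1 -> R[i]) (b : T2 -> R[i]) : cmeas E ->
  (forall z, cmod (E z) <= 1) -> cintble m1 a -> cintble m2 b ->
  cint m1 (fun x => a x * cint m2 (fun y => E (x, y) * b y))
  = cint m2 (fun y => b y * cint m1 (fun x => E (x, y) * a x)).
Proof.
move=> mE E1 ia ib.
pose F z := a z.1 * (E z * b z.2).
have mF : cmeas F.
  apply: cmeasM; first by apply: (cmeas_comp measurable_fst); case: ia.
  by apply: cmeasM => //; apply: (cmeas_comp measurable_snd); case: ib.
transitivity (cint m1 (fun x => cint m2 (fun y => F (x, y)))).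
  apply: eq_cint => x; rewrite -cintZ//; apply: cintbleMb1 => //.
  exact: cmeas_pair2.
rewrite cint_fubini//.
  apply: eq_cint => y; rewrite -cintZ.
    by apply: eq_cint => x; rewrite /F /=; ring.
  by apply: cintbleMb1 => //; exact: cmeas_pair1.
have I0 d (T : measurableType d) (m : {measure set T -> \bar R}) (c : T -> R[i]) :
    cintble m c -> (\int[m]_x (cmod (c x))%:E)%E \is a fin_num.
  move=> [_ ic]; rewrite ge0_fin_numE//.
  by apply: integral_ge0 => t _; rewrite lee_fin cmod_ge0.
apply: (@le_lt_trans _ _ (\int[m1]_x ((cmod (a x))%:E * \int[m2]_y (cmod (b y))%:E))%E).
  apply: ge0_le_integral => //.
  - by move=> x _; apply: integral_ge0 => y _; rewrite lee_fin cmod_ge0.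
  - apply: (measurable_fun_fubini_tonelli_F (m2 := m2) (fun z => (cmod (F z))%:E)).
      by apply/measurable_EFinP; exact: measurable_cmod.
    by move=> z; rewrite lee_fin cmod_ge0.
  - apply: emeasurable_funM => //.
    by apply/measurable_EFinP; apply: measurable_cmod; case: ia.
  move=> x _; rewrite -ge0_integralZl_EFin ?cmod_ge0//; first last.
  - by apply/measurable_EFinP; apply: measurable_cmod; case: ib.
  - by move=> y _; rewrite lee_fin cmod_ge0.
  apply: ge0_le_integral => //.
  - by move=> y _; rewrite lee_fin cmod_ge0.
  - by apply/measurable_EFinP; apply: measurable_cmod; exact: cmeas_pair2.
  - apply/measurable_EFinP; apply: measurable_funM => //.
    by apply: measurable_cmod; case: ib.
  move=> y _; rewrite -EFinM lee_fin /F /= !cmodM ler_wpM2l ?cmod_ge0//.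
  by rewrite ler_piMl ?cmod_ge0.
rewrite ge0_integralZr//.
- rewrite -(fineK (I0 _ _ _ _ ia)) -(fineK (I0 _ _ _ _ ib)).
  by rewrite -EFinM ltry.
- by apply/measurable_EFinP; apply: measurable_cmod; case: ia.
- by move=> x _; rewrite lee_fin cmod_ge0.
- by apply: integral_ge0 => y _; rewrite lee_fin cmod_ge0.
Qed.

Lemma cint_conj d (T : measurableType d) (m : {measure set T -> \bar R}) (f : T -> R[i]) :
  cintble m f -> cint m (fun x => conjc (f x)) = conjc (cint m f).
Proof.
move=> fi; apply: complex_ext => /=.
  by apply: eq_Rintegral => x _; case: (f x).
rewrite -[RHS]mulN1r -RintegralZl//; last exact: cintble_Im.
by apply: eq_Rintegral => x _; rewrite mulN1r; case: (f x).
Qed.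

Lemma cintble_conj d (T : measurableType d) (m : {measure set T -> \bar R}) (f : T -> R[i]) :
  cintble m f -> cintble m (fun x => conjc (f x)).
Proof.
move=> [mf fi]; split; first exact: cmeas_conj.
by under eq_integral do rewrite cmod_conj.
Qed.

Lemma cint_real d (T : measurableType d) (m : {measure set T -> \bar R}) (f : T -> R) :
  cint m (fun x => (f x)%:C%C) = (\int[m]_(x in [set: T]) f x)%:C%C.
Proof.
apply: complex_ext => //=; rewrite Rintegral_cst; last by [].
by rewrite mul0r.
Qed.

End CintSwap.

(** * Fourier transform and the Plancherel inequality *)

Section Fourier.
Variables (R : realType) (n : nat).
Local Notation leb1 := (@lebesgue_measure R).
Local Notation mu := (@lebm R n).
Local Notation Rn := (n.-tuple R).
Implicit Types (u h : Rn -> R[i]).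

Lemma fourierE u (x : Rn) : fourier u x = cint mu (fun y => cis (- dotp x y) * u y).
Proof.
rewrite /fourier; apply: (@eq_cint _ _ _ mu) => y.
by rewrite /cis cosN sinN.
Qed.

Lemma dotpC (x y : Rn) : dotp x y = dotp y x.
Proof. by apply: eq_bigr => i _; rewrite mulrC. Qed.

Lemma cmeas_kernel : cmeas (fun z : Rn * Rn => cis (- dotp z.1 z.2) : R[i]).
Proof.
apply: cmeas_cis; apply: measurableT_comp => //.
by apply: measurable_dotp; [exact: measurable_fst|exact: measurable_snd].
Qed.

Lemma cmeas_kernelN : cmeas (fun z : Rn * Rn => cis (dotp z.1 z.2) : R[i]).
Proof.
apply: cmeas_cis.
by apply: measurable_dotp; [exact: measurable_fst|exact: measurable_snd].
Qed.

Lemma cintble_kernel u x : cintble mu u -> cintble mu (fun y => cis (- dotp x y) * u y).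
Proof.
apply: cintbleMb1; first exact: (cmeas_pair2 x cmeas_kernel).
by move=> y; rewrite cmod_cis.
Qed.

Lemma cmeas_fourier u : cmeas u -> cmeas (fourier u).
Proof.
move=> mu'; rewrite (_ : fourier u = fun x => cint mu (fun y => cis (- dotp x y) * u y)).
  apply: (@cmeas_cint2 _ _ _ _ R mu (fun z => cis (- dotp z.1 z.2) * u z.2)).
  by apply: cmeasM; [exact: cmeas_kernel|exact: (cmeas_comp measurable_snd)].
by apply/funext => x; rewrite fourierE.
Qed.

Lemma fourier_le u x : cintble mu u ->
  ((cmod (fourier u x))%:E <= \int[mu]_y (cmod (u y))%:E)%E.
Proof.
move=> iu; rewrite fourierE; apply: le_trans.
  by apply: le_cmod_cint; case: (cintble_kernel x iu).
by under eq_integral do rewrite cmodM cmod_cis mul1r.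
Qed.

Lemma fourier_bounded u : cintble mu u -> exists M, forall x, cmod (fourier u x) <= M.
Proof.
move=> iu; exists (fine (\int[mu]_y (cmod (u y))%:E)) => x.
rewrite -lee_fin fineK; first exact: fourier_le.
case: iu => _ iu; rewrite ge0_fin_numE//.
by apply: integral_ge0 => t _; rewrite lee_fin cmod_ge0.
Qed.

Lemma conj_fourier u x : cintble mu u ->
  conjc (fourier u x) = cint mu (fun y => cis (dotp x y) * conjc (u y)).
Proof.
move=> iu; rewrite fourierE -cint_conj; last exact: cintble_kernel.
by apply: eq_cint => y; rewrite rmorphM /= /cis cosN sinN /= opprK.
Qed.

Lemma fourierD u h : cintble mu u -> cintble mu h ->
  fourier (fun x => u x + h x) =1 (fun x => fourier u x + fourier h x).
Proof.
move=> iu ih x; rewrite !fourierE -cintD; [|exact: cintble_kernel|exact: cintble_kernel].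
by apply: eq_cint => y; rewrite mulrDr.
Qed.

Lemma fourierB u h : cintble mu u -> cintble mu h ->
  fourier (fun x => u x - h x) =1 (fun x => fourier u x - fourier h x).
Proof.
move=> iu ih x; rewrite !fourierE -cintB; [|exact: cintble_kernel|exact: cintble_kernel].
by apply: eq_cint => y; rewrite mulrBr.
Qed.

Lemma fourierZ (c : R[i]) u : cintble mu u ->
  fourier (fun x => c * u x) =1 (fun x => c * fourier u x).
Proof.
move=> iu x; rewrite !fourierE -cintZ; last exact: cintble_kernel.
by apply: eq_cint => y; rewrite mulrCA.
Qed.

Lemma cis_sum (f : 'I_n -> R) : cis (\sum_(i < n) f i) = \prod_(i < n) cis (f i).
Proof. by apply: (big_morph (@cis R)); [exact: cisD|exact: cis0]. Qed.

Lemma real_prod (f : 'I_n -> R) : (\prod_(i < n) f i)%:C%C = \prod_(i < n) ((f i)%:C%C : R[i]).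
Proof. by rewrite rmorph_prod. Qed.

Definition pexpn (e : R) (x : Rn) : R := \prod_(i < n) pexp e (tnth x i).

Definition poissonn (e : R) (x y : Rn) : R :=
  \prod_(i < n) poisson e (tnth x i - tnth y i).

Lemma pexpn_ge0 e x : 0 <= pexpn e x.
Proof. by apply: prodr_ge0 => i _; exact: expR_ge0. Qed.

Lemma poissonn_ge0 e x y : 0 < e -> 0 <= poissonn e x y.
Proof. by move=> e0; apply: prodr_ge0 => i _; exact: poisson_ge0. Qed.

Lemma poissonC (e v : R) : poisson e (- v) = poisson e v.
Proof. by rewrite /poisson sqrrN. Qed.

Lemma poissonnC e x y : poissonn e x y = poissonn e y x.
Proof. by apply: eq_bigr => i _; rewrite -poissonC opprB. Qed.

Lemma measurable_pexpn e : measurable_fun setT (pexpn e).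
Proof. by apply: (measurable_prod_tnth (f := fun=> pexp e)) => i; exact: measurable_pexp. Qed.

Lemma measurable_poissonn e : measurable_fun setT (fun z : Rn * Rn => poissonn e z.1 z.2).
Proof.
apply: measurable_prod => i _; apply: (measurableT_comp (measurable_poisson e)).
apply: measurable_funB.
  exact: (measurableT_comp (measurable_tnthT i) measurable_fst).
exact: (measurableT_comp (measurable_tnthT i) measurable_snd).
Qed.

Lemma integral_poissonn e y : 0 < e ->
  (\int[mu]_x (poissonn e x y)%:E = ((2 * pi) ^+ n)%:E)%E.
Proof.
move=> e0; rewrite (integral_prod (f := fun i t => poisson e (t - tnth y i))).
- rewrite (eq_bigr (fun=> (2 * pi)%:E)); first by rewrite prodEFin prodr_const card_ord.
  move=> i _; rewrite (integral_translate (- tnth y i) (f := EFin \o poisson e)).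
  - exact: integral_poisson.
  - by apply/measurable_EFinP; exact: measurable_poisson.
  - by move=> t; rewrite lee_fin poisson_ge0.
- move=> i; apply: (measurableT_comp (measurable_poisson e)).
  exact: measurable_funB.
- by move=> i t; exact: poisson_ge0.
Qed.

Lemma cintble_pexpn e : 0 < e -> cintble mu (fun x => (pexpn e x)%:C%C).
Proof.
move=> e0; split; first by apply: cmeas_real; exact: measurable_pexpn.
under eq_integral do rewrite cmod_real ger0_norm ?pexpn_ge0//.
rewrite (integral_prod (f := fun i t => pexp e t)).
- by rewrite (eq_bigr (fun=> (2 / e)%:E)) ?prodEFin ?ltry// => i _; rewrite integral_pexp.
- by move=> i; exact: measurable_pexp.
- by move=> i t; exact: expR_ge0.
Qed.

Lemma cint_pexpn e x y : 0 < e ->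
  cint mu (fun z => cis (dotp z y) * (cis (- dotp x z) * (pexpn e z)%:C%C))
  = (poissonn e y x)%:C%C.
Proof.
move=> e0; rewrite real_prod.
transitivity (cint mu (fun z => \prod_(i < n) ((pexp e (tnth z i))%:C%C *
    cis ((tnth y i - tnth x i) * tnth z i)))).
  apply: eq_cint => z; rewrite big_split /= -real_prod -cis_sum mulrA -cisD mulrC.
  congr (_ * cis _); rewrite /dotp -sumrB; apply: eq_bigr => i _; ring.
rewrite (cint_prod (h := fun i t => (pexp e t)%:C%C *
    cis ((tnth y i - tnth x i) * t))); last by move=> i; exact: cintble_pexp.
by apply: eq_bigr => i _; rewrite cint_pexp.
Qed.

(** The weight makes Fubini legitimate and turns the left side into the double integral of [u x],
    [conj (u y)] and a Poisson kernel in [y - x]. As in Schur's test, [|u x| |u y|] is at most the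
    mean of the two squares, and integrating the kernel in one variable gives its mass [(2 pi)^n].
    Only this inequality, not equality, is needed for interpolation. *)
Lemma plancherel_pexpn e u : 0 < e -> cintble mu u ->
  (\int[mu]_x (cmod (fourier u x) ^+ 2 * pexpn e x)%:E
   <= ((2 * pi) ^+ n)%:E * \int[mu]_x (cmod (u x) ^+ 2)%:E)%E.
Proof.
move=> e0 iu; have mu' : cmeas u by case: iu.
have [M uM] := fourier_bounded iu.
pose G z := (pexpn e z)%:C%C * conjc (fourier u z).
have iG : cintble mu G.
  rewrite (_ : G = fun z => conjc (fourier u z) * (pexpn e z)%:C%C); last first.
    by apply/funext => z; rewrite mulrC.
  apply: (@cintbleMb _ _ _ _ _ _ M).
  - by apply: cmeas_conj; exact: cmeas_fourier.
  - by move=> z; rewrite cmod_conj.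
  - exact: cintble_pexpn.
have GE z : G z * fourier u z = (cmod (fourier u z) ^+ 2 * pexpn e z)%:C%C.
  by rewrite /G -mulrA mul_conjc -rmorphM /= mulrC.
have iI : mu.-integrable setT (EFin \o (fun z => cmod (fourier u z) ^+ 2 * pexpn e z)).
  have : cintble mu (fun z => fourier u z * G z).
    by apply: (@cintbleMb _ _ _ _ _ _ M) => //; exact: cmeas_fourier.
  move=> /cintble_Re; apply: eq_integrable => // z _.
  by rewrite -[RHS]/((Cre (cmod (fourier u z) ^+ 2 * pexpn e z)%:C%C)%:E) -GE mulrC.
have -> : (\int[mu]_x (cmod (fourier u x) ^+ 2 * pexpn e x)%:E)%E =
    (cmod (cint mu (fun z => G z * fourier u z)))%:E.
  under eq_cint do rewrite GE.
  rewrite cint_real cmod_real ger0_norm /Rintegral; last first.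
    by apply: fine_ge0; apply: integral_ge0 => z _; rewrite lee_fin mulr_ge0 ?sqr_ge0 ?pexpn_ge0.
  by rewrite fineK// integrable_fin_num.
have -> : cint mu (fun z => G z * fourier u z) =
    cint mu (fun x => u x * cint mu (fun y => conjc (u y) * (poissonn e y x)%:C%C)).
  transitivity (cint mu (fun z => G z * cint mu (fun x => cis (- dotp z x) * u x))).
    by apply: eq_cint => z; rewrite fourierE.
  have kernel_le1 (z : Rn * Rn) : cmod (cis (- dotp z.1 z.2) : R[i]) <= 1.
    by rewrite cmod_cis.
  rewrite (cint_swap cmeas_kernel kernel_le1 iG iu).
  apply: eq_cint => x; congr (_ * _).
  transitivity (cint mu (fun z => (cis (- dotp x z) * (pexpn e z)%:C%C) *
      cint mu (fun y => cis (dotp z y) * conjc (u y)))).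
    by apply: eq_cint => z; rewrite /G mulrA -conj_fourier// /= dotpC.
  rewrite (cint_swap (E := fun z => cis (dotp z.1 z.2)) cmeas_kernelN).
  - by apply: eq_cint => y; rewrite cint_pexpn.
  - by move=> z; rewrite cmod_cis.
  - exact: cintble_kernel (cintble_pexpn e0).
  - exact: cintble_conj.
have mp x : measurable_fun setT (fun y => poissonn e y x).
  by apply: (@measurable_prod_tnth R n (fun i t => poisson e (t - tnth x i))) => i; apply: (measurableT_comp (measurable_poisson e)); exact: measurable_funB.
(* The majorant of [|u x| |u y|] times the kernel by half the sum of the squares; its two halves
   have the same integral by symmetry of the kernel. *)
pose W z := (2^-1 * (cmod (u z.1) ^+ 2 * poissonn e z.2 z.1)
             + 2^-1 * (cmod (u z.2) ^+ 2 * poissonn e z.2 z.1)) : R.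
have mW : measurable_fun setT W.
  have m1 : measurable_fun setT (fun z : Rn * Rn => poissonn e z.2 z.1).
    apply: (measurableT_comp (measurable_poissonn e) (g := fun z : Rn * Rn => (z.2, z.1))).
    exact: measurable_swap.
  have m2 : measurable_fun setT (fun z => cmod (u z)) by exact: measurable_cmod.
  apply: measurable_funD; apply: measurable_funM => //; apply: measurable_funM => //;
    apply: measurable_funX.
    exact: (measurableT_comp m2 measurable_fst).
  exact: (measurableT_comp m2 measurable_snd).
have m2 : measurable_fun setT (fun z => cmod (u z)) by exact: measurable_cmod.
have mK : measurable_fun setT (fun z : Rn * Rn => poissonn e z.2 z.1).
  apply: (measurableT_comp (measurable_poissonn e) (g := fun z : Rn * Rn => (z.2, z.1))).
  exact: measurable_swap.
have W1 z : 0 <= cmod (u z.1) ^+ 2 * poissonn e z.2 z.1.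
  by rewrite mulr_ge0 ?sqr_ge0 ?poissonn_ge0.
have W2 z : 0 <= cmod (u z.2) ^+ 2 * poissonn e z.2 z.1.
  by rewrite mulr_ge0 ?sqr_ge0 ?poissonn_ge0.
have mW1 : measurable_fun setT (fun z : Rn * Rn => (cmod (u z.1) ^+ 2 * poissonn e z.2 z.1)%:E).
  apply/measurable_EFinP; apply: measurable_funM => //; apply: measurable_funX.
  exact: (measurableT_comp m2 measurable_fst).
have mW2 : measurable_fun setT (fun z : Rn * Rn => (cmod (u z.2) ^+ 2 * poissonn e z.2 z.1)%:E).
  apply/measurable_EFinP; apply: measurable_funM => //; apply: measurable_funX.
  exact: (measurableT_comp m2 measurable_snd).
apply: (@le_trans _ _ (\int[mu]_x \int[mu]_y (W (x, y))%:E)%E).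
  apply: le_trans.
    apply: le_cmod_cint; apply: cmeasM => //.
    apply: (@cmeas_cint2 _ _ _ _ R mu (fun z => conjc (u z.2) * (poissonn e z.2 z.1)%:C%C)).
    apply: cmeasM; last exact: cmeas_real.
    by apply: cmeas_conj; exact: (cmeas_comp measurable_snd).
  apply: ge0_le_integral => //.
  - by move=> x _; rewrite lee_fin cmod_ge0.
  - apply/measurable_EFinP; apply: measurable_cmod; apply: cmeasM => //.
    apply: (@cmeas_cint2 _ _ _ _ R mu (fun z => conjc (u z.2) * (poissonn e z.2 z.1)%:C%C)).
    apply: cmeasM; last exact: cmeas_real.
    by apply: cmeas_conj; exact: (cmeas_comp measurable_snd).
  - apply: (measurable_fun_fubini_tonelli_F (m2 := mu) (fun z => (W z)%:E)).
      exact/measurable_EFinP.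
    by move=> z; rewrite lee_fin addr_ge0// mulr_ge0.
  move=> x _; rewrite cmodM EFinM.
  have mc : cmeas (fun y => conjc (u y) * (poissonn e y x)%:C%C).
    by apply: cmeasM; [exact: cmeas_conj|exact: cmeas_real].
  apply: (@le_trans _ _ ((cmod (u x))%:E * \int[mu]_y (cmod (conjc (u y) * (poissonn e y x)%:C%C))%:E)%E).
    by rewrite lee_wpmul2l ?lee_fin ?cmod_ge0// le_cmod_cint.
  rewrite -ge0_integralZl_EFin ?cmod_ge0//; first last.
  - by apply/measurable_EFinP; exact: measurable_cmod.
  - by move=> y _; rewrite lee_fin cmod_ge0.
  apply: ge0_le_integral => //.
  - by move=> y _; rewrite mule_ge0 ?lee_fin ?cmod_ge0.
  - by apply/measurable_EFinP; apply: measurable_funM => //; exact: measurable_cmod.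
  - by apply/measurable_EFinP; apply: (measurableT_comp mW); exact: pair1_measurable.
  move=> y _; rewrite -EFinM lee_fin /W /= cmodM cmod_conj cmod_real.
  rewrite (ger0_norm (poissonn_ge0 _ _ e0)) !mulrA -mulrDl ler_wpM2r ?poissonn_ge0//.
  have := sqr_ge0 (cmod (u x) - cmod (u y)); nra.
have E1 : (\int[mu]_x \int[mu]_y (cmod (u x) ^+ 2 * poissonn e y x)%:E
    = ((2 * pi) ^+ n)%:E * \int[mu]_x (cmod (u x) ^+ 2)%:E)%E.
  rewrite -ge0_integralZl_EFin//; first last.
  - by rewrite exprn_ge0// mulr_ge0// pi_ge0.
  - by apply/measurable_EFinP; exact: measurable_funX.
  - by move=> x _; rewrite lee_fin sqr_ge0.
  apply: eq_integral => x _; under eq_integral do rewrite EFinM.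
  rewrite ge0_integralZl_EFin ?sqr_ge0//.
  - by rewrite integral_poissonn// muleC.
  - by move=> y _; rewrite lee_fin poissonn_ge0.
  - exact/measurable_EFinP.
have E2 : (\int[mu]_x \int[mu]_y (cmod (u y) ^+ 2 * poissonn e y x)%:E
    = ((2 * pi) ^+ n)%:E * \int[mu]_x (cmod (u x) ^+ 2)%:E)%E.
  have W2e z : (0 <= (cmod (u z.2) ^+ 2 * poissonn e z.2 z.1)%:E)%E by rewrite lee_fin.
  have := @fubini_tonelli _ _ _ _ _ mu mu _ mW2 W2e.
  move=> /= ->; rewrite -E1.
  by apply: eq_integral => x _; apply: eq_integral => y _; rewrite poissonnC.
have W12 x : (\int[mu]_y (W (x, y))%:E = 2^-1%:E * \int[mu]_y (cmod (u x) ^+ 2 * poissonn e y x)%:E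
    + 2^-1%:E * \int[mu]_y (cmod (u y) ^+ 2 * poissonn e y x)%:E)%E.
  have p1 : measurable_fun setT (fun y => (cmod (u x) ^+ 2 * poissonn e y x)%:E).
    by apply/measurable_EFinP; exact: measurable_funM.
  have p2 : measurable_fun setT (fun y => (cmod (u y) ^+ 2 * poissonn e y x)%:E).
    by apply/measurable_EFinP; apply: measurable_funM => //; exact: measurable_funX.
  rewrite -!ge0_integralZl_EFin//; last first.
  - by move=> y _; exact: (W1 (x, y)).
  - by move=> y _; exact: (W2 (x, y)).
  rewrite -ge0_integralD//.
  - by move=> y _; rewrite -EFinM lee_fin mulr_ge0// (W1 (x, y)).
  - by apply: emeasurable_funM.
  - by move=> y _; rewrite -EFinM lee_fin mulr_ge0// (W2 (x, y)).
  - by apply: emeasurable_funM.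
under eq_integral do rewrite W12.
rewrite ge0_integralD//; first last.
- apply: emeasurable_funM => //.
  exact: (measurable_fun_fubini_tonelli_F (m2 := mu) _ mW2 (fun z => W2 z)).
- move=> x _; rewrite mule_ge0//; apply: integral_ge0 => y _; exact: (W2 (x, y)).
- apply: emeasurable_funM => //.
  exact: (measurable_fun_fubini_tonelli_F (m2 := mu) _ mW1 (fun z => W1 z)).
- move=> x _; rewrite mule_ge0//; apply: integral_ge0 => y _; exact: (W1 (x, y)).
rewrite !ge0_integralZl_EFin//; first last.
- exact: (measurable_fun_fubini_tonelli_F (m2 := mu) _ mW1 (fun z => W1 z)).
- move=> x _; apply: integral_ge0 => y _; exact: (W1 (x, y)).
- exact: (measurable_fun_fubini_tonelli_F (m2 := mu) _ mW2 (fun z => W2 z)).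
- move=> x _; apply: integral_ge0 => y _; exact: (W2 (x, y)).
rewrite E1 E2 -ge0_muleDl ?lee_fin// -EFinD.
have -> : 2^-1 + 2^-1 = 1 :> R by field.
by rewrite mul1e.
Qed.

(** The weights [pexpn (1/(k+1))] increase to [1], so monotone convergence applies; the right side
    is allowed to be infinite. *)
Lemma plancherel u : cintble mu u ->
  (\int[mu]_x (cmod (fourier u x) ^+ 2)%:E
   <= ((2 * pi) ^+ n)%:E * \int[mu]_x (cmod (u x) ^+ 2)%:E)%E.
Proof.
move=> iu; have mu' : cmeas u by case: iu.
pose g k x := (cmod (fourier u x) ^+ 2 * pexpn (k.+1%:R^-1) x)%:E.
have mg k : measurable_fun setT (g k).
  apply/measurable_EFinP; apply: measurable_funM; last exact: measurable_pexpn.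
  by apply: measurable_funX; apply: measurable_cmod; exact: cmeas_fourier.
have g0 k x : (0 <= g k x)%E by rewrite lee_fin mulr_ge0 ?sqr_ge0 ?pexpn_ge0.
have ndg x : {homo g ^~ x : a b / (a <= b)%N >-> (a <= b)%E}.
  move=> a b ab; rewrite lee_fin ler_wpM2l ?sqr_ge0// ler_prod// => i _.
  rewrite expR_ge0 /= ler_expR lerN2 ler_wpM2r// lef_pV2 ?posrE//.
  by rewrite ler_nat ltnS.
have limg x : limn (g ^~ x) = (cmod (fourier u x) ^+ 2)%:E.
  apply/cvg_lim => //; apply: cvg_EFin; first exact: nearW.
  rewrite -[X in _ --> X]mulr1; apply: cvgMr.
  have h : (fun k => pexpn (k.+1%:R^-1) x) @ \oo --> \prod_(i < n) (1 : R).
    apply: cvg_big => [|i _]; first exact: mul_continuous.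
    have h : (fun k => - (k.+1%:R^-1 * `|tnth x i|)) @ \oo --> (- (0 * `|tnth x i|) : R).
      by apply: cvgN; apply: cvgMl; exact: cvg_harmonic.
    rewrite mul0r oppr0 in h.
    by have := cvg_comp _ _ h (@continuous_expR R 0); rewrite expR0.
  by rewrite big1 in h.
have -> : (\int[mu]_x (cmod (fourier u x) ^+ 2)%:E = \int[mu]_x limn (g ^~ x))%E.
  by apply: eq_integral => x _; rewrite limg.
rewrite monotone_convergence//; apply: lime_le.
  apply: ereal_nondecreasing_is_cvgn => a b ab.
  by apply: ge0_le_integral => // x _; exact: ndg.
by apply: nearW => k; exact: plancherel_pexpn.
Qed.

End Fourier.

Section DominatedConvergence.
Context d (T : measurableType d) (R : realType) (m : {measure set T -> \bar R}).

Lemma dct0 (f : nat -> T -> R) (g : T -> R) :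
  (forall k, measurable_fun setT (f k)) -> measurable_fun setT g ->
  (forall k x, 0 <= f k x) -> (forall k x, f k x <= g x) ->
  (\int[m]_x (g x)%:E < +oo)%E -> (forall x, (f ^~ x) @ \oo --> 0) ->
  forall e : R, 0 < e -> \forall k \near \oo, (\int[m]_x (f k x)%:E <= e%:E)%E.
Proof.
move=> mf mg f0 fg ig fc e e0.
have ig' : m.-integrable setT (EFin \o g).
  by apply: (integrable_le mg mg) => // x; rewrite ger0_norm// (le_trans (f0 0%N x)).
have h : (fun k => \int[m]_x (f k x)%:E)%E @ \oo --> 0%E.
  rewrite -[X in _ --> X](integral0 m setT).
  apply: (@dominated_cvg _ _ _ m setT measurableT (fun k x => (f k x)%:E) (cst 0%E) (EFin \o g)).
  - by move=> k; exact/measurable_EFinP.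
  - by move=> x _; apply: cvg_EFin (fc x); exact: nearW.
  - by [].
  - exact: ig'.
  - by move=> k x _; rewrite /= lee_fin ger0_norm.
have [[N1 _ hfin] hc] := (fine_cvgP _ _).1 h.
have /cvgrPdist_le /(_ e e0) [N2 _ hN2] := hc.
exists (maxn N1 N2) => // k /=; rewrite geq_max => /andP[/hfin kfin /hN2] /=.
rewrite sub0r normrN => le_e.
by rewrite -(fineK kfin) lee_fin; apply: le_trans le_e; exact: ler_norm.
Qed.

Lemma cint_dct (f : nat -> T -> R[i]) (f1 : T -> R[i]) (g : T -> R) :
  (forall k, cmeas (f k)) -> cmeas f1 -> measurable_fun setT g ->
  (forall k x, cmod (f k x) <= g x) -> (forall x, cmod (f1 x) <= g x) ->
  (\int[m]_x (g x)%:E < +oo)%E -> (forall x, (fun k => cmod (f k x - f1 x)) @ \oo --> 0) ->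
  forall e : R, 0 < e -> \forall k \near \oo, cmod (cint m (f k) - cint m f1) <= e.
Proof.
move=> mf mf1 mg fg f1g ig fc e e0.
have if1 : cintble m f1 by apply: (cintble_leR mf1 mg).
have ifk k : cintble m (f k) by apply: (cintble_leR (mf k) mg).
have md k : cmeas (fun x => f k x - f1 x).
  by apply: cmeasD => //; exact: cmeasN.
have g0 x : 0 <= g x by apply: le_trans (f1g x); exact: cmod_ge0.
have : \forall k \near \oo, (\int[m]_x (cmod (f k x - f1 x))%:E <= e%:E)%E.
  apply: (@dct0 (fun k x => cmod (f k x - f1 x)) (fun x => 2 * g x)) => //.
  - by move=> k; exact: measurable_cmod.
  - exact: measurable_funM.
  - by move=> k x; exact: cmod_ge0.
  - move=> k x; apply: le_trans (ler_cmodD _ _) _.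
    by rewrite cmodN mulr_natl mulr2n lerD.
  - under eq_integral do rewrite EFinM.
    rewrite ge0_integralZl_EFin//.
    + by rewrite lte_mul_pinfty// ?lee_fin.
    + by move=> x _; rewrite lee_fin.
    + exact/measurable_EFinP.
case=> N _ hN; exists N => // k /hN kl.
by rewrite -cintB//; exact: cint_le.
Qed.

End DominatedConvergence.

Section ProductIntegral.
Context d1 d2 (T1 : measurableType d1) (T2 : measurableType d2) (R : realType).
Variable m1 : {sigma_finite_measure set T1 -> \bar R}.
Variable m2 : {sigma_finite_measure set T2 -> \bar R}.

Lemma Rint_prod (F : T1 * T2 -> R) : (m1 \x m2)%E.-integrable setT (EFin \o F) ->
  \int[(m1 \x m2)%E]_(z in [set: T1 * T2]) F z =
  \int[m1]_(x in [set: T1]) (\int[m2]_(y in [set: T2]) F (x, y)).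
Proof.
move=> /[dup] iF /integrableP[/measurable_EFinP mF fF].
rewrite {1}/Rintegral -(integral12_prod_meas1 iF) {1}/Rintegral; congr fine.
apply: ae_eq_integral => //.
- exact: (measurable_fubini_F iF).
- by apply/measurable_EFinP; exact: (@measurable_Rintegral2 _ _ _ _ R _ _ mF).
have := ae_integrable1 iF; apply: filterS => t it _.
by rewrite /fubini_F /Rintegral fineK//; exact: integrable_fin_num.
Qed.

Lemma integral_cmod_prod (E : T1 * T2 -> R[i]) (a : T1 -> R[i]) (b : T2 -> R[i]) :
  cmeas E -> (forall z, cmod (E z) <= 1) -> cmeas a -> cmeas b ->
  (\int[(m1 \x m2)%E]_z (cmod (E z * (a z.1 * b z.2)))%:E
   <= (\int[m1]_x (cmod (a x))%:E) * \int[m2]_y (cmod (b y))%:E)%E.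
Proof.
move=> mE E1 ma mb.
have mab : cmeas (fun z : T1 * T2 => a z.1 * b z.2).
  by apply: cmeasM; [exact: (cmeas_comp measurable_fst)|exact: (cmeas_comp measurable_snd)].
have mf : measurable_fun setT (fun z : T1 * T2 => (cmod (a z.1 * b z.2))%:E).
  by apply/measurable_EFinP; exact: measurable_cmod.
apply: (@le_trans _ _ (\int[(m1 \x m2)%E]_z (cmod (a z.1 * b z.2))%:E)%E).
  apply: ge0_le_integral => //.
  - by move=> x _; rewrite lee_fin cmod_ge0.
  - by apply/measurable_EFinP; apply: measurable_cmod; exact: cmeasM.
  - move=> x _; rewrite lee_fin cmodM; apply: ler_piMl => //; exact: cmod_ge0.
have f0 z : (0 <= (cmod (a z.1 * b z.2))%:E)%E by rewrite lee_fin cmod_ge0.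
rewrite (fubini_tonelli1 _ mf f0) /fubini_F /=.
have b0 : (0 <= \int[m2]_y (cmod (b y))%:E)%E.
  by apply: integral_ge0 => y _; rewrite lee_fin cmod_ge0.
rewrite -ge0_integralZr//.
- apply: ge0_le_integral => //.
  + by move=> x _; apply: integral_ge0 => y _; exact: (f0 (x, y)).
  + exact: (measurable_fun_fubini_tonelli_F (m2 := m2) _ mf f0).
  + apply: emeasurable_funM; last exact: measurable_cst.
    by apply/measurable_EFinP; exact: measurable_cmod.
  move=> x _; under eq_integral do rewrite cmodM EFinM.
  rewrite ge0_integralZl_EFin ?cmod_ge0//.
  + by move=> y _; rewrite lee_fin cmod_ge0.
  + by apply/measurable_EFinP; exact: measurable_cmod.
- by apply/measurable_EFinP; exact: measurable_cmod.
- by move=> y _; rewrite lee_fin cmod_ge0.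
Qed.

Lemma cintble_kprod (E : T1 * T2 -> R[i]) (a : T1 -> R[i]) (b : T2 -> R[i]) :
  cmeas E -> (forall z, cmod (E z) <= 1) -> cintble m1 a -> cintble m2 b ->
  cintble (m1 \x m2)%E (fun z => E z * (a z.1 * b z.2)).
Proof.
move=> mE E1 [ma ia] [mb ib]; split.
  apply: cmeasM => //.
  by apply: cmeasM; [exact: (cmeas_comp measurable_fst)|exact: (cmeas_comp measurable_snd)].
apply: le_lt_trans (integral_cmod_prod mE E1 ma mb) _.
apply: lte_mul_pinfty => //.
  by apply: integral_ge0 => y _; rewrite lee_fin cmod_ge0.
by rewrite ge0_fin_numE//; apply: integral_ge0 => y _; rewrite lee_fin cmod_ge0.
Qed.

Lemma cint_kprod (E : T1 * T2 -> R[i]) (a : T1 -> R[i]) (b : T2 -> R[i]) :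
  cmeas E -> (forall z, cmod (E z) <= 1) -> cintble m1 a -> cintble m2 b ->
  cint (m1 \x m2)%E (fun z => E z * (a z.1 * b z.2)) =
  cint m1 (fun x => a x * cint m2 (fun y => E (x, y) * b y)).
Proof.
move=> mE E1 ia ib; have ik := cintble_kprod mE E1 ia ib.
transitivity (cint m1 (fun x => cint m2 (fun y => E (x, y) * (a x * b y)))).
  rewrite /cint /=; congr Complex.
    exact: (Rint_prod (cintble_Re ik)).
  exact: (Rint_prod (cintble_Im ik)).
apply: eq_cint => x; rewrite -cintZ.
  by apply: eq_cint => y; ring.
apply: (cintbleMb1 (E := fun y => E (x, y))) => //.
exact: (cmeas_pair2 x mE).
Qed.

End ProductIntegral.

(** * The converse of Hoelder's inequality *)

Section Duality.
Variables (R : realType) (n : nat).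
Local Notation mu := (@lebm R n).
Local Notation Rn := (n.-tuple R).

(** A bounded region on which [|v|] stays away from [0] and from infinity. The two-sided bound keeps
    [ln |v|] bounded there, as the exponent in the three lines lemma has to be. *)
Definition shell (v : Rn -> R[i]) (N : nat) : set Rn :=
  [set x | cube N x /\ N.+1%:R^-1 <= cmod (v x) <= N.+1%:R].

Lemma measurable_shell v N : cmeas v -> measurable (shell v N).
Proof.
move=> mv; apply: measurableI; first exact: measurable_cube.
have mc := measurable_cmod mv.
have := mc measurableT _ (measurable_itv `[N.+1%:R^-1, N.+1%:R]).
rewrite setTI; congr measurable.
Qed.

Lemma subset_shell v N M : (N <= M)%N -> shell v N `<=` shell v M.
Proof.
move=> NM x [cx /andP[h1 h2]]; split; first exact: subset_cube cx.
apply/andP; split.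
  by apply: le_trans h1; rewrite lef_pV2 ?posrE// ler_nat.
by apply: le_trans h2 _; rewrite ler_nat.
Qed.

Lemma shell_gt0 v N x : shell v N x -> 0 < cmod (v x).
Proof. by case=> _ /andP[h _]; apply: lt_le_trans h; rewrite invr_gt0. Qed.

Lemma ler_ln_shell v N x : shell v N x -> `|ln (cmod (v x))| <= ln N.+1%:R.
Proof.
move=> /[dup] /shell_gt0 vx [_ /andP[v1 v2]]; rewrite ler_norml; apply/andP; split.
    by rewrite -lnV ?posrE// ler_ln ?posrE ?invr_gt0.
by rewrite ler_ln ?posrE.
Qed.

Lemma bigcup_shell v x : v x != 0 -> exists N, shell v N x.
Proof.
move=> vx0; have v0 : 0 < cmod (v x).
  rewrite lt_def cmod_ge0 andbT; apply: contra_neq vx0; exact: cmod_eq0.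
have [N1 _ cN1] : (\bigcup_k @cube R n k) x by rewrite bigcup_cube.
have [N2 hN2] := ltr_add_invr v0; rewrite add0r in hN2.
have hN3 := archi_boundP (ltW v0).
exists (N1 + N2 + Num.bound (cmod (v x)))%N; split.
  by apply: subset_cube cN1; rewrite -addnA leq_addr.
apply/andP; split.
  apply: le_trans (ltW hN2); rewrite lef_pV2 ?posrE// ler_nat ltnS.
  by rewrite addnAC leq_addl.
apply: le_trans (ltW hN3) _; rewrite ler_nat.
by rewrite leqW// leq_addl.
Qed.

(** It is enough to test with the extremal functions of Hoelder's inequality, cut off to shells of
    [v]. They are bounded and have bounded logarithmic modulus, so the hypothesis may be restricted
    to such [h]; monotone convergence over the shells, which exhaust the set where [v] is not [0],
    removes the cut-off. *)
Lemma bnd_dual t v K : 0 < t < 1 -> cmeas v -> 0 <= K ->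
  (forall h (N : nat) (M B : R), cmeas h -> (forall x, ~ shell v N x -> h x = 0) ->
     (forall x, cmod (h x) <= M) -> (forall x, `|ln (cmod (h x))| <= M) -> 0 < B ->
     bnd mu (1 - t) (fun x => cmod (h x)) B ->
     cmod (cint mu (fun x => h x * v x)) <= K * B) ->
  bnd mu t (fun x => cmod (v x)) K.
Proof.
move=> /andP[t0 t1] mv K0 hyp; rewrite bndP//; set e := t^-1.
have e0 : 0 < e by rewrite invr_gt0.
have e1 : 0 < e - 1 by rewrite subr_gt0 invf_gt1.
have ms N := measurable_shell N mv.
have mcv : measurable_fun setT (fun x => cmod (v x)) by exact: measurable_cmod.
have mi N : measurable_fun setT (\1_(shell v N) : Rn -> R) by exact: measurable_indic.
pose g N x := cmod (v x) `^ e * \1_(shell v N) x.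
have g0 N x : 0 <= g N x by rewrite mulr_ge0 ?powR_ge0.
have mg N : measurable_fun setT (g N).
  by apply: measurable_funM => //; exact: measurable_powRf.
have gle N x : g N x <= N.+1%:R `^ e * \1_(cube N) x.
  rewrite /g !indicE; case: (boolP (x \in shell v N)) => [xS|_].
    have [xc /andP[_ xN]] := set_mem xS.
    by rewrite mem_set// !mulr1 ge0_ler_powR ?nnegrE ?cmod_ge0// ltW.
  by rewrite mulr0 mulr_ge0 ?powR_ge0.
have ig N : (\int[mu]_x (g N x)%:E <= (N.+1%:R `^ e * (2 * N%:R) ^+ n)%:E)%E.
  apply: (@le_trans _ _ (\int[mu]_x (N.+1%:R `^ e * \1_(cube N) x)%:E)%E).
    apply: ge0_le_integral => //.
    - by move=> x _; rewrite lee_fin.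
    - exact/measurable_EFinP.
    - apply/measurable_EFinP; apply: measurable_funM => //.
      by apply: measurable_indic; exact: measurable_cube.
    - by move=> x _; rewrite lee_fin.
  under eq_integral do rewrite EFinM.
  rewrite ge0_integralZl_EFin ?powR_ge0//.
  - rewrite (EFinM _ (_ ^+ n)) -(lebm_cube R n N) integral_indic // ?setIT //; exact: measurable_cube.
  - by apply/measurable_EFinP; apply: measurable_indic; exact: measurable_cube.
have main N : (\int[mu]_x (g N x)%:E <= (K `^ e)%:E)%E.
  have I0 : (0 <= \int[mu]_x (g N x)%:E)%E by apply: integral_ge0 => x _; rewrite lee_fin.
  have Ifin : (\int[mu]_x (g N x)%:E)%E \is a fin_num.
    by rewrite ge0_fin_numE//; apply: le_lt_trans (ig N) _; rewrite ltry.
  set I := fine (\int[mu]_x (g N x)%:E)%E.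
  have IE : (\int[mu]_x (g N x)%:E)%E = I%:E by rewrite fineK.
  rewrite IE lee_fin.
  have : 0 <= I by apply: fine_ge0.
  rewrite le_eqVlt => /orP[/eqP <-|Ip]; first exact: powR_ge0.
  (* The extremiser: its pairing with [v] is [I], its norm is [I^(1-t)], so the hypothesis reads
     [I <= K I^(1-t)] and yields [I^t <= K]. *)
  pose h x := cphase (v x) * (cmod (v x) `^ (e - 1) * \1_(shell v N) x)%:C%C.
  have vS x : shell v N x -> v x != 0.
    by move=> /shell_gt0 vx; apply: contraTneq vx => ->; rewrite cmod0 ltxx.
  have hS x : shell v N x -> cmod (h x) = cmod (v x) `^ (e - 1).
    move=> xS; rewrite /h cmodM cmod_cphase ?vS// cmod_real indicE mem_set// mulr1 mul1r.
    by rewrite ger0_norm// powR_ge0.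
  have hN x : ~ shell v N x -> h x = 0.
    by move=> xS; rewrite /h indicE memNset// mulr0 rmorph0 mulr0.
  have mh : cmeas h.
    apply: cmeasM; first exact: cmeas_cphase.
    by apply: cmeas_real; apply: measurable_funM => //; exact: measurable_powRf.
  (* One constant for both requirements: the first summand bounds [|h|], the second [|ln |h||].
     Outside the shell [h = 0], and [ln 0 = 0] by convention. *)
  pose M := N.+1%:R `^ (e - 1) + (e - 1) * ln N.+1%:R.
  have lnN : 0 <= ln (N.+1%:R : R) by rewrite ln_ge0// ler1n.
  have M0 : 0 <= M by rewrite addr_ge0 ?powR_ge0// mulr_ge0// ltW.
  have hb x : cmod (h x) <= M.
    have [xS|xS] := pselect (shell v N x); last by rewrite hN// cmod0.
    rewrite hS// /M -[X in X <= _]addr0 lerD//; last by rewrite mulr_ge0// ltW.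
    case: (xS) => _ /andP[_ xN].
    by rewrite ge0_ler_powR ?nnegrE ?cmod_ge0// ltW.
  have hl x : `|ln (cmod (h x))| <= M.
    have [xS|xS] := pselect (shell v N x); last by rewrite hN// cmod0 ln0// normr0.
    rewrite hS// ln_powR normrM (ger0_norm (ltW e1)) /M -[X in X <= _]add0r lerD ?powR_ge0//.
    by rewrite ler_wpM2l ?ler_ln_shell// ltW.
  have hB : bnd mu (1 - t) (fun x => cmod (h x)) (I `^ (1 - t)).
    rewrite bndP ?subr_gt0// -powRrM mulfV ?subr_eq0 ?gt_eqF// powRr1 ?(ltW Ip)// -IE.
    rewrite le_eqVlt; apply/orP; left; apply/eqP; apply: eq_integral => x _; congr EFin.
    have [xS|xS] := pselect (shell v N x).
      rewrite hS// /g indicE mem_set// mulr1 -powRrM; congr (_ `^ _).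
      by rewrite /e; field; rewrite !gt_eqF// subr_gt0.
    rewrite hN// cmod0 /g indicE memNset// mulr0 powR0// invr_neq0// subr_eq0 gt_eqF//.
  have := hyp h N M _ mh hN hb hl (powR_gt0 _ Ip) hB.
  have -> : cint mu (fun x => h x * v x) = I%:C%C.
    transitivity (cint mu (fun x => (g N x)%:C%C)); last exact: cint_real.
    apply: eq_cint => x.
    have [xS|xS] := pselect (shell v N x); last first.
      by rewrite hN// mul0r /g indicE memNset// mulr0.
    rewrite /h mulrAC cphaseM -rmorphM /g indicE mem_set// !mulr1; congr (_%:C%C).
    have vp := shell_gt0 xS.
    rewrite -[X in X * _]powRr1 ?cmod_ge0// -powRD ?subrKC//.
    by apply/implyP => _; rewrite gt_eqF.
  rewrite cmod_real (ger0_norm (ltW Ip)) => IK.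
  have : I `^ t <= K.
    rewrite -(@ler_pM2r _ (I `^ (1 - t))) ?powR_gt0//.
    rewrite -powRD; last by apply/implyP => _; rewrite gt_eqF.
    by rewrite subrKC powRr1// ltW.
  move=> /(ge0_ler_powR (ltW e0)); rewrite !nnegrE powR_ge0 -powRrM mulfV ?gt_eqF// powRr1 ?(ltW Ip)//.
  by apply.
have nd x : {homo g ^~ x : a b / (a <= b)%N >-> a <= b}.
  move=> a b ab; rewrite ler_wpM2l ?powR_ge0// !indicE ler_nat.
  case: (boolP (x \in shell v a)) => // xa.
  by rewrite mem_set//; apply: subset_shell ab _ (set_mem xa).
have lim x : limn (fun k => (g k x)%:E) = (cmod (v x) `^ e)%:E.
  apply/cvg_lim => //; apply: cvg_EFin; first exact: nearW.
  have [v0|v0] := eqVneq (v x) 0.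
    rewrite v0 cmod0 powR0 ?gt_eqF//.
    under eq_fun do rewrite /g v0 cmod0 powR0 ?gt_eqF// mul0r.
    exact: cvg_cst.
  have [N xN] := bigcup_shell v0.
  apply: cvg_near_cst.
  exists N => // k /= Nk; apply/eqP.
  by rewrite /= /g indicE mem_set ?mulr1//; apply: subset_shell Nk _ xN.
have -> : (\int[mu]_x (cmod (v x) `^ e)%:E = \int[mu]_x limn (fun k => (g k x)%:E))%E.
  by apply: eq_integral => x _; rewrite lim.
rewrite monotone_convergence//.
- apply: lime_le; last by apply: nearW => k; exact: main.
  apply: ereal_nondecreasing_is_cvgn => a b ab.
  apply: ge0_le_integral => //.
  - by move=> x _; rewrite lee_fin.
  - exact/measurable_EFinP.
  - exact/measurable_EFinP.
  - by move=> x _; rewrite lee_fin nd.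
- by move=> k; exact/measurable_EFinP.
- by move=> k x _; rewrite lee_fin.
- by move=> x _ a b ab; rewrite lee_fin nd.
Qed.

End Duality.

(** * The Hausdorff-Young inequality by interpolation *)

Section HausdorffYoung.
Variables (R : realType) (n : nat).
Local Notation mu := (@lebm R n).
Local Notation Rn := (n.-tuple R).

(* At [z = x + iy], the analytic family [phase(u) |u|^(p (1 - z / 2))]. *)
Definition powfam (u : Rn -> R[i]) (p x y : R) (s : Rn) : R[i] :=
  conjc (cphase (u s)) * (cmod (u s) `^ p)%:C%C *
  ((expR (- (p / 2) * ln (cmod (u s)) * x))%:C%C * cis (- (p / 2) * ln (cmod (u s)) * y)).

(** The bound on [x] keeps the exponent [p (1 - x/2)] positive, so both sides vanish where [u] does,
    although [ln 0 = 0] makes the exponential factor [1] there. *)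
Lemma cmod_powfam u p x y s : 0 < p -> x <= 1 ->
  cmod (powfam u p x y s) = cmod (u s) `^ (p * (1 - x / 2)).
Proof.
move=> p0 x1; rewrite /powfam !cmodM cmod_cis cmod_conj !cmod_real mulr1.
rewrite !ger0_norm ?powR_ge0 ?expR_ge0//.
have [->|u0] := eqVneq (u s) 0.
  rewrite cmod0 !powR0 ?gt_eqF ?mulr0 ?mul0r// mulr_gt0//; lra.
have up : 0 < cmod (u s).
  by rewrite lt_def cmod_ge0 andbT; apply: contra_neq u0; exact: cmod_eq0.
rewrite cmod_cphase// mul1r /powR gt_eqF// -expRD; congr expR; lra.
Qed.

Lemma powfam_id u p x s : 0 < p -> p * (1 - x / 2) = 1 -> powfam u p x 0 s = u s.
Proof.
move=> p0 px; rewrite /powfam mulr0 cis0 mulr1 -mulrA -rmorphM.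
have [u0|u0] := eqVneq (u s) 0.
  by rewrite u0 cmod0 powR0 ?gt_eqF// mul0r rmorph0 mulr0.
have up : 0 < cmod (u s).
  by rewrite lt_def cmod_ge0 andbT; apply: contra_neq u0; exact: cmod_eq0.
have -> : cmod (u s) `^ p * expR (- (p / 2) * ln (cmod (u s)) * x) = cmod (u s).
  rewrite /powR gt_eqF// -expRD -[RHS]lnK ?posrE//; congr expR.
  by transitivity (p * (1 - x / 2) * ln (cmod (u s))); [ring|rewrite px mul1r].
rewrite -[X in _ * X]/((cmod (u s))%:C%C) -(cphaseM (u s)).
rewrite mulrA mul_conjc cmod_cphase// expr1n.
by rewrite mul1r.
Qed.

Lemma cmeas_powfam u p x y : cmeas u -> cmeas (powfam u p x y).
Proof.
move=> mu'; have mc := measurable_cmod mu'.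
have ml : measurable_fun setT (fun s => - (p / 2) * ln (cmod (u s))).
  by apply: measurable_funM => //; exact: measurableT_comp.
apply: cmeasM; first apply: cmeasM.
- by apply: cmeas_conj; exact: cmeas_cphase.
- by apply: cmeas_real; exact: measurable_powRf.
- apply: cmeasM; last by apply: cmeas_cis; exact: measurable_funM.
  apply: cmeas_real; apply: (measurableT_comp (@measurable_expR R)).
  exact: measurable_funM.
Qed.

Lemma cintble_powfam u p x y M : 0 < p -> 0 <= x <= 1 -> cmeas u ->
  (forall s, `|ln (cmod (u s))| <= M) ->
  (\int[mu]_s (cmod (u s) `^ p)%:E < +oo)%E -> cintble mu (powfam u p x y).
Proof.
move=> p0 /andP[x0 x1] mu' uM iu.
have M0 : 0 <= M by apply: le_trans (uM [tuple 0 | i < n]).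
apply: (@cintble_leR _ _ _ _ _ (fun s => expR (p / 2 * M) * cmod (u s) `^ p)).
- exact: cmeas_powfam.
- by apply: measurable_funM => //; apply: measurable_powRf; exact: measurable_cmod.
- move=> s; rewrite /powfam !cmodM cmod_cis mulr1 cmod_conj !cmod_real.
  rewrite !ger0_norm ?powR_ge0 ?expR_ge0// mulrC.
  apply: ler_pM; rewrite ?expR_ge0 ?mulr_ge0 ?cmod_ge0 ?powR_ge0//.
    rewrite ler_expR; apply: le_trans (ler_norm _) _.
    have p20 : 0 <= p / 2 by rewrite divr_ge0// ltW.
    rewrite normrM [X in X * _]normrM normrN (ger0_norm x0) (ger0_norm p20).
    rewrite -[leRHS]mulr1; apply: ler_pM => //.
      by rewrite mulr_ge0// divr_ge0// ltW.
    by rewrite ler_wpM2l// divr_ge0// ltW.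
  by apply: ler_piMl; [exact: powR_ge0|exact: cmod_cphase_le1].
- under eq_integral do rewrite EFinM.
  rewrite ge0_integralZl_EFin ?expR_ge0//.
  + by rewrite lte_mul_pinfty ?lee_fin ?expR_ge0.
  + by move=> s _; rewrite lee_fin powR_ge0.
  + by apply/measurable_EFinP; apply: measurable_powRf; exact: measurable_cmod.
Qed.

(** With [p = 1/x], the families built on [u] and [h] have moduli [|u|^p], [|h|^p] on [Re z = 0],
    where the pairing is bounded by the product of the two integrals, and [|u|^(p/2)], [|h|^(p/2)]
    on [Re z = 1], where Plancherel and the Cauchy-Schwarz inequality apply. The three lines lemma
    interpolates. The logarithm hypotheses still allow zeros, because [ln 0 = 0]. *)
Lemma hausdorff_young_simple u h x A B M : 2^-1 <= x <= 1 ->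
  cmeas u -> cmeas h -> (forall s, `|ln (cmod (u s))| <= M) ->
  (forall s, `|ln (cmod (h s))| <= M) -> 0 < A -> 0 < B ->
  bnd mu x (fun s => cmod (u s)) A -> bnd mu x (fun s => cmod (h s)) B ->
  cmod (cint mu (fun s => h s * fourier u s)) <= (2 * pi) `^ (n%:R * (1 - x)) * A * B.
Proof.
move=> /andP[x12 x1] mu' mh uM hM A0 B0 uA hB.
have x0 : 0 < x by lra.
have ck := @cmeas_kernel R n.
have uA' := (@bndP _ _ _ mu x (fun s => cmod (u s)) A x0).1 uA.
have hB' := (@bndP _ _ _ mu x (fun s => cmod (h s)) B x0).1 hB.
have p0 : 0 < x^-1 by rewrite invr_gt0.
set p := x^-1 in p0 uA' hB' *.
have iu : (\int[mu]_s (cmod (u s) `^ p)%:E < +oo)%E.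
  by apply: le_lt_trans uA' _; rewrite ltry.
have ih : (\int[mu]_s (cmod (h s) `^ p)%:E < +oo)%E.
  by apply: le_lt_trans hB' _; rewrite ltry.
have iU y z : 0 <= y <= 1 -> cintble mu (powfam u p y z).
  by move=> y01; exact: (cintble_powfam z p0 y01 mu' uM iu).
have iH y z : 0 <= y <= 1 -> cintble mu (powfam h p y z).
  by move=> y01; exact: (cintble_powfam z p0 y01 mh hM ih).
have k1 (z : Rn * Rn) : cmod (cis (- dotp z.1 z.2) : R[i]) <= 1 by rewrite cmod_cis.
pose K (z : Rn * Rn) : R[i] := cis (- dotp z.1 z.2) * (powfam h p 0 0 z.1 * powfam u p 0 0 z.2).
(* The product of the two families with the Fourier kernel is a single family [A e^(L z)] on the
   product space, and [L] is bounded because both logarithms are. *)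
pose L (z : Rn * Rn) : R := - (p / 2) * (ln (cmod (h z.1)) + ln (cmod (u z.2))).
have famE y z : cint (mu \x mu)%E (expfam K L y z) = 
    cint (mu \x mu)%E (fun w => cis (- dotp w.1 w.2) * (powfam h p y z w.1 * powfam u p y z w.2)).
  apply: eq_cint => w; rewrite /expfam /K /L /powfam !mulr0 expR0 cis0 !mulr1.
  rewrite mulrDr !mulrDl expRD cisD rmorphM /=; ring.
have fE y z : 0 <= y <= 1 -> cint (mu \x mu)%E (expfam K L y z) =
    cint mu (fun s => powfam h p y z s * fourier (powfam u p y z) s).
  move=> y01; rewrite famE.
  transitivity (cint mu (fun s => powfam h p y z s *
      cint mu (fun t => cis (- dotp s t) * powfam u p y z t))).
    exact: (cint_kprod ck k1 (iH _ z y01) (iU _ z y01)).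
  by apply: eq_cint => s; rewrite fourierE.
have i01 : 0 <= (0 : R) <= 1 by lra.
have i11 : 0 <= (1 : R) <= 1 by lra.
have iK : cintble (mu \x mu)%E K by exact: (cintble_kprod ck k1 (iH _ _ i01) (iU _ _ i01)).
have mL : measurable_fun setT L.
  apply: measurable_funM => //; apply: measurable_funD.
    apply: (measurableT_comp (f := fun s => ln (cmod (h s)))) measurable_fst.
    by apply: measurableT_comp => //; exact: measurable_cmod.
  apply: (measurableT_comp (f := fun s => ln (cmod (u s)))) measurable_snd.
  by apply: measurableT_comp => //; exact: measurable_cmod.
have LM z : `|L z| <= p / 2 * (M + M).
  have p20 : 0 <= p / 2 by rewrite divr_ge0// ltW.
  rewrite /L normrM normrN (ger0_norm p20).
  rewrite ler_wpM2l ?divr_ge0 ?(ltW p0)//.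
  by apply: le_trans (ler_normD _ _) _; rewrite lerD.
have c00 : 0 < B `^ p * A `^ p by rewrite mulr_gt0// powR_gt0.
have c10 : 0 < (2 * pi) `^ (n%:R / 2) * (B `^ (p / 2) * A `^ (p / 2)).
  by rewrite !mulr_gt0// powR_gt0// mulr_gt0// pi_gt0.
have b0 z : cmod (cint (mu \x mu)%E (expfam K L 0 z)) <= B `^ p * A `^ p.
  rewrite famE; apply: cint_le.
    by case: (cintble_kprod ck k1 (iH _ z i01) (iU _ z i01)).
  have [mH _] := iH _ z i01; have [mU _] := iU _ z i01.
  apply: le_trans (integral_cmod_prod mu mu ck k1 mH mU) _.
  under eq_integral do rewrite cmod_powfam// mul0r subr0 mulr1.
  under [X in (_ * X)%E]eq_integral do rewrite cmod_powfam// mul0r subr0 mulr1.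
  rewrite EFinM; apply: lee_pmul.
  - by apply: integral_ge0 => s _; rewrite lee_fin powR_ge0.
  - by apply: integral_ge0 => s _; rewrite lee_fin powR_ge0.
  - exact: hB'.
  - exact: uA'.
have b1 z : cmod (cint (mu \x mu)%E (expfam K L 1 z)) <=
    (2 * pi) `^ (n%:R / 2) * (B `^ (p / 2) * A `^ (p / 2)).
  rewrite fE//.
  have mH := iH _ z i11; have mU := iU _ z i11.
  set Uz := powfam u p 1 z; set Hz := powfam h p 1 z.
  have half_gt0 : (0 : R) < 2^-1 by rewrite invr_gt0.
  have half2 : (2^-1)^-1 = 2%:R :> R by rewrite invrK.
  have bH : bnd mu 2^-1 (fun s => cmod (Hz s)) (B `^ (p / 2)).
    rewrite (bndP mu _ _ half_gt0) half2 -powRrM.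
    have -> : p / 2 * 2%:R = p by field.
    under eq_integral.
      move=> s _; rewrite cmod_powfam// -powRrM.
      rewrite (_ : p * (1 - 1 / 2) * 2 = p); last by lra.
      over.
    exact: hB'.
  have bU : bnd mu 2^-1 (fun s => cmod (fourier Uz s)) ((2 * pi) `^ (n%:R / 2) * A `^ (p / 2)).
    rewrite (bndP mu _ _ half_gt0) half2 powRM ?powR_ge0// -!powRrM !mulfVK//.
    under eq_integral do rewrite powR_mulrn ?cmod_ge0//.
    rewrite powR_mulrn ?mulr_ge0 ?pi_ge0// EFinM.
    apply: le_trans (plancherel mU) _.
    rewrite lee_wpmul2l ?lee_fin ?exprn_ge0 ?mulr_ge0 ?pi_ge0//.
    under eq_integral.
      move=> s _; rewrite cmod_powfam// -powR_mulrn ?powR_ge0// -powRrM.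
      rewrite (_ : p * (1 - 1 / 2) * 2 = p); last by lra.
      over.
    exact: uA'.
  have mfU : cmeas (fourier Uz) by apply: cmeas_fourier; case: mU.
  have mHz : cmeas Hz by case: mH.
  have h0 : (0 : R) <= 2^-1 by [].
  have Bp0 := powR_ge0 B (p / 2).
  have Ap0 : 0 <= (2 * pi) `^ (n%:R / 2) * A `^ (p / 2) by rewrite mulr_ge0 ?powR_ge0.
  have := bndM h0 h0 Bp0 Ap0 (measurable_cmod mHz) (measurable_cmod mfU)
     (fun s => cmod_ge0 _) (fun s => cmod_ge0 _) bH bU.
  rewrite (_ : 2^-1 + 2^-1 = 1); last by field.
  rewrite bnd1; first last.
  - by rewrite mulr_ge0.
  - by move=> s; rewrite mulr_ge0 ?cmod_ge0.
  move=> hh; apply: cint_le; first exact: cmeasM.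
  under eq_integral do rewrite cmodM.
  by apply: le_trans hh _; rewrite lee_fin mulrCA.
(* At the abscissa [2 (1 - x)] the exponent [p (1 - z/2)] equals [1], so the families give back [u]
   and [h]. *)
have y01 : 0 <= 2 * (1 - x) <= 1 by lra.
have px : p * (1 - 2 * (1 - x) / 2) = 1 by rewrite /p; field; rewrite gt_eqF.
have := three_lines iK mL LM c00 c10 b0 b1 y01.
rewrite fE//.
under eq_cint => s do rewrite powfam_id//.
have -> : powfam u p (2 * (1 - x)) 0 = u by apply/funext => s; rewrite powfam_id.
move/le_trans; apply.
set P := (2 * pi) `^ (n%:R / 2).
have PE : P `^ (2 * (1 - x)) = (2 * pi) `^ (n%:R * (1 - x)).
  by rewrite -powRrM; congr (_ `^ _); field.
have P0 : 0 <= P by exact: powR_ge0.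
have cP (c e : R) := powR_ge0 c e.
rewrite powRM// [(P * _) `^ _]powRM ?mulr_ge0// PE [(B `^ (p / 2) * _) `^ _]powRM// -!powRrM.
have e1 : p * (1 - 2 * (1 - x)) + p / 2 * (2 * (1 - x)) = 1.
  by transitivity (p * (1 - 2 * (1 - x) / 2)); [field|exact: px].
set Q := (2 * pi) `^ _.
have hp (c : R) : 0 < c -> c `^ (p * (1 - 2 * (1 - x))) * c `^ (p / 2 * (2 * (1 - x))) = c.
  move=> c0; rewrite -powRD ?e1 ?powRr1 ?(ltW c0)//.
  by apply/implyP => _; rewrite gt_eqF.
by rewrite le_eqVlt -[in X in _ == X](hp A A0) -[in X in _ == X](hp B B0); apply/orP; left; apply/eqP; ring.
Qed.

Lemma fourier_adjoint u h : cintble mu u -> cintble mu h ->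
  cint mu (fun s => h s * fourier u s) = cint mu (fun s => u s * fourier h s).
Proof.
move=> iu ih.
have k1 (z : Rn * Rn) : cmod (cis (- dotp z.1 z.2) : R[i]) <= 1 by rewrite cmod_cis.
transitivity (cint mu (fun s => h s * cint mu (fun t => cis (- dotp s t) * u t))).
  by apply: eq_cint => s; rewrite fourierE.
transitivity (cint mu (fun t => u t * cint mu (fun s => cis (- dotp s t) * h s))).
  exact: (cint_swap (@cmeas_kernel R n) k1 ih iu).
by apply: eq_cint => s; rewrite fourierE; congr (_ * _); apply: eq_cint => t; rewrite dotpC.
Qed.

Lemma cintble_shell (v h : Rn -> R[i]) N M : cmeas h -> (forall x, ~ shell v N x -> h x = 0) ->
  (forall x, cmod (h x) <= M) -> cintble mu h.
Proof.
move=> mh h0 hM.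
have mN : measurable_fun setT (\1_(cube N) : Rn -> R).
  by apply: measurable_indic; exact: measurable_cube.
have M0 : 0 <= M by apply: le_trans (hM [tuple 0 | i < n]); exact: cmod_ge0.
apply: (cintble_leR mh (g := fun x => M * \1_(cube N) x)).
- exact: measurable_funM.
- move=> x; have [xS|xS] := pselect (shell v N x).
    by rewrite indicE mem_set ?mulr1//; case: xS.
  by rewrite h0// cmod0 mulr_ge0.
- under eq_integral do rewrite EFinM.
  rewrite ge0_integralZl_EFin//; last exact/measurable_EFinP.
  rewrite integral_indic// ?setIT; last exact: measurable_cube.
  by rewrite -[X in (_ * X)%E]/(lebm (cube N)) lebm_cube -EFinM ltry.
Qed.

(** Duality restricts the test functions [h] to shells. The multiplication formula moves the
    transform onto [h]; as the transform of [h] is bounded, [u] may be truncated to its own shells,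
    where the previous lemma applies, and dominated convergence restores [u]. At [x = 1] the bound
    is the trivial one for the supremum. *)
Lemma hausdorff_young u x A : 2^-1 <= x <= 1 -> cintble mu u -> 0 < A ->
  bnd mu x (fun s => cmod (u s)) A ->
  bnd mu (1 - x) (fun s => cmod (fourier u s)) ((2 * pi) `^ (n%:R * (1 - x)) * A).
Proof.
move=> /andP[x12 x1] iu A0 uA; have mu' : cmeas u by case: iu.
have [xE|xn1] := eqVneq x 1.
  move: uA; rewrite xE subrr mulr0 powRr0 mul1r bnd1; first last.
  - exact: ltW.
  - by move=> s; exact: cmod_ge0.
  rewrite /bnd eqxx => uA; apply: aeW => s.
  by rewrite -lee_fin; apply: le_trans uA; exact: fourier_le.
have x1' : x < 1 by rewrite lt_neqAle xn1.
have K0 : 0 <= (2 * pi) `^ (n%:R * (1 - x)) * A by rewrite mulr_ge0 ?powR_ge0// ltW.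
have x0' : 0 < 1 - x < 1 by lra.
apply: (bnd_dual x0' (cmeas_fourier mu') K0) => h N M B mh h0 hM hl B0 hB.
have xE : 1 - (1 - x) = x by ring.
rewrite xE in hB.
have ih := cintble_shell mh h0 hM.
have [Mh hMh] := fourier_bounded ih.
have Mh0 : 0 <= Mh by apply: le_trans (hMh [tuple 0 | i < n]); exact: cmod_ge0.
rewrite fourier_adjoint//.
pose w k s := u s * (\1_(shell u k) s)%:C%C.
have mw k : cmeas (w k).
  apply: cmeasM => //; apply: cmeas_real; apply: measurable_indic.
  exact: measurable_shell.
have wS k s : shell u k s -> w k s = u s.
  by move=> us; rewrite /w indicE mem_set// mulr1.
have w0 k s : ~ shell u k s -> w k s = 0.
  by move=> us; rewrite /w indicE memNset// rmorph0 mulr0.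
have wle k s : cmod (w k s) <= cmod (u s).
  have [us|us] := pselect (shell u k s); first by rewrite wS.
  by rewrite w0// cmod0 cmod_ge0.
have iw k : cintble mu (w k) by apply: cintble_le iu => //.
have bound k : cmod (cint mu (fun s => w k s * fourier h s)) <=
    (2 * pi) `^ (n%:R * (1 - x)) * A * B.
  rewrite -fourier_adjoint//.
  pose M1 := Num.max M (ln k.+1%:R).
  have M1M : M <= M1 by rewrite le_max lexx.
  have lM s : `|ln (cmod (w k s))| <= M1.
    have [us|us] := pselect (shell u k s).
      by rewrite wS// /M1 le_max (ler_ln_shell us) orbT.
    rewrite w0// cmod0 ln0// normr0; apply: le_trans M1M.
    by apply: le_trans (hM s); exact: cmod_ge0.
  have lh s : `|ln (cmod (h s))| <= M1 by apply: le_trans M1M.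
  have wA : bnd mu x (fun s => cmod (w k s)) A.
    apply: le_bnd uA => //; first by lra.
    - exact: measurable_cmod.
    - exact: measurable_cmod.
    - by move=> s; exact: cmod_ge0.
  have x12' : 2^-1 <= x <= 1 by rewrite x12.
  exact: (hausdorff_young_simple x12' (mw k) mh lM lh A0 B0 wA hB).
apply/ler_addgt0Pr => e e0.
have mfh : cmeas (fourier h) by exact: cmeas_fourier.
have [|||||||N1 _ hN1] := @cint_dct _ _ R mu (fun k s => w k s * fourier h s)
   (fun s => u s * fourier h s) (fun s => Mh * cmod (u s)) _ _ _ _ _ _ _ e e0.
- by move=> k; exact: cmeasM.
- exact: cmeasM.
- by apply: measurable_funM => //; exact: measurable_cmod.
- move=> k s; rewrite cmodM mulrC; apply: ler_pM => //; exact: cmod_ge0.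
- by move=> s; rewrite cmodM mulrC; apply: ler_wpM2r => //; exact: cmod_ge0.
- under eq_integral do rewrite EFinM.
  rewrite ge0_integralZl_EFin//.
  + by rewrite lte_mul_pinfty ?lee_fin//; case: iu.
  + by move=> s _; rewrite lee_fin cmod_ge0.
  + by apply/measurable_EFinP; exact: measurable_cmod.
- move=> s; apply: cvg_near_cst.
  have [us|us] := eqVneq (u s) 0.
    by apply: nearW => k; rewrite /w us !mul0r subrr cmod0.
  have [k0 uk] := bigcup_shell us.
  exists k0 => // k /= k0k; apply/eqP.
  by rewrite wS ?subrr ?cmod0//; apply: subset_shell k0k _ uk.
have d : cmod (cint mu (fun s => w N1 s * fourier h s) - cint mu (fun s => u s * fourier h s)) <= e.
  exact: hN1 (leqnn _).
rewrite cmodB in d.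
have := le_trans (ler_cmodB _ _) d; rewrite lerBlDl => /le_trans; apply.
exact: lerD (bound N1) (lexx e).
Qed.

End HausdorffYoung.

(** * Test functions *)

Section Coordinates.
Variables (R : realType) (n : nat).
Local Notation Rn := (n.-tuple R).

Lemma tnth_upd (x : Rn) i t j : tnth (upd x i t) j = if j == i then t else tnth x j.
Proof. by rewrite tnth_mktuple. Qed.

Lemma upd_id (x : Rn) i : upd x i (tnth x i) = x.
Proof. by apply: eq_from_tnth => j; rewrite tnth_upd; case: eqP => // ->. Qed.

Lemma upd_upd (x : Rn) i s t : upd (upd x i s) i t = upd x i t.
Proof. by apply: eq_from_tnth => j; rewrite !tnth_upd; case: eqP. Qed.

Lemma is_derive_tnth_upd (x : Rn) (i j : 'I_n) :
  is_derive (tnth x i) (1 : R) (fun t : R => tnth (upd x i t) j) (i == j)%:R.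
Proof.
under eq_fun do rewrite tnth_upd eq_sym.
by case: eqP => _; [exact: is_derive_id|exact: is_derive_cst].
Qed.

Lemma is_derive_dotp_upd (x y : Rn) (i : 'I_n) :
  is_derive (tnth x i) (1 : R) (fun t : R => dotp y (upd x i t)) (tnth y i).
Proof.
have -> : (fun t : R => dotp y (upd x i t)) =
    \sum_(j < n) (fun t : R => tnth y j * tnth (upd x i t) j).
  by apply/funext => t; rewrite fct_sumE.
have -> : tnth y i = \sum_(j < n) tnth y j * (i == j)%:R.
  rewrite (bigD1 i)//= eqxx mulr1 big1 ?addr0// => j ji.
  by rewrite eq_sym (negbTE ji) mulr0.
apply: is_derive_sum => j; have := is_derive_tnth_upd x i j => h.
by apply: is_derive_eq; rewrite /GRing.scale /=; ring.
Qed.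

Definition offaxes (x : Rn) : Prop := forall j, tnth x j != 0.

Lemma sqr_le_dotp (x : Rn) i : tnth x i ^+ 2 <= dotp x x.
Proof.
rewrite /dotp (bigD1 i)//= expr2 lerDl; apply: sumr_ge0 => j _.
by rewrite -expr2 sqr_ge0.
Qed.

Lemma offaxes_dotp (x : Rn) : (0 < n)%N -> offaxes x -> 0 < dotp x x.
Proof.
move=> n0 ux; apply: lt_le_trans (sqr_le_dotp x (Ordinal n0)).
by rewrite exprn_even_gt0//= ux.
Qed.

(** Measures growth at infinity and at the origin simultaneously: it dominates [1], [|t|] and
    [1/|t|], and by the convention [0^-1 = 0] it equals [1] at [t = 0]. *)
Definition lam1 (t : R) : R := 1 + `|t| + `|t|^-1.
Definition Lam (x : Rn) : R := \prod_(i < n) lam1 (tnth x i).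

Lemma lam1_ge1 t : 1 <= lam1 t.
Proof. by rewrite /lam1 -addrA lerDl addr_ge0. Qed.

Lemma Lam_ge1 x : 1 <= Lam x.
Proof. by apply: (big_ind (fun c => 1 <= c)) => // [a b a1 b1|i _]; [exact: mulr_ege1|exact: lam1_ge1]. Qed.

Lemma lam1_le_Lam x i : lam1 (tnth x i) <= Lam x.
Proof.
rewrite /Lam (bigD1 i)//= ler_peMr//; first exact: le_trans (lam1_ge1 _).
by apply: (big_ind (fun c => 1 <= c)) => // [a b a1 b1|j _]; [exact: mulr_ege1|exact: lam1_ge1].
Qed.

Lemma Lam_coord x i : `|tnth x i| <= Lam x.
Proof.
apply: le_trans (lam1_le_Lam x i).
by rewrite /lam1 addrAC lerDr addr_ge0.
Qed.

Lemma Lam_inv x i : `|tnth x i|^-1 <= Lam x.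
Proof. by apply: le_trans (lam1_le_Lam x i); rewrite /lam1 lerDr addr_ge0. Qed.

Lemma ler_Lam k l x : (k <= l)%N -> Lam x ^+ k <= Lam x ^+ l.
Proof. by move=> kl; rewrite ler_weXn2l// Lam_ge1. Qed.

Lemma dotp_le_Lam x : dotp x x <= n%:R * Lam x ^+ 2.
Proof.
rewrite /dotp; apply: le_trans (_ : \sum_(i < n) Lam x ^+ 2 <= _).
  apply: ler_sum => i _; rewrite -expr2 -real_normK ?num_real// lerXn2r// ?nnegrE//.
    exact: le_trans (Lam_ge1 x).
  exact: Lam_coord.
by rewrite sumr_const card_ord mulr_natl.
Qed.

Lemma dotp_ge_Lam x : (0 < n)%N -> offaxes x -> Lam x ^- 2 <= dotp x x.
Proof.
move=> n0 ux; pose i := Ordinal n0.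
apply: le_trans (sqr_le_dotp x i).
have L0 : 0 < Lam x by apply: lt_le_trans (Lam_ge1 x).
have h : (Lam x)^-1 <= `|tnth x i|.
  by rewrite -[X in _ <= X]invrK lef_pV2 ?posrE ?invr_gt0 ?normr_gt0// Lam_inv.
rewrite -exprVn -[X in _ <= X]real_normK ?num_real//.
by apply: lerXn2r => //; rewrite nnegrE// invr_ge0 ltW.
Qed.

(** Off the hyperplanes [|x|^2] lies between the inverse of [n Lam^2] and [n Lam^2], so
    [|ln |x|^2| <= ln (n Lam^2)]; both signs of [b] are covered at once. *)
Lemma powR_dotp_le (b : R) : (0 < n)%N -> exists C, exists k, 0 <= C /\
  forall x, offaxes x -> dotp x x `^ b <= C * Lam x ^+ k.
Proof.
move=> n0; set l := (Num.bound `|b|).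
have bl : `|b| <= l%:R by rewrite ltW// archi_boundP.
have n1 : (1 : R) <= n%:R by rewrite ler1n.
exists (n%:R ^+ l), (2 * l)%N; split; first by rewrite exprn_ge0.
move=> x ux; have d0 := offaxes_dotp n0 ux.
have L1 := Lam_ge1 x; have L0 : 0 < Lam x by apply: lt_le_trans L1.
set A := n%:R * Lam x ^+ 2.
have A1 : 1 <= A by rewrite mulr_ege1// exprn_ege1.
have A0 : 0 < A by apply: lt_le_trans A1.
rewrite exprM -exprMn -/A.
have h1 : ln (dotp x x) <= ln A by rewrite ler_ln ?posrE// dotp_le_Lam.
have h2 : - ln A <= ln (dotp x x).
  rewrite -lnV ?posrE// ler_ln ?posrE ?invr_gt0//; apply: le_trans (dotp_ge_Lam n0 ux).
  rewrite lef_pV2 ?posrE ?exprn_gt0// /A ler_peMl// exprn_ge0// ltW//.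
rewrite /powR gt_eqF//.
have -> : A ^+ l = expR (l%:R * ln A) by rewrite expRM_natl lnK.
rewrite ler_expR; apply: le_trans (ler_norm _) _; rewrite normrM; apply: ler_pM => //.
by rewrite ler_norml h2.
Qed.

End Coordinates.

(** * Coefficients of moderate growth, closed under differentiation *)

Section SmoothClass.
Variables (R : realType) (n : nat).
Local Notation Rn := (n.-tuple R).

(* A class of functions smooth off the coordinate hyperplanes, of moderate
   growth at infinity and at the hyperplanes, and closed under differentiation. *)
Inductive gen : (Rn -> R) -> Prop :=
| gen_cst c : gen (fun=> c)
| gen_coord i : gen (fun x => tnth x i)
| gen_invcoord i : gen (fun x => (tnth x i)^-1)
| gen_sg i : gen (fun x => Num.sg (tnth x i))
| gen_pow b : gen (fun x => dotp x x `^ b)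
| gen_cos y : gen (fun x => cos (dotp y x))
| gen_sin y : gen (fun x => sin (dotp y x))
| gen_add f g : gen f -> gen g -> gen (fun x => f x + g x)
| gen_mul f g : gen f -> gen g -> gen (fun x => f x * g x)
| gen_inv f (c : R) : 0 < c -> (forall x, c <= f x) -> gen f -> gen (fun x => (f x)^-1).

Lemma gen_opp f : gen f -> gen (fun x => - f x).
Proof.
move=> gf; have := gen_mul (gen_cst (-1)) gf.
by rewrite (_ : (fun x => -1 * f x) = fun x => - f x)//; apply/funext => x; rewrite mulN1r.
Qed.

Lemma gen_measurable f : gen f -> measurable_fun setT f.
Proof.
elim=> {f}.
- by move=> c; exact: measurable_cst.
- by move=> i; exact: measurable_tnthT.
- by move=> i; apply: (measurableT_comp (@measurable_invr R)); exact: measurable_tnthT.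
- move=> i.
  have -> : (fun x : Rn => Num.sg (tnth x i)) = fun x => `|tnth x i| * (tnth x i)^-1.
    apply/funext => x; have [->|t0] := eqVneq (tnth x i) 0; first by rewrite sgr0 normr0 mul0r.
    by rewrite normrEsg mulfK.
  apply: measurable_funM.
    by apply: (measurableT_comp (@normr_measurable R setT)); exact: measurable_tnthT.
  by apply: (measurableT_comp (@measurable_invr R)); exact: measurable_tnthT.
- by move=> b; apply: (measurableT_comp (measurable_powR b)); exact: measurable_dotp.
- move=> y; have md : measurable_fun setT (fun x : Rn => dotp y x).
    by apply: (@measurable_dotp R n _ _ (fun=> y)).
  exact: (cmeas_cis md).1.
- move=> y; have md : measurable_fun setT (fun x : Rn => dotp y x).
    by apply: (@measurable_dotp R n _ _ (fun=> y)).
  exact: (cmeas_cis md).2.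
- by move=> f g _ mf _ mg; exact: measurable_funD.
- by move=> f g _ mf _ mg; exact: measurable_funM.
- by move=> f c _ _ _ mf; exact: (measurableT_comp (@measurable_invr R)).
Qed.

Lemma gen_le f : (0 < n)%N -> gen f -> exists C, exists k, 0 <= C /\
  forall x, offaxes x -> `|f x| <= C * Lam x ^+ k.
Proof.
move=> n0; elim=> {f}.
- move=> c; exists `|c|, 0%N; split=> // x _; by rewrite expr0 mulr1.
- move=> i; exists 1, 1%N; split=> // x _; by rewrite expr1 mul1r Lam_coord.
- move=> i; exists 1, 1%N; split=> // x _; by rewrite expr1 mul1r normfV Lam_inv.
- move=> i; exists 1, 0%N; split=> // x ux; by rewrite expr0 mulr1 normr_sg ux.
- move=> b; have [C [k [C0 h]]] := powR_dotp_le b n0; exists C, k; split=> // x ux.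
  by rewrite ger0_norm ?powR_ge0// h.
- move=> y; exists 1, 0%N; split=> // x _; rewrite expr0 mulr1.
  by rewrite ler_norml cos_geN1 cos_le1.
- move=> y; exists 1, 0%N; split=> // x _; rewrite expr0 mulr1.
  by rewrite ler_norml sin_geN1 sin_le1.
- move=> f g _ [C [k [C0 hf]]] _ [D [l [D0 hg]]].
  exists (C + D), (k + l)%N; split=> [|x ux]; first exact: addr_ge0.
  apply: le_trans (ler_normD _ _) _; rewrite mulrDl lerD//.
    by apply: le_trans (hf x ux) _; rewrite ler_wpM2l// ler_Lam// leq_addr.
  by apply: le_trans (hg x ux) _; rewrite ler_wpM2l// ler_Lam// leq_addl.
- move=> f g _ [C [k [C0 hf]]] _ [D [l [D0 hg]]].
  exists (C * D), (k + l)%N; split=> [|x ux]; first exact: mulr_ge0.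
  by rewrite normrM exprD mulrACA; apply: ler_pM => //; [exact: hf|exact: hg].
- move=> f c c0 cf _ _; exists c^-1, 0%N; split=> [|x _]; first by rewrite invr_ge0 ltW.
  have f0 : 0 < f x by apply: lt_le_trans (cf x).
  by rewrite expr0 mulr1 ger0_norm ?invr_ge0 ?(ltW f0)// lef_pV2 ?posrE.
Qed.

Lemma is_derive_sg (t : R) : t != 0 -> is_derive t (1 : R) (fun s : R => Num.sg s) 0.
Proof.
have d c : is_derive t (1 : R) (fun=> c : R) 0 by exact: is_derive_cst.
rewrite neq_lt => /orP[t0|t0].
  apply: near_eq_is_derive (d (-1)).
  by near=> s; rewrite ltr0_sg//; near: s; exact: lt_nbhsl.
apply: near_eq_is_derive (d 1).
by near=> s; rewrite gtr0_sg//; near: s; exact: lt_nbhsr.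
Unshelve. all: by end_near. Qed.

(** Differentiability is claimed only off the coordinate hyperplanes: there signs are locally
    constant, inverse coordinates are smooth, and [dotp x x > 0] makes its real powers
    differentiable. *)
Lemma gen_derive f (i : 'I_n) : (0 < n)%N -> gen f -> exists2 g, gen g &
  forall x, offaxes x -> is_derive (tnth x i) (1 : R) (fun t : R => f (upd x i t)) (g x).
Proof.
move=> n0; elim=> {f}.
- by move=> c; exists (fun=> 0); [exact: gen_cst|move=> x _; exact: is_derive_cst].
- move=> j; exists (fun=> (i == j)%:R); first exact: gen_cst.
  by move=> x _; exact: is_derive_tnth_upd.
- move=> j; exists (fun x => - ((i == j)%:R * ((tnth x j)^-1 * (tnth x j)^-1))).
    by apply: gen_opp; apply: gen_mul; [exact: gen_cst|apply: gen_mul; exact: gen_invcoord].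
  move=> x ux; have := @is_deriveV _ _ _ _ _ _ (is_derive_tnth_upd x i j).
  rewrite upd_id => /(_ (ux j)) h; apply: is_derive_eq.
  by rewrite /GRing.scale /= expr2 invfM mulNr mulrC.
- move=> j; exists (fun=> 0); first exact: gen_cst.
  move=> x ux; have h1 := is_derive_tnth_upd x i j.
  have := @is_derive_sg (tnth (upd x i (tnth x i)) j); rewrite upd_id => /(_ (ux j)) h2.
  have := @is_derive1_comp _ (fun s => Num.sg s) (fun t => tnth (upd x i t) j) (tnth x i) 0 _ _ h1.
  by rewrite mul0r upd_id; apply.
- move=> b; exists (fun x => b * dotp x x `^ (b - 1) * (2 * tnth x i)).
    apply: gen_mul; last by apply: gen_mul; [exact: gen_cst|exact: gen_coord].
    by apply: gen_mul; [exact: gen_cst|exact: gen_pow].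
  move=> x ux; have d0 := offaxes_dotp n0 ux.
  have h : is_derive (tnth x i) (1 : R) (fun t => dotp (upd x i t) (upd x i t)) (2 * tnth x i).
    have -> : (fun t : R => dotp (upd x i t) (upd x i t)) =
        \sum_(j < n) (fun t : R => tnth (upd x i t) j * tnth (upd x i t) j).
      by apply/funext => t; rewrite fct_sumE.
    have -> : 2 * tnth x i = \sum_(j < n) (2 * tnth x j) * (i == j)%:R.
      rewrite (bigD1 i)//= eqxx mulr1 big1 ?addr0// => j ji.
      by rewrite eq_sym (negbTE ji) mulr0.
    apply: is_derive_sum => j; have hj := is_derive_tnth_upd x i j.
    by apply: is_derive_eq; rewrite /GRing.scale /= upd_id; ring.
  apply: (@is_derive1_comp _ (@powR R ^~ b) (fun t => dotp (upd x i t) (upd x i t)) _ _ _ _ h).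
  by rewrite upd_id; exact: is_derive1_powR.
- move=> y; exists (fun x => - sin (dotp y x) * tnth y i).
    by apply: gen_mul; [apply: gen_opp; exact: gen_sin|exact: gen_cst].
  move=> x ux; have h := is_derive_dotp_upd x y i.
  have := @is_derive1_comp _ cos (fun t => dotp y (upd x i t)) (tnth x i) _ _ (is_derive_cos _) h.
  by rewrite upd_id.
- move=> y; exists (fun x => cos (dotp y x) * tnth y i).
    by apply: gen_mul; [exact: gen_cos|exact: gen_cst].
  move=> x ux; have h := is_derive_dotp_upd x y i.
  have := @is_derive1_comp _ sin (fun t => dotp y (upd x i t)) (tnth x i) _ _ (is_derive_sin _) h.
  by rewrite upd_id.
- move=> f g _ [f' gf' hf] _ [g' gg' hg]; exists (fun x => f' x + g' x); first exact: gen_add.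
  by move=> x ux; apply: is_deriveD; [exact: hf|exact: hg].
- move=> f g gf [f' gf' hf] gg [g' gg' hg]; exists (fun x => f x * g' x + g x * f' x).
    by apply: gen_add; exact: gen_mul.
  move=> x ux; have h1 := hf x ux; have h2 := hg x ux.
  by apply: is_derive_eq; rewrite /GRing.scale /= !upd_id.
- move=> f c c0 cf gf [f' gf' hf]; exists (fun x => - ((f x)^-1 * (f x)^-1) * f' x).
    apply: gen_mul => //; apply: gen_opp; apply: gen_mul; exact: gen_inv cf gf.
  move=> x ux; have h1 := hf x ux.
  have f0 : f x != 0 by rewrite gt_eqF// (lt_le_trans c0).
  have := @is_deriveV _ _ _ _ _ _ h1; rewrite upd_id => /(_ f0) h.
  by apply: is_derive_eq; rewrite /GRing.scale /= -expr2 exprVn.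
Qed.

(** Serves at the coordinate hyperplanes, where only a quadratic bound on the function is known: the
    difference quotient at [a] is [O(|s|)]. *)
Lemma is_derive_quad (h : R -> R) (a C : R) : (forall t, `|h t| <= C * (t - a) ^+ 2) ->
  is_derive a (1 : R) h 0.
Proof.
move=> hC.
have ha : h a = 0.
  by have := hC a; rewrite subrr expr0n /= mulr0 normr_le0 => /eqP.
have C0 : 0 <= C.
  have := hC (a + 1); rewrite addrAC subrr add0r expr1n mulr1; exact: le_trans.
have C1 : 0 < C + 1 by rewrite ltr_wpDl.
have c : (fun s : R => s^-1 *: (h (s *: (1 : R) + a) - h a)) @ 0^' --> (0 : R).
  apply/cvgrPdist_le => e e0; near=> s.
  have s0 : s != 0 by near: s; exact: nbhs_dnbhs_neq.
  rewrite sub0r normrN ha subr0 /GRing.scale /= mulr1 normrM normfV.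
  rewrite mulrC ler_pdivrMr ?normr_gt0//; apply: le_trans (hC _) _.
  rewrite addrK -real_normK ?num_real// expr2 mulrA ler_wpM2r//.
  have : `|s| <= e / (C + 1).
    by near: s; apply: dnbhs0_le; exact: divr_gt0.
  by rewrite ler_pdivlMr// mulrC; apply: le_trans; rewrite ler_wpM2r// lerDl.
have d : derivable h a (1 : R) by exact: (cvgP _ c).
by apply: DeriveDef => //; rewrite /derive; exact: (cvg_lim _ c).
Unshelve. all: by end_near. Qed.

End SmoothClass.

(** * Flat weights and the Schwartz functions made from them *)

Section TestFunctions.
Variables (R : realType) (n : nat).
Hypothesis n0 : (0 < n)%N.
Variables d e : R.
Hypotheses (d0 : 0 < d) (e0 : 0 < e).
Local Notation Rn := (n.-tuple R).
Local Notation mu := (@lebm R n).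

(** The value at [0] has to be prescribed: [0^-1 = 0] would otherwise make it [1] instead of the
    limit [0]. *)
Definition flat1 (d e t : R) : R :=
  if t == 0 then 0 else expR (- (d * `|t|) - e / `|t|).

Lemma flat1_ge0 t : 0 <= flat1 d e t.
Proof. by rewrite /flat1; case: eqP => // _; exact: expR_ge0. Qed.

(** Half of the decay at infinity is kept as [pexp (d/2)]. The remaining exponential is at most
    [e^(-c (|t| + 1/|t|))] with [c = min (d/2) e], which absorbs any power of
    [lam1 t = 1 + |t| + 1/|t|]. *)
Lemma flat1_bound k : exists2 C, 0 <= C & forall t, t != 0 ->
  lam1 t ^+ k * flat1 d e t <= C * pexp (d / 2) t.
Proof.
set c := Num.min (d / 2) e; set K := k.+1.
have c0 : 0 < c by rewrite lt_min e0 divr_gt0.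
(* From [y <= e^y] at [y = c lam1 / K] one gets [lam1^K <= (K/c)^K e^(c lam1)]; the factor [e^c] is
   due to the summand [1] in [lam1]. Taking [K = k + 1] avoids division by zero. *)
exists ((K%:R / c) ^+ K * expR c); first by rewrite mulr_ge0 ?expR_ge0// exprn_ge0// divr_ge0// ltW.
move=> t t0; rewrite /flat1 (negbTE t0).
have tp : 0 < `|t| by rewrite normr_gt0.
set s := `|t| + `|t|^-1.
have lE : lam1 t = 1 + s by rewrite /lam1 addrA.
have s0 : 0 <= s by rewrite addr_ge0.
have -> : expR (- (d * `|t|) - e / `|t|) = pexp (d / 2) t * expR (- (d / 2 * `|t|) - e / `|t|).
  by rewrite /pexp -expRD; congr expR; field; rewrite normr_eq0.
rewrite mulrCA [leRHS]mulrC ler_wpM2l ?expR_ge0//.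
have h1 : lam1 t ^+ k <= lam1 t ^+ K by rewrite ler_weXn2l// lam1_ge1.
have h2 : lam1 t ^+ K <= (K%:R / c) ^+ K * expR (c * lam1 t).
  have -> : c * lam1 t = (c * lam1 t / K%:R) * K%:R by rewrite mulfVK// pnatr_eq0.
  rewrite [X in expR X]mulrC expRM_natl -exprMn; apply: lerXn2r; rewrite ?nnegrE.
  - by apply: le_trans (lam1_ge1 t).
  - by rewrite mulr_ge0 ?expR_ge0// divr_ge0// ltW.
  have h := expR_ge1Dx (c * lam1 t / K%:R).
  apply: le_trans (_ : K%:R / c * (c * lam1 t / K%:R) <= _).
    have K0 : K%:R != 0 :> R by rewrite pnatr_eq0.
    have -> : K%:R / c * (c * lam1 t / K%:R) = (K%:R / K%:R) * (c / c) * lam1 t by ring.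
    by rewrite !mulfV ?gt_eqF// !mul1r.
  apply: ler_wpM2l; first by rewrite divr_ge0// ltW.
  by apply: le_trans h; rewrite lerDr.
apply: le_trans (ler_wpM2r (expR_ge0 _) (le_trans h1 h2)) _.
rewrite -!mulrA ler_wpM2l ?exprn_ge0 ?divr_ge0 ?(ltW c0)//.
rewrite -expRD ler_expR lE mulrDr mulr1 -addrA gerDl /s.
have a1 : c * `|t| <= d / 2 * `|t| by rewrite ler_wpM2r// ge_min lexx.
have a2 : c * `|t|^-1 <= e * `|t|^-1 by rewrite ler_wpM2r ?invr_ge0// ge_min lexx orbT.
by rewrite mulrDr; lra.
Qed.

Definition flat (x : Rn) : R := \prod_(i < n) flat1 d e (tnth x i).

Lemma flat_ge0 x : 0 <= flat x.
Proof. by apply: prodr_ge0 => i _; exact: flat1_ge0. Qed.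

Lemma flat0 x : ~ offaxes x -> flat x = 0.
Proof.
move=> /existsNP[i /negP]; rewrite negbK => /eqP xi.
by rewrite /flat (bigD1 i)//= xi /flat1 eqxx mul0r.
Qed.

Lemma flat_bound k : exists2 C, 0 <= C & forall x, offaxes x ->
  Lam x ^+ k * flat x <= C * pexpn (d / 2) x.
Proof.
have [C C0 h] := flat1_bound k.
exists (C ^+ n) => [|x ux]; first exact: exprn_ge0.
have -> : C ^+ n = \prod_(i < n) C by rewrite prodr_const card_ord.
rewrite /Lam /flat -prodrXl -!big_split /=; apply: ler_prod => i _.
by rewrite h// mulr_ge0 ?flat1_ge0// exprn_ge0// (le_trans ler01)// lam1_ge1.
Qed.

Lemma measurable_flat1 : measurable_fun [set: R] (flat1 d e).
Proof.
rewrite /flat1; apply: measurable_fun_ifT => //.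
  by apply: measurable_fun_eqr.
apply: (measurableT_comp (@measurable_expR R)); apply: measurable_funB.
  apply: measurableT_comp => //; apply: measurable_funM => //.
apply: measurable_funM => //; apply: (measurableT_comp (@measurable_invr R)).
exact: normr_measurable.
Qed.

Lemma measurable_flat : measurable_fun setT flat.
Proof. by apply: (@measurable_prod_tnth R n (fun _ => flat1 d e)) => _; exact: measurable_flat1. Qed.

Definition test (f : Rn -> R) (x : Rn) : R := f x * flat x.

Lemma test_bound f l : gen f -> exists2 C, 0 <= C & forall x, offaxes x ->
  Lam x ^+ l * `|test f x| <= C * pexpn (d / 2) x.
Proof.
move=> gf; have [C [k [C0 hf]]] := gen_le n0 gf.
have [D D0 hD] := flat_bound (l + k).
exists (C * D) => [|x ux]; first exact: mulr_ge0.
rewrite /test normrM (ger0_norm (flat_ge0 x)) -mulrA.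
apply: le_trans (_ : Lam x ^+ l * ((C * Lam x ^+ k) * flat x) <= _).
  rewrite ler_wpM2l ?exprn_ge0 ?(le_trans ler01 (Lam_ge1 x))//.
  by rewrite ler_wpM2r ?flat_ge0 ?hf.
have -> : Lam x ^+ l * (C * Lam x ^+ k * flat x) = C * (Lam x ^+ (l + k) * flat x).
  by rewrite exprD; ring.
by rewrite ler_wpM2l// hD.
Qed.

Lemma test0 f x : ~ offaxes x -> test f x = 0.
Proof. by move=> /flat0 h; rewrite /test h mulr0. Qed.

Lemma test_le f : gen f -> exists2 C, 0 <= C & forall x, `|test f x| <= C * pexpn (d / 2) x.
Proof.
move=> gf; have [C C0 h] := test_bound 0 gf; exists C => // x.
have [ux|ux] := pselect (offaxes x); first by have := h x ux; rewrite expr0 mul1r.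
by rewrite test0// normr0 mulr_ge0 ?pexpn_ge0.
Qed.

Lemma pexpn_le1 (c : R) x : 0 <= c -> @pexpn R n c x <= 1.
Proof.
move=> c0; apply: prodr_ile1 => i _.
by rewrite expR_ge0 -[X in _ <= X]expR0 ler_expR oppr_le0 mulr_ge0.
Qed.

Lemma test_quad f i : gen f -> exists C, forall x, `|test f x| <= C * tnth x i ^+ 2.
Proof.
move=> gf; have [C C0 h] := test_bound 2 gf; exists C => x.
have [ux|ux] := pselect (offaxes x); last first.
  by rewrite test0// normr0 mulr_ge0 ?sqr_ge0.
have xi : 0 < `|tnth x i| by rewrite normr_gt0.
have L2 : `|tnth x i| ^- 2 <= Lam x ^+ 2.
  by rewrite -exprVn lerXn2r ?nnegrE ?invr_ge0// ?(le_trans ler01 (Lam_ge1 x))// Lam_inv.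
have : `|tnth x i| ^- 2 * `|test f x| <= C.
  apply: le_trans (_ : Lam x ^+ 2 * `|test f x| <= _); first by rewrite ler_wpM2r.
  apply: le_trans (h x ux) _; rewrite ler_piMr// pexpn_le1// divr_ge0// ltW//.
by rewrite mulrC ler_pdivrMr ?exprn_gt0// -[X in _ -> _ <= C * X]real_normK ?num_real.
Qed.

Lemma test_decay f k : gen f -> exists M, forall x, enorm x ^+ k * `|test f x| <= M.
Proof.
move=> gf; have [C C0 h] := test_bound k gf; exists (n%:R ^+ k * C) => x.
have [ux|ux] := pselect (offaxes x); last first.
  by rewrite test0// normr0 mulr0 mulr_ge0 ?exprn_ge0.
have L0 := le_trans ler01 (Lam_ge1 x).
have en : enorm x <= n%:R * Lam x.
  rewrite -[leRHS]ger0_norm ?mulr_ge0// -sqrtr_sqr ler_sqrt ?sqr_ge0// exprMn.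
  apply: le_trans (dotp_le_Lam x) _; rewrite ler_wpM2r ?sqr_ge0//.
  by rewrite expr2 ler_peMr// ler1n.
apply: le_trans (_ : (n%:R * Lam x) ^+ k * `|test f x| <= _).
  by rewrite ler_wpM2r// lerXn2r// ?nnegrE ?mulr_ge0// sqrtr_ge0.
rewrite exprMn -mulrA ler_wpM2l ?exprn_ge0//.
by apply: le_trans (h x ux) _; rewrite ler_piMr// pexpn_le1// divr_ge0// ltW.
Qed.

Lemma is_derive_flat1 (t : R) : t != 0 -> is_derive t (1 : R) (flat1 d e)
  (flat1 d e t * (- (d * Num.sg t) + e * (Num.sg t * (t^-1 * t^-1)))).
Proof.
move=> t0; set c := Num.sg t.
have c2 : c * c = 1 by rewrite -expr2 sqr_sg t0.
have c0 : c != 0 by rewrite sgr_eq0.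
have ct : c * t != 0 by rewrite mulf_neq0.
have dE : is_derive t (1 : R) (fun s : R => expR (- (d * (c * s)) - e * (c * s)^-1))
    (flat1 d e t * (- (d * c) + e * (c * (t^-1 * t^-1)))).
  apply: (@is_derive1_comp _ expR (fun s : R => - (d * (c * s)) - e * (c * s)^-1)).
    have -> : flat1 d e t = expR (- (d * (c * t)) - e * (c * t)^-1).
      by rewrite /flat1 (negbTE t0) /c -normrEsg.
    exact: is_derive_expR.
  have dl : is_derive t (1 : R) (fun s : R => c * s) c.
    by apply: is_derive_eq; rewrite /GRing.scale /=; ring.
  have dV := @is_deriveV _ (fun s : R => c * s) t c 1 ct dl.
  apply: is_derive_eq; rewrite /GRing.scale /=.
  rewrite -[(c * t) ^- 2]/((c * t) ^+ 2)^-1.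
  have -> : ((c * t) ^+ 2)^-1 = (t^-1 * t^-1).
    by rewrite exprMn !expr2 c2 mul1r invfM.
  ring.
have near_sg : \forall s \near t, Num.sg s = c.
  move: (t0); rewrite neq_lt => /orP[tn|tp].
    by near=> s; rewrite /c !ltr0_sg//; near: s; exact: lt_nbhsl.
  by near=> s; rewrite /c !gtr0_sg//; near: s; exact: lt_nbhsr.
apply: near_eq_is_derive dE.
near=> s; have sc : Num.sg s = c by near: s.
by rewrite /flat1 -sgr_eq0 sc (negbTE c0) -sc -normrEsg.
Unshelve. all: by end_near. Qed.

Lemma flat_upd x i t : flat (upd x i t) = flat1 d e t * \prod_(j < n | j != i) flat1 d e (tnth x j).
Proof.
rewrite /flat (bigD1 i)//= tnth_upd eqxx; congr (_ * _).
by apply: eq_bigr => j ji; rewrite tnth_upd (negbTE ji).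
Qed.

Definition logder (i : 'I_n) (x : Rn) : R := - (d * Num.sg (tnth x i))
  + e * (Num.sg (tnth x i) * ((tnth x i)^-1 * (tnth x i)^-1)).

Lemma gen_logder i : gen (logder i).
Proof.
have gs := gen_sg R i; have gi := gen_invcoord R i.
apply: gen_add; first by apply: gen_opp; apply: gen_mul => //; exact: gen_cst.
by apply: gen_mul; [exact: gen_cst|apply: gen_mul => //; exact: gen_mul].
Qed.

(** Off the hyperplanes this is the product rule, [logder] being the logarithmic derivative of the
    weight. If another coordinate vanishes, the function is [0] along the whole line. If only the
    [i]-th coordinate vanishes, flatness of the weight gives a quadratic bound, hence derivative
    [0]. *)
Lemma test_is_derive f f' i x : gen f ->
  (offaxes x -> is_derive (tnth x i) (1 : R) (fun t : R => f (upd x i t)) (f' x)) ->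
  is_derive (tnth x i) (1 : R) (fun t : R => test f (upd x i t))
    (test (fun x => f' x + f x * logder i x) x).
Proof.
move=> gf hf; set g := fun x => f' x + f x * logder i x.
have [ux|ux] := pselect (offaxes x).
  have h1 := hf ux; have h2 := is_derive_flat1 (ux i).
  have -> : (fun t : R => test f (upd x i t)) =
      (fun t => f (upd x i t) * (flat1 d e t * \prod_(j < n | j != i) flat1 d e (tnth x j))).
    by apply/funext => t; rewrite /test flat_upd.
  apply: is_derive_eq; rewrite /GRing.scale /= upd_id /test /g /logder.
  have -> : flat x = flat1 d e (tnth x i) * \prod_(j < n | j != i) flat1 d e (tnth x j).
    by rewrite -flat_upd upd_id.
  ring.
rewrite (test0 g ux).
have [[j ji xj]|nj] := pselect (exists2 j, j != i & tnth x j = 0).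
  have -> : (fun t : R => test f (upd x i t)) = (fun=> 0).
    apply/funext => t; apply: test0 => /(_ j).
    by rewrite tnth_upd (negbTE ji) xj eqxx.
  exact: is_derive_cst.
have xi : tnth x i = 0.
  move: ux => /existsNP[j /negP]; rewrite negbK => /eqP xj.
  have [<-//|ji] := eqVneq j i.
  by case: nj; exists j.
have [C hC] := test_quad i gf.
apply: (@is_derive_quad _ _ _ C) => t.
by rewrite xi subr0; apply: le_trans (hC _) _; rewrite tnth_upd eqxx.
Qed.

Lemma test_derive f i : gen f -> exists2 g, gen g &
  forall x, is_derive (tnth x i) (1 : R) (fun t : R => test f (upd x i t)) (test g x).
Proof.
move=> gf; have [f' gf' hf] := gen_derive i n0 gf.
exists (fun x => f' x + f x * logder i x).
  by apply: gen_add => //; apply: gen_mul => //; exact: gen_logder.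
by move=> x; apply: test_is_derive => //; exact: hf.
Qed.

Lemma partial_test f i : gen f -> exists2 g, gen g & partial i (test f) = test g.
Proof.
move=> gf; have [g gg h] := test_derive i gf; exists g => //.
by apply/funext => x; rewrite /partial; apply: is_derive1_val.
Qed.

(** Every iterated partial derivative is again [test g] with [g] in the class, so rapid decay of a
    single function of this form suffices. *)
Lemma test_schwartz f : gen f -> schwartzR (test f).
Proof.
move=> gf s.
have [g gg ->] : exists2 g, gen g & partials s (test f) = test g.
  elim: s => [|i s [g gg IH]]; first by exists f.
  have [h gh hE] := partial_test i gg; exists h => //.
  by rewrite /partials /= -/(partials s (test f)) IH.
split=> [i x|k]; last exact: test_decay.
by have [h gh hE] := test_derive i gg; have [] := hE x.
Qed.

Lemma measurable_test f : gen f -> measurable_fun setT (test f).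
Proof.
by move=> gf; apply: measurable_funM; [exact: gen_measurable|exact: measurable_flat].
Qed.

Lemma cintble_test f : gen f -> cintble mu (fun x => (test f x)%:C%C).
Proof.
move=> gf; have [C C0 h] := test_le gf.
have d2 : 0 < d / 2 by rewrite divr_gt0.
apply: (@cintble_leR _ _ _ _ _ (fun x => C * pexpn (d / 2) x)).
- by apply: cmeas_real; exact: measurable_test.
- by apply: measurable_funM => //; exact: measurable_pexpn.
- by move=> x; rewrite cmod_real.
- under eq_integral do rewrite EFinM.
  have [_ ip] := cintble_pexpn n d2.
  rewrite ge0_integralZl_EFin//.
  + rewrite lte_mul_pinfty ?lee_fin//.
    move: ip; under eq_integral do rewrite cmod_real ger0_norm ?pexpn_ge0//.
    by [].
  + by move=> x _; rewrite lee_fin pexpn_ge0.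
  + by apply/measurable_EFinP; exact: measurable_pexpn.
Qed.

End TestFunctions.

(** * Integration by parts on the whole space *)

Section IntegralOfPartial.
Variable R : realType.
Local Notation leb1 := (@lebesgue_measure R).

Lemma tcons_upd0 n (t s : R) (x : n.-tuple R) : upd (tcons (t, x)) ord0 s = tcons (s, x).
Proof.
apply: eq_from_tnth => j; rewrite tnth_upd.
by case: (unliftP ord0 j) => [k ->|->]; rewrite ?eqxx ?tnth_tcons0// !tnth_tconsS.
Qed.

Lemma tcons_updS n (t s : R) (x : n.-tuple R) i :
  upd (tcons (t, x)) (lift ord0 i) s = tcons (t, upd x i s).
Proof.
apply: eq_from_tnth => j; rewrite tnth_upd.
case: (unliftP ord0 j) => [k ->|->]; last by rewrite !tnth_tcons0.
by rewrite !tnth_tconsS tnth_upd (inj_eq lift_inj).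
Qed.

Lemma pexpn_tcons n (c t : R) (x : n.-tuple R) : pexpn c (tcons (t, x)) = pexp c t * pexpn c x.
Proof.
rewrite /pexpn big_ord_recl tnth_tcons0; congr (_ * _).
by apply: eq_bigr => i _; rewrite tnth_tconsS.
Qed.

Lemma integral_pexpn_fin n (c C : R) : 0 < c -> 0 <= C ->
  (\int[lebm (n := n)]_x (C * pexpn c x)%:E < +oo)%E.
Proof.
move=> c0 C0; under eq_integral do rewrite EFinM.
have [_ ip] := cintble_pexpn n c0.
rewrite ge0_integralZl_EFin//.
- rewrite lte_mul_pinfty ?lee_fin//.
  by move: ip; under eq_integral do rewrite cmod_real ger0_norm ?pexpn_ge0//.
- by move=> x _; rewrite lee_fin pexpn_ge0.
- by apply/measurable_EFinP; exact: measurable_pexpn.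
Qed.

Lemma cintble_pexpn_le n (c C : R) (G : n.-tuple R -> R[i]) : 0 < c -> 0 <= C ->
  cmeas G -> (forall x, cmod (G x) <= C * pexpn c x) -> cintble (lebm (n := n)) G.
Proof.
move=> c0 C0 mG GC; apply: (cintble_leR mG (g := fun x => C * pexpn c x)) => //.
  by apply: measurable_funM => //; exact: measurable_pexpn.
exact: integral_pexpn_fin.
Qed.

Lemma integral_pexp_fin (c C : R) : 0 < c -> 0 <= C ->
  (\int[leb1]_x (C * pexp c x)%:E < +oo)%E.
Proof.
move=> c0 C0; under eq_integral do rewrite EFinM.
rewrite ge0_integralZl_EFin//.
- by rewrite integral_pexp// -EFinM ltry.
- by move=> x _; rewrite lee_fin expR_ge0.
- by apply/measurable_EFinP; exact: measurable_pexp.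
Qed.

(** Induction on the dimension. A derivative in a later coordinate is handled on each slice, with
    [C] multiplied by the weight of the first coordinate; for the first coordinate Fubini exchanges
    the order, and the inner integral is that of a derivative on the line. *)
Lemma cint_partial0 n (i : 'I_n) (F G : n.-tuple R -> R) (c C : R) : 0 < c -> 0 <= C ->
  (forall x, is_derive (tnth x i) (1 : R) (fun t => F (upd x i t)) (G x)) ->
  (forall x, continuous (fun t => G (upd x i t))) -> measurable_fun setT G ->
  (forall x, `|F x| <= C * pexpn c x) -> (forall x, `|G x| <= C * pexpn c x) ->
  cint (lebm (n := n)) (fun x => (G x)%:C%C) = 0.
Proof.
elim: n i F G C => [[]//|n IH] i F G C c0 C0 dF cG mG FC GC.
have mGC : cmeas (fun x => (G x)%:C%C) by exact: cmeas_real.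
have iG : cintble (lebm (n := n.+1)) (fun x => (G x)%:C%C).
  by apply: (cintble_pexpn_le c0 C0 mGC) => x; rewrite cmod_real.
rewrite cint_lebS//.
have mt t : measurable_fun setT (fun x : n.-tuple R => tcons (t, x)).
  apply: (measurableT_comp (@measurable_tcons R n)); exact: pair1_measurable.
case: (unliftP ord0 i) dF cG => [j ->|->] dF cG.
  rewrite -[RHS](@cint0 _ _ R leb1); apply: eq_cint => t.
  apply: (IH j (fun x => F (tcons (t, x))) _ (C * pexp c t)) => //.
  - by rewrite mulr_ge0 ?expR_ge0.
  - move=> x; have := dF (tcons (t, x)); rewrite tnth_tconsS.
    by under eq_fun do rewrite tcons_updS.
  - move=> x; have := cG (tcons (t, x)).
    by under eq_fun do rewrite tcons_updS.
  - exact: (measurableT_comp mG).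
  - by move=> x; rewrite -mulrA -pexpn_tcons.
  - by move=> x; rewrite -mulrA -pexpn_tcons.
have mGt : measurable_fun setT (G \o @tcons R n).
  by apply: measurableT_comp => //; exact: measurable_tcons.
rewrite (@cint_fubini _ _ (measurableTypeR R) _ R leb1 (lebm (n := n)) (fun z => (G (tcons z))%:C%C)).
- rewrite -[RHS](@cint0 _ _ R (lebm (n := n))); apply: eq_cint => x.
  rewrite cint_real.
  suff -> : \int[leb1]_(t in [set: R]) G (tcons (t, x)) = 0 by [].
  apply: (@Rint_derive0 _ _ (fun t => F (tcons (t, x)))).
  + have := cG (tcons (0, x)); by under eq_fun do rewrite tcons_upd0.
  + move=> t; have := dF (tcons (t, x)); rewrite tnth_tcons0.
    by under eq_fun do rewrite tcons_upd0.
  + apply: (@integrable_le _ (measurableTypeR R) R leb1 (fun t => G (tcons (t, x))) (fun t => (C * pexpn c x) * pexp c t)).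
    * apply: (measurableT_comp mGt); exact: pair2_measurable.
    * by apply: measurable_funM => //; exact: measurable_pexp.
    * by move=> t; apply: le_trans (GC _) _; rewrite pexpn_tcons [pexp c t * _]mulrC mulrA.
    * by apply: integral_pexp_fin => //; rewrite mulr_ge0 ?pexpn_ge0.
  + apply: (@cvg0_le _ _ (fun k => C * pexpn c x * expR (- (c * k%:R)))).
      move=> k; apply: le_trans (FC _) _.
      by rewrite pexpn_tcons [pexp c _ * _]mulrC mulrA /pexp ger0_norm.
    by rewrite -(mulr0 (C * pexpn c x)); apply: cvgMr; exact: cvg_expRn.
  + apply: (@cvg0_le _ _ (fun k => C * pexpn c x * expR (- (c * k%:R)))).
      move=> k; apply: le_trans (FC _) _.
      by rewrite pexpn_tcons [pexp c _ * _]mulrC mulrA /pexp normrN ger0_norm.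
    by rewrite -(mulr0 (C * pexpn c x)); apply: cvgMr; exact: cvg_expRn.
- by apply: cmeas_real.
- have [_] := iG; rewrite integral_lebS//.
    by apply/measurable_EFinP; exact: measurable_cmod.
  by move=> x; rewrite lee_fin cmod_ge0.
Qed.

End IntegralOfPartial.

Section FourierDecay.
Variables (R : realType) (n : nat).
Hypothesis n0 : (0 < n)%N.
Variables d e : R.
Hypotheses (d0 : 0 < d) (e0 : 0 < e).
Local Notation Rn := (n.-tuple R).
Local Notation mu := (@lebm R n).
Local Notation test := (@test R n d e).

Lemma continuous_coord_test (f : Rn -> R) i x : gen f -> continuous (fun t : R => test f (upd x i t)).
Proof.
move=> gf t; have [g gg h] := test_derive n0 d0 e0 i gf.
have := h (upd x i t); rewrite tnth_upd eqxx.
under eq_fun do rewrite upd_upd.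
by move=> [/derivable1_diffP/differentiable_continuous].
Qed.

Lemma cint_test_derive0 f g i : gen f -> gen g ->
  (forall x, is_derive (tnth x i) (1 : R) (fun t : R => test f (upd x i t)) (test g x)) ->
  cint mu (fun x => (test g x)%:C%C) = 0.
Proof.
move=> gf gg h.
have [C C0 hC] := test_le n0 d0 e0 gf; have [D D0 hD] := test_le n0 d0 e0 gg.
apply: (@cint_partial0 R n i (test f) (test g) (d / 2) (C + D)) => //.
- by rewrite divr_gt0.
- by rewrite addr_ge0.
- by move=> x; exact: continuous_coord_test.
- exact: measurable_test.
- by move=> x; apply: le_trans (hC x) _; rewrite ler_wpM2r ?pexpn_ge0// lerDl.
- by move=> x; apply: le_trans (hD x) _; rewrite ler_wpM2r ?pexpn_ge0// lerDr.
Qed.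

Definition ftest (f : Rn -> R) (x : Rn) : R[i] := fourier (fun y => (test f y)%:C%C) x.

Lemma ftestE f x : gen f -> ftest f x =
  cint mu (fun y => (test (fun y => cos (dotp x y) * f y) y)%:C%C)
  - 'i%C * cint mu (fun y => (test (fun y => sin (dotp x y) * f y) y)%:C%C).
Proof.
move=> gf.
have g1 : gen (fun y => cos (dotp x y) * f y) by apply: gen_mul => //; exact: gen_cos.
have g2 : gen (fun y => sin (dotp x y) * f y) by apply: gen_mul => //; exact: gen_sin.
have i1 := cintble_test n0 d0 e0 g1; have i2 := cintble_test n0 d0 e0 g2.
rewrite -cintZ// -cintB//; last exact: cintbleZ.
rewrite /ftest fourierE; apply: eq_cint => y; rewrite /test /cis cosN sinN.
by apply/eqP; rewrite eq_complex /=; apply/andP; split; apply/eqP; ring.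
Qed.

(** The real and imaginary parts of a character lie in the class [gen], so the integral of the
    derivative of [cos] or [sin] times [test f] vanishes, which is the integration by parts. Only
    moduli are recorded; the factor [i] plays the part of a rotation. *)
Lemma ftest_derive f g i x : gen f -> gen g ->
  (forall x, is_derive (tnth x i) (1 : R) (fun t : R => test f (upd x i t)) (test g x)) ->
  cmod (ftest g x) = `|tnth x i| * cmod (ftest f x).
Proof.
move=> gf gg h.
have gc := gen_cos x; have gs := gen_sin x.
have c1 : cint mu (fun y => (test (fun y => cos (dotp x y) * g y) y)%:C%C) =
    (tnth x i)%:C%C * cint mu (fun y => (test (fun y => sin (dotp x y) * f y) y)%:C%C).
  apply/eqP; rewrite -subr_eq0; apply/eqP.
  have g1 : gen (fun y => cos (dotp x y) * g y) by exact: gen_mul.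
  have g2 : gen (fun y => sin (dotp x y) * f y) by exact: gen_mul.
  have g3 : gen (fun y => cos (dotp x y) * f y) by exact: gen_mul.
  have g4 : gen (fun y => cos (dotp x y) * g y + - tnth x i * (sin (dotp x y) * f y)).
    by apply: gen_add => //; apply: gen_mul => //; exact: gen_cst.
  have i1 := cintble_test n0 d0 e0 g1; have i2 := cintble_test n0 d0 e0 g2.
  rewrite -cintZ// -cintB//; last exact: cintbleZ.
  transitivity (cint mu (fun y => (test (fun y => cos (dotp x y) * g y + - tnth x i * (sin (dotp x y) * f y)) y)%:C%C)).
    by apply: eq_cint => y; rewrite /test -rmorphM -rmorphB /=; congr (_%:C%C); ring.
  apply: (cint_test_derive0 (i := i) g3 g4).
  move=> y; have hy := h y.
  have hc := @is_derive1_comp _ cos (fun t => dotp x (upd y i t)) (tnth y i) _ _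
    (is_derive_cos _) (is_derive_dotp_upd y x i).
  have -> : (fun t : R => test (fun y => cos (dotp x y) * f y) (upd y i t)) =
     (cos \o (fun t => dotp x (upd y i t))) * (fun t : R => test f (upd y i t)).
    by apply/funext => t; rewrite /test /= mulrA.
  apply: is_derive_eq; rewrite /GRing.scale /= !upd_id /test; ring.
have c2 : cint mu (fun y => (test (fun y => sin (dotp x y) * g y) y)%:C%C) =
    - ((tnth x i)%:C%C * cint mu (fun y => (test (fun y => cos (dotp x y) * f y) y)%:C%C)).
  apply/eqP; rewrite -subr_eq0 opprK; apply/eqP.
  have g1 : gen (fun y => sin (dotp x y) * g y) by exact: gen_mul.
  have g2 : gen (fun y => cos (dotp x y) * f y) by exact: gen_mul.
  have g3 : gen (fun y => sin (dotp x y) * f y) by exact: gen_mul.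
  have g4 : gen (fun y => sin (dotp x y) * g y + tnth x i * (cos (dotp x y) * f y)).
    by apply: gen_add => //; apply: gen_mul => //; exact: gen_cst.
  have i1 := cintble_test n0 d0 e0 g1; have i2 := cintble_test n0 d0 e0 g2.
  rewrite -cintZ// -cintD//; last exact: cintbleZ.
  transitivity (cint mu (fun y => (test (fun y => sin (dotp x y) * g y + tnth x i * (cos (dotp x y) * f y)) y)%:C%C)).
    by apply: eq_cint => y; rewrite /test -rmorphM -rmorphD /=; congr (_%:C%C); ring.
  apply: (cint_test_derive0 (i := i) g3 g4).
  move=> y; have hy := h y.
  have hc := @is_derive1_comp _ sin (fun t => dotp x (upd y i t)) (tnth y i) _ _
    (is_derive_sin _) (is_derive_dotp_upd y x i).
  have -> : (fun t : R => test (fun y => sin (dotp x y) * f y) (upd y i t)) =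
     (sin \o (fun t => dotp x (upd y i t))) * (fun t : R => test f (upd y i t)).
    by apply/funext => t; rewrite /test /= mulrA.
  apply: is_derive_eq; rewrite /GRing.scale /= !upd_id /test; ring.
rewrite ftestE// c1 c2 ftestE//.
set a := cint _ _; set b := cint _ _.
have -> : (tnth x i)%:C%C * a - 'i%C * - ((tnth x i)%:C%C * b) =
    'i%C * (tnth x i)%:C%C * (b - 'i%C * a).
  by apply/eqP; rewrite eq_complex; case: a => a1 a2; case: b => b1 b2 /=; apply/andP; split; apply/eqP; ring.
by rewrite !cmodM cmod_real cmodE /= expr0n expr1n add0r sqrtr1 mul1r.
Qed.

Lemma ftest_partial f i : gen f -> exists2 g, gen g &
  forall x, cmod (ftest g x) = `|tnth x i| * cmod (ftest f x).
Proof.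
move=> gf; have [g gg h] := test_derive n0 d0 e0 i gf; exists g => // x.
exact: ftest_derive.
Qed.

(** Each index in the list costs one derivative and gains a factor [1 + |x_i|]. Applied to the list
    of all coordinates this is decay in product form. *)
Lemma ftest_decay (s : seq 'I_n) f : gen f -> exists2 M, 0 <= M &
  forall x, (\prod_(i <- s) (1 + `|tnth x i|)) * cmod (ftest f x) <= M.
Proof.
elim: s f => [|i s IH] f gf.
  have [M hM] := fourier_bounded (cintble_test n0 d0 e0 gf).
  exists M => [|x]; first by apply: le_trans (hM [tuple 0 | i < n]); exact: cmod_ge0.
  by rewrite big_nil mul1r; exact: hM.
have [g gg h] := ftest_partial i gf.
have [M M0 hM] := IH f gf; have [N N0 hN] := IH g gg.
exists (M + N) => [|x]; first exact: addr_ge0.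
rewrite big_cons -mulrA [(1 + _) * _]mulrDl mul1r; apply: lerD => //.
by rewrite mulrCA -h.
Qed.

End FourierDecay.

(** * Product decay and its norms *)

Section Decay.
Variable R : realType.
Local Notation leb1 := (@lebesgue_measure R).

(** The decay gained by one derivative. It belongs to [L_q] for every [q > 1], which is enough for
    pairings with [L_p] since the dual exponent exceeds [1]. *)
Definition dec1 (t : R) : R := (1 + `|t|)^-1.

Lemma dec1_gt0 t : 0 < dec1 t.
Proof. by rewrite invr_gt0 ltr_wpDr. Qed.

Lemma dec1_le1 t : dec1 t <= 1.
Proof. by rewrite invf_le1 ?ltr_wpDr// lerDl. Qed.

Lemma measurable_dec1 : measurable_fun [set: R] dec1.
Proof.
apply: (measurableT_comp (@measurable_invr R)); apply: measurable_funD => //.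
Qed.

Lemma measurable_powR_dec1 q : measurable_fun [set: R] (fun t => dec1 t `^ q).
Proof. by apply: (measurableT_comp (measurable_powR q)); exact: measurable_dec1. Qed.

Lemma is_derive_addl (c t : R) : is_derive t (1 : R) (fun t : R => c + t) 1.
Proof.
by have := is_deriveD (is_derive_cst (c : R) t (1 : R)) (is_derive_id t (1 : R)); rewrite add0r.
Qed.

Lemma integral_dec1 q : 1 < q ->
  (\int[leb1]_t (dec1 t `^ q)%:E = (2 / (q - 1))%:E)%E.
Proof.
move=> q1; rewrite integral_sym; first last.
- by move=> t; rewrite lee_fin powR_ge0.
- by apply/measurable_EFinP; exact: measurable_powR_dec1.
have q10 : 0 < q - 1 by rewrite subr_gt0.
pose F (t : R) := - ((q - 1)^-1 * (1 + t) `^ (1 - q)).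
have h : (\int[leb1]_(t in `[0%R, +oo[) ((1 + t) `^ (- q))%:E = (0 : R)%:E - (F 0)%:E)%E.
  have dF (t : R) : 0 <= t -> is_derive t (1 : R) F ((1 + t) `^ (- q)).
    move=> t0; have t1 : 0 < 1 + t by rewrite ltr_pwDl.
    have dp := @is_derive1_comp _ (@powR R ^~ (1 - q)) (fun t => 1 + t) t _ 1
      (is_derive1_powR _ t1) (is_derive_addl _ _).
    apply: is_derive_eq; rewrite /GRing.scale /=.
    rewrite (_ : 1 - q - 1 = - q); last by ring.
    by field; rewrite gt_eqF.
  apply: ge0_continuous_FTC2y.
  - by move=> x _; exact: powR_ge0.
  - apply: continuous_subspaceW (_ : `[0%R, +oo[ `<=` [set t : R | 0 <= t]) _.
      by move=> x /=; rewrite in_itv /= andbT.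
    apply: continuous_in_subspaceT => x; rewrite inE /= => x0.
    have x1 : 0 < 1 + x by rewrite ltr_pwDl.
    have dp : is_derive x (1 : R) (fun t : R => (1 + t) `^ (- q)) (- q * (1 + x) `^ (- q - 1) * 1).
      apply: (@is_derive1_comp _ (@powR R ^~ (- q)) (fun t => 1 + t)).
        exact: is_derive1_powR.
      exact: is_derive_addl.
    by case: dp => /derivable1_diffP/differentiable_continuous.
  - rewrite -[X in _ --> X]oppr0; apply: cvgN; rewrite -(mulr0 (q - 1)^-1); apply: cvgMr.
    apply/cvgrPdist_le => e e0; near=> t.
    have t0 : 0 <= t by near: t; exact: nbhs_pinfty_ge.
    have t1 : 0 < 1 + t by rewrite ltr_pwDl.
    rewrite sub0r normrN ger0_norm ?powR_ge0// -opprB powRN.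
    rewrite -[leRHS]invrK lef_pV2 ?posrE ?invr_gt0 ?powR_gt0//.
    have <- : (e^-1 `^ (q - 1)^-1) `^ (q - 1) = e^-1.
      by rewrite -powRrM mulVf ?gt_eqF// powRr1 ?invr_ge0// ltW.
    apply: ge0_ler_powR; rewrite ?nnegrE ?powR_ge0 ?(ltW t1) ?(ltW q10)//.
    apply: le_trans (_ : t <= _); last by rewrite lerDr.
    by near: t; exact: nbhs_pinfty_ge.
  - by move=> x x0; have [] := dF x (ltW x0).
  - have [/derivable1_diffP/differentiable_continuous c _] := dF 0 (lexx _).
    by apply: cvg_at_right_filter.
  - move=> x; rewrite in_itv /= andbT => x0.
    by apply: is_derive1_val; exact: dF (ltW x0).
have mq : measurable_fun [set: R] (fun t : R => (1 + t) `^ (- q)).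
  by apply: (measurableT_comp (measurable_powR (- q))); exact: measurable_funD.
transitivity (\int[leb1]_(t in `[0%R, +oo[) (((1 + t) `^ (- q))%:E + ((1 + t) `^ (- q))%:E))%E.
  apply: eq_integral => t; rewrite inE /= in_itv /= andbT => t0.
  have t1 : 0 < 1 + t by rewrite ltr_pwDl.
  have -> : dec1 (- t) = dec1 t by rewrite /dec1 normrN.
  have -> // : dec1 t `^ q = (1 + t) `^ (- q).
  by rewrite /powR /dec1 ger0_norm// invr_eq0 gt_eqF// lnV ?posrE// mulrN mulNr.
rewrite ge0_integralD//.
- rewrite h -EFinB -EFinD /F addr0 powR1 mulr1; congr EFin; field.
  by rewrite gt_eqF.
- by move=> t _; rewrite lee_fin powR_ge0.
- by apply: measurable_funTS; exact/measurable_EFinP.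
- by move=> t _; rewrite lee_fin powR_ge0.
- by apply: measurable_funTS; exact/measurable_EFinP.
Unshelve. all: by end_near. Qed.

Variable n : nat.
Local Notation Rn := (n.-tuple R).
Local Notation mu := (@lebm R n).

Definition dec (x y : Rn) : R := \prod_(i < n) dec1 (tnth x i - tnth y i).

Lemma dec_gt0 x y : 0 < dec x y.
Proof. by apply: prodr_gt0 => i _; exact: dec1_gt0. Qed.

Lemma measurable_dec1l y : measurable_fun setT (fun x : Rn => dec x y).
Proof.
apply: (@measurable_prod_tnth R n (fun i t => dec1 (t - tnth y i))) => i.
by apply: (measurableT_comp measurable_dec1); exact: measurable_funB.
Qed.

Lemma integral_dec q y : 1 < q ->
  (\int[mu]_x (dec x y `^ q)%:E = ((2 / (q - 1)) ^+ n)%:E)%E.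
Proof.
move=> q1.
transitivity (\int[mu]_x (\prod_(i < n) dec1 (tnth x i - tnth y i) `^ q)%:E)%E.
  apply: eq_integral => x _; congr EFin; rewrite /dec.
  have [_ ] : 0 <= \prod_(i < n) dec1 (tnth x i - tnth y i) /\
      (\prod_(i < n) dec1 (tnth x i - tnth y i)) `^ q = \prod_(i < n) dec1 (tnth x i - tnth y i) `^ q.
    elim/big_rec2: _ => [|i a b _ [b0 <-]]; first by rewrite powR1.
    by have h := ltW (dec1_gt0 (tnth x i - tnth y i)); rewrite mulr_ge0// powRM.
  by [].
rewrite (@integral_prod R n (fun i t => dec1 (t - tnth y i) `^ q)).
- rewrite (eq_bigr (fun=> (2 / (q - 1))%:E)); first by rewrite prodEFin prodr_const card_ord.
  move=> i _; rewrite -(integral_dec1 q1).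
  apply: (@integral_translate R (- tnth y i) (fun t => (dec1 t `^ q)%:E)).
    by apply/measurable_EFinP; exact: measurable_powR_dec1.
  by move=> t; rewrite lee_fin powR_ge0.
- move=> i; apply: (measurableT_comp (measurable_powR_dec1 q)).
  exact: measurable_funB.
- by move=> i t; exact: powR_ge0.
Qed.

End Decay.

(** * Fourier transforms of the weights *)

Section FlatTransform.
Variable R : realType.
Local Notation leb1 := (@lebesgue_measure R).
Variables d e : R.
Hypotheses (d0 : 0 < d) (e0 : 0 < e).

Definition fw (d e v : R) : R[i] := cint leb1 (fun t => cis (- (v * t)) * (flat1 d e t)%:C%C).

Lemma flat1_le_pexp t : flat1 d e t <= pexp d t.
Proof.
rewrite /flat1; case: eqP => [->|_]; first exact: expR_ge0.
by rewrite ler_expR gerBl// divr_ge0// ltW.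
Qed.

Lemma cintble_flat1 v : cintble leb1 (fun t => cis (- (v * t)) * (flat1 d e t)%:C%C).
Proof.
apply: (@cintble_leR _ (measurableTypeR R) R leb1 _ (pexp d)).
- apply: cmeasM; last by apply: cmeas_real; exact: measurable_flat1.
  by apply: cmeas_cis; apply: measurableT_comp => //; exact: measurable_funM.
- exact: measurable_pexp.
- move=> t; rewrite cmodM cmod_cis mul1r cmod_real ger0_norm ?flat1_ge0//.
  exact: flat1_le_pexp.
- by rewrite integral_pexp// ltry.
Qed.

Lemma fw_le v : cmod (fw d e v) <= 2 / d.
Proof.
have [m1 _] := cintble_flat1 v.
apply: cint_le => //; rewrite -(integral_pexp d0); apply: ge0_le_integral => //.
- by move=> t _; rewrite lee_fin cmod_ge0.
- by apply/measurable_EFinP; exact: measurable_cmod.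
- by apply/measurable_EFinP; exact: measurable_pexp.
move=> t _; rewrite cmodM cmod_cis mul1r cmod_real ger0_norm ?flat1_ge0// lee_fin.
exact: flat1_le_pexp.
Qed.

Lemma ftest_flat n (x : n.-tuple R) : (0 < n)%N ->
  ftest d e (fun=> 1) x = \prod_(i < n) fw d e (tnth x i).
Proof.
move=> n0; rewrite /ftest fourierE /fw.
rewrite -(@cint_prod R n (fun i t => cis (- (tnth x i * t)) * (flat1 d e t)%:C%C)); last first.
  by move=> i; exact: cintble_flat1.
apply: eq_cint => y; rewrite big_split /= -cis_sum -real_prod /test mul1r /flat.
by congr (cis _ * _); rewrite /dotp -sumrN.
Qed.

(** The modulus of the derivative of [e^(-e/|t|)], which rises from [0] to [1] on each side of the
    origin; hence its integral is [2] for every [e > 0]. *)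
Let jump (t : R) : R := e * (`|t|^-1 * `|t|^-1) * flat1 0 e t.

Let measurable_jump : measurable_fun [set: R] jump.
Proof.
apply: measurable_funM; last exact: measurable_flat1.
have mV : measurable_fun [set: R] (fun t : R => `|t|^-1).
  by apply: (measurableT_comp (@measurable_invr R)); exact: normr_measurable.
by apply: measurable_funM => //; exact: measurable_funM.
Qed.

Let jump_ge0 t : 0 <= jump t.
Proof. by rewrite mulr_ge0 ?flat1_ge0// mulr_ge0 ?mulr_ge0// ltW. Qed.

Let integral_jump : (\int[leb1]_t (jump t)%:E = 2%:E)%E.
Proof.
rewrite integral_sym; first last.
- by move=> t; rewrite lee_fin.
- exact/measurable_EFinP.
have dF (t : R) : 0 < t -> is_derive t (1 : R) (flat1 0 e) (jump t).
  move=> t0; have := @is_derive_flat1 R 0 e t; rewrite gt_eqF// => /(_ isT) h.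
  apply: is_derive_eq.
  by rewrite /jump gtr0_sg// gtr0_norm// mul0r oppr0 add0r mul1r mulrC.
(* Continuity of [jump] at the origin: [e^y >= y^3/6] with [y = e/|t|] beats the factor [|t|^(-2)]
   by one power. *)
have jle (t : R) : `|jump t| <= 6 / e ^+ 2 * `|t|.
  rewrite ger0_norm// /jump /flat1; case: eqP => [->|/eqP t0].
    by rewrite mulr0 normr0 mulr0.
  have tp : 0 < `|t| by rewrite normr_gt0.
  rewrite mul0r oppr0 sub0r expRN.
  have := @expR_ge1Dxn R (e / `|t|) 2 _; rewrite divr_ge0 ?(ltW e0)// => /(_ isT) h.
  have {}h : (e / `|t|) ^+ 3 / 6 <= expR (e / `|t|).
    by apply: le_trans h; rewrite -[3%N`!]/6%N; rewrite lerDr.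
  apply: le_trans (_ : e * (`|t|^-1 * `|t|^-1) * ((e / `|t|) ^+ 3 / 6)^-1 <= _).
    rewrite ler_wpM2l ?mulr_ge0 ?(ltW e0)// lef_pV2 ?posrE ?expR_gt0//.
    by rewrite divr_gt0// exprn_gt0// divr_gt0.
  rewrite le_eqVlt; apply/orP; left; apply/eqP; field.
  by rewrite gt_eqF//= gt_eqF.
have lim0 (F : R -> R) (C : R) : (forall t, `|F t| <= C * `|t|) -> F x @[x --> 0^'+] --> (0 : R).
  move=> FC; apply: cvg_at_right_filter; apply/cvgrPdist_le => a a0; near=> t.
  rewrite sub0r normrN; apply: le_trans (FC t) _.
  apply: le_trans (_ : (`|C| + 1) * `|t| <= _).
    by rewrite ler_wpM2r// (le_trans (ler_norm _))// lerDl.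
  have C1 : 0 < `|C| + 1 by rewrite ltr_wpDl.
  rewrite mulrC -ler_pdivlMr//; near: t.
  by apply: (@nbhs0_le R R); exact: divr_gt0.
have h : (\int[leb1]_(t in `[0%R, +oo[) (jump t)%:E = (1 : R)%:E - (flat1 0 e 0)%:E)%E.
  have f00 : flat1 0 e 0 = 0 by rewrite /flat1 eqxx.
  apply: ge0_continuous_FTC2y.
  - by [].
  - apply/continuous_within_itvcyP; split.
      move=> x; rewrite in_itv /= andbT => x0.
      have cV : (fun t : R => `|t|^-1) t @[t --> x] --> `|x|^-1.
        by apply: cvgV; [rewrite normr_eq0 gt_eqF|exact: norm_continuous].
      apply: cvgM; first by apply: cvgMr; exact: cvgM.
      by have [/derivable1_diffP/differentiable_continuous] := dF x x0.
    by rewrite /jump f00 mulr0; exact: lim0 jle.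
  - apply/cvgrPdist_le => a a0; near=> t.
    have t0 : 0 < t by near: t; exact: nbhs_pinfty_gt.
    rewrite /flat1 gt_eqF// mul0r oppr0 sub0r (gtr0_norm t0).
    have h1 : expR (- (e / t)) <= 1 by rewrite -[leRHS]expR0 ler_expR oppr_le0 divr_ge0// ltW.
    rewrite ger0_norm ?subr_ge0// lerBlDl.
    apply: le_trans (_ : a + (1 + - (e / t)) <= _); last first.
      by rewrite addrC lerD2r; exact: expR_ge1Dx.
    have : e / t <= a by rewrite ler_pdivrMr// mulrC -ler_pdivrMr//; near: t; exact: nbhs_pinfty_ge.
    lra.
  - by move=> x x0; have [] := dF x x0.
  - rewrite f00; apply: (lim0 _ e^-1) => t.
    rewrite ger0_norm ?flat1_ge0// /flat1; case: eqP => [_|/eqP t0].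
      by rewrite mulr_ge0 ?invr_ge0// ltW.
    have tp : 0 < `|t| by rewrite normr_gt0.
    rewrite mul0r oppr0 sub0r expRN.
    have -> : e^-1 * `|t| = (e / `|t|)^-1 by rewrite invf_div mulrC.
    rewrite lef_pV2 ?posrE ?expR_gt0 ?divr_gt0//.
    by apply: le_trans (expR_ge1Dx _); rewrite lerDr.
  - move=> x; rewrite in_itv /= andbT => x0.
    by apply: is_derive1_val; exact: dF.
have jE t : jump (- t) = jump t by rewrite /jump /flat1 normrN oppr_eq0.
have -> : (\int[leb1]_(t in `[0%R, +oo[) ((jump t)%:E + (jump (- t))%:E) =
   \int[leb1]_(t in `[0%R, +oo[) ((jump t)%:E + (jump t)%:E))%E.
  by apply: eq_integral => t _; rewrite jE.
rewrite ge0_integralD//.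
- by rewrite h /flat1 eqxx -EFinB -EFinD; congr EFin; ring.
- by move=> t _; rewrite lee_fin.
- by apply: measurable_funTS; exact/measurable_EFinP.
- by move=> t _; rewrite lee_fin.
- by apply: measurable_funTS; exact/measurable_EFinP.
Unshelve. all: by end_near. Qed.

(** The point is uniformity in [e]. The derivative of [flat1 d e] is at most [d pexp d + jump], with
    integral [d (2/d) + 2 = 4] for all [d] and [e]; this provides the majorant for the limit
    [e -> 0]. *)
Lemma fw_decay v : `|v| * cmod (fw d e v) <= 4.
Proof.
(* In dimension one the transform of the derivative is already available from [ftest_derive]. *)
pose x : 1.-tuple R := [tuple v].
have -> : cmod (fw d e v) = cmod (ftest d e (fun=> 1) x).
  by rewrite ftest_flat// big_ord1.
have g1 : gen (fun _ : 1.-tuple R => (1 : R)) by exact: gen_cst.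
pose g (y : 1.-tuple R) := 0 + 1 * logder d e ord0 y.
have gg : gen g.
  by apply: gen_add; [exact: gen_cst|apply: gen_mul => //; exact: gen_logder].
have dg (y : 1.-tuple R) : is_derive (tnth y ord0) (1 : R)
    (fun t : R => test d e (fun=> 1) (upd y ord0 t)) (test d e g y).
  apply: (@test_is_derive _ _ _ d e d0 e0 (fun=> 1) (fun=> 0)) => //.
  by move=> _; exact: is_derive_cst.
have -> : `|v| * cmod (ftest d e (fun=> 1) x) = cmod (ftest d e g x).
  by rewrite (ftest_derive (ltn0Sn 0) d0 e0 x g1 gg dg) /x (tnth_nth 0).
rewrite -lee_fin; apply: le_trans (fourier_le _ (cintble_test (ltn0Sn 0) d0 e0 gg)) _.
pose h t := d * pexp d t + jump t.
apply: (@le_trans _ _ (\int[lebm (n := 1)]_y (\prod_(i < 1) h (tnth y i))%:E)%E).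
  apply: ge0_le_integral => //.
  - by move=> y _; rewrite lee_fin cmod_ge0.
  - apply/measurable_EFinP; apply: measurable_cmod; apply: cmeas_real.
    exact: measurable_test.
  - apply/measurable_EFinP; apply: (@measurable_prod_tnth R 1 (fun=> h)) => _.
    by apply: measurable_funD => //; apply: measurable_funM => //; exact: measurable_pexp.
  move=> y _; rewrite lee_fin cmod_real /test /flat !big_ord1 normrM.
  rewrite (ger0_norm (flat1_ge0 _ _ _)) /g add0r mul1r /logder.
  set t := tnth y ord0.
  have [t0|t0] := eqVneq t 0.
    rewrite /flat1 t0 eqxx mulr0 addr_ge0//; rewrite mulr_ge0 ?expR_ge0// ltW//.
  apply: le_trans (_ : (d + e * (`|t|^-1 * `|t|^-1)) * flat1 d e t <= _).
    rewrite ler_wpM2r ?flat1_ge0//; apply: le_trans (ler_normD _ _) _.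
    rewrite normrN !normrM normfV normr_sg t0 mulr1 mul1r.
    by rewrite (ger0_norm (ltW d0)) (ger0_norm (ltW e0)).
  rewrite mulrDl lerD//; first by rewrite ler_wpM2l ?(ltW d0)// flat1_le_pexp.
  rewrite /jump ler_wpM2l//; first by rewrite !mulr_ge0// ltW.
  rewrite /flat1 (negbTE t0) ler_expR mul0r oppr0 lerD2r oppr_le0.
  by rewrite mulr_ge0// ltW.
have h0 t : 0 <= h t by rewrite addr_ge0// mulr_ge0 ?expR_ge0// ltW.
have mh : measurable_fun [set: R] h.
  by apply: measurable_funD => //; apply: measurable_funM => //; exact: measurable_pexp.
rewrite (@integral_prod R 1 (fun=> h))// big_ord1 /h.
have -> : (\int[leb1]_t (d * pexp d t + jump t)%:E =
    \int[leb1]_t ((d * pexp d t)%:E + (jump t)%:E))%E by [].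
have mp := @measurable_pexp R d.
rewrite ge0_integralD//.
- rewrite integral_jump; under eq_integral do rewrite EFinM.
  rewrite ge0_integralZl_EFin ?(ltW d0)//.
  + rewrite integral_pexp// -EFinM -EFinD lee_fin mulrCA mulfV ?gt_eqF// mulr1.
    by rewrite -natrD.
  + by move=> t _; rewrite lee_fin expR_ge0.
  + exact/measurable_EFinP.
- by move=> t _; rewrite lee_fin mulr_ge0 ?expR_ge0// ltW.
- by apply/measurable_EFinP; exact: measurable_funM.
- by move=> t _; rewrite lee_fin.
- exact/measurable_EFinP.
Qed.

Lemma fw_le_dec v : cmod (fw d e v) <= (2 / d + 4) * dec1 v.
Proof.
rewrite /dec1 ler_pdivlMr ?ltr_wpDr// mulrDr mulr1 lerD ?fw_le//.
by rewrite mulrC fw_decay.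
Qed.

End FlatTransform.

Section FlatLimit.
Variable R : realType.
Local Notation leb1 := (@lebesgue_measure R).
Variable d : R.
Hypothesis d0 : 0 < d.

(** Dominated convergence with majorant [pexp d]; the limit weight [flat1 d 0] differs from [pexp d]
    at the point [0] only. *)
Lemma cvg_fw v : forall a : R, 0 < a -> \forall k \near \oo,
  cmod (fw d k.+1%:R^-1 v - (poisson d v)%:C%C) <= a.
Proof.
move=> a a0.
have mc : cmeas (fun t : measurableTypeR R => cis (- (v * t)) : R[i]).
  by apply: cmeas_cis; apply: measurableT_comp => //; exact: measurable_funM.
have mf (e : R) : cmeas (fun t : measurableTypeR R => cis (- (v * t)) * (flat1 d e t)%:C%C).
  by apply: cmeasM => //; apply: cmeas_real; exact: measurable_flat1.
have -> : (poisson d v)%:C%C = cint leb1 (fun t => cis (- (v * t)) * (flat1 d 0 t)%:C%C).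
  rewrite -[v]opprK poissonC opprK /poisson -cint_pexp//.
  apply: ae_eq_cint => //.
    apply: cmeasM; first by apply: cmeas_real; exact: measurable_pexp.
    by apply: cmeas_cis; exact: measurable_funM.
  exists [set 0]; split=> //; first exact: lebesgue_measure_set1.
  move=> t /= h; apply: contrapT => /eqP t0; apply: h.
  by rewrite /flat1 (negbTE t0) mul0r subr0 mulrC mulNr.
have fle k t : flat1 d k.+1%:R^-1 t <= pexp d t by exact: flat1_le_pexp.
apply: (@cint_dct _ (measurableTypeR R) R leb1 (fun k t => cis (- (v * t)) * (flat1 d k.+1%:R^-1 t)%:C%C)
   (fun t => cis (- (v * t)) * (flat1 d 0 t)%:C%C) (pexp d)) => //.
- exact: measurable_pexp.
- by move=> k t; rewrite cmodM cmod_cis mul1r cmod_real ger0_norm ?flat1_ge0.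
- move=> t; rewrite cmodM cmod_cis mul1r cmod_real ger0_norm ?flat1_ge0//.
  rewrite /flat1; case: eqP => _; first exact: expR_ge0.
  by rewrite mul0r subr0.
- by rewrite integral_pexp// ltry.
move=> t.
have [t0|t0] := eqVneq t 0.
  rewrite [X in X @ _](_ : _ = fun=> 0); first exact: cvg_cst.
  by apply/funext => k; rewrite /flat1 t0 eqxx subrr cmod0.
apply: (@cvg0_le _ _ (fun k => `|flat1 d k.+1%:R^-1 t - flat1 d 0 t|)).
  by move=> k; rewrite -mulrBr -rmorphB cmodM cmod_cis mul1r cmod_real normr_id.
rewrite -[X in _ --> X](normr0 R); apply: cvg_norm.
rewrite -[X in _ --> X](subrr (flat1 d 0 t)).
apply: cvgB; last exact: cvg_cst.
rewrite /flat1 (negbTE t0).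
have h : (fun k : nat => - (d * `|t|) - k.+1%:R^-1 / `|t|) @ \oo --> - (d * `|t|) - 0 / `|t|.
  by apply: cvgB; [exact: cvg_cst|apply: cvgMl; exact: cvg_harmonic].
exact: (cvg_comp _ _ h (@continuous_expR R _)).
Qed.

End FlatLimit.

Section NormBounds.
Variables (R : realType) (n : nat).
Local Notation mu := (@lebm R n).
Local Notation Rn := (n.-tuple R).

(** Selects the essential supremum in the definition of [Lnorm] at [+oo], where a null space is
    treated separately. *)
Lemma lebm_setT_gt0 : (0 < mu [set: Rn])%E.
Proof.
apply: (@lt_le_trans _ _ (mu (cube 1))).
  by rewrite -[X in (0 < X)%E]/(lebm (cube 1)) lebm_cube lte_fin exprn_gt0// mulr1.
by apply: le_measure; rewrite ?inE//; exact: measurable_cube.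
Qed.

Lemma cnorm_ge0 r (f : Rn -> R[i]) : (0 <= cnorm r f)%E.
Proof. exact: Lnorm_ge0. Qed.

Lemma cnorm_bnd r (f : Rn -> R[i]) : (0 < r)%E -> Lp r f ->
  bnd mu (einv r) (fun x => cmod (f x)) (fine (cnorm r f)).
Proof.
move=> r0 [mf fr].
have fN : cnorm r f \is a fin_num by rewrite ge0_fin_numE// cnorm_ge0.
case: r r0 fr fN => [r| |] r0 fr fN; last by [].
  rewrite lte_fin in r0; rewrite /einv bndP ?invr_gt0// invrK.
  have r1 : r != 0 by rewrite gt_eqF.
  have h : (cnorm r%:E f `^ r = \int[mu]_x `|(cmod (f x))%:E| `^ r)%E := powR_Lnorm _ _ r1.
  rewrite -poweR_EFin (fineK fN) h.
  apply: ge0_le_integral => //.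
  - by move=> x _; rewrite lee_fin powR_ge0.
  - by apply/measurable_EFinP; apply: measurable_powRf; exact: measurable_cmod.
  - under eq_fun do rewrite abse_EFin poweR_EFin.
    apply/measurable_EFinP; apply: measurable_powRf.
    by under eq_fun do rewrite (ger0_norm (cmod_ge0 _)); exact: measurable_cmod.
  - by move=> x _; rewrite abse_EFin poweR_EFin (ger0_norm (cmod_ge0 _)).
rewrite /einv /bnd eqxx.
have h := ess_sup_ge mu (abse \o (fun x : Rn => (cmod (f x))%:E)).
have E : cnorm +oo f = ess_sup mu (abse \o (fun x : Rn => (cmod (f x))%:E)).
  by rewrite /cnorm unlock; rewrite [X in if X then _ else _]lebm_setT_gt0.
apply: filterS h => x /=; rewrite -E -{1}(fineK fN) lee_fin ger0_norm//.
exact: cmod_ge0.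
Qed.

Lemma bnd_cnorm p (f : Rn -> R[i]) A : 0 < p -> 0 <= A ->
  bnd mu p^-1 (fun x => cmod (f x)) A -> (cnorm p%:E f <= A%:E)%E.
Proof.
move=> p0 A0; rewrite bndP ?invr_gt0// invrK => h.
rewrite /cnorm unlock.
have -> : A%:E = ((A `^ p)%:E `^ p^-1)%E.
  by rewrite poweR_EFin -powRrM mulfV ?gt_eqF// powRr1.
apply: gt0_ler_poweR.
- by rewrite invr_ge0 ltW.
- by rewrite in_itv /= leey andbT integral_ge0// => x _; rewrite poweR_ge0.
- by rewrite in_itv /= leey andbT lee_fin powR_ge0.
by under eq_integral do rewrite abse_EFin poweR_EFin (ger0_norm (cmod_ge0 _)).
Qed.

(** The norm of [dec] in its first variable in the dual space of [L_p]; by translation invariance it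
    does not depend on the second variable. *)
Definition decN (p : R) : R := ((2 / ((1 - p^-1)^-1 - 1)) ^+ n) `^ (1 - p^-1).

Lemma dual_exp_gt1 (p : R) : 1 < p -> 1 < (1 - p^-1)^-1.
Proof.
move=> p1; have p0 : 0 < p by apply: lt_trans p1.
have ip : 0 < p^-1 by rewrite invr_gt0.
have ip1 : p^-1 < 1 by rewrite invf_lt1.
by rewrite invf_gt1 ?subr_gt0// gtrBl.
Qed.

Lemma bnd_dec (p : R) y : 1 < p -> bnd mu (1 - p^-1) (fun x => dec x y) (decN p).
Proof.
move=> p1; have q1 := dual_exp_gt1 p1.
have p10 : 0 < 1 - p^-1 by rewrite subr_gt0 invf_lt1// (lt_trans ltr01).
rewrite bndP// /decN -powRrM mulfV ?gt_eqF// powRr1.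
  by rewrite integral_dec.
by rewrite exprn_ge0// divr_ge0// subr_ge0 ltW.
Qed.

Lemma Lp_dec_le (p : R) (u F : Rn -> R[i]) A M y : 1 < p -> cmeas u -> cmeas F ->
  0 <= A -> 0 <= M -> bnd mu p^-1 (fun x => cmod (u x)) A ->
  (forall x, cmod (F x) <= M * dec x y) ->
  (\int[mu]_x (cmod (u x * F x))%:E <= (A * (M * decN p))%:E)%E.
Proof.
move=> p1 mu' mF A0 M0 uA FM.
have p0 : 0 < p by apply: lt_trans p1.
have ip : 0 <= p^-1 by rewrite invr_ge0 ltW.
have ip1 : 0 <= 1 - p^-1 by rewrite subr_ge0 invf_le1// ltW.
have md := @measurable_dec1l R n y.
have d0 x : 0 <= dec x y by exact: ltW (dec_gt0 x y).
have N0 : 0 <= decN p by exact: powR_ge0.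
have h := bndZ ip1 M0 N0 md d0 (bnd_dec y p1).
have MN : 0 <= M * decN p by rewrite mulr_ge0.
have hF : bnd mu (1 - p^-1) (fun x => cmod (F x)) (M * decN p).
  apply: le_bnd h => //; first exact: measurable_cmod.
  - exact: measurable_funM.
  - by move=> x; exact: cmod_ge0.
have := bndM ip ip1 A0 MN (measurable_cmod mu') (measurable_cmod mF)
  (fun x => cmod_ge0 _) (fun x => cmod_ge0 _) uA hF.
rewrite addrC subrK bnd1; first last.
- by rewrite mulr_ge0.
- by move=> x; rewrite mulr_ge0 ?cmod_ge0.
by under [X in _ -> (X <= _)%E]eq_integral do rewrite cmodM.
Qed.

Lemma Lp_dec_cintble (p : R) (u F : Rn -> R[i]) A M y : 1 < p -> cmeas u -> cmeas F ->
  0 <= A -> 0 <= M -> bnd mu p^-1 (fun x => cmod (u x)) A ->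
  (forall x, cmod (F x) <= M * dec x y) -> cintble mu (fun x => u x * F x).
Proof.
move=> p1 mu' mF A0 M0 uA FM; split; first exact: cmeasM.
by apply: le_lt_trans (Lp_dec_le p1 mu' mF A0 M0 uA FM) _; rewrite ltry.
Qed.

End NormBounds.

(** * Complex test functions modulated by characters *)

Section ComplexTest.
Variables (R : realType) (n : nat).
Hypothesis n0 : (0 < n)%N.
Variables d e : R.
Hypotheses (d0 : 0 < d) (e0 : 0 < e).
Local Notation Rn := (n.-tuple R).
Local Notation mu := (@lebm R n).

Definition cgen (F : Rn -> R[i]) : Prop :=
  gen (fun x => Cre (F x)) /\ gen (fun x => Cim (F x)).

Lemma cgen_real f : gen f -> cgen (fun x => (f x)%:C%C).
Proof. by move=> gf; split => //; exact: gen_cst. Qed.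

Lemma cgen_cis y : cgen (fun x => cis (dotp y x)).
Proof. by split; [exact: gen_cos|exact: gen_sin]. Qed.

Lemma cgen_cst c : cgen (fun=> c).
Proof. by split; exact: gen_cst. Qed.

Lemma cgenM F G : cgen F -> cgen G -> cgen (fun x => F x * G x).
Proof.
move=> [F1 F2] [G1 G2]; split.
  under eq_fun do rewrite CreM.
  by apply: gen_add; [exact: gen_mul|apply: gen_opp; exact: gen_mul].
under eq_fun do rewrite CimM.
by apply: gen_add; exact: gen_mul.
Qed.

Definition ctest (d e : R) (F : Rn -> R[i]) (x : Rn) : R[i] := (flat d e x)%:C%C * F x.

Lemma Cre_ctest F : (fun x => Cre (ctest d e F x)) = test d e (fun x => Cre (F x)).
Proof. by apply/funext => x; rewrite /ctest /test CreM /= mul0r subr0 mulrC. Qed.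

Lemma Cim_ctest F : (fun x => Cim (ctest d e F x)) = test d e (fun x => Cim (F x)).
Proof. by apply/funext => x; rewrite /ctest /test CimM /= mul0r addr0 mulrC. Qed.

Lemma ctest_schwartz F : cgen F -> schwartz (ctest d e F).
Proof.
by move=> [F1 F2]; split; rewrite ?Cre_ctest ?Cim_ctest; exact: test_schwartz.
Qed.

Lemma ctestE F x : ctest d e F x =
  (test d e (fun x => Cre (F x)) x)%:C%C + 'i%C * (test d e (fun x => Cim (F x)) x)%:C%C.
Proof.
rewrite -Cre_ctest -Cim_ctest; case: (ctest d e F x) => a b.
by apply/eqP; rewrite eq_complex /=; apply/andP; split; apply/eqP; ring.
Qed.

Lemma cintble_ctest F : cgen F -> cintble mu (ctest d e F).
Proof.
move=> [F1 F2]; rewrite (_ : ctest d e F = fun x => ctest d e F x)//.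
under eq_fun do rewrite ctestE.
apply: cintbleD; first exact: (cintble_test n0 d0 e0 F1).
by apply: cintbleZ; exact: (cintble_test n0 d0 e0 F2).
Qed.

Definition tsub (x y : Rn) : Rn := [tuple tnth x i - tnth y i | i < n].

Lemma dotp_tsub x y z : dotp (tsub x y) z = dotp x z - dotp y z.
Proof.
rewrite /dotp -sumrB; apply: eq_bigr => i _.
by rewrite tnth_mktuple mulrBl.
Qed.

Lemma fourier_translate (F : Rn -> R[i]) x y :
  fourier (fun z => cis (dotp y z) * F z) x = fourier F (tsub x y).
Proof.
rewrite !fourierE; apply: eq_cint => z.
by rewrite mulrA -cisD dotp_tsub; congr (cis _ * _); ring.
Qed.

Lemma dec_tsub x y : dec x y = (\prod_(i < n) (1 + `|tnth (tsub x y) i|))^-1.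
Proof.
rewrite /dec -prodfV; apply: eq_bigr => i _.
by rewrite /dec1 tnth_mktuple.
Qed.

(** A character only translates the transform, so the same constant [M] works for all [y]; this
    uniformity is what the later uses of Fubini in [y] rest on. *)
Lemma fourier_ctest_decay F : cgen F -> exists2 M, 0 <= M & forall x y,
  cmod (fourier (ctest d e (fun z => cis (dotp y z) * F z)) x) <= M * dec x y.
Proof.
move=> [F1 F2].
have [M M0 hM] := ftest_decay n0 d0 e0 (enum 'I_n) F1.
have [N N0 hN] := ftest_decay n0 d0 e0 (enum 'I_n) F2.
exists (M + N) => [|x y]; first exact: addr_ge0.
have -> : ctest d e (fun z => cis (dotp y z) * F z) = fun z => cis (dotp y z) * ctest d e F z.
  by apply/funext => z; rewrite /ctest mulrCA.
rewrite fourier_translate dec_tsub; set v := tsub x y.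
have P0 : 0 < \prod_(i < n) (1 + `|tnth v i|).
  by apply: prodr_gt0 => i _; rewrite ltr_wpDr.
rewrite ler_pdivlMr// mulrC.
have -> : fourier (ctest d e F) v = ftest d e (fun x => Cre (F x)) v +
    'i%C * ftest d e (fun x => Cim (F x)) v.
  rewrite /ftest -fourierZ; last exact: (cintble_test n0 d0 e0 F2).
  rewrite -fourierD.
  - by congr fourier; apply/funext => z; rewrite ctestE.
  - exact: (cintble_test n0 d0 e0 F1).
  - by apply: cintbleZ; exact: (cintble_test n0 d0 e0 F2).
apply: le_trans (ler_wpM2l (ltW P0) (ler_cmodD _ _)) _.
rewrite cmodM (_ : cmod 'i%C = 1) ?mul1r; last by rewrite cmodE /= expr0n expr1n add0r sqrtr1.
rewrite mulrDr; have := hM v; have := hN v; rewrite !big_enum /= => h1 h2.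
exact: lerD.
Qed.

Lemma cmeas_ctest F : cgen F -> cmeas (ctest d e F).
Proof. by move=> /cintble_ctest[]. Qed.

End ComplexTest.

(** * The resolvent equation *)

Section Symbol.
Variables (R : realType) (n : nat).
Hypothesis n0 : (0 < n)%N.
Local Notation Rn := (n.-tuple R).
Local Notation mu := (@lebm R n).
Variables (m : R) (lam : R[i]).
Hypothesis hlam : ~ @nonneg_axis R lam.

(** The reciprocal [(|x|^(2m) - lam)^-1] with numerator and denominator made real, so that
    membership of its real and imaginary parts in [gen] can be read off. *)
Definition symb (x : Rn) : R[i] :=
  let D := (dotp x x `^ m - Cre lam) ^+ 2 + Cim lam ^+ 2 in
  Complex ((dotp x x `^ m - Cre lam) * D^-1) (Cim lam * D^-1).

(** Off the nonnegative axis either [Im lam] is nonzero or [Re lam < 0]. The uniform lower bound is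
    the side condition of [gen_inv]. *)
Lemma denom_ge : exists2 c, 0 < c & forall x : Rn,
  c <= (dotp x x `^ m - Cre lam) ^+ 2 + Cim lam ^+ 2.
Proof.
have [i0|i0] := eqVneq (Cim lam) 0.
  have r0 : Cre lam < 0.
    by rewrite ltNge; apply/negP => h; apply: hlam; split.
  exists (Cre lam ^+ 2); first by rewrite exprn_even_gt0//= lt_eqF.
  move=> x; rewrite i0 expr0n addr0 -sqrrN lerXn2r ?nnegrE ?oppr_ge0 ?(ltW r0)//.
    by rewrite addr_ge0 ?powR_ge0// oppr_ge0 ltW.
  by rewrite lerDr powR_ge0.
exists (Cim lam ^+ 2); first by rewrite exprn_even_gt0.
by move=> x; rewrite lerDr sqr_ge0.
Qed.

Lemma cgen_symb : cgen symb.
Proof.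
have [c c0 hc] := denom_ge.
have gp : gen (fun x : Rn => dotp x x `^ m - Cre lam).
  by apply: gen_add; [exact: gen_pow|exact: gen_cst].
have gi : gen (fun x : Rn => ((dotp x x `^ m - Cre lam) ^+ 2 + Cim lam ^+ 2)^-1).
  apply: (gen_inv c0 hc); apply: gen_add; last exact: gen_cst.
  exact: gen_mul.
by split; apply: gen_mul => //; exact: gen_cst.
Qed.

Lemma symbM x : ((dotp x x `^ m)%:C%C - lam) * symb x = 1.
Proof.
have [c c0 /(_ x) hc] := denom_ge.
have D0 := lt_le_trans c0 hc.
have DE := mulfV (lt0r_neq0 D0).
apply: complex_ext; rewrite ?CreM ?CimM ?CreD ?CimD ?CreN ?CimN /symb /=; last by ring.
by rewrite -[RHS]DE; ring.
Qed.

Lemma cmod_symb x : cmod (symb x) = (cmod ((dotp x x `^ m)%:C%C - lam))^-1.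
Proof.
have h : cmod ((dotp x x `^ m)%:C%C - lam) * cmod (symb x) = 1.
  by rewrite -cmodM symbM cmodE /= expr1n expr0n addr0 sqrtr1.
have h0 : cmod ((dotp x x `^ m)%:C%C - lam) != 0.
  by apply/negP => /eqP h0; move: h; rewrite h0 mul0r => /eqP; rewrite eq_sym oner_eq0.
by rewrite -[LHS]mul1r -(mulVf h0) -mulrA h mulr1.
Qed.

Lemma cintegralE (f : Rn -> R[i]) : cintegral f = cint mu f.
Proof. by []. Qed.

Lemma enorm_powR (x : Rn) : enorm x `^ (2 * m) = dotp x x `^ m.
Proof.
have d0 : 0 <= dotp x x by apply: sumr_ge0 => i _; rewrite -expr2 sqr_ge0.
by rewrite /enorm -powR12_sqrt// -powRrM mulrA mulVf ?mul1r.
Qed.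

Variables d e : R.
Hypotheses (d0 : 0 < d) (e0 : 0 < e).
Variable p : R.
Hypothesis p1 : 1 < p.

Lemma Lp_bnd (u : Rn -> R[i]) : Lp p%:E u -> exists2 A, 0 <= A &
  bnd mu p^-1 (fun x => cmod (u x)) A.
Proof.
move=> Lu; exists (fine (cnorm p%:E u)); first by rewrite fine_ge0// cnorm_ge0.
have p0 : (0 < p%:E)%E by rewrite lte_fin (lt_trans ltr01).
exact: (cnorm_bnd p0 Lu).
Qed.

Lemma Lp_fourier_cintble (u : Rn -> R[i]) F y : Lp p%:E u -> cgen F ->
  cintble mu (fun x => u x * fourier (ctest d e (fun z => cis (dotp y z) * F z)) x).
Proof.
move=> Lu gF; have [A A0 uA] := Lp_bnd Lu.
have [M M0 hM] := fourier_ctest_decay n0 d0 e0 gF.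
apply: (Lp_dec_cintble p1 _ _ A0 M0 uA (hM ^~ y)); first by case: Lu.
apply: cmeas_fourier; apply: (cmeas_ctest n0 d0 e0).
by apply: cgenM => //; exact: cgen_cis.
Qed.

(** The weighted, modulated symbol is a legitimate Schwartz test function. Testing with it and using
    [(|x|^(2m) - lam) symb = 1] leaves on the side of [g] the transform of the weight alone, which
    tends to an approximate identity. *)
Lemma resolvent_eq (g f f' : Rn -> R[i]) y :
  Lp p%:E g -> Lp p%:E f -> Lp p%:E f' ->
  fourier_mult (fun xi => enorm xi `^ (2 * m)) g f' ->
  aeq f (fun x => f' x - lam * g x) ->
  cint mu (fun x => g x * fourier (ctest d e (fun z => cis (dotp y z) * 1)) x) =
  cint mu (fun x => f x * fourier (ctest d e (fun z => cis (dotp y z) * symb z)) x).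
Proof.
move=> Lg Lf Lf' gf' ff'.
have gs := cgen_symb; have g1 := @cgen_cst R n 1; have gc := cgen_cis y.
have gp : cgen (fun x : Rn => (dotp x x `^ m)%:C%C) by apply: cgen_real; exact: gen_pow.
have gps := cgenM gp gs.
set P1 := fourier (ctest d e (fun z => cis (dotp y z) * symb z)).
pose P2 := fourier (ctest d e (fun z => cis (dotp y z) * ((dotp z z `^ m)%:C%C * symb z))).
have iP1 u : Lp p%:E u -> cintble mu (fun x => u x * P1 x).
  by move=> Lu; exact: Lp_fourier_cintble.
have iP2 u : Lp p%:E u -> cintble mu (fun x => u x * P2 x).
  by move=> Lu; exact: Lp_fourier_cintble.
have main : cint mu (fun x => f' x * P1 x) = cint mu (fun x => g x * P2 x).
  have := gf' _ (ctest_schwartz n0 d0 e0 (cgenM gc gs)).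
  rewrite !cintegralE => ->.
  apply: (@eq_cint _ _ R mu) => x; congr (_ * _); rewrite /P2; congr fourier.
  by apply/funext => z; rewrite enorm_powR /ctest mulrCA [X in _ * X]mulrCA.
have mP1 : cmeas P1 by apply: cmeas_fourier; apply: (cmeas_ctest n0 d0 e0); exact: cgenM.
have E1 : cint mu (fun x => f x * P1 x) = cint mu (fun x => f' x * P1 x - lam * (g x * P1 x)).
  transitivity (cint mu (fun x => (f' x - lam * g x) * P1 x)).
    apply: ae_eq_cint.
    - by apply: cmeasM; [exact: Lf.1|exact: mP1].
    - apply: cmeasM; last exact: mP1.
      apply: cmeasD; first exact: Lf'.1.
      by apply: cmeasN; apply: cmeasM; [exact: cmeas_cst|exact: Lg.1].
    - by apply: filterS ff' => x ->.
  by apply: eq_cint => x; rewrite mulrBl mulrA.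
rewrite E1 cintB; [|exact: iP1|by apply: cintbleZ; exact: iP1].
rewrite main.
rewrite -cintB; [|exact: iP2|by apply: cintbleZ; exact: iP1].
apply: eq_cint => x; rewrite mulrCA -mulrBr; congr (_ * _).
rewrite /P1 /P2 -fourierZ; last by apply: (cintble_ctest n0 d0 e0); exact: cgenM.
rewrite -fourierB.
- congr fourier; apply/funext => z; rewrite /ctest -[in LHS](symbM z); ring.
- by apply: (cintble_ctest n0 d0 e0); exact: cgenM.
- by apply: cintbleZ; apply: (cintble_ctest n0 d0 e0); exact: cgenM.
Qed.

Lemma cmod_ctest_le F (x : Rn) : cmod (ctest d e F x) <= cmod (F x).
Proof.
rewrite /ctest cmodM cmod_real ger0_norm ?flat_ge0// ler_piMl ?cmod_ge0//.
apply: prodr_ile1 => i _; rewrite flat1_ge0 /=.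
apply: le_trans (flat1_le_pexp d e0 _) _.
by rewrite /pexp -[leRHS]expR0 ler_expR oppr_le0 mulr_ge0// ltW.
Qed.

(** The inverse transform without the factor [(2 pi)^(-n)]. It is the conjugate of the transform of
    [conj k], so Hausdorff-Young applies to it unchanged. *)
Definition ifourier (k : Rn -> R[i]) (xi : Rn) := cint mu (fun y => cis (dotp y xi) * k y).

Lemma cmod_ifourier k xi : cintble mu k ->
  cmod (ifourier k xi) = cmod (fourier (fun y => conjc (k y)) xi).
Proof.
move=> ik; rewrite -[RHS]cmod_conj conj_fourier; last exact: cintble_conj.
by congr cmod; apply: eq_cint => y; rewrite dotpC conjcK.
Qed.

Lemma cmeas_ifourier k : cmeas k -> cmeas (ifourier k).
Proof.
move=> mk; apply: (@cmeas_cint2 _ _ _ _ R mu (fun z : Rn * Rn => cis (dotp z.2 z.1) * k z.2)).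
apply: cmeasM; last exact: (cmeas_comp measurable_snd).
by apply: cmeas_cis; apply: measurable_dotp; [exact: measurable_snd|exact: measurable_fst].
Qed.

Lemma bnd_ifourier k w B : 0 <= w <= 2^-1 -> cintble mu k -> 0 < B ->
  bnd mu (1 - w) (fun y => cmod (k y)) B ->
  bnd mu w (fun xi => cmod (ifourier k xi)) ((2 * pi) `^ (n%:R * w) * B).
Proof.
move=> /andP[w0 w1] ik B0 kB.
have w1' : 2^-1 <= 1 - w <= 1 by lra.
have kB' : bnd mu (1 - w) (fun y => cmod (conjc (k y))) B.
  by rewrite (_ : (fun y => _) = fun y => cmod (k y))//; apply/funext => y; rewrite cmod_conj.
have := hausdorff_young w1' (cintble_conj ik) B0 kB'.
rewrite (_ : 1 - (1 - w) = w); last by ring.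
by rewrite (_ : (fun s => _) = fun xi => cmod (ifourier k xi))//; apply/funext => y; rewrite cmod_ifourier.
Qed.

(** Averaging the characters in [y] against [k] produces [ifourier k] next to the test function.
    Fubini is justified by the decay of the modulated transforms in the dual of [L_p], uniform in
    [y], together with integrability of [k]. *)
Lemma swap_test (f k : Rn -> R[i]) F : Lp p%:E f -> cintble mu k -> cgen F ->
  cint mu (fun y => k y * cint mu (fun x =>
    f x * fourier (ctest d e (fun z => cis (dotp y z) * F z)) x)) =
  cint mu (fun x => f x * fourier (fun xi => ctest d e F xi * ifourier k xi) x).
Proof.
move=> Lf ik gF.
have mf : cmeas f by case: Lf.
have [mk k1] := ik.
have [A A0 fA] := Lp_bnd Lf.
have [M M0 hM] := fourier_ctest_decay n0 d0 e0 gF.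
have iF := cintble_ctest n0 d0 e0 gF.
pose P (z : Rn * Rn) := cint mu (fun xi => cis (- dotp z.2 xi) * (cis (dotp z.1 xi) * ctest d e F xi)).
have PE y x : fourier (ctest d e (fun z => cis (dotp y z) * F z)) x = P (y, x).
  by rewrite fourierE /P; apply: eq_cint => xi; rewrite /ctest /=; ring.
have mP : cmeas P.
  have m1 : measurable_fun setT (fun w : Rn * Rn * Rn => w.1.1).
    exact: (measurableT_comp measurable_fst measurable_fst).
  have m2 : measurable_fun setT (fun w : Rn * Rn * Rn => w.1.2).
    exact: (measurableT_comp measurable_snd measurable_fst).
  apply: (@cmeas_cint2 _ _ _ _ R mu (fun w : Rn * Rn * Rn =>
     cis (- dotp w.1.2 w.2) * (cis (dotp w.1.1 w.2) * ctest d e F w.2))).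
  apply: cmeasM.
    by apply: cmeas_cis; apply: measurableT_comp => //; exact: measurable_dotp.
  apply: cmeasM; last by apply: (cmeas_comp measurable_snd); case: iF.
  by apply: cmeas_cis; exact: measurable_dotp.
have PE2 y x : P (y, x) = cint mu (fun xi => cis (- dotp x xi) * (cis (dotp y xi) * ctest d e F xi)).
  by [].
clearbody P.
have mfP : cmeas (fun w : Rn * Rn => f w.2 * P w).
  by apply: cmeasM; [exact: (cmeas_comp measurable_snd)|exact: mP].
transitivity (cint mu (fun y => cint mu (fun x => k y * (f x * P (y, x))))).
  apply: eq_cint => y; rewrite cintZ.
    by congr (_ * _); apply: eq_cint => x; congr (_ * _); exact: PE.
  have -> : (fun x => f x * P (y, x)) =
      (fun x => f x * fourier (ctest d e (fun z => cis (dotp y z) * F z)) x).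
    by apply/funext => x; rewrite PE.
  exact: Lp_fourier_cintble.
rewrite (@cint_fubini _ _ _ _ R mu mu (fun w => k w.1 * (f w.2 * P w))).
- apply: eq_cint => x.
  transitivity (cint mu (fun y => f x * (k y * P (y, x)))).
    by apply: eq_cint => y; rewrite mulrCA.
  have Pb y : cmod (P (y, x)) <= M.
    rewrite -PE; apply: le_trans (hM _ _) _; rewrite ler_piMr//.
    apply: prodr_ile1 => i _; by rewrite dec1_le1 (ltW (dec1_gt0 _)).
  rewrite cintZ.
    congr (_ * _); rewrite fourierE.
    have e1 (z : Rn * Rn) : cmod (cis (dotp z.1 z.2) : R[i]) <= 1 by rewrite cmod_cis.
    have ib : cintble mu (fun xi => cis (- dotp x xi) * ctest d e F xi).
      exact: cintble_kernel.
    transitivity (cint mu (fun xi => (cis (- dotp x xi) * ctest d e F xi) *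
        cint mu (fun y => cis (dotp y xi) * k y))).
      rewrite -(cint_swap (@cmeas_kernelN R n) e1 ik ib).
      apply: eq_cint => y; congr (_ * _); rewrite PE2; apply: eq_cint => xi; rewrite /=; ring.
    by apply: eq_cint => xi; rewrite -mulrA.
  rewrite (_ : (fun y => k y * P (y, x)) = fun y => P (y, x) * k y); last first.
    by apply/funext => y; rewrite mulrC.
  apply: cintbleMb ik => //; first exact: (cmeas_pair1 x mP).
- by apply: cmeasM => //; exact: (cmeas_comp measurable_fst).
apply: (@le_lt_trans _ _ (\int[mu]_y ((cmod (k y))%:E * (A * (M * decN n p))%:E))%E).
  have mF1 : measurable_fun setT (fun w : Rn * Rn => (cmod (k w.1 * (f w.2 * P w)))%:E).
    apply/measurable_EFinP; apply: measurable_cmod; apply: cmeasM => //.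
    exact: (cmeas_comp measurable_fst).
  have F10 w : (0 <= (cmod (k w.1 * (f w.2 * P w)))%:E)%E by rewrite lee_fin cmod_ge0.
  apply: ge0_le_integral => //.
  - by move=> y _; apply: integral_ge0 => x _; exact: (F10 (y, x)).
  - exact: (measurable_fun_fubini_tonelli_F (m2 := mu) _ mF1 F10).
  - by apply: emeasurable_funM => //; apply/measurable_EFinP; exact: measurable_cmod.
  move=> y _; under eq_integral do rewrite cmodM EFinM /=.
  rewrite ge0_integralZl_EFin ?cmod_ge0//; first last.
  - by apply/measurable_EFinP; apply: measurable_cmod; exact: (cmeas_pair2 y mfP).
  - by move=> x _; rewrite lee_fin cmod_ge0.
  rewrite lee_wpmul2l ?lee_fin ?cmod_ge0//.
  apply: (Lp_dec_le (y := y) p1 mf _ A0 M0 fA).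
    exact: (cmeas_pair2 y mP).
  by move=> x; rewrite -PE.
rewrite ge0_integralZr//.
- rewrite muleC; apply: lte_mul_pinfty => //.
  by rewrite lee_fin !mulr_ge0// powR_ge0.
- by apply/measurable_EFinP; exact: measurable_cmod.
- by move=> y _; rewrite lee_fin cmod_ge0.
- by rewrite lee_fin !mulr_ge0// powR_ge0.
Qed.

(** The chain of reciprocal exponents: [ifourier k] is in [w] by Hausdorff-Young, its product with
    the symbol in [ia + w] by Hoelder, the transform of the product in [1 - (ia + w)] by
    Hausdorff-Young again, and [f] in [ia + w] completes the pairing. The weight is at most [1] and
    enters no constant, so the bound is uniform in [d] and [e]. *)
Lemma resolvent_bound (g f f' k : Rn -> R[i]) (ia w S Af B : R) :
  Lp p%:E g -> Lp p%:E f -> Lp p%:E f' ->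
  fourier_mult (fun xi => enorm xi `^ (2 * m)) g f' ->
  aeq f (fun x => f' x - lam * g x) ->
  0 <= ia -> 0 <= w <= 2^-1 -> 2^-1 <= ia + w <= 1 -> cintble mu k ->
  0 < S -> bnd mu ia (fun xi => cmod (symb xi)) S ->
  0 <= Af -> bnd mu (ia + w) (fun x => cmod (f x)) Af ->
  0 < B -> bnd mu (1 - w) (fun y => cmod (k y)) B ->
  cmod (cint mu (fun y => k y *
    cint mu (fun x => g x * fourier (ctest d e (fun z => cis (dotp y z) * 1)) x)))
  <= Af * ((2 * pi) `^ (n%:R * (1 - (ia + w))) * (S * ((2 * pi) `^ (n%:R * w) * B))).
Proof.
move=> Lg Lf Lf' gf' ff' ia0 w01 t01 ik S0 hS Af0 fA B0 kB.
have w0 : 0 <= w by case/andP: w01.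
rewrite [X in cmod X](_ : _ = cint mu (fun y => k y *
    cint mu (fun x => f x * fourier (ctest d e (fun z => cis (dotp y z) * symb z)) x))); last first.
  by apply: eq_cint => y; rewrite (resolvent_eq y Lg Lf Lf' gf' ff').
rewrite (swap_test Lf ik cgen_symb).
have [mk k1] := ik.
have iS := cintble_ctest n0 d0 e0 cgen_symb.
have mS : cmeas symb.
  by have [g1 g2] := cgen_symb; split; exact: gen_measurable.
have miF := cmeas_ifourier mk.
have pi2 : (0 : R) < 2 * pi by rewrite mulr_gt0// pi_gt0.
have X0 : 0 < (2 * pi) `^ (n%:R * w) * B by rewrite mulr_gt0// powR_gt0.
have hk := bnd_ifourier w01 ik B0 kB.
set X := (2 * pi) `^ (n%:R * w) * B in X0 hk *.
have hc : bnd mu ia (fun xi => cmod (ctest d e symb xi)) S.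
  apply: le_bnd hS => //.
  - by apply: measurable_cmod; case: iS.
  - exact: measurable_cmod.
  - by move=> x; exact: cmod_ge0.
  - by move=> x; exact: cmod_ctest_le.
have mcS : cmeas (ctest d e symb) by case: iS.
have hp := bndM ia0 w0 (ltW S0) (ltW X0) (measurable_cmod mcS) (measurable_cmod miF)
  (fun x => cmod_ge0 _) (fun x => cmod_ge0 _) hc hk.
set h := fun xi => ctest d e symb xi * ifourier k xi.
have hh : bnd mu (ia + w) (fun xi => cmod (h xi)) (S * X).
  by rewrite (_ : (fun xi => cmod (h xi)) = fun xi => cmod (ctest d e symb xi) * cmod (ifourier k xi))//;
    apply/funext => xi; rewrite /h cmodM.
have ih : cintble mu h.
  have [M hM] := fourier_bounded (cintble_conj ik).
  rewrite (_ : h = fun xi => ifourier k xi * ctest d e symb xi); last first.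
    by apply/funext => xi; rewrite mulrC.
  apply: (@cintbleMb _ _ _ _ _ _ M) => // xi.
  by rewrite cmod_ifourier.
have SX0 : 0 < S * X by rewrite mulr_gt0.
have hy := hausdorff_young t01 ih SX0 hh.
have mfh : cmeas (fourier h) by apply: cmeas_fourier; case: ih.
have mf : cmeas f := Lf.1.
have /andP[t0 t1] := t01.
have tt0 : 0 <= ia + w by rewrite addr_ge0.
have t1' : 0 <= 1 - (ia + w) by rewrite subr_ge0.
set Y := (2 * pi) `^ _ * (S * X) in hy *.
have Y0 : 0 <= Y by rewrite mulr_ge0 ?powR_ge0// ltW.
have := bndM tt0 t1' Af0 Y0 (measurable_cmod mf) (measurable_cmod mfh)
  (fun x => cmod_ge0 _) (fun x => cmod_ge0 _) fA hy.
rewrite (_ : ia + w + (1 - (ia + w)) = 1); last by ring.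
rewrite bnd1; first last.
- by rewrite mulr_ge0.
- by move=> x; rewrite mulr_ge0 ?cmod_ge0.
move=> hi; apply: cint_le; first exact: cmeasM.
by under eq_integral do rewrite cmodM.
Qed.

End Symbol.

(** * Poisson kernels as an approximate identity *)

Section HalfOpenBoxes.
Variables (R : realType) (n : nat).
Local Notation Rn := (n.-tuple R).
Local Notation mu := (@lebm R n).

Definition orthants : set (set Rn) :=
  [set [set x : Rn | forall i, (s i < (tnth x i)%:E)%E] | s in [set: 'I_n -> \bar R]].

Lemma orthants_setI : setI_closed orthants.
Proof.
move=> A B [s _ <-] [t _ <-]; exists (fun i => Order.max (s i) (t i)) => //.
apply/seteqP; split => x /=.
  by move=> h; split => i; have := h i; rewrite gt_max => /andP[].
by move=> [h1 h2] i; rewrite gt_max h1 h2.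
Qed.

(** Measurability of the identity out of the generated sigma-algebra can be tested coordinatewise on
    open rays, whose preimages are orthants. *)
Lemma measurable_orthants : @measurable _ Rn = <<s orthants >>.
Proof.
apply/seteqP; split; last first.
  apply: smallest_sub; first exact: sigma_algebra_measurable.
  move=> A [s _ <-].
  rewrite (_ : [set x | _] = [set x : Rn | forall i, [set t : R | (s i < t%:E)%E] (tnth x i)])//.
  apply: (@measurable_box R n (fun i => [set t : R | (s i < t%:E)%E])) => i.
  case: (s i) => [r| |].
  - rewrite (_ : [set t : R | _] = `]r, +oo[%classic)//.
    by apply/seteqP; split => t /=; rewrite in_itv /= andbT lte_fin.
  - by rewrite (_ : [set t : R | _] = set0)//; apply/seteqP; split => t.
  - by rewrite (_ : [set t : R | _] = setT)//; apply/seteqP; split => t //= _; rewrite ltNyr.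
move=> A mA.
pose id' : g_sigma_algebraType orthants -> Rn := id.
have : measurable_fun setT id'.
  apply/measurable_fun_tnthP => i.
  apply: (measurability _ (RGenOInfty.measurableE R)).
  move=> _ [_ [r ->] <-]; rewrite setTI.
  apply: sub_sigma_algebra; exists (fun j => if j == i then r%:E else -oo%E) => //.
  apply/seteqP; split => x /=.
    by move=> /(_ i); rewrite eqxx lte_fin in_itv /= andbT.
  rewrite in_itv /= andbT => h j; case: eqP => [->|_]; last exact: ltNyr.
  by rewrite lte_fin.
by move=> /(_ measurableT A mA); rewrite setTI.
Qed.

Definition hbox (a b : 'I_n -> R) : set Rn := [set x | forall i, `]a i, b i]%classic (tnth x i)].

Lemma measurable_hbox a b : measurable (hbox a b).
Proof. by apply: (@measurable_box R n (fun i => `]a i, b i]%classic)). Qed.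

Definition hcube (N : nat) : set Rn := hbox (fun=> - N%:R) (fun=> N%:R).

Lemma lebm_hcube_fin N (E : set Rn) : measurable E -> (mu (E `&` hcube N) < +oo)%E.
Proof.
move=> mE; apply: (@le_lt_trans _ _ (mu (cube N))).
  apply: le_measure; rewrite ?inE.
  - by apply: measurableI => //; exact: measurable_hbox.
  - exact: measurable_cube.
  by move=> x [_ h] i; have := h i; rewrite /= !in_itv /= => /andP[/ltW -> ->].
by rewrite -[X in (X < _)%E]/(lebm (cube N)) lebm_cube ltry.
Qed.

(** The corner is clipped to the cube coordinate by coordinate; an empty intersection appears as a
    box with some [a i = N]. *)
Lemma orthant_hcube N (s : 'I_n -> \bar R) : exists a,
  [set x : Rn | forall i, (s i < (tnth x i)%:E)%E] `&` hcube N = hbox a (fun=> N%:R) /\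
  forall i, - N%:R <= a i <= N%:R.
Proof.
have N0 : - N%:R <= N%:R :> R by rewrite (le_trans (y := 0))// oppr_le0.
pose a i := match s i with r%:E => Num.min (Num.max r (- N%:R)) N%:R
  | +oo%E => N%:R | -oo%E => - N%:R end : R.
exists a; split=> [|i]; last first.
  rewrite /a; case: (s i) => [r| |]; rewrite ?lexx ?N0//.
  by rewrite le_min le_max lexx orbT N0 ge_min lexx orbT.
apply/seteqP; split => x.
  move=> [h1 h2] i; have := h1 i; have := h2 i; rewrite /= !in_itv /= /a.
  case: (s i) => [r| |]; rewrite ?ltNyr => // /andP[h3 ->]; rewrite andbT ?h3//.
  by rewrite lte_fin => h4; rewrite gt_min gt_max h3 h4.
move=> h; split => i; have := h i; rewrite /= !in_itv /= /a.
  case: (s i) => [r| |] /andP[h1 h2]; rewrite ?ltNyr//; last by move: (lt_le_trans h1 h2); rewrite ltxx.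
  rewrite lte_fin; move: h1; rewrite gt_min gt_max => /orP[/andP[]//|h1].
  by move: (lt_le_trans h1 h2); rewrite ltxx.
case: (s i) => [r| |] /andP[h1 h2]; rewrite h2 andbT//; last by apply: le_lt_trans h1.
move: h1; rewrite gt_min gt_max => /orP[/andP[]//|h1].
by move: (lt_le_trans h1 h2); rewrite ltxx.
Qed.

End HalfOpenBoxes.

(** * Poisson integrals of intervals *)

Section PoissonLine.
Variable R : realType.
Local Notation leb1 := (@lebesgue_measure R).

Lemma poisson_le_dec (d v : R) : 0 < d -> poisson d v <= (2 / d + 1) * dec1 v.
Proof.
move=> d0; have D0 : 0 < d ^+ 2 + v ^+ 2 by rewrite ltr_pwDl ?sqr_ge0// exprn_gt0.
have h1 : poisson d v <= 2 / d.
  rewrite /poisson ler_pdivrMr// mulrDr; have -> : 2 / d * d ^+ 2 = 2 * d by field; rewrite gt_eqF.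
  by rewrite lerDl mulr_ge0 ?sqr_ge0// divr_ge0// ltW.
have h2 : poisson d v * `|v| <= 1.
  rewrite /poisson mulrAC ler_pdivrMr// mul1r -[v ^+ 2]real_normK ?num_real//.
  have := sqr_ge0 (d - `|v|); nra.
have v1 : 0 < 1 + `|v| by rewrite ltr_wpDr.
have : poisson d v * (1 + `|v|) <= 2 / d + 1 by rewrite mulrDr mulr1 lerD.
by rewrite -ler_pdivlMr.
Qed.

Definition pconv1 (d a b x : R) : R :=
  \int[leb1]_(y in [set: R]) (\1_(`]a, b]%classic) y * poisson d (x - y)).

Let measurable_ind (a b : R) : measurable_fun [set: R] (\1_(`]a, b]%classic) : R -> R).
Proof. by apply: measurable_indic. Qed.

Let measurable_poissonB (d x : R) : measurable_fun [set: R] (fun y => poisson d (x - y)).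
Proof. by apply: (measurableT_comp (measurable_poisson d)); exact: measurable_funB. Qed.

Let measurable_integrand (d a b x : R) :
  measurable_fun [set: R] (fun y => \1_(`]a, b]%classic) y * poisson d (x - y)).
Proof. exact: measurable_funM. Qed.

Lemma integral_poissonB (d x : R) : 0 < d -> (\int[leb1]_y (poisson d (x - y))%:E = (2 * pi)%:E)%E.
Proof.
move=> d0; rewrite -(integral_poisson d0).
rewrite -(@integral_translate R (- x) (fun y => (poisson d y)%:E)).
- by apply: eq_integral => y _; rewrite -poissonC opprB.
- by apply/measurable_EFinP; exact: measurable_poisson.
- by move=> y; rewrite lee_fin poisson_ge0.
Qed.

Lemma integrand_ge0 (d a b x y : R) : 0 < d -> 0 <= (\1_(`]a, b]%classic) y : R) * poisson d (x - y).
Proof. by move=> d0; rewrite mulr_ge0// poisson_ge0. Qed.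

Lemma pconv1_int (d a b x : R) : 0 < d ->
  (\int[leb1]_y (\1_(`]a, b]%classic) y * poisson d (x - y))%:E = (pconv1 d a b x)%:E)%E.
Proof.
move=> d0; rewrite /pconv1 /Rintegral fineK// ge0_fin_numE; last first.
  by apply: integral_ge0 => y _; rewrite lee_fin integrand_ge0.
apply: (@le_lt_trans _ _ (2 * pi)%:E); last exact: ltry.
rewrite -(integral_poissonB x d0); apply: ge0_le_integral => //.
- by move=> y _; rewrite lee_fin integrand_ge0.
- by apply/measurable_EFinP; exact: measurable_integrand.
- by apply/measurable_EFinP; exact: measurable_poissonB.
- by move=> y _; rewrite lee_fin ler_piMl ?poisson_ge0// indicE lern1 leq_b1.
Qed.

Lemma pconv1_ge0 (d a b x : R) : 0 < d -> 0 <= pconv1 d a b x.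
Proof.
move=> d0; apply: fine_ge0; apply: integral_ge0 => y _.
by rewrite lee_fin integrand_ge0.
Qed.

Lemma pconv1_le (d a b x : R) : 0 < d -> pconv1 d a b x <= 2 * pi.
Proof.
move=> d0; rewrite -lee_fin -pconv1_int// -(integral_poissonB x d0); apply: ge0_le_integral => //.
- by move=> y _; rewrite lee_fin integrand_ge0.
- by apply/measurable_EFinP; exact: measurable_integrand.
- by apply/measurable_EFinP; exact: measurable_poissonB.
- by move=> y _; rewrite lee_fin ler_piMl ?poisson_ge0// indicE lern1 leq_b1.
Qed.

(** A majorant uniform in [d <= 1]. For [|x| <= 2 M] the total mass [2 pi] suffices. Beyond,
    [|x - y| >= |x|/2], so the kernel is at most [8/|x|^2], while the interval is shorter than
    [|x|]; multiplied by [1 + |x| <= 2 |x|] this gives [16]. *)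
Lemma pconv1_le_dec (d a b M x : R) : 0 < d <= 1 -> 1 <= M -> - M <= a -> a <= b -> b <= M ->
  pconv1 d a b x <= (2 * pi * (1 + 2 * M) + 16) * dec1 x.
Proof.
move=> /andP[d0 d1] M1 Ma ab bM.
have x1 : 0 < 1 + `|x| by rewrite ltr_wpDr.
have M0 : 0 < M by apply: lt_le_trans M1.
have p0 := @pi_ge0 R.
rewrite /dec1 ler_pdivlMr//.
have [xM|Mx] := lerP `|x| (2 * M).
  apply: le_trans (_ : 2 * pi * (1 + 2 * M) <= _); last by rewrite lerDl.
  apply: ler_pM; [exact: pconv1_ge0|exact: ltW|exact: pconv1_le|by rewrite lerD2l].
have xp : 0 < `|x| by apply: le_lt_trans Mx; rewrite mulr_ge0// ltW.
have h : pconv1 d a b x <= 8 / `|x| ^+ 2 * (b - a).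
  rewrite -lee_fin -pconv1_int//.
  apply: (@le_trans _ _ (\int[leb1]_y ((8 / `|x| ^+ 2)%:E * (\1_(`]a, b]%classic) y)%:E))%E).
    apply: ge0_le_integral => //.
    - by move=> y _; rewrite lee_fin integrand_ge0.
    - by apply/measurable_EFinP; exact: measurable_integrand.
    - by apply: emeasurable_funM => //; exact/measurable_EFinP.
    move=> y _; rewrite -EFinM lee_fin mulrC indicE.
    case: (boolP (y \in _)) => yab; last by rewrite !mulr0.
    rewrite !mulr1; move: yab; rewrite inE /= in_itv /= => /andP[ay yb].
    have y2 : `|x| / 2 <= `|x - y|.
      have yM : `|y| <= M by rewrite ler_norml; apply/andP; split; [exact: le_trans Ma (ltW ay)|exact: le_trans bM].
      have := lerB_dist x y; lra.
    have y0 : 0 < `|x - y| by apply: lt_le_trans y2; rewrite divr_gt0.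
    rewrite /poisson -[(x - y) ^+ 2]real_normK ?num_real//.
    apply: le_trans (_ : 2 / `|x - y| ^+ 2 <= _).
      apply: ler_pM; rewrite ?invr_ge0 ?addr_ge0 ?sqr_ge0 ?mulr_ge0 ?(ltW d0)//; first by lra.
      by rewrite lef_pV2 ?posrE ?exprn_gt0// ?ltr_pwDl ?sqr_ge0 ?exprn_gt0// lerDr sqr_ge0.
    have -> : 8 / `|x| ^+ 2 = 2 / (`|x| / 2) ^+ 2 by field; rewrite gt_eqF.
    rewrite ler_pM2l// lef_pV2 ?posrE ?exprn_gt0 ?divr_gt0//.
    by rewrite lerXn2r// nnegrE// ltW// divr_gt0.
  rewrite ge0_integralZl_EFin ?divr_ge0 ?exprn_ge0//; last exact/measurable_EFinP.
  have -> : (\int[leb1]_y (\1_(`]a, b]%classic) y)%:E = leb1 `]a, b])%E.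
    by rewrite integral_indic// setIT.
  rewrite lebesgue_measure_itv /= lte_fin.
  case: ltP => _; last by rewrite mule0 lee_fin mulr_ge0 ?subr_ge0// divr_ge0 ?exprn_ge0.
  by rewrite -EFinB -EFinM.
apply: le_trans (_ : 16 <= _); last by rewrite lerDr !mulr_ge0// addr_ge0// mulr_ge0// ltW.
apply: le_trans (_ : 8 / `|x| ^+ 2 * (b - a) * (2 * `|x|) <= _).
  by apply: ler_pM; [exact: pconv1_ge0|exact: ltW|exact: h|lra].
have -> : 8 / `|x| ^+ 2 * (b - a) * (2 * `|x|) = 16 * ((b - a) / `|x|) by field; rewrite gt_eqF.
rewrite -[leRHS]mulr1 ler_pM2l// ler_pdivrMr// mul1r; lra.
Qed.

Lemma pconv1E (d a b x : R) : 0 < d -> (pconv1 d a b x)%:E =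
  (\int[leb1]_u (poisson 1 u * \1_(`]a, b]%classic) (d * u + x)%R)%:E)%E.
Proof.
move=> d0; rewrite -pconv1_int//.
rewrite -(@integral_affine R d x (fun y => (\1_(`]a, b]%classic) y * poisson d (x - y))%:E) d0); first last.
- by move=> y; rewrite lee_fin integrand_ge0.
- by apply/measurable_EFinP; exact: measurable_integrand.
rewrite -ge0_integralZl_EFin ?(ltW d0)//; first last.
- apply/measurable_EFinP; apply: (measurableT_comp (measurable_integrand d a b x)).
  by apply: measurable_funD => //; exact: measurable_funM.
- by move=> y _; rewrite lee_fin integrand_ge0.
apply: eq_integral => u _; rewrite -EFinM; congr EFin.
rewrite mulrCA mulrC; congr (_ * _).
rewrite opprD addrCA subrr addr0 poissonC /poisson.
have u0 : 1 + u ^+ 2 != 0 by rewrite gt_eqF// ltr_pwDl// sqr_ge0.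
have -> : d ^+ 2 + (d * u) ^+ 2 = d ^+ 2 * (1 + u ^+ 2) by ring.
by rewrite expr1n; field; rewrite u0 gt_eqF.
Qed.

(** After the substitution [y = d u + x] the kernel is fixed and only the indicator depends on [d];
    for each [u] it is eventually constant unless [x] is an endpoint, where the limit would be
    different. *)
Lemma cvg_pconv1 (a b x : R) : x != a -> x != b ->
  (fun k => pconv1 k.+1%:R^-1 a b x) @ \oo --> 2 * pi * \1_(`]a, b]%classic) x.
Proof.
move=> xa xb; set c := \1_(`]a, b]%classic) x.
have dk k : 0 < (k.+1%:R : R)^-1 by [].
have ev u : \forall k \near \oo, \1_(`]a, b]%classic) (k.+1%:R^-1 * u + x) = c.
  have h : (fun k : nat => k.+1%:R^-1 * u + x) @ \oo --> x.
    rewrite -[X in _ --> X]add0r; apply: cvgD; last exact: cvg_cst.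
    by rewrite -(mul0r u); apply: cvgMl; exact: cvg_harmonic.
  have ha : \forall k \near \oo, (a < k.+1%:R^-1 * u + x) = (a < x).
    move: xa; rewrite neq_lt => /orP[xa|xa].
      by rewrite (lt_gtF xa); apply: filterS (cvgr_lt _ h a xa) => k; exact: lt_gtF.
    by rewrite xa; apply: filterS (cvgr_gt _ h a xa) => k ->.
  have hb : \forall k \near \oo, (k.+1%:R^-1 * u + x <= b) = (x <= b).
    move: xb; rewrite neq_lt => /orP[xb|xb].
      by rewrite (ltW xb); apply: filterS (cvgr_lt _ h b xb) => k /ltW ->.
    by rewrite (lt_geF xb); apply: filterS (cvgr_gt _ h b xb) => k; exact: lt_geF.
  have inb (y : R) : (y \in `]a, b]%classic) = (a < y <= b).
    by apply/idP/idP; rewrite inE /= in_itv.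
  by apply: filterS2 ha hb => k h1 h2; rewrite /c !indicE !inb h1 h2.
apply/cvgrPdist_le => e e0.
have mi k : measurable_fun [set: R] (fun u : R => \1_(`]a, b]%classic) (k.+1%:R^-1 * u + x) : R).
  apply: (measurableT_comp (@measurable_ind a b)).
  by apply: measurable_funD => //; exact: measurable_funM.
have mp := @measurable_poisson R 1.
have p0 u : 0 <= poisson 1 u by exact: poisson_ge0.
have c01 : 0 <= c <= 1 by rewrite /c indicE ler0n lern1 leq_b1.
have [|||||||N _ hN] := @cint_dct _ (measurableTypeR R) R leb1
  (fun k u => (poisson 1 u * \1_(`]a, b]%classic) (k.+1%:R^-1 * u + x))%:C%C)
  (fun u => (poisson 1 u * c)%:C%C) (poisson 1) _ _ _ _ _ _ _ e e0.
- by move=> k; apply: cmeas_real; apply: measurable_funM; [exact: mp|exact: mi].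
- by apply: cmeas_real; apply: measurable_funM; [exact: mp|].
- exact: mp.
- move=> k u; rewrite cmod_real ger0_norm; last by rewrite indicE mulr_ge0 ?p0 ?ler0n.
  by rewrite indicE ler_piMr ?p0// lern1 leq_b1.
- move=> u; rewrite cmod_real ger0_norm; last by case/andP: c01 => c0 _; rewrite mulr_ge0 ?p0.
  by case/andP: c01 => _ c1; rewrite ler_piMr ?p0.
- by rewrite integral_poisson// ltry.
- move=> u; apply: cvg_near_cst; apply: filterS (ev u) => k ->.
  by rewrite subrr cmod0.
exists N => // k /= Nk.
have : cmod (cint leb1 (fun u => (poisson 1 u * \1_(`]a, b]%classic) (k.+1%:R^-1 * u + x))%:C%C)
    - cint leb1 (fun u => (poisson 1 u * c)%:C%C)) <= e by exact: hN.
rewrite !cint_real -rmorphB cmod_real distrC.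
congr (`|_ - _| <= _).
  rewrite -[RHS]/(fine (2 * pi * c)%:E) /Rintegral; congr fine.
  under eq_integral do rewrite EFinM.
  rewrite ge0_integralZr//.
  - by rewrite integral_poisson.
  - exact/measurable_EFinP.
  - by move=> u _; rewrite lee_fin; exact: p0.
  - by rewrite lee_fin; case/andP: c01.
by rewrite -[RHS]/(fine (pconv1 k.+1%:R^-1 a b x)%:E) pconv1E.
Qed.

End PoissonLine.

(** * Poisson integrals of functions in L_p *)

Section PoissonLimit.
Variables (R : realType) (n : nat).
Local Notation leb1 := (@lebesgue_measure R).
Local Notation Rn := (n.-tuple R).
Local Notation mu := (@lebm R n).
Variables (p : R) (g : Rn -> R[i]) (A : R).
Hypotheses (p1 : 1 < p) (mg : cmeas g) (A0 : 0 <= A).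
Hypothesis gA : bnd mu p^-1 (fun x => cmod (g x)) A.

Definition pconv (d : R) (y : Rn) : R[i] :=
  cint mu (fun x => g x * (poissonn d x y)%:C%C).

Lemma poissonn_le_dec (d : R) (x y : Rn) : 0 < d ->
  poissonn d x y <= (2 / d + 1) ^+ n * dec x y.
Proof.
move=> d0; have -> : (2 / d + 1) ^+ n = \prod_(i < n) (2 / d + 1).
  by rewrite prodr_const card_ord.
rewrite /poissonn /dec -big_split /=; apply: ler_prod => i _.
by rewrite poisson_ge0//= poisson_le_dec.
Qed.

Let mpoisson d : measurable_fun setT (fun z : Rn * Rn => poissonn d z.1 z.2).
Proof. exact: measurable_poissonn. Qed.

Let mpoisson2 d (x : Rn) : measurable_fun setT (fun y : Rn => poissonn d x y).
Proof. exact: (measurableT_comp (mpoisson d) (pair1_measurable x)). Qed.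

Let mpoisson1 d (y : Rn) : measurable_fun setT (fun x : Rn => poissonn d x y).
Proof. exact: (measurableT_comp (mpoisson d) (pair2_measurable y)). Qed.

Let mpoissonC d : measurable_fun setT (fun z : Rn * Rn => poissonn d z.2 z.1).
Proof.
by under eq_fun do rewrite poissonnC; exact: mpoisson.
Qed.

Lemma cmeas_pconv d : cmeas (pconv d).
Proof.
apply: (@cmeas_cint2 _ _ _ _ R mu (fun z : Rn * Rn => g z.2 * (poissonn d z.2 z.1)%:C%C)).
by apply: cmeasM; [exact: (cmeas_comp measurable_snd)|exact: cmeas_real].
Qed.

Lemma cintble_pconv d y : 0 < d -> cintble mu (fun x => g x * (poissonn d x y)%:C%C).
Proof.
move=> d0; apply: (@Lp_dec_cintble R n p g _ A ((2 / d + 1) ^+ n) y) => //.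
- by apply: cmeas_real; exact: mpoisson1.
- by rewrite exprn_ge0// addr_ge0// divr_ge0// ltW.
- by move=> x; rewrite cmod_real ger0_norm ?poissonn_ge0// poissonn_le_dec.
Qed.

Lemma integral_ind (E : set Rn) : measurable E -> (\int[mu]_x (\1_E x)%:E = mu E)%E.
Proof. by move=> mE; rewrite integral_indic// setIT. Qed.

(** The Poisson integral of an indicator function, which majorises that of any function dominated by
    a multiple of it. *)
Definition tau (d : R) (E : set Rn) (x : Rn) : R :=
  \int[mu]_(y in [set: Rn]) (\1_E y * poissonn d x y).

Let tau_integrand_ge0 d E (x y : Rn) : 0 < d -> 0 <= (\1_E y : R) * poissonn d x y.
Proof. by move=> d0; rewrite mulr_ge0// poissonn_ge0. Qed.

Let measurable_tau_integrand d E : measurable E ->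
  measurable_fun setT (fun z : Rn * Rn => (\1_E z.2 : R) * poissonn d z.1 z.2).
Proof.
move=> mE; apply: measurable_funM => //.
have mi : measurable_fun setT (\1_E : Rn -> R) by exact: measurable_indic.
exact: (measurableT_comp mi measurable_snd).
Qed.

Let measurable_tau_integrand2 d E (x : Rn) : measurable E ->
  measurable_fun setT (fun y => (\1_E y : R) * poissonn d x y).
Proof. by move=> mE; apply: measurable_funM => //; exact: measurable_indic. Qed.

Lemma tau_int d E x : 0 < d -> measurable E ->
  (\int[mu]_y (\1_E y * poissonn d x y)%:E = (tau d E x)%:E)%E /\ 0 <= tau d E x <= (2 * pi) ^+ n.
Proof.
move=> d0 mE.
have I0 : (0 <= \int[mu]_y (\1_E y * poissonn d x y)%:E)%E.
  by apply: integral_ge0 => y _; rewrite lee_fin tau_integrand_ge0.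
have I1 : (\int[mu]_y (\1_E y * poissonn d x y)%:E <= ((2 * pi) ^+ n)%:E)%E.
  rewrite -(integral_poissonn x d0); apply: ge0_le_integral => //.
  - by move=> y _; rewrite lee_fin tau_integrand_ge0.
  - by apply/measurable_EFinP; exact: measurable_tau_integrand2.
  - by apply/measurable_EFinP; exact: mpoisson1.
  by move=> y _; rewrite lee_fin [leRHS]poissonnC ler_piMl ?poissonn_ge0// indicE lern1 leq_b1.
have If : (\int[mu]_y (\1_E y * poissonn d x y)%:E)%E = (tau d E x)%:E.
  by rewrite /tau /Rintegral fineK// ge0_fin_numE//; apply: le_lt_trans I1 _; rewrite ltry.
by split=> //; rewrite -!lee_fin -If I0 I1.
Qed.

Lemma measurable_tau d E : measurable E -> measurable_fun setT (tau d E).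
Proof.
by move=> mE; exact: (@measurable_Rintegral2 _ _ _ _ R mu _ (measurable_tau_integrand d mE)).
Qed.

Lemma integral_tau d E : 0 < d -> measurable E ->
  (\int[mu]_x (tau d E x)%:E = ((2 * pi) ^+ n)%:E * mu E)%E.
Proof.
move=> d0 mE.
transitivity (\int[mu]_x \int[mu]_y (\1_E y * poissonn d x y)%:E)%E.
  by apply: eq_integral => x _; have [-> _] := tau_int x d0 mE.
have m2 : measurable_fun setT (fun z : Rn * Rn => (\1_E z.2 * poissonn d z.1 z.2)%:E).
  by apply/measurable_EFinP; exact: measurable_tau_integrand.
have f0 z : (0 <= (\1_E (z : Rn * Rn).2 * poissonn d z.1 z.2)%:E)%E.
  by rewrite lee_fin tau_integrand_ge0.
have := @fubini_tonelli _ _ _ _ _ mu mu _ m2 f0 => /= ->.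
transitivity (\int[mu]_y (((2 * pi) ^+ n)%:E * (\1_E y)%:E))%E.
  apply: eq_integral => y _.
  under eq_integral do rewrite EFinM.
  rewrite ge0_integralZl_EFin//.
  - by rewrite integral_poissonn// muleC.
  - by move=> x _; rewrite lee_fin poissonn_ge0.
  - by apply/measurable_EFinP; exact: mpoisson1.
rewrite ge0_integralZl_EFin//.
- by rewrite integral_ind//.
- by apply/measurable_EFinP; exact: measurable_indic.
- by rewrite exprn_ge0// mulr_ge0// pi_ge0.
Qed.

(** Interpolation by hand: [tau] is at most [(2 pi)^n] and has integral [(2 pi)^n mu E], so with [q]
    the dual exponent [tau^q <= (2 pi)^(n (q-1)) tau] is integrated directly. *)
Lemma bnd_tau d E v : 0 < d -> measurable E -> mu E = v%:E -> 0 <= v ->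
  bnd mu (1 - p^-1) (tau d E) ((2 * pi) ^+ n * v `^ (1 - p^-1)).
Proof.
move=> d0 mE Ev v0.
have t0 : 0 < 1 - p^-1 by rewrite subr_gt0 invf_lt1// (lt_trans ltr01).
have t1 : 1 <= (1 - p^-1)^-1 by rewrite ltW// dual_exp_gt1.
have pn0 : 0 < (2 * pi : R) ^+ n by rewrite exprn_gt0// mulr_gt0// pi_gt0.
set q := (1 - p^-1)^-1 in t1 *.
rewrite bndP//; apply: (@le_trans _ _ (\int[mu]_x ((((2 * pi) ^+ n) `^ (q - 1))%:E * (tau d E x)%:E))%E).
  apply: ge0_le_integral => //.
  - by move=> x _; rewrite lee_fin powR_ge0.
  - by apply/measurable_EFinP; apply: measurable_powRf; exact: measurable_tau.
  - by apply: emeasurable_funM => //; apply/measurable_EFinP; exact: measurable_tau.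
  move=> x _; have [_ /andP[h0 h1]] := tau_int x d0 mE.
  rewrite -EFinM lee_fin -/q.
  have [->|tn0] := eqVneq (tau d E x) 0; first by rewrite powR0 ?mulr0// gt_eqF// (lt_le_trans ltr01).
  have tp : 0 < tau d E x by rewrite lt_neqAle eq_sym tn0.
  have -> : tau d E x `^ q = tau d E x `^ (q - 1) * tau d E x.
    rewrite -[X in _ = _ * X]powRr1// -powRD ?subrK//.
    by apply/implyP.
  by rewrite ler_wpM2r// ge0_ler_powR// ?nnegrE ?subr_ge0// ltW.
rewrite ge0_integralZl_EFin ?powR_ge0//; first last.
- by apply/measurable_EFinP; exact: measurable_tau.
- by move=> x _; have [_ /andP[h0 h1]] := tau_int x d0 mE; rewrite lee_fin.
rewrite integral_tau// Ev -!EFinM lee_fin powRM ?powR_ge0 ?(ltW pn0)//.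
rewrite -powRrM mulfV ?gt_eqF// powRr1// mulrA ler_wpM2r//.
rewrite -[X in _ * X <= _]powRr1 ?(ltW pn0)// -powRD ?subrK//.
by apply/implyP => _; rewrite gt_eqF.
Qed.

Definition dominated (k : Rn -> R[i]) c (E : set Rn) : Prop :=
  cmeas k /\ forall x, cmod (k x) <= c * \1_E x.

Lemma dominated_cintble k c E v : 0 <= c -> measurable E -> mu E = v%:E -> dominated k c E -> cintble mu k.
Proof.
move=> c0 mE Ev [mk kc].
have mi : measurable_fun setT (\1_E : Rn -> R) by exact: measurable_indic.
apply: (cintble_leR mk (g := fun x => c * \1_E x)) => //; first exact: measurable_funM.
under eq_integral do rewrite EFinM.
rewrite ge0_integralZl_EFin//; last exact/measurable_EFinP.
by rewrite integral_ind// Ev -EFinM ltry.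
Qed.

(** Symmetry of the kernel moves the smoothing from [g], known only in [L_p], to the bounded
    function [k], where it can be estimated pointwise by [tau]. *)
Lemma pconv_swap k c E v d : 0 < d -> 0 <= c -> measurable E -> mu E = v%:E ->
  dominated k c E ->
  cint mu (fun y => k y * pconv d y) =
  cint mu (fun x => g x * cint mu (fun y => (poissonn d x y)%:C%C * k y)) /\
  forall x, cmod (cint mu (fun y => (poissonn d x y)%:C%C * k y)) <= c * tau d E x.
Proof.
move=> d0 c0 mE Ev dk; have ik := dominated_cintble c0 mE Ev dk.
have [mk kc] := dk; have mi : measurable_fun setT (\1_E : Rn -> R) by exact: measurable_indic.
have pb (x y : Rn) : poissonn d x y <= (2 / d + 1) ^+ n.
  apply: le_trans (poissonn_le_dec x y d0) _.
  rewrite ler_piMr ?exprn_ge0 ?addr_ge0 ?divr_ge0 ?(ltW d0)//.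
  by apply: prodr_ile1 => i _; rewrite dec1_le1 (ltW (dec1_gt0 _)).
split.
  transitivity (cint mu (fun y => cint mu (fun x => k y * (g x * (poissonn d x y)%:C%C)))).
    by apply: eq_cint => y; rewrite /pconv -cintZ//; exact: cintble_pconv.
  rewrite (@cint_fubini _ _ _ _ R mu mu (fun w => k w.1 * (g w.2 * (poissonn d w.2 w.1)%:C%C))).
  - apply: eq_cint => x; rewrite -cintZ.
      by apply: eq_cint => y /=; ring.
    apply: (@cintbleMb _ _ _ _ _ _ ((2 / d + 1) ^+ n)) => //.
    + by apply: cmeas_real; exact: mpoisson2.
    + by move=> y; rewrite cmod_real ger0_norm ?poissonn_ge0// pb.
  - apply: cmeasM; first exact: (cmeas_comp measurable_fst).
    apply: cmeasM; first exact: (cmeas_comp measurable_snd).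
    exact: cmeas_real.
  set B := A * ((2 / d + 1) ^+ n * decN n p).
  have B0 : 0 <= B.
    by rewrite !mulr_ge0 ?powR_ge0// exprn_ge0// addr_ge0// divr_ge0// ltW.
  apply: (@le_lt_trans _ _ (\int[mu]_y ((cmod (k y))%:E * B%:E))%E).
    have mF1 : measurable_fun setT (fun w : Rn * Rn =>
        (cmod (k w.1 * (g w.2 * (poissonn d w.2 w.1)%:C%C)))%:E).
      apply/measurable_EFinP; apply: measurable_cmod; apply: cmeasM; first exact: (cmeas_comp measurable_fst).
      by apply: cmeasM; [exact: (cmeas_comp measurable_snd)|exact: cmeas_real].
    have F10 (w : Rn * Rn) : (0 <= (cmod (k w.1 * (g w.2 * (poissonn d w.2 w.1)%:C%C)))%:E)%E.
      by rewrite lee_fin cmod_ge0.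
    apply: ge0_le_integral => //.
    - by move=> y _; apply: integral_ge0 => x _; exact: (F10 (y, x)).
    - exact: (measurable_fun_fubini_tonelli_F (m2 := mu) _ mF1 F10).
    - by apply: emeasurable_funM => //; apply/measurable_EFinP; exact: measurable_cmod.
    move=> y _; under eq_integral do rewrite cmodM EFinM /=.
    rewrite ge0_integralZl_EFin ?cmod_ge0//; first last.
    - by apply/measurable_EFinP; apply: measurable_cmod; case: (cintble_pconv y d0).
    - by move=> x _; rewrite lee_fin cmod_ge0.
    rewrite lee_wpmul2l ?lee_fin ?cmod_ge0//.
    apply: (Lp_dec_le (y := y) p1 mg _ A0 _ gA).
    - by apply: cmeas_real; exact: mpoisson1.
    - by rewrite exprn_ge0// addr_ge0// divr_ge0// ltW.
    - by move=> x; rewrite cmod_real ger0_norm ?poissonn_ge0// poissonn_le_dec.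
  rewrite ge0_integralZr//.
  - by rewrite muleC; apply: lte_mul_pinfty => //; case: ik.
  - by apply/measurable_EFinP; exact: measurable_cmod.
  - by move=> y _; rewrite lee_fin cmod_ge0.
move=> x; have [It _] := tau_int x d0 mE.
have mpk : cmeas (fun y => (poissonn d x y)%:C%C * k y).
  by apply: cmeasM => //; apply: cmeas_real; exact: mpoisson2.
apply: cint_le => //.
rewrite EFinM -It -ge0_integralZl_EFin//; first last.
- by apply/measurable_EFinP; exact: measurable_tau_integrand2.
- by move=> y _; rewrite lee_fin tau_integrand_ge0.
apply: ge0_le_integral => //.
- by move=> y _; rewrite lee_fin cmod_ge0.
- by apply/measurable_EFinP; exact: measurable_cmod.
- by apply: emeasurable_funM => //; apply/measurable_EFinP; exact: measurable_tau_integrand2.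
move=> y _; rewrite -EFinM lee_fin cmodM cmod_real ger0_norm ?poissonn_ge0//.
by rewrite mulrA [leRHS]mulrC ler_wpM2l ?poissonn_ge0.
Qed.

Lemma Lp_pair_le (F : Rn -> R[i]) B : cmeas F -> 0 <= B ->
  bnd mu (1 - p^-1) (fun x => cmod (F x)) B -> cmod (cint mu (fun x => g x * F x)) <= A * B.
Proof.
move=> mF B0 FB.
have p0 : 0 < p by apply: lt_trans p1.
have ip : 0 <= p^-1 by rewrite invr_ge0 ltW.
have ip1 : 0 <= 1 - p^-1 by rewrite subr_ge0 invf_le1// ltW.
have := bndM ip ip1 A0 B0 (measurable_cmod mg) (measurable_cmod mF)
  (fun x => cmod_ge0 _) (fun x => cmod_ge0 _) gA FB.
rewrite addrC subrK bnd1; first last.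
- by rewrite mulr_ge0.
- by move=> x; rewrite mulr_ge0 ?cmod_ge0.
by move=> h; apply: cint_le; [exact: cmeasM|under eq_integral do rewrite cmodM].
Qed.

(** The defect of the approximate identity when tested against [k]; the factor [(2 pi)^n] is the
    mass of the unnormalised kernel. *)
Definition Phi d (k : Rn -> R[i]) : R[i] :=
  cint mu (fun y => k y * pconv d y) - ((2 * pi) ^+ n)%:C%C * cint mu (fun x => g x * k x).

Lemma bnd_dominated k c E v : 0 <= c -> measurable E -> mu E = v%:E -> 0 <= v ->
  dominated k c E -> bnd mu (1 - p^-1) (fun x => cmod (k x)) (c * v `^ (1 - p^-1)).
Proof.
move=> c0 mE Ev v0 [mk kc].
have t0 : 0 < 1 - p^-1 by rewrite subr_gt0 invf_lt1// (lt_trans ltr01).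
have mi : measurable_fun setT (\1_E : Rn -> R) by exact: measurable_indic.
have i0 x : 0 <= (\1_E x : R) by [].
have hE : bnd mu (1 - p^-1) (\1_E : Rn -> R) (v `^ (1 - p^-1)).
  rewrite bndP// -powRrM mulfV ?gt_eqF// powRr1// -Ev -integral_ind//.
  rewrite le_eqVlt; apply/orP; left; apply/eqP; apply: eq_integral => x _; congr EFin.
  by rewrite indicE; case: (x \in E); rewrite ?powR1 ?powR0// invr_neq0// gt_eqF.
have h := bndZ (ltW t0) c0 (powR_ge0 v (1 - p^-1)) mi i0 hE.
apply: (le_bnd (ltW t0) _ _ _ kc h).
- exact: measurable_cmod.
- exact: measurable_funM.
- by move=> x; exact: cmod_ge0.
Qed.

(** Uniform in [d], and small with the measure of [E] since [1 - 1/p > 0]. This continuity carries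
    the limit from boxes to measurable sets and from sets to functions. *)
Lemma Phi_bound k c E v d : 0 < d -> 0 <= c -> measurable E -> mu E = v%:E -> 0 <= v ->
  dominated k c E -> cmod (Phi d k) <= 2 * c * ((2 * pi) ^+ n * A) * v `^ (1 - p^-1).
Proof.
move=> d0 c0 mE Ev v0 dk; have [mk kc] := dk.
have t0 : 0 < 1 - p^-1 by rewrite subr_gt0 invf_lt1// (lt_trans ltr01).
have pn0 : 0 < (2 * pi : R) ^+ n by rewrite exprn_gt0// mulr_gt0// pi_gt0.
have [e1 e2] := pconv_swap d0 c0 mE Ev dk.
have w0 : 0 <= (2 * pi) ^+ n * v `^ (1 - p^-1).
  by apply: mulr_ge0; [exact: ltW|exact: powR_ge0].
have mi : measurable_fun setT (\1_E : Rn -> R) by exact: measurable_indic.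
have b1 : cmod (cint mu (fun y => k y * pconv d y)) <= A * (c * ((2 * pi) ^+ n * v `^ (1 - p^-1))).
  pose F x := cint mu (fun y => (poissonn d x y)%:C%C * k y).
  have mF : cmeas F.
    apply: (@cmeas_cint2 _ _ _ _ R mu (fun z : Rn * Rn => (poissonn d z.1 z.2)%:C%C * k z.2)).
    by apply: cmeasM; [exact: cmeas_real|exact: (cmeas_comp measurable_snd)].
  have {e1} -> : cint mu (fun y => k y * pconv d y) = cint mu (fun x => g x * F x) by exact: e1.
  have {}e2 x : cmod (F x) <= c * tau d E x by exact: e2.
  clearbody F.
  apply: Lp_pair_le; [exact: mF|exact: mulr_ge0|].
  have tg0 x : 0 <= tau d E x by have [_ /andP[]] := tau_int x d0 mE.
  have h := bndZ (ltW t0) c0 w0 (measurable_tau d mE) tg0 (bnd_tau d0 mE Ev v0).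
  apply: (le_bnd (ltW t0) _ _ _ e2 h).
  - exact: measurable_cmod.
  - by apply: measurable_funM => //; exact: measurable_tau.
  - by move=> x; exact: cmod_ge0.
have b2 : cmod (cint mu (fun x => g x * k x)) <= A * (c * v `^ (1 - p^-1)).
  apply: Lp_pair_le; [exact: mk|by rewrite mulr_ge0 ?powR_ge0|].
  exact: (bnd_dominated c0 mE Ev v0 dk).
rewrite /Phi; apply: le_trans (ler_cmodD _ _) _.
rewrite cmodN cmodM cmod_real (ger0_norm (ltW pn0)).
have b3 := ler_wpM2l (ltW pn0) b2.
apply: le_trans (lerD b1 b3) _.
by rewrite le_eqVlt; apply/orP; left; apply/eqP; ring.
Qed.

Lemma Phi_linear (a : R[i]) k1 k2 c1 c2 E v d : 0 < d -> 0 <= c1 -> 0 <= c2 ->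
  measurable E -> mu E = v%:E -> dominated k1 c1 E -> dominated k2 c2 E ->
  Phi d (fun x => a * k1 x + k2 x) = a * Phi d k1 + Phi d k2.
Proof.
move=> d0 c10 c20 mE Ev dk1 dk2.
have B y : cmod (pconv d y) <= A * ((2 / d + 1) ^+ n * decN n p).
  apply: cint_le; first by case: (cintble_pconv y d0).
  apply: (Lp_dec_le (y := y) p1 mg _ A0 _ gA).
  - by apply: cmeas_real; exact: mpoisson1.
  - by rewrite exprn_ge0// addr_ge0// divr_ge0// ltW.
  - by move=> x; rewrite cmod_real ger0_norm ?poissonn_ge0// poissonn_le_dec.
have i1 k c : 0 <= c -> dominated k c E -> cintble mu (fun y => k y * pconv d y).
  move=> c0 dk; rewrite (_ : (fun y => _) = fun y => pconv d y * k y); last first.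
    by apply/funext => y; rewrite mulrC.
  by apply: (cintbleMb (cmeas_pconv d) B); exact: (dominated_cintble c0 mE Ev).
have i2 k c : 0 <= c -> dominated k c E -> cintble mu (fun x => g x * k x).
  move=> c0 [mk kc]; split; first exact: cmeasM.
  have p0 : 0 < p by apply: lt_trans p1.
  have ip : 0 <= p^-1 by rewrite invr_ge0 ltW.
  have ip1 : 0 < 1 - p^-1 by rewrite subr_gt0 invf_lt1.
  have v0 : 0 <= v by rewrite -lee_fin -Ev.
  have hE := bnd_dominated c0 mE Ev v0 (conj mk kc).
  have B0 : 0 <= c * v `^ (1 - p^-1) by rewrite mulr_ge0 ?powR_ge0.
  have := bndM ip (ltW ip1) A0 B0 (measurable_cmod mg) (measurable_cmod mk)
    (fun x => cmod_ge0 _) (fun x => cmod_ge0 _) gA hE.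
  rewrite addrC subrK bnd1; first last.
  - by rewrite mulr_ge0.
  - by move=> x; rewrite mulr_ge0 ?cmod_ge0.
  by under [X in _ -> (X < _)%E]eq_integral do rewrite cmodM; move=> h; apply: le_lt_trans h _; rewrite ltry.
rewrite /Phi.
have -> : cint mu (fun y => (a * k1 y + k2 y) * pconv d y) =
    a * cint mu (fun y => k1 y * pconv d y) + cint mu (fun y => k2 y * pconv d y).
  rewrite -cintZ; last exact: i1 dk1.
  rewrite -cintD; [|by apply: cintbleZ; exact: i1 dk1|exact: i1 dk2].
  by apply: eq_cint => y; ring.
have -> : cint mu (fun x => g x * (a * k1 x + k2 x)) =
    a * cint mu (fun x => g x * k1 x) + cint mu (fun x => g x * k2 x).
  rewrite -cintZ; last exact: i2 dk1.
  rewrite -cintD; [|by apply: cintbleZ; exact: i2 dk1|exact: i2 dk2].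
  by apply: eq_cint => y; ring.
ring.
Qed.

End PoissonLimit.

(** * Weak convergence to the identity, from boxes to bounded functions *)

Section PoissonWeakLimit.
Variables (R : realType) (n : nat).
Local Notation leb1 := (@lebesgue_measure R).
Local Notation Rn := (n.-tuple R).
Local Notation mu := (@lebm R n).
Variables (p : R) (g : Rn -> R[i]) (A : R).
Hypotheses (p1 : 1 < p) (mg : cmeas g) (A0 : 0 <= A).
Hypothesis gA : bnd mu p^-1 (fun x => cmod (g x)) A.
Variable N : nat.
Local Notation H := (@hcube R n N).

Lemma ae_coord_neq (i : 'I_n) (c : R) : {ae mu, forall x, tnth x i != c}.
Proof.
exists [set x : Rn | forall j, (if j == i then [set c] else setT) (tnth x j)]; split.
- by apply: (@measurable_box R n (fun j => if j == i then [set c] else setT)) => j; case: eqP.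
- rewrite [LHS](@leb_box R n (fun j => if j == i then [set c] else setT)); last first.
    by move=> j; case: eqP.
  by rewrite (bigD1 i)//= eqxx lebesgue_measure_set1 mul0e.
- move=> x /= /negP; rewrite negbK => /eqP xc j.
  by case: eqP => [->|].
Qed.

Definition vanish (k : Rn -> R[i]) : Prop := forall a : R, 0 < a ->
  \forall j \near \oo, cmod (Phi g j.+1%:R^-1 k) <= a.

Lemma dominated_ind (E : set Rn) : measurable E -> dominated (fun x => (\1_E x)%:C%C) 1 E.
Proof.
move=> mE; split; first by apply: cmeas_real; exact: measurable_indic.
by move=> x; rewrite mul1r cmod_real ger0_norm.
Qed.

(** For a box the Poisson integral is a product of one-dimensional ones, which converge off the
    faces and are dominated by a multiple of [dec], a function in the dual of [L_p]. *)
Lemma vanish_hbox (a : 'I_n -> R) : (forall i, - N%:R <= a i <= N%:R) ->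
  vanish (fun x => (\1_(hbox a (fun=> N%:R)) x)%:C%C).
Proof.
move=> aN e e0; set E := hbox a _.
have mE : measurable E by exact: measurable_hbox.
have EH : E = E `&` H.
  apply/seteqP; split => x; last by case.
  move=> Ex; split=> // i; have := Ex i; rewrite /= !in_itv /= => /andP[h ->].
  by case/andP: (aN i) => h1 _; rewrite (le_lt_trans h1 h).
have Efin : mu E \is a fin_num.
  by rewrite ge0_fin_numE// EH; exact: lebm_hcube_fin.
set v := fine (mu E); have Ev : mu E = v%:E by rewrite fineK.
have v0 : 0 <= v by exact: fine_ge0.
have dE := dominated_ind mE.
pose T (d : R) (x : Rn) := \prod_(i < n) pconv1 d (a i) N%:R (tnth x i).
have indE (x : Rn) : (\1_E x : R) = \prod_(i < n) \1_(`]a i, N%:R]%classic) (tnth x i).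
  rewrite indicE; case: (boolP (x \in E)) => [/set_mem Ex|/negP xE].
    by rewrite big1// => i _; rewrite indicE mem_set//; exact: Ex.
  have [i xi] : exists i, ~ `]a i, N%:R]%classic (tnth x i).
    by apply/existsNP => h; apply: xE; rewrite inE; exact: h.
  by rewrite (bigD1 i)//= indicE memNset// mul0r.
have TE d x : 0 < d -> cint mu (fun y => (poissonn d x y)%:C%C * (\1_E y)%:C%C) = (T d x)%:C%C.
  move=> d0.
  pose h i t : R[i] := (\1_(`]a i, N%:R]%classic) t * poisson d (tnth x i - t))%:C%C.
  have ih i : cintble leb1 (h i).
    split.
      apply: cmeas_real; apply: measurable_funM; first exact: measurable_indic.
      by apply: (measurableT_comp (measurable_poisson d)); exact: measurable_funB.
    apply: (@le_lt_trans _ _ (pconv1 d (a i) N%:R (tnth x i))%:E); last by rewrite ltry.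
    rewrite -pconv1_int// le_eqVlt; apply/orP; left; apply/eqP; apply: eq_integral => t _.
    by rewrite /h cmod_real ger0_norm// integrand_ge0.
  rewrite /T real_prod.
  transitivity (\prod_(i < n) cint leb1 (h i)); last first.
    by apply: eq_bigr => i _; rewrite /h cint_real.
  rewrite -(cint_prod ih); apply: eq_cint => y; rewrite indE -rmorphM -real_prod; congr (_%:C%C).
  by rewrite mulrC -big_split.
pose good : set Rn := [set x | forall i, (tnth x i != a i) && (tnth x i != N%:R)].
have mgood : measurable good.
  apply: (@measurable_box R n (fun i => [set t | (t != a i) && (t != N%:R)])) => i.
  have -> : [set t | (t != a i) && (t != N%:R)] = ~` [set a i] `&` ~` [set N%:R].
    by apply/seteqP; split => t /= => [/andP[/eqP ? /eqP ?]|[/eqP -> /eqP ->]].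
  by apply: measurableI; apply: measurableC; exact: measurable_set1.
have aegood : {ae mu, forall x, good x}.
  apply: filter_forall => i; apply: filterS2 (ae_coord_neq i (a i)) (ae_coord_neq i N%:R).
  by move=> x -> ->.
(* Dominated convergence is stated with convergence at every point; cutting [g] off on the null set
   of hyperplanes that carry the faces achieves this without changing the integrals. *)
pose g' x := g x * (\1_good x)%:C%C.
have mg' : cmeas g'.
  by apply: cmeasM => //; apply: cmeas_real; exact: measurable_indic.
have aeg F : cmeas F -> cint mu (fun x => g x * F x) = cint mu (fun x => g' x * F x).
  move=> mF; apply: ae_eq_cint; [exact: cmeasM|exact: cmeasM|].
  by apply: filterS aegood => x gx; rewrite /g' indicE mem_set// mulr1.
have mcv d i : 0 < d -> measurable_fun [set: R] (fun t => pconv1 d (a i) N%:R t).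
  move=> d0; apply: (@measurable_Rintegral2 _ _ (measurableTypeR R) (measurableTypeR R) R leb1
    (fun z => \1_(`]a i, N%:R]%classic) z.2 * poisson d (z.1 - z.2))).
  apply: measurable_funM.
    have mi : measurable_fun [set: R] (\1_(`]a i, N%:R]%classic) : R -> R) by exact: measurable_indic.
    exact: (measurableT_comp mi measurable_snd).
  by apply: (measurableT_comp (measurable_poisson d)); apply: measurable_funB.
have mT d : 0 < d -> measurable_fun setT (T d).
  by move=> d0; apply: (@measurable_prod_tnth R n (fun i t => pconv1 d (a i) N%:R t)) => i; exact: mcv.
(* [N + 1] instead of [N], because the one-dimensional majorant asks for [M >= 1] and [N] may be
   [0]. *)
pose M : R := N.+1%:R; pose C := 2 * pi * (1 + 2 * M) + 16.
have M1 : 1 <= M by rewrite ler1n.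
have C0 : 0 <= C.
  by rewrite addr_ge0// !mulr_ge0 ?pi_ge0// addr_ge0// mulr_ge0// (le_trans ler01).
pose z0 : Rn := [tuple 0 | i < n].
have Tle j x : 0 <= T j.+1%:R^-1 x <= C ^+ n * dec x z0.
  have -> : C ^+ n = \prod_(i < n) C by rewrite prodr_const card_ord.
  rewrite /T /dec -big_split /=; apply/andP; split.
    by apply: prodr_ge0 => i _; exact: pconv1_ge0.
  apply: ler_prod => i _; rewrite pconv1_ge0//= tnth_mktuple subr0.
  have /andP[h1 h2] := aN i.
  apply: (@pconv1_le_dec _ _ _ _ M) => //.
  - by rewrite invr_gt0 ltr0n invf_le1// ler1n.
  - by apply: le_trans h1; rewrite lerN2 ler_nat.
  - by rewrite ler_nat.
have pn0 : 0 <= (2 * pi : R) ^+ n by rewrite exprn_ge0// mulr_ge0// pi_ge0.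
have Tc x : good x -> (fun j => T j.+1%:R^-1 x) @ \oo --> (2 * pi) ^+ n * \1_E x.
  move=> gx; have -> : (2 * pi : R) ^+ n * \1_E x =
      \prod_(i < n) (2 * pi * \1_(`]a i, N%:R]%classic) (tnth x i)).
    by rewrite big_split /= prodr_const card_ord indE.
  apply: cvg_big => [|i _]; first exact: mul_continuous.
  by have /andP[h1 h2] := gx i; exact: cvg_pconv1.
have EleT x : good x -> (2 * pi : R) ^+ n * \1_E x <= C ^+ n * dec x z0.
  move=> gx; rewrite -(cvg_lim _ (Tc x gx))//; apply: limr_le.
    by apply/cvg_ex; eexists; exact: (Tc x gx).
  by apply: nearW => j; have /andP[] := Tle j x.
pose gd x := cmod (g x) * (C ^+ n * dec x z0).
have mdec : measurable_fun setT (fun x : Rn => C ^+ n * dec x z0).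
  by apply: measurable_funM => //; exact: measurable_dec1l.
have dec0 x : 0 <= C ^+ n * dec x z0 by rewrite mulr_ge0 ?exprn_ge0// ltW// dec_gt0.
have igd : (\int[mu]_x (gd x)%:E < +oo)%E.
  have mF : cmeas (fun x => (C ^+ n * dec x z0)%:C%C : R[i]) by exact: cmeas_real.
  have Fle x : cmod ((C ^+ n * dec x z0)%:C%C) <= C ^+ n * dec x z0.
    by rewrite cmod_real ger0_norm.
  have := Lp_dec_le p1 mg mF A0 (exprn_ge0 n C0) gA Fle.
  under eq_integral do rewrite cmodM cmod_real ger0_norm//.
  by move=> h; apply: le_lt_trans h _; rewrite ltry.
have g'le x : cmod (g' x) <= cmod (g x).
  rewrite /g' cmodM cmod_real ger0_norm// indicE ler_piMr ?cmod_ge0//.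
  by rewrite lern1 leq_b1.
have g'0 x : ~ good x -> g' x = 0.
  by move=> gx; rewrite /g' indicE memNset// rmorph0 mulr0.
have dj j : 0 < (j.+1%:R : R)^-1 by rewrite invr_gt0.
have mE1 : cmeas (fun x : Rn => ((2 * pi : R) ^+ n * \1_E x)%:C%C : R[i]).
  by apply: cmeas_real; apply: measurable_funM => //; exact: measurable_indic.
have mTj j : cmeas (fun x => (T j.+1%:R^-1 x)%:C%C) by apply: cmeas_real; exact: mT.
have [|||||||M2 _ hM] := @cint_dct _ _ R mu (fun j x => g' x * (T j.+1%:R^-1 x)%:C%C)
  (fun x => g' x * ((2 * pi) ^+ n * \1_E x)%:C%C) gd _ _ _ _ _ _ _ e e0.
- by move=> j; exact: cmeasM.
- exact: cmeasM.
- by apply: measurable_funM => //; exact: measurable_cmod.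
- move=> j x; have /andP[h1 h2] := Tle j x.
  rewrite cmodM cmod_real ger0_norm//.
  by apply: ler_pM; [exact: cmod_ge0|exact: h1|exact: g'le|exact: h2].
- move=> x; have [gx|gx] := pselect (good x); last first.
    by rewrite g'0// mul0r cmod0 mulr_ge0 ?cmod_ge0.
  rewrite cmodM cmod_real ger0_norm; last by rewrite mulr_ge0.
  apply: ler_pM; [exact: cmod_ge0| |exact: g'le|exact: EleT].
  by rewrite mulr_ge0.
- exact: igd.
- move=> x; have [gx|gx] := pselect (good x); last first.
    by under eq_fun do rewrite g'0// !mul0r subrr cmod0; exact: cvg_cst.
  have h := Tc x gx.
  apply: (@cvg0_le _ _ (fun j => cmod (g' x) * `|T j.+1%:R^-1 x - (2 * pi) ^+ n * \1_E x|)).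
    by move=> j; rewrite ger0_norm ?cmod_ge0// -mulrBr -rmorphB cmodM cmod_real.
  rewrite -[X in _ --> X](mulr0 (cmod (g' x))); apply: cvgMr.
  rewrite -[X in _ --> X](normr0 R); apply: cvg_norm.
  by rewrite -[X in _ --> X](subrr ((2 * pi) ^+ n * \1_E x)); apply: cvgB => //; exact: cvg_cst.
exists M2 => // j Mj.
have : cmod (cint mu (fun x => g' x * (T j.+1%:R^-1 x)%:C%C)
   - cint mu (fun x => g' x * ((2 * pi) ^+ n * \1_E x)%:C%C)) <= e by exact: hM.
congr (cmod (_ - _) <= _).
  rewrite -aeg//.
  have [-> _] := pconv_swap p1 mg A0 gA (dj j) (ler01 : 0 <= 1 :> R) mE Ev dE.
  by apply: eq_cint => x; rewrite TE.
rewrite -aeg// -cintZ; last first.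
  have ip : 0 <= 1 * v `^ (1 - p^-1) by rewrite mul1r powR_ge0.
  have := bnd_dominated p1 ler01 mE Ev v0 dE => h.
  have p0 : 0 < p by apply: lt_trans p1.
  have ip0 : 0 <= p^-1 by rewrite invr_ge0 ltW.
  have ip1 : 0 <= 1 - p^-1 by rewrite subr_ge0 invf_le1// ltW.
  have mi : cmeas (fun x => (\1_E x)%:C%C : R[i]) by case: dE.
  have := bndM ip0 ip1 A0 ip (measurable_cmod mg) (measurable_cmod mi)
    (fun x => cmod_ge0 _) (fun x => cmod_ge0 _) gA h.
  rewrite addrC subrK bnd1; first last.
  + by rewrite mulr_ge0.
  + by move=> x; rewrite mulr_ge0 ?cmod_ge0.
  move=> hi; split; first exact: cmeasM.
  by under eq_integral do rewrite cmodM; apply: le_lt_trans hi _; rewrite ltry.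
by apply: eq_cint => x; rewrite rmorphM /= mulrCA.
Qed.

Lemma dominated_sub k c c' (E F : set Rn) : c <= c' -> 0 <= c' -> E `<=` F ->
  dominated k c E -> dominated k c' F.
Proof.
move=> cc' c'0 EF [mk kc]; split=> // x; apply: le_trans (kc x) _.
rewrite !indicE; case: (boolP (x \in E)) => [xE|_]; last by rewrite mulr0 mulr_ge0.
by rewrite mem_set ?mulr1//; apply: EF; exact: set_mem.
Qed.

Let mH : measurable H. Proof. exact: measurable_hbox. Qed.
Let vH := fine (mu H).
Let HE : mu H = vH%:E.
Proof.
rewrite /vH fineK// ge0_fin_numE// -[H]setTI; apply: lebm_hcube_fin.
exact: measurableT.
Qed.
Let vH0 : 0 <= vH. Proof. exact: fine_ge0. Qed.
Let dj j : 0 < (j.+1%:R : R)^-1. Proof. by rewrite invr_gt0. Qed.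

Lemma vanish_lin (a : R[i]) k1 k2 c1 c2 : 0 <= c1 -> 0 <= c2 ->
  dominated k1 c1 H -> dominated k2 c2 H -> vanish k1 -> vanish k2 ->
  vanish (fun x => a * k1 x + k2 x).
Proof.
move=> c10 c20 d1 d2 v1 v2 e e0.
have a1 : 0 < 2 * (cmod a + 1) by rewrite mulr_gt0// ltr_wpDl// cmod_ge0.
have e2 : 0 < e / 2 by rewrite divr_gt0.
apply: filterS2 (v1 _ (divr_gt0 e0 a1)) (v2 _ e2) => j h1 h2.
rewrite (Phi_linear p1 mg A0 gA _ (dj j) c10 c20 mH HE d1 d2).
apply: le_trans (ler_cmodD _ _) _; rewrite cmodM.
have h3 : cmod a * cmod (Phi g j.+1%:R^-1 k1) <= e / 2.
  apply: le_trans (_ : (cmod a + 1) * (e / (2 * (cmod a + 1))) <= _).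
    by apply: ler_pM => //; rewrite ?cmod_ge0// lerDl.
  have a2 : cmod a + 1 != 0 by rewrite gt_eqF// ltr_wpDl// cmod_ge0.
  rewrite le_eqVlt; apply/orP; left; apply/eqP; field.
  exact: a2.
by rewrite [leRHS]splitr lerD.
Qed.

Lemma dominated_indI (E : set Rn) : measurable E -> dominated (fun x => (\1_(E `&` H) x)%:C%C) 1 H.
Proof.
move=> mE; apply: dominated_sub (@subIsetr _ E H) (dominated_ind (measurableI _ _ mE mH)) => //.
Qed.

(** Dynkin's theorem, starting from orthants cut by the cube. Complements use linearity. For a
    countable disjoint union the finite part is handled by linearity, and the tail by the bound on
    [Phi], which is uniform in [d]. *)
Lemma vanish_ind (E : set Rn) : measurable E -> vanish (fun x => (\1_(E `&` H) x)%:C%C).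
Proof.
move=> mE.
pose P (E : set Rn) := vanish (fun x => (\1_(E `&` H) x)%:C%C).
apply: (@dynkin_induction _ Rn (@orthants R n) P (@measurable_orthants R n) (@orthants_setI R n)).
- rewrite /P setTI; apply: vanish_hbox => i.
  by rewrite lexx /= lerNl (le_trans (y := 0))// oppr_le0.
- by move=> _ [s _ <-]; have [a [E1 E2]] := orthant_hcube N s; rewrite /P E1; exact: vanish_hbox.
- move=> S mS PS; rewrite /P.
  have -> : (fun x => (\1_(~` S `&` H) x)%:C%C) =
      (fun x => -1 * (\1_(S `&` H) x)%:C%C + (\1_(setT `&` H) x)%:C%C : R[i]).
    apply/funext => x; rewrite mulN1r -rmorphN -rmorphD; congr (_%:C%C).
    rewrite setTI !indicE !in_setI in_setC.
    by case: (x \in S); case: (x \in H); rewrite ?addr0 ?oppr0 ?add0r ?addNr.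
  apply: vanish_lin (dominated_indI mS) (dominated_indI measurableT) PS _ => //.
  rewrite setTI; apply: vanish_hbox => i.
  by rewrite lexx /= lerNl (le_trans (y := 0))// oppr_le0.
- move=> F mF tF PF; rewrite /P.
  pose U m := \bigcup_(k < m) F k.
  have mU m : measurable (U m) by apply: bigcup_measurable.
  have PU m : P (U m).
    elim: m => [|m IH].
      move=> e e0; apply: nearW => j.
      have E0 : (fun x => (\1_(U 0%N `&` H) x)%:C%C : R[i]) = fun=> 0.
        by apply/funext => x; rewrite indicE in_setI /U bigcup_mkord big_ord0 in_set0.
      rewrite E0 /Phi; under eq_cint do rewrite mul0r.
      by under [X in _ * X]eq_cint do rewrite mulr0; rewrite cint0 mulr0 subrr cmod0 ltW.
    rewrite /P (_ : (fun x => (\1_(U m.+1 `&` H) x)%:C%C) =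
       (fun x => 1 * (\1_(F m `&` H) x)%:C%C + (\1_(U m `&` H) x)%:C%C : R[i])).
      exact: vanish_lin (dominated_indI (mF m)) (dominated_indI (mU m)) (PF m) IH.
    apply/funext => x; rewrite mul1r -rmorphD; congr (_%:C%C).
    have UE : U m.+1 = F m `|` U m by rewrite /U !bigcup_mkord big_ord_recr setUC.
    rewrite UE !indicE !in_setI in_setU.
    have [xF|xF] := boolP (x \in F m); last by rewrite add0r.
    have -> : (x \in U m) = false.
      apply/negP => /set_mem[k /= km xk].
      have := tF k m I I (ex_intro _ x (conj xk (set_mem xF))) => km'.
      by move: km; rewrite km' ltnn.
    by case: (x \in H); rewrite /= addr0.
  (* The tails decrease to the empty set; the intersection with the cube keeps their measure finite,
     as continuity from above requires. *)
  pose W m := (\bigcup_k F k `\` U m) `&` H.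
  have mBU : measurable (\bigcup_k F k) by exact: bigcup_measurable.
  have mW m : measurable (W m) by apply: measurableI => //; exact: measurableD.
  have W0 : (mu \o W) @ \oo --> 0%E.
    rewrite -[X in _ --> X](measure0 mu).
    have -> : set0 = \bigcap_m W m.
      apply/esym/seteqP; split => x //= h.
      have [[[k _ xk] _] _] := h 0%N I.
      have [[_ nU] _] := h k.+1 I.
      by apply: nU; exists k => //=.
    apply: nonincreasing_cvg_mu => //.
    - apply: (le_lt_trans (y := mu H)); last by rewrite HE ltry.
      by apply: le_measure; rewrite ?inE//; move=> x [].
    - exact: bigcap_measurable.
    - move=> a b ab; apply/subsetPset => x [[xF nU] xH]; split => //; split => //.
      by apply: contra_not nU => -[k /= ka xk]; exists k => //=; exact: leq_trans ka ab.
  move=> e e0.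
  have t0 : 0 < 1 - p^-1 by rewrite subr_gt0 invf_lt1// (lt_trans ltr01).
  have pn0 : 0 <= (2 * pi : R) ^+ n by rewrite exprn_ge0// mulr_ge0// pi_ge0.
  set B := 2 * 1 * ((2 * pi) ^+ n * A).
  have B0 : 0 <= B by rewrite mulr_ge0// mulr_ge0.
  have B1 : 0 < B + 1 by rewrite ltr_wpDl.
  (* Chosen so that [eta^(1 - 1/p) = e / (2 (B + 1))]; the bound [B v^(1 - 1/p)] on the tail is then
     at most [e/2]. *)
  pose eta := (e / 2 / (B + 1)) `^ (1 - p^-1)^-1.
  have eta0 : 0 < eta by rewrite powR_gt0// !divr_gt0.
  have [[N1 _ hfin] hc] := (fine_cvgP _ _).1 W0.
  move: hc => /cvgrPdist_le /(_ eta eta0) [N2 _ hN2].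
  set m := maxn N1 N2.
  have Wfin : mu (W m) \is a fin_num by apply: hfin; rewrite /= leq_maxl.
  set v := fine (mu (W m)).
  have Wv : mu (W m) = v%:E by rewrite fineK.
  have v0 : 0 <= v by exact: fine_ge0.
  have vle : v <= eta.
    have := hN2 m; rewrite /= leq_maxr sub0r normrN => /(_ isT).
    by apply: le_trans; exact: ler_norm.
  have dW := dominated_ind (mW m).
  have WH : W m `<=` H by move=> x [].
  have e2 : 0 < e / 2 by rewrite divr_gt0.
  apply: filterS (PU m _ e2) => j h.
  rewrite (_ : (fun x => (\1_(\bigcup_k F k `&` H) x)%:C%C) =
       (fun x => 1 * (\1_(W m) x)%:C%C + (\1_(U m `&` H) x)%:C%C : R[i])); last first.
    apply/funext => x; rewrite mul1r -rmorphD; congr (_%:C%C).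
    rewrite /W setDE !indicE !in_setI in_setC.
    have [xU|xU] := boolP (x \in U m).
      rewrite andbF add0r; congr (nat_of_bool _)%:R.
      by rewrite mem_set//; move: xU => /set_mem[k _ xk]; exists k.
    by rewrite andbT addr0.
  rewrite (Phi_linear p1 mg A0 gA _ (dj j) ler01 ler01 mH HE (dominated_sub (lexx 1) ler01 WH dW) (dominated_indI (mU m))).
  rewrite mul1r; apply: le_trans (ler_cmodD _ _) _.
  rewrite [leRHS]splitr lerD//.
  apply: le_trans (Phi_bound p1 mg A0 gA (dj j) ler01 (mW m) Wv v0 dW) _.
  rewrite -/B; apply: le_trans (_ : B * (e / 2 / (B + 1)) <= _).
    rewrite ler_wpM2l//.
    have -> : e / 2 / (B + 1) = eta `^ (1 - p^-1).
      by rewrite /eta -powRrM mulVf ?gt_eqF// powRr1// !divr_ge0// ltW.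
    by rewrite ge0_ler_powR// ?nnegrE ltW.
  rewrite mulrA ler_pdivrMr// mulrC ler_wpM2l ?(ltW e2)//.
  by rewrite lerDl.
- by rewrite -measurable_orthants.
Qed.

(** Binary expansion of [k]: splitting off the first digit leaves half of a function of the same
    kind, so each step halves the trivial bound and adds only an indicator, for which the limit is
    known. *)
Lemma vanish_unit_approx (m : nat) (k : Rn -> R) : measurable_fun setT k ->
  (forall x, 0 <= k x) -> (forall x, k x <= \1_H x) -> forall a : R, 0 < a ->
  \forall j \near \oo, cmod (Phi g j.+1%:R^-1 (fun x => (k x)%:C%C))
    <= 2^-1 ^+ m * (2 * 1 * ((2 * pi) ^+ n * A) * vH `^ (1 - p^-1)) + a.
Proof.
elim: m k => [|m IH] k mk k0 kH a a0.
  apply: nearW => j; rewrite expr0 mul1r.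
  have dk : dominated (fun x => (k x)%:C%C) 1 H.
    split; first exact: cmeas_real.
    by move=> x; rewrite cmod_real ger0_norm// mul1r.
  apply: le_trans (Phi_bound p1 mg A0 gA (dj j) ler01 mH HE vH0 dk) _.
  by rewrite lerDl ltW.
pose E := k @^-1` `[2^-1, +oo[.
have mE : measurable E by rewrite -[E]setTI; exact: mk.
have inE' x : (x \in E) = (2^-1 <= k x).
  by apply/idP/idP; rewrite inE /E /= in_itv /= andbT.
(* The remainder after the first binary digit: [E] is the set where [k >= 1/2], and
   [k = (1_E + k') / 2] with [k'] again between [0] and the indicator of the cube. *)
pose k' x := 2 * k x - \1_(E `&` H) x.
have mk' : measurable_fun setT k'.
  apply: measurable_funB; first exact: measurable_funM.
  by apply: measurable_indic; exact: measurableI.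
have kH0 x : x \notin H -> k x = 0.
  by move=> xH; apply/eqP; rewrite eq_le k0 andbT; apply: le_trans (kH x) _; rewrite indicE (negbTE xH).
have k'0 x : 0 <= k' x.
  rewrite /k' indicE in_setI inE'; have [h|h] /= := lerP 2^-1 (k x).
    by have := leq_b1 (x \in H); rewrite -(ler_nat R); lra.
  by have := k0 x; lra.
have k'H x : k' x <= \1_H x.
  rewrite /k' !indicE in_setI inE'; have [xH|xH] /= := boolP (x \in H); last first.
    by rewrite kH0// andbF mulr0 subrr.
  have := kH x; rewrite indicE xH /= andbT.
  by have [h|h] /= := lerP 2^-1 (k x); lra.
have a2 : 0 < a / 2 by rewrite divr_gt0.
apply: filterS2 (IH k' mk' k'0 k'H a a0) (vanish_ind mE a0) => j h1 h2.
have dk' : dominated (fun x => (k' x)%:C%C) 1 H.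
  split; first exact: cmeas_real.
  by move=> x; rewrite cmod_real ger0_norm// mul1r.
have dE := dominated_indI mE.
have h12 : 0 <= (2^-1 : R) by [].
have dk2 : dominated (fun x => 2^-1%:C%C * (k' x)%:C%C) 2^-1 H.
  split; first by apply: cmeasM; [exact: cmeas_cst|case: dk'].
  by move=> x; rewrite cmodM !cmod_real !ger0_norm// ler_wpM2l.
rewrite (_ : (fun x => (k x)%:C%C) = (fun x => 2^-1%:C%C * (\1_(E `&` H) x)%:C%C + 2^-1%:C%C * (k' x)%:C%C)); last first.
  by apply/funext => x; rewrite -!rmorphM -rmorphD /k'; congr (_%:C%C); field.
rewrite (Phi_linear p1 mg A0 gA _ (dj j) ler01 h12 mH HE dE dk2).
have -> : Phi g j.+1%:R^-1 (fun x => 2^-1%:C%C * (k' x)%:C%C) = 2^-1%:C%C * Phi g j.+1%:R^-1 (fun x => (k' x)%:C%C).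
  have d0 : dominated (fun=> 0) 0 H.
    by split; [exact: cmeas_cst|move=> x; rewrite cmod0 mul0r].
  have := Phi_linear p1 mg A0 gA 2^-1%:C%C (dj j) ler01 (lexx 0) mH HE dk' d0.
  have -> : Phi g j.+1%:R^-1 (fun=> 0) = 0.
    rewrite /Phi; under eq_cint do rewrite mul0r.
    by under [X in _ * X]eq_cint do rewrite mulr0; rewrite cint0 mulr0 subrr.
  by rewrite addr0; under [X in Phi _ _ X]eq_fun do rewrite addr0.
rewrite -mulrDr cmodM cmod_real ger0_norm//.
apply: le_trans (ler_wpM2l h12 (ler_cmodD _ _)) _.
apply: le_trans (ler_wpM2l h12 (lerD h2 h1)) _.
by rewrite exprS; lra.
Qed.

Lemma vanish_unit (k : Rn -> R) : measurable_fun setT k ->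
  (forall x, 0 <= k x) -> (forall x, k x <= \1_H x) -> vanish (fun x => (k x)%:C%C).
Proof.
move=> mk k0 kH a a0; set B := 2 * 1 * ((2 * pi) ^+ n * A) * vH `^ (1 - p^-1).
have B0 : 0 <= B.
  by rewrite !mulr_ge0 ?powR_ge0// exprn_ge0// mulr_ge0// pi_ge0.
have a2 : 0 < a / 2 by rewrite divr_gt0.
have B1 : 0 < B + 1 by rewrite ltr_wpDl.
have [m hm] : exists m, 2^-1 ^+ m * B <= a / 2.
  have c : (fun m : nat => 2^-1 ^+ m : R) @ \oo --> (0 : R).
    by apply: cvg_expr; rewrite ger0_norm// invf_lt1// ltr1n.
  move: c => /cvgrPdist_le /(_ _ (divr_gt0 a2 B1)) [m _ /(_ m (leqnn m))].
  rewrite sub0r normrN ger0_norm ?exprn_ge0// => h; exists m.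
  apply: le_trans (_ : a / 2 / (B + 1) * B <= _); first by rewrite ler_wpM2r.
  by rewrite mulrAC ler_pdivrMr// ler_wpM2l ?(ltW a2)// lerDl.
apply: filterS (vanish_unit_approx m mk k0 kH a2) => j h.
by apply: le_trans h _; rewrite -/B [leRHS]splitr lerD2r.
Qed.

Lemma vanish_dominated k c : 0 <= c -> dominated k c H -> vanish k.
Proof.
move=> c0 [mk kc].
pose D := c + 1; have D0 : 0 < D by rewrite ltr_wpDl.
have mi : measurable_fun setT (\1_H : Rn -> R) by exact: measurable_indic.
have vH1 : vanish (fun x => (\1_H x)%:C%C).
  by have := vanish_ind (@measurableT _ Rn); rewrite setTI.
have dH := dominated_ind mH.
have part (u : Rn -> R) : measurable_fun setT u -> (forall x, `|u x| <= c * \1_H x) ->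
    vanish (fun x => (u x)%:C%C) /\ dominated (fun x => (u x)%:C%C) c H.
  move=> mu' uc; split; last by split; [exact: cmeas_real|move=> x; rewrite cmod_real].
  (* An affine change brings a real function bounded by [c] into the range [[0, 1]] on the cube;
     [D = c + 1] is positive even if [c = 0]. *)
  pose w x := (u x / D + \1_H x) / 2.
  have uD x : `|u x / D| <= \1_H x.
    rewrite normrM normfV (gtr0_norm D0) ler_pdivrMr// mulrC.
    by apply: le_trans (uc x) _; rewrite ler_wpM2r// lerDl.
  have mw : measurable_fun setT w.
    apply: measurable_funM => //; apply: measurable_funD => //; exact: measurable_funM.
  have w0 x : 0 <= w x by have := uD x; rewrite ler_norml /w => /andP[]; lra.
  have wH x : w x <= \1_H x by have := uD x; rewrite ler_norml /w => /andP[]; lra.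
  have vw := vanish_unit mw w0 wH.
  have dw : dominated (fun x => (w x)%:C%C) 1 H.
    by split; [exact: cmeas_real|move=> x; rewrite cmod_real ger0_norm// mul1r].
  have dN : dominated (fun x => - D%:C%C * (\1_H x)%:C%C) D H.
    split; first by apply: cmeasM; [exact: cmeas_cst|case: dH].
    by move=> x; rewrite cmodM cmodN !cmod_real !ger0_norm// ltW.
  have d0 : dominated (fun=> 0) 0 H.
    by split; [exact: cmeas_cst|move=> x; rewrite cmod0 mul0r].
  have v0 : vanish (fun=> 0).
    move=> e e0; apply: nearW => j; rewrite /Phi; under eq_cint do rewrite mul0r.
    by under [X in _ * X]eq_cint do rewrite mulr0; rewrite cint0 mulr0 subrr cmod0 ltW.
  have vN : vanish (fun x => - D%:C%C * (\1_H x)%:C%C).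
    have := vanish_lin (- D%:C%C) ler01 (lexx 0) dH d0 vH1 v0.
    by under [X in vanish X]eq_fun do rewrite addr0.
  have := vanish_lin (2 * D)%:C%C ler01 (ltW D0) dw dN vw vN.
  rewrite (_ : (fun x => (2 * D)%:C%C * (w x)%:C%C + - D%:C%C * (\1_H x)%:C%C) = fun x => (u x)%:C%C)//.
  apply/funext => x; rewrite -rmorphN -!rmorphM -rmorphD /w; congr (_%:C%C).
  by field; rewrite gt_eqF.
have [v1 d1] : vanish (fun x => (Cre (k x))%:C%C) /\ dominated (fun x => (Cre (k x))%:C%C) c H.
  by apply: part; [case: mk|move=> x; apply: le_trans (ler_Cre _) (kc x)].
have [v2 d2] : vanish (fun x => (Cim (k x))%:C%C) /\ dominated (fun x => (Cim (k x))%:C%C) c H.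
  by apply: part; [case: mk|move=> x; apply: le_trans (ler_Cim _) (kc x)].
have := vanish_lin 'i%C c0 c0 d2 d1 v2 v1.
rewrite (_ : (fun x => 'i%C * (Cim (k x))%:C%C + (Cre (k x))%:C%C) = k)//.
apply/funext => x; case: (k x) => u w; apply/eqP; rewrite eq_complex /=.
by apply/andP; split; apply/eqP; ring.
Qed.

End PoissonWeakLimit.

Section FlatLimitN.
Variables (R : realType) (n : nat).
Hypothesis n0 : (0 < n)%N.
Local Notation leb1 := (@lebesgue_measure R).
Local Notation Rn := (n.-tuple R).
Local Notation mu := (@lebm R n).

Lemma cvg_cprod (I : eqType) (r : seq I) (u : I -> nat -> R[i]) (l : I -> R[i]) :
  (forall i, (fun k => cmod (u i k - l i)) @ \oo --> (0 : R)) ->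
  (fun k => cmod (\prod_(i <- r) u i k - \prod_(i <- r) l i)) @ \oo --> (0 : R).
Proof.
move=> h; elim: r => [|i r IH].
  by under eq_fun do rewrite !big_nil subrr cmod0; exact: cvg_cst.
pose U k := \prod_(j <- r) u j k; pose L := \prod_(j <- r) l j.
apply: (@cvg0_le _ _ (fun k => cmod (u i k - l i) * cmod (U k - L) +
   (cmod (l i) * cmod (U k - L) + cmod (u i k - l i) * cmod L))).
  move=> k; rewrite !big_cons -/(U k) -/L ger0_norm ?cmod_ge0//.
  have -> : u i k * U k - l i * L = (u i k - l i) * (U k - L) +
     (l i * (U k - L) + (u i k - l i) * L) by ring.
  apply: le_trans (ler_cmodD _ _) _; rewrite cmodM lerD2l.
  by apply: le_trans (ler_cmodD _ _) _; rewrite !cmodM.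
have z : 0 = 0 * 0 + (cmod (l i) * 0 + 0 * cmod L) :> R by ring.
rewrite [X in _ --> X]z; apply: cvgD; first by apply: cvgM; [exact: h|exact: IH].
by apply: cvgD; [apply: cvgMr; exact: IH|apply: cvgMl; exact: h].
Qed.

Definition fwn (d e : R) (x y : Rn) : R[i] := \prod_(i < n) fw d e (tnth x i - tnth y i).

Lemma fourier_flat (d e : R) y x : 0 < d -> 0 < e ->
  fourier (ctest d e (fun z => cis (dotp y z) * 1)) x = fwn d e x y.
Proof.
move=> d0 e0.
have -> : ctest d e (fun z => cis (dotp y z) * 1) =
    fun z => cis (dotp y z) * (test d e (fun=> 1) z)%:C%C.
  by apply/funext => z; rewrite /ctest /test mulr1 mul1r mulrC.
rewrite fourier_translate -/(ftest d e (fun=> 1) (tsub x y)) ftest_flat//.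
by apply: eq_bigr => i _; rewrite tnth_mktuple.
Qed.

Lemma cmeas_fw d e : cmeas (fw d e : measurableTypeR R -> R[i]).
Proof.
apply: (@cmeas_cint2 _ _ (measurableTypeR R) (measurableTypeR R) R leb1
  (fun z => cis (- (z.1 * z.2)) * (flat1 d e z.2)%:C%C)).
apply: cmeasM.
  by apply: cmeas_cis; apply: measurableT_comp => //; exact: measurable_funM.
apply: cmeas_real; exact: (measurableT_comp (@measurable_flat1 R d e) measurable_snd).
Qed.

Lemma cmeas_fwn d e : cmeas (fun z : Rn * Rn => fwn d e z.1 z.2).
Proof.
apply: cmeas_prod => i; apply: (cmeas_comp _ (cmeas_fw d e)).
apply: measurable_funB.
  exact: (measurableT_comp (measurable_tnthT i) measurable_fst).
exact: (measurableT_comp (measurable_tnthT i) measurable_snd).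
Qed.

Lemma cmeas_fwn1 d e y : cmeas (fun x : Rn => fwn d e x y).
Proof. exact: (cmeas_pair1 y (cmeas_fwn d e)). Qed.

Lemma fwn_le (d e : R) x y : 0 < d -> 0 < e ->
  cmod (fwn d e x y) <= (2 / d + 4) ^+ n * dec x y.
Proof.
move=> d0 e0; have -> : (2 / d + 4) ^+ n = \prod_(i < n) (2 / d + 4).
  by rewrite prodr_const card_ord.
rewrite /fwn cmod_prod /dec -big_split; apply: ler_prod => i _.
by apply/andP; split; [exact: cmod_ge0|exact: fw_le_dec].
Qed.

Lemma poissonn_le_dec4 (d : R) (x y : Rn) : 0 < d ->
  poissonn d x y <= (2 / d + 4) ^+ n * dec x y.
Proof.
move=> d0; apply: le_trans (poissonn_le_dec x y d0) _.
have d2 : 0 <= 2 / d by rewrite divr_ge0// ltW.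
rewrite ler_wpM2r ?(ltW (dec_gt0 _ _))// lerXn2r ?nnegrE ?addr_ge0//.
by rewrite lerD2l ler1n.
Qed.

Lemma cvg_fwn d x y : 0 < d ->
  (fun k => cmod (fwn d k.+1%:R^-1 x y - (poissonn d x y)%:C%C)) @ \oo --> (0 : R).
Proof.
move=> d0; rewrite /poissonn real_prod; apply: cvg_cprod => i.
apply/cvgrPdist_le => a a0; have := cvg_fw d0 (tnth x i - tnth y i) a0.
by apply: filterS => k; rewrite sub0r normrN ger0_norm ?cmod_ge0.
Qed.

Variables (p : R) (g : Rn -> R[i]) (A : R).
Hypotheses (p1 : 1 < p) (mg : cmeas g) (A0 : 0 <= A).
Hypothesis gA : bnd mu p^-1 (fun x => cmod (g x)) A.

(** For fixed [d] the limit [e -> 0] is by dominated convergence, first in [x] and then in [y], the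
    decay of [fwn] being uniform in [e]. The limit [d -> 0] has no such majorant for [g] and goes
    through the weak statement [vanish_dominated]. *)
Lemma weak_limit (N : nat) (k : Rn -> R[i]) (c K : R) : 0 <= c -> dominated k c (@hcube R n N) ->
  (forall d e, 0 < d -> 0 < e -> cmod (cint mu (fun y => k y *
    cint mu (fun x => g x * fourier (ctest d e (fun z => cis (dotp y z) * 1)) x))) <= K) ->
  (2 * pi) ^+ n * cmod (cint mu (fun x => g x * k x)) <= K.
Proof.
move=> c0 dk hK; have [mk kc] := dk.
have mH : measurable (@hcube R n N) by exact: measurable_hbox.
have HE : mu (hcube N) = (fine (mu (hcube N)))%:E.
  rewrite fineK// ge0_fin_numE// -[hcube N]setTI; apply: lebm_hcube_fin.
  exact: measurableT.
have ik := dominated_cintble c0 mH HE dk.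
have ej j : 0 < (j.+1%:R : R)^-1 by rewrite invr_gt0.
have step1 d : 0 < d -> cmod (cint mu (fun y => k y * pconv g d y)) <= K.
  move=> d0; set C := (2 / d + 4) ^+ n.
  have C0 : 0 <= C by rewrite exprn_ge0// addr_ge0// divr_ge0// ltW.
  pose G e y := cint mu (fun x => g x * fwn d e x y).
  have GK e : 0 < e -> cmod (cint mu (fun y => k y * G e y)) <= K.
    move=> e0; have GE y : cint mu (fun x => g x *
        fourier (ctest d e (fun z => cis (dotp y z) * 1)) x) = G e y.
      by apply: eq_cint => x; rewrite fourier_flat.
    have := hK d e d0 e0.
    by under eq_cint do rewrite GE.
  have Gle e y : 0 < e -> cmod (G e y) <= A * (C * decN n p).
    move=> e0; apply: cint_le; first by apply: cmeasM => //; exact: cmeas_fwn1.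
    apply: (Lp_dec_le (y := y) p1 mg _ A0 C0 gA); first exact: cmeas_fwn1.
    by move=> x; exact: fwn_le.
  have mpy (y : Rn) : cmeas (fun x => (poissonn d x y)%:C%C : R[i]).
    by apply: cmeas_real; exact: (measurableT_comp (measurable_poissonn d) (pair2_measurable y)).
  have pdec (x y : Rn) : cmod ((poissonn d x y)%:C%C) <= C * dec x y.
    by rewrite cmod_real (ger0_norm (poissonn_ge0 x y d0)); exact: poissonn_le_dec4.
  have ple y : cmod (pconv g d y) <= A * (C * decN n p).
    apply: cint_le; first by apply: cmeasM => //; exact: mpy.
    apply: (Lp_dec_le (y := y) p1 mg _ A0 C0 gA); first exact: mpy.
    by move=> x; exact: pdec.
  have Gc y : (fun j => cmod (G j.+1%:R^-1 y - pconv g d y)) @ \oo --> (0 : R).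
    apply/cvgrPdist_le => a a0.
    have [|||||||M _ hM] := @cint_dct _ _ R mu (fun j x => g x * fwn d j.+1%:R^-1 x y)
      (fun x => g x * (poissonn d x y)%:C%C) (fun x => cmod (g x) * (C * dec x y)) _ _ _ _ _ _ _ a a0.
    - by move=> j; apply: cmeasM => //; exact: cmeas_fwn1.
    - by apply: cmeasM => //; exact: mpy.
    - apply: measurable_funM; first exact: measurable_cmod.
      by apply: measurable_funM => //; exact: measurable_dec1l.
    - by move=> j x; rewrite cmodM; apply: ler_wpM2l; [exact: cmod_ge0|exact: fwn_le].
    - by move=> x; rewrite cmodM; apply: ler_wpM2l; [exact: cmod_ge0|exact: pdec].
    - have mF : cmeas (fun x => (C * dec x y)%:C%C : R[i]).
        by apply: cmeas_real; apply: measurable_funM => //; exact: measurable_dec1l.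
      have dec0 x : 0 <= C * dec x y by rewrite mulr_ge0// ltW// dec_gt0.
      have Fle x : cmod ((C * dec x y)%:C%C) <= C * dec x y by rewrite cmod_real ger0_norm.
      apply: le_lt_trans (ltry (A * (C * decN n p))).
      apply: le_trans (Lp_dec_le p1 mg mF A0 C0 gA Fle).
      rewrite le_eqVlt; apply/orP; left; apply/eqP; apply: eq_integral => x _.
      by rewrite cmodM cmod_real (ger0_norm (dec0 x)).
    - move=> x; apply: (@cvg0_le _ _ (fun j => cmod (g x) * cmod (fwn d j.+1%:R^-1 x y - (poissonn d x y)%:C%C))).
        by move=> j; rewrite ger0_norm ?cmod_ge0// -mulrBr cmodM.
      by rewrite -[X in _ --> X](mulr0 (cmod (g x))); apply: cvgMr; exact: cvg_fwn.
    exists M => // j Mj; rewrite sub0r normrN ger0_norm ?cmod_ge0//.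
    exact: hM.
  have mG e : cmeas (G e).
    apply: (@cmeas_cint2 _ _ _ _ R mu (fun z : Rn * Rn => g z.2 * fwn d e z.2 z.1)).
    apply: cmeasM; first exact: (cmeas_comp measurable_snd).
    apply: (@cmeas_comp _ _ _ _ R (fun z : Rn * Rn => (z.2, z.1)) _ _ (cmeas_fwn d e)).
    by apply: measurable_fun_pair; [exact: measurable_snd|exact: measurable_fst].
  have mp := cmeas_pconv mg d.
  set B := A * (C * decN n p) in Gle ple *.
  have B0 : 0 <= B by rewrite !mulr_ge0// powR_ge0.
  apply/ler_addgt0Pr => a a0.
  have [|||||||M _ hM] := @cint_dct _ _ R mu (fun j y => k y * G j.+1%:R^-1 y)
      (fun y => k y * pconv g d y) (fun y => B * cmod (k y)) _ _ _ _ _ _ _ a a0.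
  - by move=> j; exact: cmeasM.
  - exact: cmeasM.
  - by apply: measurable_funM => //; exact: measurable_cmod.
  - by move=> j y; rewrite cmodM mulrC; apply: ler_wpM2r; [exact: cmod_ge0|exact: Gle].
  - by move=> y; rewrite cmodM mulrC; apply: ler_wpM2r; [exact: cmod_ge0|exact: ple].
  - under eq_integral do rewrite EFinM.
    rewrite ge0_integralZl_EFin//.
    + by rewrite lte_mul_pinfty ?lee_fin//; case: ik.
    + by move=> y _; rewrite lee_fin cmod_ge0.
    + by apply/measurable_EFinP; exact: measurable_cmod.
  - move=> y; apply: (@cvg0_le _ _ (fun j => cmod (k y) * cmod (G j.+1%:R^-1 y - pconv g d y))).
      by move=> j; rewrite ger0_norm ?cmod_ge0// -mulrBr cmodM.
    by rewrite -[X in _ --> X](mulr0 (cmod (k y))); apply: cvgMr; exact: Gc.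
  have h : cmod (cint mu (fun y => k y * G M.+1%:R^-1 y) - cint mu (fun y => k y * pconv g d y)) <= a.
    exact: (hM M (leqnn M)).
  rewrite cmodB in h.
  have := le_trans (ler_cmodB _ _) h; rewrite lerBlDl => /le_trans; apply.
  exact: lerD (GK _ (ej M)) (lexx a).
have pn0 : 0 <= (2 * pi : R) ^+ n by rewrite exprn_ge0// mulr_ge0// pi_ge0.
apply/ler_addgt0Pr => a a0.
have [M _ hM] := vanish_dominated p1 mg A0 gA c0 dk a0.
have := hM M (leqnn M); rewrite /Phi cmodB => h.
have := le_trans (ler_cmodB _ _) h; rewrite cmodM cmod_real ger0_norm// lerBlDl => /le_trans; apply.
exact: lerD (step1 _ (ej M)) (lexx a).
Qed.

End FlatLimitN.

(** * The Birman-Schwinger bound *)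

Section Minkowski.
Variables (R : realType) (n : nat).
Local Notation mu := (@lebm R n).
Local Notation Rn := (n.-tuple R).
Variable p : R.
Hypothesis p1 : 1 <= p.
Let p0 : 0 < p. Proof. exact: lt_le_trans p1. Qed.

Lemma le_Lnorm (f g : Rn -> R) : measurable_fun setT f -> measurable_fun setT g ->
  (forall x, 0 <= f x) -> (forall x, f x <= g x) ->
  (Lnorm mu p%:E (EFin \o f) <= Lnorm mu p%:E (EFin \o g))%E.
Proof.
move=> mf mg f0 fg; rewrite unlock.
have g0 x : 0 <= g x by exact: le_trans (fg x).
have I0 (h : Rn -> R) : (0 <= \int[mu]_x (`|(EFin \o h) x| `^ p))%E.
  by apply: integral_ge0 => x _; rewrite poweR_ge0.
apply: gt0_ler_poweR.
- by rewrite invr_ge0 ltW.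
- by rewrite in_itv /= leey andbT I0.
- by rewrite in_itv /= leey andbT I0.
have E (h : Rn -> R) : (forall x, 0 <= h x) ->
    (\int[mu]_x (`|(EFin \o h) x| `^ p) = \int[mu]_x (h x `^ p)%:E)%E.
  by move=> h0; apply: eq_integral => x _; rewrite -[(EFin \o h) x]/((h x)%:E) abse_EFin poweR_EFin ger0_norm.
rewrite !E//.
apply: ge0_le_integral => //.
- by move=> x _; rewrite lee_fin powR_ge0.
- by apply/measurable_EFinP; exact: measurable_powRf.
- by apply/measurable_EFinP; exact: measurable_powRf.
- by move=> x _; rewrite lee_fin ge0_ler_powR ?nnegrE// ltW.
Qed.

Lemma cnormE r (f : Rn -> R[i]) : cnorm r f = Lnorm mu r (EFin \o (fun x => cmod (f x))).
Proof. by rewrite /cnorm !unlock; case: r. Qed.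

Lemma cnormD (f g : Rn -> R[i]) : cmeas f -> cmeas g ->
  (cnorm p%:E (fun x => f x + g x)%R <= cnorm p%:E f + cnorm p%:E g)%E.
Proof.
move=> mf mg; have m1 := measurable_cmod mf; have m2 := measurable_cmod mg.
have h := @minkowski_EFin _ _ R mu _ _ p m1 m2 p1.
rewrite !cnormE; apply: le_trans h.
apply: (@le_Lnorm (fun x => cmod (f x + g x)) (fun x => cmod (f x) + cmod (g x))).
- by apply: measurable_cmod; exact: cmeasD.
- exact: measurable_funD.
- by move=> x; exact: cmod_ge0.
- by move=> x; exact: ler_cmodD.
Qed.

Lemma eq_cnorm r (f g : Rn -> R[i]) : (forall x, cmod (f x) = cmod (g x)) -> cnorm r f = cnorm r g.
Proof. by move=> fg; apply: eq_Lnorm => x; rewrite fg. Qed.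

Lemma cnorm_eq0 (f : Rn -> R[i]) : cmeas f -> cnorm p%:E f = 0%E -> aeq f (fun=> 0).
Proof.
move=> mf f0.
rewrite cnormE in f0.
have := @Lnorm_eq0_eq0 _ _ R mu (EFin \o (fun x => cmod (f x))) p%:E _ _ f0.
have m1 : measurable_fun setT (EFin \o (fun x => cmod (f x))).
  by apply/measurable_EFinP; exact: measurable_cmod.
rewrite lte_fin => /(_ m1 p0) h.
apply: filterS h => x /= /(_ I)[] h; exact: cmod_eq0.
Qed.

Lemma bnd_mono (t K : R) (f : nat -> Rn -> R) (f1 : Rn -> R) : 0 < t ->
  (forall k, measurable_fun setT (f k)) -> (forall k x, 0 <= f k x) ->
  (forall x, {homo f ^~ x : a b / (a <= b)%N >-> a <= b}) ->
  (forall x, \forall k \near \oo, f k x = f1 x) ->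
  (forall k, bnd mu t (f k) K) -> bnd mu t f1 K.
Proof.
move=> t0 mf f0 nd ev fK; have ti : 0 < t^-1 by rewrite invr_gt0.
rewrite bndP//.
have lim x : limn (fun k => (f k x `^ t^-1)%:E) = (f1 x `^ t^-1)%:E.
  apply/cvg_lim => //; apply: cvg_EFin; first exact: nearW.
  by apply: cvg_near_cst; apply: filterS (ev x) => k /= ->.
have -> : (\int[mu]_x (f1 x `^ t^-1)%:E = \int[mu]_x limn (fun k => (f k x `^ t^-1)%:E))%E.
  by apply: eq_integral => x _; rewrite lim.
have ndp x a b : (a <= b)%N -> f a x `^ t^-1 <= f b x `^ t^-1.
  by move=> ab; rewrite ge0_ler_powR ?nnegrE ?(ltW ti)// nd.
have mfp k : measurable_fun setT (fun x => (f k x `^ t^-1)%:E).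
  by apply/measurable_EFinP; exact: measurable_powRf.
rewrite monotone_convergence//.
- apply: lime_le; last by apply: nearW => k; have := fK k; rewrite bndP.
  apply: ereal_nondecreasing_is_cvgn => a b ab; apply: ge0_le_integral => //.
  + by move=> x _; rewrite lee_fin powR_ge0.
  + by move=> x _; rewrite lee_fin ndp.
- by move=> k x _; rewrite lee_fin powR_ge0.
- by move=> x _ a b ab; rewrite lee_fin ndp.
Qed.

End Minkowski.

Section BirmanSchwinger.
Variables (R : realType) (n : nat).
Hypothesis n0 : (0 < n)%N.
Local Notation Rn := (n.-tuple R).
Local Notation mu := (@lebm R n).
Variables (m : R) (lam : R[i]).
Hypothesis hlam : ~ @nonneg_axis R lam.
Variables (p : R).
Hypothesis p1 : 1 < p.
(* [ir] and [si] stand for [1 / r] and [1 / s]. *)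
Variables (ir si : R) (a b : Rn -> R[i]) (S na nb : R).
Hypotheses (ma : cmeas a) (mb : cmeas b) (ir0 : 0 <= ir) (si0 : 0 <= si).
Hypotheses (hr1 : 2^-1 - p^-1 <= ir) (hr2 : ir <= 1 - p^-1).
Hypotheses (hs1 : - 2^-1 + p^-1 <= si) (hs2 : si <= p^-1).
Hypotheses (S0 : 0 < S) (hS : bnd mu (ir + si) (fun xi => cmod (symb m lam xi)) S).
Hypotheses (na0 : 0 <= na) (ha : bnd mu ir (fun x => cmod (a x)) na).
Hypotheses (nb0 : 0 < nb) (hb : bnd mu si (fun x => cmod (b x)) nb).

Let K := (2 * pi) `^ (- (n%:R * (ir + si))) * S * na * nb.

Let p0 : 0 < p. Proof. exact: lt_trans p1. Qed.
Let ip0 : 0 < p^-1. Proof. by rewrite invr_gt0. Qed.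
Let ip1 : p^-1 < 1. Proof. by rewrite invf_lt1. Qed.
Let K0 : 0 <= K. Proof. by rewrite !mulr_ge0 ?powR_ge0// ltW. Qed.

(** Duality reduces the bound on [w = b g] to pairings of [g] with [k = h b], which the resolvent
    estimate controls with exponents [w = 1/p - 1/s] and [ia + w = 1/r + 1/p]; the four conditions
    on [r] and [s] are the two ranges needed there. *)
Lemma BRA_bound v w Av : BRA p m a b lam v w -> 0 <= Av ->
  bnd mu p^-1 (fun x => cmod (v x)) Av -> bnd mu p^-1 (fun x => cmod (w x)) (K * Av).
Proof.
move=> [g [f [Lv Lf fav] [Lf2 [f' [[Lg _] Lf' gf'] ff']]] [_ Lw wbg]] Av0 vA.
have [mg mf] : cmeas g /\ cmeas f by split; [exact: Lg.1|exact: Lf.1].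
have mv : cmeas v := Lv.1; have mw : cmeas w := Lw.1.
have [Ag Ag0 gA] := Lp_bnd p1 Lg.
have fA : bnd mu (ir + si + (p^-1 - si)) (fun x => cmod (f x)) (na * Av).
  have -> : ir + si + (p^-1 - si) = ir + p^-1 by ring.
  have h := bndM ir0 (ltW ip0) na0 Av0 (measurable_cmod ma) (measurable_cmod mv)
    (fun x => cmod_ge0 _) (fun x => cmod_ge0 _) ha vA.
  apply: bnd_ae h.
  - by apply: measurable_funM; exact: measurable_cmod.
  - exact: measurable_cmod.
  - by apply: filterS fav => x ->; rewrite cmodM.
(* The weak limit is available only for [k] bounded and supported in a cube. Truncating [b] where
   [|b| <= N] makes [h bN] such a function; monotone convergence in [N] removes the truncation. *)
pose bN (N : nat) x := b x * (\1_[set x | cmod (b x) <= N%:R] x)%:C%C.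
have mset (N : nat) : measurable [set x | cmod (b x) <= N%:R].
  have := measurable_cmod mb measurableT (measurable_itv `]-oo, N%:R]).
  by rewrite setTI; congr measurable.
have mbN N : cmeas (bN N).
  by apply: cmeasM => //; apply: cmeas_real; exact: measurable_indic.
have bNle N x : cmod (bN N x) <= cmod (b x).
  rewrite /bN cmodM cmod_real ger0_norm// indicE ler_piMr ?cmod_ge0//.
  by rewrite lern1 leq_b1.
have bNN N x : cmod (bN N x) <= N%:R.
  rewrite /bN cmodM cmod_real indicE; case: (boolP (x \in _)) => [/set_mem h|_].
    by rewrite normr1 mulr1.
  by rewrite normr0 mulr0.
have hbN N : bnd mu si (fun x => cmod (bN N x)) nb.
  apply: le_bnd hb => //.
  - exact: measurable_cmod.
  - exact: measurable_cmod.
  - by move=> x; exact: cmod_ge0.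
have KA0 : 0 <= K * Av by rewrite mulr_ge0.
have main N : bnd mu p^-1 (fun x => cmod (bN N x * g x)) (K * Av).
  have p01 : 0 < p^-1 < 1 by rewrite ip0.
  apply: (bnd_dual p01 (cmeasM (mbN N) mg) KA0) => h N' M B mh h0 hM _ B0 hB.
  pose k x := h x * bN N x.
  have mk : cmeas k by exact: cmeasM.
  have M0 : 0 <= M by apply: le_trans (hM [tuple 0 | i < n]); exact: cmod_ge0.
  (* A shell lies in the closed cube of side parameter [N'], while [hcube] is half-open; one more
     unit makes up for the missing faces. *)
  have dk : dominated k (M * N%:R) (@hcube R n N'.+1).
    split=> // x; have [xS|xS] := pselect (shell (fun x => bN N x * g x) N' x).
      have xH : hcube N'.+1 x.
        move=> i; case: xS => /(_ i) + _; rewrite /= !in_itv /= => /andP[h1 h2].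
        apply/andP; split; first by apply: lt_le_trans h1; rewrite ltrN2 ltr_nat.
        by apply: le_trans h2 _; rewrite ler_nat.
      rewrite indicE mem_set// mulr1 /k cmodM; apply: ler_pM => //; exact: cmod_ge0.
    by rewrite /k h0// mul0r cmod0 mulr_ge0// mulr_ge0.
  have MN0 : 0 <= M * N%:R by rewrite mulr_ge0.
  have mH : measurable (@hcube R n N'.+1) by exact: measurable_hbox.
  have HE : mu (hcube N'.+1) = (fine (mu (hcube N'.+1)))%:E.
    rewrite fineK// ge0_fin_numE// -[hcube N'.+1]setTI; apply: lebm_hcube_fin.
    exact: measurableT.
  have ik := dominated_cintble MN0 mH HE dk.
  have w01 : 0 <= p^-1 - si <= 2^-1 by move: hs1 hs2; lra.
  have t01 : 2^-1 <= ir + si + (p^-1 - si) <= 1 by move: hr1 hr2; lra.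
  have ia0 : 0 <= ir + si by rewrite addr_ge0.
  have kB : bnd mu (1 - (p^-1 - si)) (fun y => cmod (k y)) (nb * B).
    have -> : 1 - (p^-1 - si) = si + (1 - p^-1) by ring.
    have ip1' : 0 <= 1 - p^-1 by rewrite subr_ge0 ltW.
    have := bndM si0 ip1' (ltW nb0) (ltW B0) (measurable_cmod (mbN N)) (measurable_cmod mh)
      (fun x => cmod_ge0 _) (fun x => cmod_ge0 _) (hbN N) hB.
    rewrite (_ : (fun x => _ * _) = fun y => cmod (k y))//.
    by apply/funext => x; rewrite /k cmodM mulrC.
  have nB0 : 0 < nb * B by rewrite mulr_gt0.
  have nA0 : 0 <= na * Av by rewrite mulr_ge0.
  have rb d e (d0 : 0 < d) (e0 : 0 < e) := resolvent_bound n0 hlam d0 e0 p1 Lg Lf Lf' gf' ff'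
    ia0 w01 t01 ik S0 hS nA0 fA nB0 kB.
  have := weak_limit n0 p1 mg Ag0 gA MN0 dk rb.
  have -> : cint mu (fun x => g x * k x) = cint mu (fun x => h x * (bN N x * g x)).
    by apply: eq_cint => x; rewrite /k; ring.
  have pi2 : (0 : R) < 2 * pi by rewrite mulr_gt0// pi_gt0.
  have pn0 : 0 < (2 * pi : R) ^+ n by rewrite exprn_gt0.
  rewrite mulrC -ler_pdivlMr// => /le_trans; apply.
  rewrite ler_pdivrMr// /K -powR_mulrn; last exact: ltW.
  set X := 2 * pi in pi2 *.
  (* The two Hausdorff-Young powers of [2 pi] add up to [n - n (ir + si)]; the [n] is cancelled by
     the mass of the Poisson kernel on the left of the weak limit. *)
  have XE : X `^ (n%:R * (1 - (ir + si + (p^-1 - si)))) * X `^ (n%:R * (p^-1 - si)) =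
      X `^ (- (n%:R * (ir + si))) * X `^ n%:R.
    by rewrite -!powRD ?(gt_eqF pi2) ?implybT//; congr (_ `^ _); ring.
  rewrite le_eqVlt; apply/orP; left; apply/eqP.
  transitivity ((X `^ (n%:R * (1 - (ir + si + (p^-1 - si)))) * X `^ (n%:R * (p^-1 - si))) *
     (S * na * nb * Av * B)); first ring.
  by rewrite XE; ring.
have hbg : bnd mu p^-1 (fun x => cmod (b x * g x)) (K * Av).
  apply: (bnd_mono (f := fun N x => cmod (bN N x * g x)) ip0) => //.
  - by move=> N; apply: measurable_cmod; exact: cmeasM.
  - by move=> N x; exact: cmod_ge0.
  - move=> x N N' NN'; rewrite !cmodM ler_wpM2r ?cmod_ge0//.
    rewrite ler_wpM2l ?cmod_ge0// !cmod_real !ger0_norm// !indicE ler_nat.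
    case: (boolP (x \in _)) => // /set_mem /= xN.
    by rewrite mem_set//=; apply: le_trans xN _; rewrite ler_nat.
  - move=> x; exists (Num.bound (cmod (b x))) => // N /= Nb.
    rewrite /bN indicE mem_set ?mulr1//=.
    apply: le_trans (ltW (archi_boundP (cmod_ge0 (b x)))) _.
    by rewrite ler_nat.
apply: bnd_ae hbg.
- by apply: measurable_cmod; exact: cmeasM.
- exact: measurable_cmod.
- by apply: filterS wbg => x ->.
Qed.

(** The eigenfunction [u] is approximated by [v] in the domain of [B (H_0 - lam)^-1 A]. With
    [f = Q v], boundedness of [Q] makes [f + u] small, while [f] has norm at most [K] times that of
    [v]; letting [v -> u] gives [||u|| <= K ||u||]. *)
Lemma eigenvalue_bound Q : is_Q p m a b lam Q -> eigenvalue_op Q (-1) -> 1 <= K.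
Proof.
move=> [dd [opQ _ [M QM]] BQ] [u [u0 Quu]].
have [Lu _] := op_Lp opQ Quu.
have mu' : cmeas u := Lu.1.
have ufin : cnorm p%:E u \is a fin_num by rewrite ge0_fin_numE ?cnorm_ge0//; case: Lu.
have p1' : 1 <= p by exact: ltW.
set U := fine (cnorm p%:E u).
have UE : cnorm p%:E u = U%:E by rewrite fineK.
have U0 : 0 < U.
  rewrite lt_neqAle; apply/andP; split; last by rewrite fine_ge0// cnorm_ge0.
  apply/eqP => U0; apply: u0; apply: (cnorm_eq0 p1' mu').
  by rewrite UE -U0.
have M0 : 0 <= Num.max M 0 by rewrite le_max lexx orbT.
set M' := Num.max M 0 in M0.
suff : U <= K * U by rewrite -[X in X <= _]mul1r ler_pM2r.
apply/ler_addgt0Pr => e e0.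
have MK : 0 < M' + K + 1 by rewrite ltr_wpDl// addr_ge0.
(* The total error of the approximation is [(M' + K) D] with [D < eta]; the summand [1] in the
   denominator keeps it nonzero. *)
pose eta := e / (M' + K + 1); have eta0 : 0 < eta by rewrite divr_gt0.
have [v [f [vf uv]]] := dd u Lu eta eta0.
have Qvf := BQ v f vf.
have [Lv Lf] := op_Lp opQ Qvf.
have mv : cmeas v := Lv.1; have mf : cmeas f := Lf.1.
have Q1 := op_lin opQ (-1) Qvf Quu.
have h1 := QM _ _ Q1.
have e1 : cnorm p%:E (fun x => -1 * v x + u x) = cnorm p%:E (vsub u v).
  by apply: eq_cnorm => x; rewrite /vsub mulN1r addrC.
have e2 : cnorm p%:E (fun x => -1 * f x + -1 * u x) = cnorm p%:E (fun x => f x + u x).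
  by apply: eq_cnorm => x; rewrite !mulN1r -opprD cmodN.
rewrite e1 e2 in h1.
have uvfin : cnorm p%:E (vsub u v) \is a fin_num.
  by rewrite ge0_fin_numE ?cnorm_ge0//; apply: lt_trans uv _; rewrite ltry.
set D := fine (cnorm p%:E (vsub u v)).
have DE : cnorm p%:E (vsub u v) = D%:E by rewrite fineK.
have D0 : 0 <= D by rewrite fine_ge0// cnorm_ge0.
have De : D < eta by move: uv; rewrite DE lte_fin.
have h2 : (cnorm p%:E (fun x => f x + u x)%R <= (M' * D)%:E)%E.
  apply: le_trans h1 _; rewrite DE -EFinM lee_fin ler_wpM2r//.
  by rewrite le_max lexx.
have Vfin : cnorm p%:E v \is a fin_num by rewrite ge0_fin_numE ?cnorm_ge0//; case: Lv.
set V := fine (cnorm p%:E v).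
have VE : cnorm p%:E v = V%:E by rewrite fineK.
have V0 : 0 <= V by rewrite fine_ge0// cnorm_ge0.
have VU : V <= U + D.
  rewrite -lee_fin -VE EFinD -UE -DE.
  have -> : cnorm p%:E v = cnorm p%:E (fun x => u x + -1 * vsub u v x).
    by apply: eq_cnorm => x; rewrite /vsub mulN1r opprB addrC subrK.
  have -> : cnorm p%:E (vsub u v) = cnorm p%:E (fun x => -1 * vsub u v x).
    by apply: eq_cnorm => x; rewrite mulN1r cmodN.
  apply: cnormD => //; apply: cmeasM; first exact: cmeas_cst.
  by apply: cmeasD => //; exact: cmeasN.
have pe0 : (0 < p%:E)%E by rewrite lte_fin.
have KV0 : 0 <= K * V by rewrite mulr_ge0.
have h3 : (cnorm p%:E f <= (K * V)%:E)%E.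
  apply: (bnd_cnorm p0 KV0); apply: (BRA_bound vf V0).
  exact: (cnorm_bnd pe0 Lv).
have h4 : (cnorm p%:E u <= (M' * D)%:E + (K * V)%:E)%E.
  have -> : cnorm p%:E u = cnorm p%:E (fun x => (f x + u x) + -1 * f x).
    by apply: eq_cnorm => x; rewrite mulN1r addrAC subrr add0r.
  have mNf : cmeas (fun x => -1 * f x) by apply: cmeasM => //; exact: cmeas_cst.
  apply: le_trans (cnormD p1' (cmeasD mf mu') mNf) _; apply: leeD => //.
  have -> // : cnorm p%:E (fun x => -1 * f x) = cnorm p%:E f.
  by apply: eq_cnorm => x; rewrite mulN1r cmodN.
move: h4; rewrite UE -EFinD lee_fin => h4.
apply: le_trans h4 _.
have h5 : K * V <= K * U + K * D by rewrite -mulrDr ler_wpM2l.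
have h6 : (M' + K) * D <= e.
  apply: le_trans (_ : (M' + K + 1) * eta <= _).
    by apply: ler_pM; rewrite ?addr_ge0// ?lerDl// ltW.
  by rewrite /eta mulrCA mulfV ?gt_eqF// mulr1.
move: h6; rewrite mulrDl; lra.
Qed.

End BirmanSchwinger.

(** * Radial integrals and Euler integrals *)

Section HalfLine.
Variable R : realType.
Local Notation leb1 := (@lebesgue_measure R).

(** The integral over the positive half-line, written with an indicator on the whole line so that
    affine substitutions and Tonelli's theorem for the line apply directly. *)
Definition ipos (f : R -> R) : \bar R := (\int[leb1]_t ((0 < t)%R%:R * f t)%:E)%E.

Lemma measurable_pos d (T : measurableType d) (N : T -> R) : measurable_fun setT N ->
  measurable_fun setT (fun x => (0 < N x)%R%:R : R).
Proof.
move=> mN; have m0 : measurable_fun [set: R] (fun t : R => (0 < t)%R%:R : R).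
  rewrite (_ : (fun t : R => _) = \1_(`]0, +oo[%classic)); first exact: measurable_indic.
  apply/funext => t; rewrite indicE; congr (nat_of_bool _)%:R.
  by apply/idP/idP; rewrite inE /= in_itv /= andbT.
exact: (measurableT_comp m0 mN).
Qed.

Lemma measurable_posM (f : R -> R) : measurable_fun [set: R] f ->
  measurable_fun [set: R] (fun t : R => (0 < t)%R%:R * f t).
Proof.
by move=> mf; apply: measurable_funM => //; apply: (@measurable_pos _ (measurableTypeR R)).
Qed.

Lemma iposE (f : R -> R) : ipos f = (\int[leb1]_(t in `]0%R, +oo[) (f t)%:E)%E.
Proof.
rewrite [RHS]integral_mkcond; apply: eq_integral => t _.
rewrite patchE; case: ifP => [|/negP].
  by rewrite inE /= in_itv /= andbT => ->; rewrite mul1r.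
by rewrite inE /= in_itv /= andbT => /negP /negbTE ->; rewrite mul0r.
Qed.

Lemma ipos_ge0 (f : R -> R) : (forall t, 0 < t -> 0 <= f t) -> (0 <= ipos f)%E.
Proof.
move=> f0; apply: integral_ge0 => t _; rewrite lee_fin.
by have [t0|t0] := ltrP 0 t; rewrite ?mul0r ?mul1r ?f0.
Qed.

Lemma eq_ipos (f g : R -> R) : (forall t, 0 < t -> f t = g t) -> ipos f = ipos g.
Proof.
move=> fg; apply: eq_integral => t _; congr EFin.
by have [t0|t0] := ltrP 0 t; rewrite ?mul0r ?mul1r ?fg.
Qed.

Lemma le_ipos (f g : R -> R) : measurable_fun [set: R] f -> measurable_fun [set: R] g ->
  (forall t, 0 < t -> 0 <= f t <= g t) -> (ipos f <= ipos g)%E.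
Proof.
move=> mf mg fg; apply: ge0_le_integral => //.
- move=> t _; rewrite lee_fin; have [t0|t0] := ltrP 0 t; rewrite ?mul0r ?mul1r//.
  by case/andP: (fg _ t0).
- by apply/measurable_EFinP; exact: measurable_posM.
- by apply/measurable_EFinP; exact: measurable_posM.
- move=> t _; rewrite lee_fin; have [t0|t0] := ltrP 0 t; rewrite ?mul0r ?mul1r//.
  by case/andP: (fg _ t0).
Qed.

Lemma iposZ (c : R) (f : R -> R) : 0 <= c -> measurable_fun [set: R] f ->
  (forall t, 0 < t -> 0 <= f t) -> ipos (fun t => c * f t) = (c%:E * ipos f)%E.
Proof.
move=> c0 mf f0; rewrite /ipos -ge0_integralZl_EFin//.
- by apply: eq_integral => t _; rewrite -EFinM mulrCA.
- move=> t _; rewrite lee_fin; have [t0|t0] := ltrP 0 t; rewrite ?mul0r ?mul1r//.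
  exact: f0.
- by apply/measurable_EFinP; exact: measurable_posM.
Qed.

Lemma iposD (f g : R -> R) : measurable_fun [set: R] f -> measurable_fun [set: R] g ->
  (forall t, 0 < t -> 0 <= f t) -> (forall t, 0 < t -> 0 <= g t) ->
  ipos (fun t => f t + g t) = (ipos f + ipos g)%E.
Proof.
move=> mf mg f0 g0; rewrite /ipos -ge0_integralD//.
- by apply: eq_integral => t _; rewrite -EFinD mulrDr.
- move=> t _; rewrite lee_fin; have [t0|t0] := ltrP 0 t; rewrite ?mul0r ?mul1r//.
  exact: f0.
- by apply/measurable_EFinP; exact: measurable_posM.
- move=> t _; rewrite lee_fin; have [t0|t0] := ltrP 0 t; rewrite ?mul0r ?mul1r//.
  exact: g0.
- by apply/measurable_EFinP; exact: measurable_posM.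
Qed.

Lemma ipos_scale (c : R) (f : R -> R) : 0 < c -> measurable_fun [set: R] f ->
  (forall t, 0 < t -> 0 <= f t) -> (c%:E * ipos (fun t => f (c * t)%R) = ipos f)%E.
Proof.
move=> c0 mf f0.
rewrite /ipos -(@integral_affine R c 0 (fun t => ((0 < t)%R%:R * f t)%:E) c0); first last.
- move=> t; rewrite lee_fin; have [t0|t0] := ltrP 0 t; rewrite ?mul0r ?mul1r//.
  exact: f0.
- by apply/measurable_EFinP; exact: measurable_posM.
by congr (_ * _)%E; apply: eq_integral => t _; rewrite addr0 pmulr_rgt0.
Qed.

Lemma measurable_powRl (a : R) : measurable_fun [set: R] (fun t : R => t `^ a).
Proof. exact: measurable_powR. Qed.

End HalfLine.

(** * Homogeneous functions in place of polar coordinates *)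

Section Homogeneous.
Context d (X : measurableType d) (R : realType).
Local Notation leb1 := (@lebesgue_measure R).
Variable mu : {sigma_finite_measure set X -> \bar R}.
Variables (N : X -> R) (k : R).
Hypothesis mN : measurable_fun setT N.

(** The integral of [H] against the distribution of [N] on the positive axis. Homogeneity determines
    this distribution as a multiple of [u^(k-1) du], and the multiple is found by comparison with
    any convenient kernel [w]. *)
Definition inorm (H : R -> R) : \bar R := (\int[mu]_x ((0 < N x)%R%:R * H (N x))%:E)%E.

Hypothesis homog : forall (H : R -> R) (c : R), measurable_fun setT H -> (forall t, 0 <= H t) ->
  0 < c -> inorm (fun t => H (c * t)) = ((c `^ (- k))%:E * inorm H)%E.

Lemma measurable_inorm (H : R -> R) : measurable_fun [set: R] H ->
  measurable_fun setT (fun x => (0 < N x)%R%:R * H (N x)).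
Proof.
move=> mH; apply: measurable_funM; first exact: measurable_pos.
exact: measurableT_comp.
Qed.

Lemma inorm_ge0 H : (forall t, 0 <= H t) -> (0 <= inorm H)%E.
Proof. by move=> H0; apply: integral_ge0 => x _; rewrite lee_fin mulr_ge0. Qed.

(* Both sides are the integral of [G u w (N x / u) / u] over [x] and [u > 0]. *)
Lemma homogeneous_swap (G w : R -> R) : measurable_fun [set: R] G -> measurable_fun [set: R] w ->
  (forall t, 0 <= G t) -> (forall t, 0 <= w t) ->
  (inorm G * ipos (fun t => w t^-1 * t `^ (- k - 1))%R =
   ipos (fun u => G u * u `^ (k - 1))%R * inorm w)%E.
Proof.
move=> mG mw G0 w0.
have mV := @measurable_invr R.
have mp a := @measurable_powRl R a.
have mwV : measurable_fun [set: R] (fun t : R => w t^-1) by exact: measurableT_comp.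
have mX : measurable_fun setT (fun z : X * measurableTypeR R => N z.1).
  exact: (measurableT_comp mN measurable_fst).
have mT : measurable_fun setT (fun z : X * measurableTypeR R => z.2 : R) by exact: measurable_snd.
pose F (z : X * measurableTypeR R) : R := (0 < N z.1)%R%:R *
   ((0 < z.2)%R%:R * (G z.2 * z.2^-1 * w (N z.1 * z.2^-1))).
have mF : measurable_fun setT (EFin \o F).
  apply/measurable_EFinP; apply: measurable_funM; first exact: measurable_pos.
  apply: measurable_funM; first exact: measurable_pos.
  have mV2 : measurable_fun setT (fun z : X * measurableTypeR R => z.2^-1 : R).
    exact: (measurableT_comp mV mT).
  apply: measurable_funM.
    by apply: measurable_funM => //; exact: (measurableT_comp mG mT).
  by apply: (measurableT_comp mw); exact: measurable_funM.
have F0 z : (0 <= (EFin \o F) z)%E.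
  rewrite lee_fin /F; have [z0|z0] := ltrP 0 z.2; last by rewrite mul0r mulr0.
  by rewrite !mulr_ge0// invr_ge0 ltW.
have pw a (t : R) : 0 <= t `^ a by exact: powR_ge0.
have lhs : (\int[leb1]_u \int[mu]_x (EFin \o F) (x, u) =
    ipos (fun u => G u * u `^ (k - 1))%R * inorm w)%E.
  rewrite /ipos -ge0_integralZr//; first last.
  - exact: inorm_ge0.
  - by move=> u _; rewrite lee_fin mulr_ge0// mulr_ge0.
  - by apply/measurable_EFinP; apply: measurable_posM; exact: measurable_funM.
  apply: eq_integral => u _; rewrite /F /=.
  have [u0|u0] := ltrP 0 u; last first.
    by under eq_integral do rewrite mul0r mulr0; rewrite integral0 mul0r mul0e.
  have uV : 0 < u^-1 by rewrite invr_gt0.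
  have := homog mw w0 uV; rewrite /inorm => h.
  transitivity ((G u * u^-1)%:E * \int[mu]_x ((0 < N x)%R%:R * w (u^-1 * N x))%:E)%E.
    rewrite -ge0_integralZl_EFin.
    - by apply: eq_integral => x _; rewrite -EFinM mul1r; congr EFin; rewrite [N x * _]mulrC; ring.
    - by [].
    - by move=> x _; rewrite lee_fin mulr_ge0.
    - apply/measurable_EFinP; apply: measurable_funM; first exact: measurable_pos.
      by apply: (measurableT_comp mw); exact: measurable_funM.
    - by rewrite mulr_ge0// ltW.
  rewrite h muleA -EFinM mul1r; congr (_%:E * _)%E.
  rewrite -mulrA; congr (_ * _).
  rewrite -[in u^-1 `^ _]powR_inv1 ?(ltW u0)// -powRrM mulN1r opprK.
  by rewrite -powR_inv1 ?(ltW u0)// -powRD ?(gt_eqF u0) ?implybT// addrC.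
have rhs : (\int[mu]_x \int[leb1]_u (EFin \o F) (x, u) =
    inorm G * ipos (fun t => w t^-1 * t `^ (- k - 1))%R)%E.
  transitivity (\int[mu]_x ((0 < N x)%R%:R%:E *
     ipos (fun t => G (N x * t) * t^-1 * w t^-1)%R))%E.
    apply: eq_integral => x _; rewrite /F /=.
    have [x0|x0] := ltrP 0 (N x); last first.
      by under eq_integral do rewrite mul0r; rewrite integral0 mul0e.
    rewrite mul1e; under eq_integral do rewrite mul1r.
    rewrite -/(ipos (fun u => G u * u^-1 * w (N x * u^-1))) -(ipos_scale x0).
    - rewrite -iposZ; [|exact: ltW| |].
      + apply: eq_ipos => t t0; rewrite invfM.
        have -> : N x * ((N x)^-1 * t^-1) = t^-1 by rewrite mulrA mulfV ?gt_eqF// mul1r.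
        by field; rewrite !gt_eqF.
      + apply: measurable_funM; first apply: measurable_funM.
        * by apply: (measurableT_comp mG); exact: measurable_funM.
        * by apply: (measurableT_comp mV); exact: measurable_funM.
        * apply: (measurableT_comp mw); apply: measurable_funM => //.
          by apply: (measurableT_comp mV); exact: measurable_funM.
      + by move=> t t0; rewrite !mulr_ge0// invr_ge0 mulr_ge0// ltW.
    - apply: measurable_funM; first exact: measurable_funM.
      by apply: (measurableT_comp mw); exact: measurable_funM.
    - by move=> t t0; rewrite !mulr_ge0// invr_ge0 ltW.
  pose F2 (z : X * measurableTypeR R) : R := (0 < N z.1)%R%:R *
     ((0 < z.2)%R%:R * (G (N z.1 * z.2) * z.2^-1 * w z.2^-1)).
  have mF2 : measurable_fun setT (EFin \o F2).
    apply/measurable_EFinP; apply: measurable_funM; first exact: measurable_pos.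
    apply: measurable_funM; first exact: measurable_pos.
    have mV2 : measurable_fun setT (fun z : X * measurableTypeR R => z.2^-1 : R).
      exact: (measurableT_comp mV mT).
    apply: measurable_funM; last exact: (measurableT_comp mw mV2).
    apply: measurable_funM => //.
    by apply: (measurableT_comp mG); exact: measurable_funM.
  have F20 z : (0 <= (EFin \o F2) z)%E.
    rewrite lee_fin /F2; have [z0|z0] := ltrP 0 z.2; last by rewrite mul0r mulr0.
    by rewrite !mulr_ge0// invr_ge0 ltW.
  transitivity (\int[mu]_x \int[leb1]_t (EFin \o F2) (x, t))%E.
    apply: eq_integral => x _; rewrite /F2 /= /ipos.
    have [x0|x0] := ltrP 0 (N x); last first.
      by under [RHS]eq_integral do rewrite mul0r; rewrite integral0 mul0e.
    by rewrite mul1e; apply: eq_integral => t _; rewrite mul1r.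
  rewrite (@fubini_tonelli _ _ _ _ _ mu leb1 _ mF2 F20).
  rewrite /ipos -ge0_integralZl//; first last.
  - exact: inorm_ge0.
  - by move=> t _; rewrite lee_fin mulr_ge0// mulr_ge0.
  - by apply/measurable_EFinP; apply: measurable_posM; exact: measurable_funM.
  apply: eq_integral => t _; rewrite /F2 /=.
  have [t0|t0] := ltrP 0 t; last first.
    by under eq_integral do rewrite mul0r mulr0; rewrite integral0 mul0r mule0.
  have := homog mG G0 t0; rewrite /inorm => h.
  transitivity ((t^-1 * w t^-1)%:E * \int[mu]_x ((0 < N x)%R%:R * G (t * N x))%:E)%E.
    rewrite -ge0_integralZl_EFin.
    - by apply: eq_integral => x _; rewrite -EFinM mul1r; congr EFin; rewrite [N x * t]mulrC; ring.
    - by [].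
    - by move=> x _; rewrite lee_fin mulr_ge0.
    - apply/measurable_EFinP; apply: measurable_funM; first exact: measurable_pos.
      by apply: (measurableT_comp mG); exact: measurable_funM.
    - by rewrite mulr_ge0// invr_ge0 ltW.
  rewrite h muleA -EFinM mul1r muleC; congr (_ * _%:E)%E.
  rewrite mulrAC mulrC; congr (_ * _).
  by rewrite -powR_inv1 ?(ltW t0)// -powRD ?(gt_eqF t0) ?implybT// addrC.
rewrite -lhs -rhs.
exact: (@fubini_tonelli _ _ _ _ _ mu leb1 _ mF F0).
Qed.

End Homogeneous.

Section PowerIntegrals.
Variable R : realType.
Local Notation leb1 := (@lebesgue_measure R).

Lemma measurable_ge (a : R) : measurable_fun [set: R] (fun t : R => (a <= t)%R%:R : R).
Proof.
rewrite (_ : (fun t : R => _) = \1_(`[a, +oo[%classic)); first exact: measurable_indic.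
apply/funext => t; rewrite indicE; congr (nat_of_bool _)%:R.
by apply/idP/idP; rewrite inE /= in_itv /= andbT.
Qed.

Lemma measurable_le (a : R) : measurable_fun [set: R] (fun t : R => (t <= a)%R%:R : R).
Proof.
rewrite (_ : (fun t : R => _) = \1_(`]-oo, a]%classic)); first exact: measurable_indic.
by apply/funext => t; rewrite indicE; congr (nat_of_bool _)%:R; apply/idP/idP; rewrite inE /= in_itv.
Qed.

Lemma continuous_powRl (a x : R) : 0 < x -> {for x, continuous (fun t : R => t `^ a)}.
Proof.
move=> x0; apply/differentiable_continuous/derivable1_diffP.
by apply: derivable_powR; rewrite in_itv /= andbT.
Qed.

Lemma ipos_tail (y : R) : 0 < y ->
  ipos (fun t => (1 <= t)%R%:R * t `^ (- y - 1)) = (y^-1)%:E.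
Proof.
move=> y0.
have -> : ipos (fun t => (1 <= t)%R%:R * t `^ (- y - 1)) =
    (\int[leb1]_(t in `[1%R, +oo[) (t `^ (- y - 1))%:E)%E.
  rewrite [RHS]integral_mkcond; apply: eq_integral => t _; rewrite patchE.
  case: ifP => [|/negP]; rewrite inE /= in_itv /= andbT.
    by move=> t1; rewrite t1 (lt_le_trans ltr01 t1) !mul1r.
  by move=> /negP /negbTE ->; rewrite mul0r mulr0.
rewrite (@ge0_continuous_FTC2y R _ (fun t => - y^-1 * t `^ (- y)) 1 0).
- by rewrite powR1 mulr1 -EFinD sub0r opprK.
- by move=> x x1; exact: powR_ge0.
- apply/continuous_within_itvcyP; split=> [x|].
    rewrite in_itv /= andbT => x1; apply: continuous_powRl.
    by rewrite (lt_trans _ x1).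
  by apply: cvg_at_right_filter; apply: continuous_powRl.
- rewrite -[0](mulr0 (- y^-1)); apply: cvgMr.
  apply/cvgrPdist_le => e e0; near=> t.
  have t0 : 0 < t by near: t; exact: nbhs_pinfty_gt.
  rewrite sub0r normrN ger0_norm ?powR_ge0// powRN.
  rewrite -[e]invrK lef_pV2 ?posrE ?powR_gt0 ?invr_gt0//.
  have -> : e^-1 = (e^-1 `^ (y^-1)) `^ y by rewrite -powRrM mulVf ?gt_eqF// powRr1 ?invr_ge0// ltW.
  apply: ge0_ler_powR; rewrite ?nnegrE ?powR_ge0 ?(ltW y0) ?(ltW t0)//.
- move=> x x1; apply: derivableM => //.
  by apply: derivable_powR; rewrite in_itv /= andbT (lt_trans _ x1).
- apply: cvg_at_right_filter; apply: cvgMr.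
  exact: continuous_powRl.
- move=> x; rewrite in_itv /= andbT => x1.
  have x0 : 0 < x by rewrite (lt_trans _ x1).
  have [_ dx] := is_derive1_powR (- y) x0.
  rewrite derive1E deriveM//; last by apply: derivable_powR; rewrite in_itv /= andbT.
  by rewrite dx derive_cst scaler0 addr0 /GRing.scale /=; field; rewrite gt_eqF.
Unshelve. all: by end_near. Qed.

(** The substitution [t -> 1/t], obtained from [homogeneous_swap] on the line itself, where [k = 1],
    with a function [G] of integral [1]. *)
Lemma ipos_inv (w : R -> R) : measurable_fun [set: R] w -> (forall t, 0 <= w t) ->
  ipos (fun t => w t^-1 * t `^ (- 2)) = ipos w.
Proof.
move=> mw w0.
have mG : measurable_fun [set: R] (fun t : R => (1 <= t)%R%:R * t `^ (- 1 - 1)).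
  by apply: measurable_funM; [exact: measurable_ge|exact: measurable_powR].
have G0 (t : R) : 0 <= (1 <= t)%R%:R * t `^ (- 1 - 1) by rewrite mulr_ge0// powR_ge0.
pose N (s : measurableTypeR R) : R := s.
have mN : measurable_fun setT N by exact: measurable_id.
have hom (H : R -> R) (c : R) : measurable_fun setT H -> (forall t, 0 <= H t) -> 0 < c ->
    inorm leb1 N (fun t => H (c * t)) = ((c `^ (- 1))%:E * inorm leb1 N H)%E.
  move=> mH H0 c0; rewrite powR_inv1 ?(ltW c0)//.
  have E1 (K : R -> R) : inorm leb1 N K = ipos K by [].
  rewrite !E1 -(ipos_scale c0 mH); last by move=> t _; exact: H0.
  by rewrite muleA -EFinM mulVf ?gt_eqF// mul1e.
have := homogeneous_swap (mu := leb1) (k := 1) mN hom mG mw G0 w0.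
have E1 (K : R -> R) : inorm leb1 N K = ipos K by [].
rewrite !E1 ipos_tail// invr1 mul1e.
rewrite (@eq_ipos _ (fun t => (1 <= t)%R%:R * t `^ (- 1 - 1) * t `^ (1 - 1))
   (fun t => (1 <= t)%R%:R * t `^ (- 1 - 1))); last first.
  by move=> t _; rewrite subrr powRr0 mulr1.
rewrite ipos_tail// invr1 mul1e => <-.
by apply: eq_ipos => t _; rewrite (_ : -2 = - 1 - 1 :> R)//; ring.
Qed.

Lemma ipos_head (x : R) : 0 < x ->
  ipos (fun t => (t <= 1)%R%:R * t `^ (x - 1)) = (x^-1)%:E.
Proof.
move=> x0; rewrite -(ipos_tail x0) -ipos_inv; first last.
- by move=> t; rewrite mulr_ge0// powR_ge0.
- by apply: measurable_funM; [exact: measurable_le|exact: measurable_powR].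
apply: eq_ipos => t t0; rewrite invf_le1// -mulrA; congr (_ * _).
rewrite -powR_inv1 ?(ltW t0)// -powRrM -powRD ?(gt_eqF t0) ?implybT//.
by congr (_ `^ _); ring.
Qed.

End PowerIntegrals.

(** * Gamma and beta integrals *)

Section EulerIntegrals.
Variable R : realType.
Local Notation leb1 := (@lebesgue_measure R).

Lemma expR_ge_pow (N : nat) (t : R) : (0 < N)%N -> 0 <= t -> t ^+ N <= N%:R ^+ N * expR t.
Proof.
move=> N0 t0; have n0 : (0 : R) < N%:R by rewrite ltr0n.
have -> : expR t = expR (t / N%:R) ^+ N.
  by rewrite -expRM_natl; congr expR; field; rewrite gt_eqF.
rewrite -exprMn; apply: lerXn2r; rewrite ?nnegrE ?mulr_ge0 ?expR_ge0 ?(ltW n0)//.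
apply: (@le_trans _ _ (N%:R * (t / N%:R))).
  by rewrite mulrCA divff ?gt_eqF// mulr1.
rewrite ler_pM2l//; apply: le_trans (expR_ge1Dx _).
by rewrite lerDr.
Qed.

Lemma powR_expR_le (a : R) : exists2 C : R, 0 <= C &
  forall t : R, 1 <= t -> t `^ a * expR (- t) <= C.
Proof.
pose N := (Num.truncn `|a|).+1; exists (N%:R ^+ N); first by rewrite exprn_ge0.
move=> t t1; have t0 : 0 <= t by rewrite (le_trans ler01).
rewrite expRN ler_pdivrMr ?expR_gt0//; apply: le_trans (expR_ge_pow _ t0) => //.
rewrite -powR_mulrn//; apply: ler_powR => //; apply: le_trans (ler_norm a) _.
exact/ltW/truncnS_gt.
Qed.

Lemma measurable_expRN : measurable_fun [set: R] (fun t : R => expR (- t)).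
Proof. by apply: measurableT_comp => //; exact: measurable_funN. Qed.

Lemma measurable_gamma (x : R) : measurable_fun [set: R] (fun t : R => t `^ (x - 1) * expR (- t)).
Proof. by apply: measurable_funM; [exact: measurable_powR|exact: measurable_expRN]. Qed.

(** [Gamma] is defined through [fine], so the content is convergence: the integrand is at most
    [t^(x-1)] up to [1] and a multiple of [t^(-2)] beyond. *)
Lemma ipos_gamma (x : R) : 0 < x ->
  ipos (fun t => t `^ (x - 1) * expR (- t)) = (Gamma x)%:E.
Proof.
move=> x0; rewrite /Gamma /Rintegral -iposE fineK// ge0_fin_numE; last first.
  by apply: ipos_ge0 => t t0; rewrite mulr_ge0 ?powR_ge0 ?expR_ge0.
have [C C0 hC] := powR_expR_le (x + 1).
pose f1 (t : R) : R := (t <= 1)%R%:R * t `^ (x - 1).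
pose f2 (t : R) : R := (1 <= t)%R%:R * t `^ (- 1 - 1).
have m1 : measurable_fun [set: R] f1.
  by apply: measurable_funM; [exact: measurable_le|exact: measurable_powR].
have m2 : measurable_fun [set: R] f2.
  by apply: measurable_funM; [exact: measurable_ge|exact: measurable_powR].
have f10 (t : R) : 0 <= f1 t by rewrite mulr_ge0// powR_ge0.
have f20 (t : R) : 0 <= f2 t by rewrite mulr_ge0// powR_ge0.
have mCf : measurable_fun [set: R] (fun t => C * f2 t) by exact: measurable_funM.
have h : (ipos (fun t => f1 t + C * f2 t)%R < +oo)%E.
  rewrite iposD//; last by move=> t _; rewrite mulr_ge0.
  by rewrite iposZ// (ipos_head x0) ipos_tail// -EFinM -EFinD ltry.
apply: le_lt_trans h; apply: le_ipos => //; first exact: measurable_gamma.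
  exact: measurable_funD.
move=> t t0; rewrite mulr_ge0 ?powR_ge0 ?expR_ge0//=.
rewrite /f1 /f2; have [t1|t1] := leP t 1.
  rewrite mul1r ler_wpDr ?mulr_ge0 ?powR_ge0//.
  by rewrite ler_piMr ?powR_ge0// -expR0 ler_expR oppr_le0 ltW.
rewrite mul0r add0r (ltW t1) mul1r.
have -> : t `^ (x - 1) = t `^ (x + 1) * t `^ (- 1 - 1).
  by rewrite -powRD ?(gt_eqF t0) ?implybT//; congr (_ `^ _); ring.
by rewrite mulrAC ler_wpM2r ?powR_ge0// hC// ltW.
Qed.

Lemma Gamma_gt0 (x : R) : 0 < x -> 0 < Gamma x.
Proof.
move=> x0; rewrite -lte_fin -(ipos_gamma x0).
apply: (@lt_le_trans _ _ ((expR (- 1))%:E * (x^-1)%:E)%E).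
  by rewrite -EFinM lte_fin mulr_gt0 ?expR_gt0 ?invr_gt0.
have m1 : measurable_fun [set: R] (fun t : R => (t <= 1)%R%:R * t `^ (x - 1)).
  by apply: measurable_funM; [exact: measurable_le|exact: measurable_powR].
rewrite -(ipos_head x0) -iposZ ?expR_ge0//; last first.
  by move=> t _; rewrite mulr_ge0// powR_ge0.
apply: le_ipos; [exact: measurable_funM|exact: measurable_gamma|].
move=> t t0; rewrite !mulr_ge0 ?powR_ge0 ?expR_ge0//=.
have [t1|t1] := leP t 1; last by rewrite mul0r mulr0 mulr_ge0 ?powR_ge0 ?expR_ge0.
by rewrite mul1r mulrC ler_wpM2l ?powR_ge0// ler_expR lerN2.
Qed.

Lemma measurable_shiftR (a : R) : measurable_fun [set: R] (fun t : R => (1 + t) `^ a).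
Proof.
by apply: (measurableT_comp (@measurable_powR _ a)); exact: measurable_funD.
Qed.

(** Euler's beta integral over the half-line, with value [B(x, y)]. This is the form in which the
    expansion of the radial integral produces beta functions. *)
Definition ibeta (x y : R) : \bar R := ipos (fun t => t `^ (x - 1) * (1 + t) `^ (- (x + y))).

(* Tonelli for [t^(x-1) s^(x+y-1) e^(-s(1+t))]. *)
Lemma ibetaM (x y : R) : 0 < x -> 0 < y ->
  (ibeta x y * (Gamma (x + y))%:E = (Gamma x * Gamma y)%:E)%E.
Proof.
move=> x0 y0; have xy0 : 0 < x + y by exact: addr_gt0.
have mp a := @measurable_powRl R a.
have ms := measurable_expRN.
pose F (z : measurableTypeR R * measurableTypeR R) : R := (0 < z.1)%R%:R * ((0 < z.2)%R%:R *
   (z.1 `^ (x - 1) * (z.2 `^ (x + y - 1) * expR (- (z.2 * (1 + z.1)))))).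
have mT1 : measurable_fun setT (fun z : measurableTypeR R * measurableTypeR R => z.1 : R) by exact: measurable_fst.
have mT2 : measurable_fun setT (fun z : measurableTypeR R * measurableTypeR R => z.2 : R) by exact: measurable_snd.
have mF : measurable_fun setT (EFin \o F).
  apply/measurable_EFinP; apply: measurable_funM; first exact: measurable_pos.
  apply: measurable_funM; first exact: measurable_pos.
  apply: measurable_funM; first exact: (measurableT_comp (mp _) mT1).
  apply: measurable_funM; first exact: (measurableT_comp (mp _) mT2).
  apply: (measurableT_comp ms); apply: measurable_funM => //.
  exact: measurable_funD.
have F0 z : (0 <= (EFin \o F) z)%E by rewrite lee_fin /F !mulr_ge0 ?powR_ge0 ?expR_ge0.
have lhs : (\int[leb1]_t \int[leb1]_s (EFin \o F) (t, s) = ibeta x y * (Gamma (x + y))%:E)%E.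
  rewrite /ibeta /ipos -ge0_integralZr//; first last.
  - by rewrite lee_fin ltW// Gamma_gt0.
  - by move=> t _; rewrite lee_fin !mulr_ge0 ?powR_ge0.
  - apply/measurable_EFinP; apply: measurable_posM; apply: measurable_funM => //.
    exact: measurable_shiftR.
  apply: eq_integral => t _; rewrite /F /=.
  have [t0|t0] := ltrP 0 t; last first.
    by under eq_integral do rewrite mul0r; rewrite integral0 mul0r mul0e.
  have t1 : 0 < 1 + t by rewrite addr_gt0.
  under eq_integral do rewrite mul1r.
  rewrite -/(ipos (fun s => t `^ (x - 1) * (s `^ (x + y - 1) * expR (- (s * (1 + t)))))).
  have pos (s : R) : 0 <= s `^ (x + y - 1) * expR (- s) by rewrite mulr_ge0 ?powR_ge0 ?expR_ge0.
  have mg := measurable_gamma (x + y).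
  have mgc : measurable_fun [set: R]
      (fun s => (1 + t) * s `^ (x + y - 1) * expR (- ((1 + t) * s))).
    apply: measurable_funM; first exact: measurable_funM.
    by apply: (measurableT_comp ms); exact: measurable_funM.
  rewrite -(ipos_gamma xy0) -(ipos_scale t1 mg) // muleA -EFinM -iposZ.
  - apply: eq_ipos => s s0; rewrite mul1r powRM ?(ltW t1) ?(ltW s0)// [s * (1 + t)]mulrC.
    have h : (1 + t) `^ (- (x + y)) * (1 + t) * (1 + t) `^ (x + y - 1) = 1.
      rewrite -[X in _ * X * _]powRr1 ?(ltW t1)// -!powRD ?(gt_eqF t1) ?implybT//.
      by rewrite [X in _ `^ X](_ : _ = 0) ?powRr0//; ring.
    by rewrite -[LHS]mul1r -[X in X * _ = _]h; ring.
  - by rewrite !mulr_ge0 ?powR_ge0// ltW.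
  - apply: measurable_funM.
      by apply: (measurableT_comp (mp _)); exact: measurable_funM.
    by apply: (measurableT_comp ms); exact: measurable_funM.
  - by move=> s _; rewrite !mulr_ge0 ?powR_ge0 ?expR_ge0.
have rhs : (\int[leb1]_s \int[leb1]_t (EFin \o F) (t, s) = (Gamma x * Gamma y)%:E)%E.
  rewrite EFinM -(ipos_gamma y0) muleC /ipos -ge0_integralZr//; first last.
  - by rewrite lee_fin ltW// Gamma_gt0.
  - by move=> t _; rewrite lee_fin !mulr_ge0 ?powR_ge0 ?expR_ge0.
  - by apply/measurable_EFinP; apply: measurable_posM; exact: measurable_gamma.
  apply: eq_integral => s _; rewrite /F /=.
  have [s0|s0] := ltrP 0 s; last first.
    by under eq_integral do rewrite mul0r mulr0; rewrite integral0 mul0r mul0e.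
  under eq_integral do rewrite mul1r.
  rewrite -/(ipos (fun t => t `^ (x - 1) * (s `^ (x + y - 1) * expR (- (s * (1 + t)))))).
  have pos (t : R) : 0 <= t `^ (x - 1) * expR (- t) by rewrite mulr_ge0 ?powR_ge0 ?expR_ge0.
  have mg := measurable_gamma x.
  rewrite -(ipos_gamma x0) -(ipos_scale s0 mg) // muleA -EFinM -iposZ.
  - apply: eq_ipos => t t0; rewrite mul1r powRM ?(ltW t0) ?(ltW s0)// mulrDr mulr1 opprD expRD.
    have -> : s `^ (x + y - 1) = s `^ (y - 1) * s * s `^ (x - 1).
      rewrite -[X in _ * X * _]powRr1 ?(ltW s0)// -!powRD ?(gt_eqF s0) ?implybT//.
      by congr (_ `^ _); ring.
    by ring.
  - by rewrite !mulr_ge0 ?powR_ge0 ?expR_ge0// ltW.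
  - apply: measurable_funM.
      by apply: (measurableT_comp (mp _)); exact: measurable_funM.
    by apply: (measurableT_comp ms); exact: measurable_funM.
  - by move=> t _; rewrite !mulr_ge0 ?powR_ge0 ?expR_ge0.
rewrite -lhs -rhs.
exact: (@fubini_tonelli _ _ _ _ _ leb1 leb1 _ mF F0).
Qed.

Lemma ipos_translate1 (f : R -> R) : measurable_fun [set: R] f -> (forall t, 0 < t -> 0 <= f t) ->
  ipos f = ipos (fun t => (0 < t - 1)%R%:R * f (t - 1)).
Proof.
move=> mf f0; rewrite /ipos.
rewrite -(@integral_translate R (- 1) (fun t => ((0 < t)%R%:R * f t)%:E)); first last.
- by move=> t; rewrite lee_fin; have [t0|t0] := ltrP 0 t; rewrite ?mul0r ?mul1r// f0.
- by apply/measurable_EFinP; exact: measurable_posM.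
apply: eq_integral => t _; congr EFin.
have [t0|t0] := ltrP 0 (t - 1); rewrite ?mul0r ?mulr0// !mul1r.
by rewrite (_ : 0 < t) ?mul1r//; move: t0; lra.
Qed.

(** The substitution [s = 1/(1 + t)], carried out as a translation by [1] followed by inversion; it
    interchanges the two arguments, which [BetaC] later puts back. *)
Lemma BetaE (x y : R) : 0 < x -> 0 < y -> (Beta x y)%:E = ibeta y x.
Proof.
move=> x0 y0; have xy0 : 0 < y + x by exact: addr_gt0.
pose w (t : R) : R := (0 < 1 - t)%R%:R * (t `^ (x - 1) * (1 - t) `^ (y - 1)).
have mw1 : measurable_fun [set: R] (fun t : R => t `^ (x - 1) * (1 - t) `^ (y - 1)).
  apply: measurable_funM => //.
  by apply: (measurableT_comp (@measurable_powR _ _)); exact: measurable_funB.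
have mw : measurable_fun [set: R] w.
  apply: measurable_funM => //.
  by apply: (@measurable_pos _ _ (measurableTypeR R)); exact: measurable_funB.
have w0 (t : R) : 0 <= w t by rewrite !mulr_ge0 ?powR_ge0.
have E : ibeta y x = ipos w.
  rewrite -(ipos_inv mw w0) /ibeta ipos_translate1; first last.
  - by move=> t _; rewrite mulr_ge0 ?powR_ge0.
  - by apply: measurable_funM => //; exact: measurable_shiftR.
  apply: eq_ipos => t t0; rewrite /w !subr_gt0 invf_lt1//.
  have [t1|_] := ltP 1 t; last by rewrite !mul0r.
  have t10 : 0 < t - 1 by rewrite subr_gt0.
  rewrite !mul1r (_ : 1 - t^-1 = (t - 1) * t^-1); last by field; rewrite gt_eqF.
  rewrite powRM ?(ltW t10) ?invr_ge0 ?(ltW t0)// (_ : 1 + (t - 1) = t); last by ring.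
  have tV a : t^-1 `^ (a - 1) = t `^ (1 - a).
    by rewrite -powR_inv1 ?(ltW t0)// -powRrM; congr (_ `^ _); ring.
  have e : t `^ (- (y + x)) = t `^ (1 - x) * t `^ (1 - y) * t `^ (- 2).
    by rewrite -!powRD ?(gt_eqF t0) ?implybT//; congr (_ `^ _); ring.
  by rewrite !tV e; ring.
have fin : ibeta y x \is a fin_num.
  have := ibetaM y0 x0.
  have g0 := Gamma_gt0 xy0.
  rewrite ge0_fin_numE ?ipos_ge0//; last by move=> t _; rewrite mulr_ge0 ?powR_ge0.
  case: (ibeta y x) => [r| |] //; first by rewrite ltry.
  by rewrite mulyr gtr0_sg// mul1e.
rewrite -[RHS](fineK fin) E /Beta /Rintegral; congr (fine _)%:E.
rewrite -integral_itv_obnd_cbnd; last first.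
  by apply/measurable_EFinP; apply: measurable_funTS.
rewrite -integral_itv_bndo_bndc; last first.
  by apply/measurable_EFinP; apply: measurable_funTS.
rewrite integral_mkcond; apply: eq_integral => t _; rewrite patchE.
case: ifP => [|/negP]; rewrite inE /= in_itv /=.
  by move=> /andP[t0 t1]; rewrite /w t0 subr_gt0 t1 !mul1r.
by move=> /negP; rewrite /w subr_gt0; case: (0 < t) => /=; rewrite ?mul0r// => /negbTE ->; rewrite mul0r mulr0.
Qed.

Lemma ipos_ge1 (f : R -> R) : measurable_fun [set: R] f ->
  ipos (fun t => (0 < t - 1)%R%:R * f t) = ipos (fun t => (1 <= t)%R%:R * f t).
Proof.
move=> mf; transitivity (\int[leb1]_(t in `]1%R, +oo[) (f t)%:E)%E.
  rewrite [RHS]integral_mkcond; apply: eq_integral => t _; rewrite patchE subr_gt0.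
  case: ifP => [|/negP]; rewrite inE /= in_itv /= andbT.
    by move=> t1; rewrite t1 (lt_trans ltr01 t1) !mul1r.
  by move=> /negP /negbTE ->; rewrite mul0r mulr0.
rewrite integral_itv_obnd_cbnd; last by apply/measurable_EFinP; exact: measurable_funTS.
rewrite integral_mkcond; apply: eq_integral => t _; rewrite patchE.
case: ifP => [|/negP]; rewrite inE /= in_itv /= andbT.
  by move=> t1; rewrite t1 (lt_le_trans ltr01 t1) !mul1r.
by move=> /negP /negbTE ->; rewrite mul0r mulr0.
Qed.

Local Opaque Gamma Beta.

Lemma BetaM (x y : R) : 0 < x -> 0 < y -> Beta x y * Gamma (x + y) = Gamma x * Gamma y.
Proof.
move=> x0 y0; have h := ibetaM y0 x0; rewrite -(BetaE x0 y0) -EFinM in h.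
by rewrite addrC (EFin_inj h); exact: mulrC.
Qed.

Lemma Beta_gt0 (x y : R) : 0 < x -> 0 < y -> 0 < Beta x y.
Proof.
move=> x0 y0; have h := BetaM x0 y0.
have g := Gamma_gt0 (addr_gt0 x0 y0); have gx := Gamma_gt0 x0; have gy := Gamma_gt0 y0.
move: (Gamma x) (Gamma y) (Gamma (x + y)) (Beta x y) h g gx gy => a b c d h c0 a0 b0.
by rewrite -(pmulr_lgt0 _ c0) h; exact: mulr_gt0.
Qed.

Lemma BetaC (x y : R) : 0 < x -> 0 < y -> Beta x y = Beta y x.
Proof.
move=> x0 y0; have h := BetaM x0 y0; have h' := BetaM y0 x0; rewrite addrC in h'.
have g := Gamma_gt0 (addr_gt0 x0 y0).
move: (Gamma x) (Gamma y) (Gamma (x + y)) (Beta x y) (Beta y x) h h' g => a b c d e h h' c0.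
by apply: (mulIf (negbT (gt_eqF c0))); rewrite h h'; exact: mulrC.
Qed.

Lemma ibetaE (x y : R) : 0 < x -> 0 < y -> ibeta x y = (Beta x y)%:E.
Proof. by move=> x0 y0; rewrite -(BetaE y0 x0) (BetaC y0 x0). Qed.

(** Follows from [B(1, x) = 1/x] and the beta-gamma relation. The factor [Gamma 1] is left
    unevaluated, since it cancels in the quotients formed below. *)
Lemma GammaS (x : R) : 0 < x -> Gamma (x + 1) = x * Gamma 1 * Gamma x.
Proof.
move=> x0.
have h : Beta 1 x = x^-1.
  apply: EFin_inj; rewrite -(ibetaE ltr01 x0) /ibeta ipos_translate1; first last.
  - by move=> t _; rewrite mulr_ge0 ?powR_ge0.
  - by apply: measurable_funM; [exact: measurable_powR|exact: measurable_shiftR].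
  rewrite -(ipos_tail x0) -ipos_ge1; last exact: measurable_powR.
  apply: eq_ipos => t _; rewrite subrr powRr0 mul1r (_ : 1 + (t - 1) = t); last by ring.
  by congr (_ * _ `^ _); ring.
have := BetaM ltr01 x0; rewrite h [1 + x]addrC.
move: (Gamma x) (Gamma 1) (Gamma (x + 1)) => a b c e.
by rewrite -mulrA -e mulrA divff ?mul1r// gt_eqF.
Qed.

Lemma Beta_add1 (x y : R) : 0 < x -> 0 < y ->
  Beta (x + 1) (y + 1) * ((x + y) * (x + y + 1)) = x * y * Beta x y.
Proof.
move=> x0 y0; have xy0 := addr_gt0 x0 y0.
have x1 := addr_gt0 x0 (@ltr01 R); have y1 := addr_gt0 y0 (@ltr01 R).
have xy1 := addr_gt0 xy0 (@ltr01 R).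
have g := Gamma_gt0 xy0; have g1 := Gamma_gt0 (@ltr01 R).
have h := BetaM x1 y1; have h' := BetaM x0 y0.
rewrite (_ : x + 1 + (y + 1) = x + y + 1 + 1) in h; last by ring.
rewrite (GammaS x0) (GammaS y0) (GammaS xy1) (GammaS xy0) in h.
move: (Beta (x + 1) _) (Beta x y) (Gamma x) (Gamma y) (Gamma (x + y)) (Gamma 1) g g1 h h'.
move=> b1 b gx gy gxy c gxy0 c0 h h'.
apply: (mulIf (negbT (gt_eqF (mulr_gt0 (mulr_gt0 c0 c0) gxy0)))).
transitivity (x * c * gx * (y * c * gy)); first by rewrite -h; ring.
by transitivity (x * y * (c * c) * (b * gxy)); [rewrite h'; ring|ring].
Qed.

End EulerIntegrals.

(** * Radial integrals on the whole space *)

Section RadialIntegrals.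
Variable R : realType.
Local Notation leb1 := (@lebesgue_measure R).

Definition scalet n (c : R) (x : n.-tuple R) : n.-tuple R := [tuple c * tnth x i | i < n].

Lemma measurable_scalet n (c : R) : measurable_fun setT (@scalet n c).
Proof.
apply/measurable_fun_tnthP => i.
rewrite (_ : _ \o _ = fun x : n.-tuple R => c * tnth x i).
  by apply: measurable_funM => //; exact: measurable_tnthT.
by apply/funext => x /=; rewrite tnth_mktuple.
Qed.

Lemma scalet_tcons n (c t : R) (x : n.-tuple R) :
  scalet c (tcons (t, x)) = tcons (c * t, scalet c x).
Proof.
apply: eq_from_tnth => i; rewrite tnth_mktuple; case: (unliftP ord0 i) => [j ->|->].
  by rewrite !tnth_tconsS tnth_mktuple.
by rewrite !tnth_tcons0.
Qed.

Lemma integral_scalet n (c : R) (F : n.-tuple R -> \bar R) : 0 < c ->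
  measurable_fun setT F -> (forall x, 0 <= F x)%E ->
  ((c ^+ n)%:E * \int[lebm (n := n)]_x F (scalet c x) = \int[lebm (n := n)]_x F x)%E.
Proof.
move=> c0; elim: n F => [|n IH] F mF F0.
  rewrite expr0 mul1e; apply: eq_integral => x _; congr F.
  by apply: eq_from_tnth; case.
have mFs : measurable_fun setT (fun x => F (scalet c x)).
  exact: (measurableT_comp mF (@measurable_scalet n.+1 c)).
have mFt (t : R) : measurable_fun setT (fun x : n.-tuple R => F (tcons (t, x))).
  apply: (measurableT_comp mF); apply: (measurableT_comp (@measurable_tcons R n)).
  exact: measurable_pair1.
rewrite [LHS](_ : _ = ((c ^+ n.+1)%:E *
    \int[leb1]_t \int[lebm (n := n)]_x F (scalet c (tcons (t, x))))%E); last first.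
  by congr (_ * _)%E; apply: integral_lebS => // x; exact: F0.
rewrite [RHS]integral_lebS//.
pose G (t : R) := (\int[lebm (n := n)]_x F (tcons (t, x)))%E.
have G0 t : (0 <= G t)%E by apply: integral_ge0 => x _; exact: F0.
have mG : measurable_fun setT G.
  apply: (@measurable_fun_fubini_tonelli_F _ _ _ _ _ (lebm (n := n)) (fun z => F (tcons z))) => //.
  exact: (measurableT_comp mF (@measurable_tcons R n)).
transitivity (c%:E * \int[leb1]_t G (c * t + 0)%R)%E; last exact: integral_affine.
rewrite exprS EFinM -muleA; congr (_ * _)%E.
have eG (t : R) : G (c * t + 0)%R =
    ((c ^+ n)%:E * \int[lebm (n := n)]_x F (scalet c (tcons (t, x))))%E.
  rewrite addr0 /G -IH//; congr (_ * _)%E.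
  by apply: eq_integral => x _; rewrite scalet_tcons.
rewrite -ge0_integralZl_EFin.
- by apply: eq_integral => t _; rewrite eG.
- by [].
- by move=> t _; apply: integral_ge0 => x _; exact: F0.
- apply: (@measurable_fun_fubini_tonelli_F _ _ _ _ _ (lebm (n := n))
    (fun z => F (scalet c (tcons z)))) => //.
  exact: (measurableT_comp mFs (@measurable_tcons R n)).
- by rewrite exprn_ge0// ltW.
Qed.

Lemma dotp_scalet n (c : R) (x : n.-tuple R) : dotp (scalet c x) (scalet c x) = c ^+ 2 * dotp x x.
Proof.
by rewrite /dotp mulr_sumr; apply: eq_bigr => i _; rewrite !tnth_mktuple expr2; ring.
Qed.

Lemma dotp_ge0 n (x : n.-tuple R) : 0 <= dotp x x.
Proof. by apply: sumr_ge0 => i _; rewrite -expr2 sqr_ge0. Qed.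

Lemma ae_dotp_gt0 n : (0 < n)%N -> {ae lebm (n := n), forall x : n.-tuple R, 0 < dotp x x}.
Proof.
move=> n0; exists [set x | forall i : 'I_n, [set 0] (tnth x i)]; split.
- by apply: (@measurable_box R n (fun=> [set 0])) => i; exact: measurable_set1.
- rewrite /lebm (@leb_box R n (fun=> [set 0])); last by move=> i; exact: measurable_set1.
  rewrite (bigD1 (Ordinal n0))//=.
  have -> : lebesgue_measure [set 0 : R] = 0%E by exact: lebesgue_measure_set1.
  by rewrite mul0e.
- move=> x /= /negP; rewrite -leNgt => x0 i.
  have /eqP := le_anti (introT andP (conj x0 (dotp_ge0 x))).
  rewrite psumr_eq0; last by move=> j _; rewrite -expr2 sqr_ge0.
  move=> /allP /(_ i); rewrite mem_index_enum => /(_ isT).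
  by rewrite mulf_eq0 orbb => /eqP.
Qed.

Lemma integral_gauss n :
  (\int[lebm (n := n)]_x (expR (- dotp x x)%R)%:E = ((pi : R) `^ (n%:R / 2))%:E)%E.
Proof.
transitivity (\int[lebm (n := n)]_x (\prod_(i < n) @gauss_fun R (tnth x i))%R%:E)%E.
  apply: eq_integral => x _; congr EFin.
  by rewrite /gauss_fun -expR_sum /dotp -sumrN.
rewrite (@integral_prod R n (fun=> @gauss_fun R)); first last.
- by move=> _ t; exact: gauss_fun_ge0.
- by move=> _; exact: measurable_gauss_fun.
rewrite (eq_bigr (fun=> (Num.sqrt pi)%:E)); last by move=> i _; exact: integralT_gauss.
rewrite prodEFin prodr_const card_ord -powR12_sqrt ?pi_ge0// -powR_mulrn ?powR_ge0//.
by rewrite -powRrM mulrC.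
Qed.

(* Both constants are obtained from the same kernel [w u = exp (- u^(1/m))]:
   on the half-line with the function [s^m], and on [R^n] with [(|x|^2)^m]. *)
Lemma ipos_stretched_gamma (m v : R) : 0 < m -> 0 < v ->
  ipos (fun t => expR (- (t^-1 `^ m^-1)) * t `^ (- (v / m) - 1)) = (m * Gamma v)%:E.
Proof.
move=> m0 v0.
pose N (s : measurableTypeR R) : R := (0 < s)%R%:R * s `^ m.
have mN : measurable_fun setT N by apply: measurable_posM; exact: measurable_powR.
have NE (H : R -> R) : inorm leb1 N H = ipos (fun s => H (s `^ m)).
  apply: eq_integral => s _; rewrite /N; have [s0|s0] := ltrP 0 s.
    by rewrite !mul1r powR_gt0// mul1r.
  by rewrite !mul0r ltxx mul0r.
have hom (H : R -> R) (c : R) : measurable_fun setT H -> (forall t, 0 <= H t) -> 0 < c ->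
    inorm leb1 N (fun t => H (c * t)) = ((c `^ (- m^-1))%:E * inorm leb1 N H)%E.
  move=> mH H0 c0; rewrite !NE.
  have c'0 : 0 < c `^ m^-1 by exact: powR_gt0.
  have mHm : measurable_fun [set: R] (fun s : R => H (s `^ m)).
    exact: (measurableT_comp mH (@measurable_powR _ m)).
  rewrite -(ipos_scale c'0 mHm) => [|t _]; last exact: H0.
  rewrite muleA -EFinM powRN mulVf ?gt_eqF// mul1e.
  apply: eq_ipos => s s0; rewrite powRM ?powR_ge0 ?(ltW s0)//.
  by rewrite -powRrM mulVf ?gt_eqF// powRr1// ltW.
(* At [u = s^m] the factor [u^e] becomes [s^(v-1)], so that the integral of [w] is the one defining
   [Gamma v]. *)
pose e := (v - 1) / m.
pose G (u : R) : R := (1 <= u)%R%:R * u `^ (- 1 - m^-1).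
pose w (u : R) : R := expR (- (u `^ m^-1)) * u `^ e.
have mG : measurable_fun [set: R] G.
  by apply: measurable_funM; [exact: measurable_ge|exact: measurable_powR].
have mw : measurable_fun [set: R] w.
  apply: measurable_funM; last exact: measurable_powR.
  exact: (measurableT_comp (@measurable_expRN R) (@measurable_powR _ _)).
have G0 (u : R) : 0 <= G u by rewrite mulr_ge0 ?powR_ge0.
have w0 (u : R) : 0 <= w u by rewrite mulr_ge0 ?powR_ge0 ?expR_ge0.
have iG : inorm leb1 N G = (m^-1)%:E.
  rewrite NE -(ipos_tail m0); apply: eq_ipos => s s0; rewrite /G -powRrM.
  have -> : (1 <= s `^ m) = (1 <= s).
    have e1 : (1 : R) = 1 `^ m by rewrite powR1.
    rewrite [X in X <= s `^ m]e1.
    have [s1|s1] := leP 1 s; first by apply: ge0_ler_powR; rewrite ?nnegrE// ltW.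
    by apply/negbTE; rewrite -ltNge; apply: gt0_ltr_powR; rewrite ?nnegrE// ltW.
  by congr (_ * _ `^ _); field; rewrite gt_eqF.
have iw : inorm leb1 N w = (Gamma v)%:E.
  rewrite NE -(ipos_gamma v0); apply: eq_ipos => s s0; rewrite /w -!powRrM.
  rewrite mulfV ?gt_eqF// powRr1 ?(ltW s0)// mulrC; congr (_ `^ _ * _).
  by rewrite /e; field; rewrite gt_eqF.
have := homogeneous_swap mN hom mG mw G0 w0; rewrite iG iw.
rewrite (@eq_ipos _ (fun u => G u * u `^ (m^-1 - 1)) (fun u => (1 <= u)%R%:R * u `^ (- 1 - 1))).
  rewrite (ipos_tail ltr01) invr1 mul1e.
  rewrite (@eq_ipos _ (fun t => w t^-1 * t `^ (- m^-1 - 1))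
    (fun t => expR (- (t^-1 `^ m^-1)) * t `^ (- (v / m) - 1))).
    move=> h; rewrite EFinM -h muleA -EFinM mulfV ?gt_eqF// mul1e.
    by [].
  move=> t t0; rewrite /w -mulrA; congr (_ * _).
  rewrite -powR_inv1 ?(ltW t0)// -powRrM -powRD ?(gt_eqF t0) ?implybT//.
  by congr (_ `^ _); rewrite /e; field; rewrite gt_eqF.
move=> u u0; rewrite /G -mulrA -powRD ?(gt_eqF u0) ?implybT//.
by congr (_ * _ `^ _); ring.
Qed.

Lemma integral_radial n (m : R) (G : R -> R) : (0 < n)%N -> 0 < m ->
  measurable_fun [set: R] G -> (forall t, 0 <= G t) ->
  ((\int[lebm (n := n)]_x (G (dotp x x `^ m))%:E) * (m * Gamma (n%:R / 2))%:E =
   (pi `^ (n%:R / 2))%:E * ipos (fun u => G u * u `^ (n%:R / (2 * m) - 1))%R)%E.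
Proof.
move=> n0 m0 mG G0; have n20 : (0 : R) < n%:R / 2 by rewrite divr_gt0// ltr0n.
pose N (x : n.-tuple R) : R := dotp x x `^ m.
have mN : measurable_fun setT N.
  apply: (measurableT_comp (@measurable_powR _ m)).
  by apply: measurable_dotp; exact: measurable_id.
pose mu := lebm (R := R) (n := n).
have NE (H : R -> R) : measurable_fun [set: R] H -> (forall t, 0 <= H t) ->
    inorm mu N H = (\int[mu]_x (H (N x))%:E)%E.
  move=> mH H0; have mHN := measurableT_comp mH mN.
  apply: ae_eq_integral => //.
  - by apply/measurable_EFinP; exact: measurable_inorm.
  - by apply/measurable_EFinP.
  - apply: filterS (ae_dotp_gt0 n0) => x x0 _.
    by rewrite /N powR_gt0// mul1r.
have hom (H : R -> R) (c : R) : measurable_fun setT H -> (forall t, 0 <= H t) -> 0 < c ->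
    inorm mu N (fun t => H (c * t)) = ((c `^ (- (n%:R / (2 * m))))%:E * inorm mu N H)%E.
  move=> mH H0 c0.
  have mHc : measurable_fun [set: R] (fun t => H (c * t)).
    by apply: (measurableT_comp mH); exact: measurable_funM.
  (* Dilating [x] by [d = c^(1/(2m))] multiplies [|x|^(2m)] by [c] and the volume by
     [d^n = c^(n/(2m))]. *)
  rewrite !NE//; pose d := c `^ (2 * m)^-1; have d0 : 0 < d by exact: powR_gt0.
  rewrite -(@integral_scalet n d (fun x => (H (N x))%:E) d0).
  - rewrite muleA -EFinM -powR_mulrn ?(ltW d0)// -powRrM.
    rewrite (_ : c `^ (- (n%:R / (2 * m))) * c `^ ((2 * m)^-1 * n%:R) = 1); last first.
      rewrite -powRD ?(gt_eqF c0) ?implybT// [X in _ `^ X](_ : _ = 0) ?powRr0//.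
      by rewrite mulrC addNr.
    rewrite mul1e; apply: eq_integral => x _; congr (H _)%:E.
    rewrite /N dotp_scalet powRM ?sqr_ge0 ?dotp_ge0//; congr (_ * _).
    rewrite -powR_mulrn ?(ltW d0)// -!powRrM.
    by rewrite [X in _ `^ X](_ : _ = 1) ?powRr1 ?(ltW c0)//; field; rewrite gt_eqF.
  - by apply/measurable_EFinP; exact: measurableT_comp.
  - by move=> x; rewrite lee_fin.
pose w (u : R) : R := expR (- (u `^ m^-1)).
have mw : measurable_fun [set: R] w.
  exact: (measurableT_comp (@measurable_expRN R) (@measurable_powR _ _)).
have w0 (u : R) : 0 <= w u by exact: expR_ge0.
have := homogeneous_swap mN hom mG mw G0 w0.
rewrite NE// NE//.
have -> : (\int[mu]_x (w (N x))%:E = (pi `^ (n%:R / 2))%:E)%E.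
  rewrite -integral_gauss; apply: eq_integral => x _; congr (expR (- _))%:E.
  by rewrite /N -powRrM mulfV ?gt_eqF// powRr1// dotp_ge0.
have -> : ipos (fun t => w t^-1 * t `^ (- (n%:R / (2 * m)) - 1)) = (m * Gamma (n%:R / 2))%:E.
  rewrite -(ipos_stretched_gamma m0 n20); apply: eq_ipos => t t0.
  by rewrite (_ : n%:R / (2 * m) = n%:R / 2 / m)//; field; rewrite gt_eqF.
by move=> ->; rewrite muleC.
Qed.

End RadialIntegrals.

(** * Hypergeometric series *)

Section PowerSeries.
Variable R : realType.
Implicit Types (u : nat -> R) (x : R).

Definition psum u x : R := limn (pseries u x).
Local Notation diffs := (@pseries_diffs R).

(** Coefficient ratios tending to [1], which gives convergence on the open unit interval and is
    inherited by differentiated series. Written multiplicatively rather than as a quotient, it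
    admits vanishing coefficients, hence terminating hypergeometric series. *)
Definition ratio1 u := exists2 r : nat -> R, r @ \oo --> (1 : R) & forall j, u j.+1 = r j * u j.

(** Since [y < 1], eventually [|r j| y <= 1] and the terms stop growing; the finitely many earlier
    ones are bounded by their sum. *)
Lemma ratio1_bounded u (y : R) : ratio1 u -> 0 < y < 1 ->
  exists2 M, 0 <= M & forall j, `|u j * y ^+ j| <= M.
Proof.
move=> [r r1 hu] /andP[y0 y1].
have [N hN] : exists N, forall j, (N <= j)%N -> `|r j| * y <= 1.
  have e0 : 0 < y^-1 - 1 by rewrite subr_gt0 invf_gt1.
  have /cvgrPdist_le /(_ _ e0) [N _ h] := r1.
  exists N => j /h; rewrite /= => hj; rewrite -ler_pdivlMr// mul1r.
  rewrite -[r j](subrK 1) -normrN opprD opprB; apply: le_trans (ler_normD _ _) _.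
  by rewrite normrN1; move: hj; lra.
exists (\sum_(i < N.+1) `|u i * y ^+ i|); first exact: sumr_ge0.
elim=> [|j IH].
  by rewrite big_ord_recl lerDl sumr_ge0.
have [jN|jN] := ltnP j N.
  rewrite (bigD1 (Ordinal (jN : (j.+1 < N.+1)%N)))//= lerDl sumr_ge0//.
apply: le_trans IH; rewrite hu exprS.
rewrite (_ : r j * u j * (y * y ^+ j) = (r j * y) * (u j * y ^+ j)); last by ring.
by rewrite normrM ler_piMl// normrM (ger0_norm (ltW y0)) hN.
Qed.

Lemma ratio1_cvg u x : ratio1 u -> `|x| < 1 -> cvgn (pseries u x).
Proof.
move=> ru x1; pose y := (`|x| + 1) / 2.
have y01 : 0 < y < 1 by have := normr_ge0 x; rewrite /y; lra.
have [M M0 hM] := ratio1_bounded ru y01; case/andP: y01 => y0 y1.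
have q1 : `| `|x| / y| < 1.
  rewrite ger0_norm ?divr_ge0 ?(ltW y0)// ltr_pdivrMr// mul1r.
  by rewrite /y; lra.
apply: normed_cvg; apply: (@series_le_cvg R _ (geometric M (`|x| / y))) => [j|j|j|].
- exact: normr_ge0.
- by rewrite /geometric /= mulr_ge0// exprn_ge0// divr_ge0// ltW.
- rewrite /geometric /= expr_div_n -(ler_pM2r (exprn_gt0 j y0)) -mulrA divfK ?gt_eqF ?exprn_gt0//.
  rewrite normrM normrX mulrAC ler_wpM2r ?exprn_ge0//.
  by have := hM j; rewrite normrM (ger0_norm (exprn_ge0 _ (ltW y0))).
- exact: is_cvg_geometric_series.
Qed.

Lemma psumP u x : ratio1 u -> `|x| < 1 -> pseries u x @ \oo --> psum u x.
Proof. by move=> ru x1; exact: ratio1_cvg. Qed.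

Lemma cvg_harmonic_shift (b : R) : 0 < b -> (fun j : nat => (b + j%:R)^-1) @ \oo --> (0 : R).
Proof.
move=> b0; apply/cvgrPdist_le => e e0; exists (Num.truncn e^-1).+1 => // j /= hj.
have p : 0 < b + j%:R by rewrite ltr_wpDr.
rewrite sub0r normrN ger0_norm ?invr_ge0 ?(ltW p)//.
rewrite invf_ple ?posrE//; apply: le_trans (ltW (truncnS_gt _)) _.
by rewrite -[X in X <= _]add0r lerD ?(ltW b0)// ler_nat.
Qed.

Lemma cvg_ratio1 (a b : R) : 0 < b -> (fun j : nat => (a + j%:R) / (b + j%:R)) @ \oo --> (1 : R).
Proof.
move=> b0; rewrite (_ : (fun _ => _) = (fun j : nat => 1 + (a - b) * (b + j%:R)^-1)).
  rewrite -[X in _ --> X]addr0 -[X in _ --> _ + X](mulr0 (a - b)).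
  by apply: cvgD; [exact: cvg_cst|apply: cvgMr; exact: cvg_harmonic_shift].
by apply/funext => j; field; rewrite gt_eqF// ltr_wpDr.
Qed.

Lemma ratio1_diffs u : ratio1 u -> ratio1 (diffs u).
Proof.
move=> [r r1 hu]; exists (fun j => (2 + j%:R) / (1 + j%:R) * r j.+1).
  rewrite -[X in _ --> X]mul1r; apply: cvgM; first exact: cvg_ratio1.
  by rewrite -cvg_shiftS in r1.
move=> j; rewrite /pseries_diffs hu -natr1 -[j.+1%:R]natr1; field.
by rewrite gt_eqF// ltr_wpDr.
Qed.

Lemma is_derive_psum u x : ratio1 u -> `|x| < 1 -> is_derive x (1 : R) (psum u) (psum (diffs u) x).
Proof.
move=> ru x1; have ru1 := ratio1_diffs ru; have ru2 := ratio1_diffs ru1.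
pose y := (`|x| + 1) / 2.
have y1 : `|y| < 1 by have := normr_ge0 x; rewrite /y => h; rewrite ger0_norm; lra.
apply: (@pseries_snd_diffs R u y); [exact: ratio1_cvg|exact: ratio1_cvg|exact: ratio1_cvg|].
have h := normr_ge0 x; rewrite [X in _ < X]ger0_norm /y; last by move: h; lra.
by move: x1; lra.
Qed.

(** The operator [x d/dx] multiplies the [j]-th coefficient by [j]; in this form the hypergeometric
    equation becomes a relation between coefficients of equal index. *)
Lemma cvg_pseries_nat u x : cvgn (pseries (diffs u) x) ->
  pseries (fun j => j%:R * u j) x @ \oo --> x * psum (diffs u) x.
Proof.
move=> /pseries_diffs_equiv h.
rewrite (_ : pseries _ x = fun k => x * series (fun i => i%:R * u i * x ^+ i.-1) k).
  by apply: cvgMr.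
apply/funext => k; rewrite /pseries /series /= mulr_sumr; apply: eq_bigr => i _.
by case: i => [|i]; rewrite ?mul0r ?mulr0// [i.+1.-1]/= exprS; ring.
Qed.

Lemma psum0 u : psum u 0 = u 0%N.
Proof.
apply: cvg_lim => //; apply: (@cvg_near_cst _ _ _ _ _ _) => //.
exists 1%N => // k /= k1; rewrite /pseries /series /=.
case: k k1 => // k _; rewrite big_nat_recl// expr0 mulr1 big1 ?addr0// => i _.
by rewrite expr0n mulr0.
Qed.

Lemma const_of_derive0 (f : R -> R) x : 0 <= x ->
  (forall t, 0 <= t <= x -> is_derive t (1 : R) f 0) -> f x = f 0.
Proof.
move=> x0 hf.
have cf : {within `[0, x], continuous f}.
  apply: continuous_in_subspaceT => t; rewrite inE /= in_itv /= => t0x.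
  by apply: differentiable_continuous; apply/derivable1_diffP; have [] := hf _ t0x.
have [t _] := @MVT_segment R f (fun=> 0) 0 x x0 (fun t ht => hf t (subset_itv_oo_cc ht)) cf.
by rewrite mul0r => /eqP; rewrite subr_eq0 => /eqP.
Qed.

Lemma is_derive_powR1m (e x : R) : 0 < 1 - x ->
  is_derive x (1 : R) (fun t => (1 - t) `^ e) (- e * (1 - x) `^ (e - 1)).
Proof.
move=> x1; have d1 := is_derive1_powR e x1.
have d2 : is_derive x (1 : R) (fun t : R => 1 - t) (- 1).
  have d := is_deriveB (is_derive_cst (1 : R) x (1 : R)) (is_derive_id x (1 : R)).
  by apply: (is_derive_eq d); rewrite sub0r.
have d := is_derive1_comp (f := fun t => t `^ e) (g := fun t : R => 1 - t) d1 d2.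
by apply: (is_derive_eq d); ring.
Qed.

(** The equation says [t (D^2)' = -2 c D^2 <= 0], so [D^2] is nonincreasing from [0]. Working with
    the square avoids the factor [t^c], which need not be differentiable at the singular point
    [0]. *)
Lemma eq0_of_derive (c : R) (D D' : R -> R) x : 0 <= c -> 0 <= x -> D 0 = 0 ->
  (forall t, 0 <= t <= x -> is_derive t (1 : R) D (D' t)) ->
  (forall t, 0 <= t <= x -> t * D' t = - c * D t) -> D x = 0.
Proof.
move=> c0 x0 D0 hD hD'.
have hf t : 0 <= t <= x -> is_derive t (1 : R) (fun s => D s * D s) (2 * (D t * D' t)).
  move=> ht; have d := hD t ht.
  by apply: is_derive_eq; rewrite /GRing.scale /=; ring.
have cf : {within `[0, x], continuous (fun s => D s * D s)}.
  apply: continuous_in_subspaceT => t; rewrite inE /= in_itv /= => t0x.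
  by apply: differentiable_continuous; apply/derivable1_diffP; have [] := hf _ t0x.
have [t] := @MVT_segment R _ _ 0 x x0 (fun t ht => hf t (subset_itv_oo_cc ht)) cf.
rewrite in_itv /= => /[dup] t0x /andP[t0 tx]; rewrite D0 mulr0 !subr0 => h.
have : D x * D x <= 0.
  rewrite h; apply: mulr_le0_ge0 => //; apply: mulr_ge0_le0 => //.
  have [->|tn0] := eqVneq t 0; first by rewrite D0 mul0r.
  have tp : 0 < t by rewrite lt_neqAle eq_sym tn0.
  rewrite -(pmulr_rle0 _ tp) mulrCA hD'//.
  by rewrite mulrCA mulNr oppr_le0 mulr_ge0// -expr2 sqr_ge0.
by rewrite -expr2 => h2; apply/eqP; rewrite -sqrf_eq0 eq_le h2 sqr_ge0.
Qed.

End PowerSeries.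

(** * The hypergeometric equation and Euler's transformation *)

Section Hypergeometric.
Variable R : realType.
Implicit Types a b c x : R.
Local Notation diffs := (@pseries_diffs R).
Local Notation poch := (@pochhammer R).

Lemma pochhammerS a k : poch a k.+1 = (a + k%:R) * poch a k.
Proof. by rewrite /pochhammer big_ord_recr /= mulrC. Qed.

Lemma pochhammer0 a : poch a 0 = 1.
Proof. by rewrite /pochhammer big_ord0. Qed.

Lemma pochhammer_gt0 a k : 0 < a -> 0 < poch a k.
Proof. by move=> a0; apply: prodr_gt0 => i _; rewrite ltr_wpDr. Qed.

Definition hyp a b c k : R := poch a k * poch b k / (poch c k * k`!%:R).

Lemma hyp2F1E a b c x : hyp2F1 a b c x = psum (hyp a b c) x.
Proof. by []. Qed.

Lemma hyp0 a b c : hyp a b c 0 = 1.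
Proof. by rewrite /hyp !pochhammer0 fact0 !mulr1 divff ?oner_eq0. Qed.

Lemma hypS a b c k : 0 < c ->
  (1 + k%:R) * (c + k%:R) * hyp a b c k.+1 = (a + k%:R) * (b + k%:R) * hyp a b c k.
Proof.
move=> c0; rewrite /hyp !pochhammerS factS natrM -natr1.
have c1 : c + k%:R != 0 by rewrite gt_eqF// ltr_wpDr.
have c2 : poch c k != 0 by rewrite gt_eqF// pochhammer_gt0.
have c3 : (k`!%:R : R) != 0 by rewrite pnatr_eq0 -lt0n fact_gt0.
have c4 : (k%:R + 1 : R) != 0 by rewrite gt_eqF// ltr_wpDl.
by field; rewrite c1 c2 c3 c4.
Qed.

Lemma ratio1_hyp a b c : 0 < c -> ratio1 (hyp a b c).
Proof.
move=> c0; exists (fun k => (a + k%:R) / (1 + k%:R) * ((b + k%:R) / (c + k%:R))).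
  rewrite -[X in _ --> X]mulr1; apply: cvgM; exact: cvg_ratio1.
move=> k; have c1 : c + k%:R != 0 by rewrite gt_eqF// ltr_wpDr.
have c4 : (1 + k%:R : R) != 0 by rewrite gt_eqF// ltr_wpDr.
apply: (mulfI (mulf_neq0 c4 c1)); rewrite hypS//; field.
by rewrite c1 c4.
Qed.

(** The recursion [hypS] is the equation read on coefficients, once all terms are expressed through
    [x d/dx]. *)
Lemma hyp2F1_ode a b c x : 0 < c -> `|x| < 1 ->
  x * (1 - x) * psum (diffs (diffs (hyp a b c))) x + (c - (a + b + 1) * x) * psum (diffs (hyp a b c)) x
  = a * b * psum (hyp a b c) x.
Proof.
move=> c0 x1; pose h := hyp a b c.
have r0 : ratio1 h by exact: ratio1_hyp.
have r1 := ratio1_diffs r0; have r2 := ratio1_diffs r1.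
have P0 := psumP r0 x1; have P1 := psumP r1 x1; have P2 := psumP r2 x1.
have Q1 := cvg_pseries_nat (ratio1_cvg r1 x1).
have Q2 := cvg_pseries_nat (ratio1_cvg r2 x1).
rewrite -/h; set S0 := psum h x in P0 *; set S1 := psum (diffs h) x in P1 Q1 *.
set S2 := psum (diffs (diffs h)) x in P2 Q2 *.
have eD : pseries (diffs (fun j => j%:R * h j)) x =
    (fun k => pseries (fun j => j%:R * diffs h j) x k + pseries (diffs h) x k).
  apply/funext => k; rewrite /pseries /series /= -big_split /=; apply: eq_bigr => i _.
  by rewrite /pseries_diffs -natr1; ring.
have Q3 : pseries (diffs (fun j => j%:R * h j)) x @ \oo --> x * S2 + S1.
  by rewrite eD; exact: cvgD.
have Q4 := cvg_pseries_nat (cvgP _ Q3).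
have eS : psum (diffs (fun j => j%:R * h j)) x = x * S2 + S1 by exact: cvg_lim.
rewrite eS in Q4.
(* All series run over the same indices, the shift being contained in [diffs], so the combination
   vanishes already for partial sums and only limits of sums remain to be taken. *)
have Z : (fun k => pseries (fun j => j%:R * diffs h j) x k + c * pseries (diffs h) x k
   - pseries (fun j => j%:R * (j%:R * h j)) x k - (a + b) * pseries (fun j => j%:R * h j) x k
   - a * b * pseries h x k) = fun=> 0.
  apply/funext => k; rewrite /pseries /series /= !mulr_sumr -big_split -!sumrB big1//= => i _.
  have := hypS a b i c0; rewrite -/h /pseries_diffs -natr1 => e.
  transitivity (((1 + i%:R) * (c + i%:R) * h i.+1 - (a + i%:R) * (b + i%:R) * h i) * x ^+ i); first by ring.
  by rewrite e subrr mul0r.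
have L : (fun k => pseries (fun j => j%:R * diffs h j) x k + c * pseries (diffs h) x k
   - pseries (fun j => j%:R * (j%:R * h j)) x k - (a + b) * pseries (fun j => j%:R * h j) x k
   - a * b * pseries h x k) @ \oo -->
   x * S2 + c * S1 - x * (x * S2 + S1) - (a + b) * (x * S1) - a * b * S0.
  by apply: cvgB; [apply: cvgB; [apply: cvgB; [apply: cvgD; [|apply: cvgMr]|]|apply: cvgMr]|apply: cvgMr].
rewrite Z in L.
have E : x * S2 + c * S1 - x * (x * S2 + S1) - (a + b) * (x * S1) - a * b * S0 = 0.
  by rewrite -(cvg_lim (@Rhausdorff R) L) lim_cst.
by apply/eqP; rewrite -subr_eq0 -E; apply/eqP; ring.
Qed.

Lemma psum_hyp_gt0 a b c x : 0 < a -> 0 < b -> 0 < c -> 0 <= x < 1 -> 0 < psum (hyp a b c) x.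
Proof.
move=> a0 b0 c0 /andP[x0 x1]; apply: (@lt_le_trans _ _ 1) => //.
have cv : cvgn (pseries (hyp a b c) x).
  by apply: ratio1_cvg; [exact: ratio1_hyp|rewrite ger0_norm].
apply: (limr_ge cv); exists 1%N => // k /= k1.
case: k k1 => // k _; rewrite /pseries /series /= big_nat_recl// expr0 mulr1 hyp0 lerDl.
apply: sumr_ge0 => i _; rewrite mulr_ge0 ?exprn_ge0//.
by rewrite /hyp divr_ge0// ?mulr_ge0// ltW// pochhammer_gt0.
Qed.

(* [D / (1-x)^c] is the derivative of the ratio of the two sides, and
   [x^c D] is (a multiple of) their Wronskian, hence constant. *)
Lemma euler_transformation a b c x : 0 < a -> 0 < b -> 0 < c -> a + b = 2 * c - 1 -> 0 <= x < 1 ->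
  psum (hyp a b c) x = (1 - x) `^ (1 - c) * psum (hyp (c - a) (c - b) c) x.
Proof.
move=> a0 b0 c0 ab /andP[x0 x1].
have rF := ratio1_hyp a b c0; have rG := ratio1_hyp (c - a) (c - b) c0.
pose F := psum (hyp a b c); pose G := psum (hyp (c - a) (c - b) c).
pose F1 := psum (diffs (hyp a b c)); pose G1 := psum (diffs (hyp (c - a) (c - b) c)).
pose F2 := psum (diffs (diffs (hyp a b c))).
pose G2 := psum (diffs (diffs (hyp (c - a) (c - b) c))).
have small t : 0 <= t <= x -> `|t| < 1.
  by move=> /andP[t0 tx]; rewrite ger0_norm// (le_lt_trans tx).
have dF t : 0 <= t <= x -> is_derive t (1 : R) F (F1 t).
  by move=> /small t1; exact: is_derive_psum.
have dG t : 0 <= t <= x -> is_derive t (1 : R) G (G1 t).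
  by move=> /small t1; exact: is_derive_psum.
have dF1 t : 0 <= t <= x -> is_derive t (1 : R) F1 (F2 t).
  by move=> /small t1; apply: is_derive_psum => //; exact: ratio1_diffs.
have dG1 t : 0 <= t <= x -> is_derive t (1 : R) G1 (G2 t).
  by move=> /small t1; apply: is_derive_psum => //; exact: ratio1_diffs.
(* The relation [a + b = 2 c - 1] turns the coefficient [a + b + 1] into [2 c] here and into [2] for
   the parameters [c - a], [c - b]. *)
have oF t : 0 <= t <= x -> t * (1 - t) * F2 t + (c - 2 * c * t) * F1 t = a * b * F t.
  move=> /small t1; rewrite -hyp2F1_ode//; congr (_ + (c - _ * t) * _).
  by rewrite ab; ring.
have oG t : 0 <= t <= x -> t * (1 - t) * G2 t + (c - 2 * t) * G1 t = (c - a) * (c - b) * G t.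
  move=> /small t1; rewrite -hyp2F1_ode//; congr (_ + (c - _ * t) * _).
  by move: ab; lra.
pose D (t : R) := (1 - t) * (F t * G1 t - F1 t * G t) + (c - 1) * (F t * G t).
pose D' (t : R) := - (F t * G1 t - F1 t * G t) + (1 - t) * (F t * G2 t - F2 t * G t)
  + (c - 1) * (F t * G1 t + F1 t * G t).
have hD t : 0 <= t <= x -> is_derive t (1 : R) D (D' t).
  move=> ht; have d1 := dF t ht; have d2 := dG t ht; have d3 := dF1 t ht; have d4 := dG1 t ht.
  by rewrite /D; apply: is_derive_eq; rewrite /GRing.scale /= /D'; ring.
have hW t : 0 <= t <= x -> t * D' t = - c * D t.
  move=> ht; have := oF t ht; have := oG t ht; rewrite /D /D'.
  move: (F t) (F1 t) (F2 t) (G t) (G1 t) (G2 t) => f f1 f2 g g1 g2 og of_.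
  have -> : t * (- (f * g1 - f1 * g) + (1 - t) * (f * g2 - f2 * g) + (c - 1) * (f * g1 + f1 * g))
     = f * (t * (1 - t) * g2 + (c - 2 * t) * g1) - g * (t * (1 - t) * f2 + (c - 2 * c * t) * f1)
       - f * (c - 2 * t) * g1 + g * (c - 2 * c * t) * f1 - t * (f * g1 - f1 * g)
       + (c - 1) * t * (f * g1 + f1 * g) by ring.
  rewrite og of_.
  have -> : (c - a) * (c - b) = c ^+ 2 - c * (a + b) + a * b by ring.
  by rewrite ab; ring.
have D00 t : 0 <= t <= x -> D t = 0.
  move=> /andP[t0 tx].
  have sub s : 0 <= s <= t -> 0 <= s <= x by move=> /andP[-> /= st]; exact: le_trans tx.
  apply: (@eq0_of_derive R c D D' t (ltW c0) t0).
  (* At [t = 0] the identity [t D' = - c D] reads [0 = - c D(0)], so the initial value vanishes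
     because [c > 0]. *)
  - have h : 0 <= (0 : R) <= x by rewrite lexx.
    by have := hW 0 h; rewrite mul0r => /esym/eqP; rewrite mulf_eq0 oppr_eq0 gt_eqF//= => /eqP.
  - by move=> s /sub; exact: hD.
  - by move=> s /sub; exact: hW.
have F_gt0 t : 0 <= t <= x -> 0 < F t.
  by move=> /andP[t0 tx]; apply: psum_hyp_gt0; rewrite // t0 (le_lt_trans tx).
pose Q (t : R) := (1 - t) `^ (1 - c) * (G t / F t).
have dQ t : 0 <= t <= x -> is_derive t (1 : R) Q 0.
  move=> ht; have d1 := dF t ht; have d2 := dG t ht; have f0 := F_gt0 t ht.
  have t1 : 0 < 1 - t by case/andP: ht => _ tx; rewrite subr_gt0 (le_lt_trans tx).
  have d3 := is_derive_powR1m (1 - c) t1.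
  have d4 : is_derive t (1 : R) (fun s => (F s)^-1) (- F t ^- 2 * F1 t).
    by apply: is_deriveV; rewrite gt_eqF.
  rewrite /Q; apply: is_derive_eq; rewrite /GRing.scale /=.
  have := D00 t ht; rewrite /D.
  have -> : (1 - t) `^ (1 - c) = (1 - t) * (1 - t) `^ (1 - c - 1).
    by rewrite -[X in X * _]powRr1 ?(ltW t1)// -powRD ?(gt_eqF t1) ?implybT//; congr (_ `^ _); ring.
  move: (F t) (F1 t) (G t) (G1 t) (_ `^ _) f0 => f f1 g g1 P f0 h.
  transitivity (P * f ^- 2 * ((1 - t) * (f * g1 - f1 * g) + (c - 1) * (f * g))).
    by field; rewrite gt_eqF.
  by rewrite h mulr0.
have := const_of_derive0 x0 dQ; rewrite /Q subr0 powR1 mul1r.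
have -> : F 0 = 1 by rewrite /F psum0 hyp0.
have -> : G 0 = 1 by rewrite /G psum0 hyp0.
rewrite divr1 -/F -/G => h.
have fx : F x != 0 by rewrite gt_eqF// F_gt0// lexx x0.
by apply/esym; rewrite -[RHS]mul1r -[in RHS]h; field.
Qed.

Lemma binomialS b k :
  (1 + k%:R) * (poch b k.+1 / k.+1`!%:R) = (b + k%:R) * (poch b k / k`!%:R).
Proof.
rewrite pochhammerS factS natrM -natr1.
have c3 : (k`!%:R : R) != 0 by rewrite pnatr_eq0 -lt0n fact_gt0.
have c4 : (k%:R + 1 : R) != 0 by rewrite gt_eqF// ltr_wpDl.
by field; rewrite c3 c4.
Qed.

Lemma ratio1_binomial b : ratio1 (fun k => poch b k / k`!%:R).
Proof.
exists (fun k => (b + k%:R) / (1 + k%:R)); first exact: cvg_ratio1.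
move=> k; have c4 : (1 + k%:R : R) != 0 by rewrite gt_eqF// ltr_wpDr.
by apply: (mulfI c4); rewrite binomialS; move: (poch b k / _) => z; field.
Qed.

(** The binomial series satisfies [(1 - t) f' = b f], so [(1 - t)^b f] is constant and equal to its
    value [1] at [0]. *)
Lemma psum_binomial b x : 0 <= x < 1 ->
  psum (fun k => poch b k / k`!%:R) x = (1 - x) `^ (- b).
Proof.
move=> /andP[x0 x1]; pose u k := poch b k / k`!%:R.
have uS k : (1 + k%:R) * u k.+1 = (b + k%:R) * u k by exact: binomialS.
have ru : ratio1 u by exact: ratio1_binomial.
have small t : 0 <= t <= x -> `|t| < 1.
  by move=> /andP[t0 tx]; rewrite ger0_norm// (le_lt_trans tx).
have ode t : `|t| < 1 -> (1 - t) * psum (diffs u) t = b * psum u t.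
  move=> t1; have P0 := psumP ru t1; have P1 := psumP (ratio1_diffs ru) t1.
  have Q1 := cvg_pseries_nat (cvgP _ P1).
  have e : pseries (diffs u) t = (fun k => b * pseries u t k + pseries (fun j => j%:R * u j) t k).
    apply/funext => k; rewrite /pseries /series /= mulr_sumr -big_split /=.
    apply: eq_bigr => i _; have := uS i; rewrite /pseries_diffs -natr1 [i%:R + 1]addrC => ->.
    by ring.
  rewrite [in X in X @ _ --> _]e in P1.
  have Q2 : (fun k => b * pseries u t k + pseries (fun j => j%:R * u j) t k) @ \oo -->
      b * psum u t + t * psum (diffs u) t by apply: cvgD; [apply: cvgMr|].
  have := cvg_unique (@Rhausdorff R) P1 Q2.
  by move=> h; rewrite mulrBl mul1r [X in X - _]h; ring.
pose Q (t : R) := (1 - t) `^ b * psum u t.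
have dQ t : 0 <= t <= x -> is_derive t (1 : R) Q 0.
  move=> ht; have d1 := is_derive_psum ru (small _ ht).
  have t1 : 0 < 1 - t by case/andP: ht => _ tx; rewrite subr_gt0 (le_lt_trans tx).
  have d3 := is_derive_powR1m b t1.
  rewrite /Q; apply: is_derive_eq; rewrite /GRing.scale /=.
  have -> : (1 - t) `^ b = (1 - t) * (1 - t) `^ (b - 1).
    by rewrite -[X in X * _]powRr1 ?(ltW t1)// -powRD ?(gt_eqF t1) ?implybT//; congr (_ `^ _); ring.
  have := ode _ (small _ ht).
  move: (psum _ _) (psum _ _) (_ `^ _) => f1 f P h.
  transitivity (P * ((1 - t) * f - b * f1)); first by ring.
  by rewrite h subrr mulr0.
have := const_of_derive0 x0 dQ; rewrite /Q subr0 powR1 mul1r psum0 /u pochhammer0 fact0 divr1.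
have x1' : 0 < 1 - x by rewrite subr_gt0.
move=> h; have p := powR_gt0 b x1'.
by apply: (mulfI (negbT (gt_eqF p))); rewrite h powRN mulfV// gt_eqF.
Qed.

End Hypergeometric.

(** * The norm of the symbol *)

Section AngularIntegral.
Variable R : realType.
Local Notation leb1 := (@lebesgue_measure R).

Local Opaque Gamma Beta.

Lemma nneseries_psum (u : nat -> R) (x : R) : cvgn (pseries u x) ->
  (\sum_(0 <= j <oo) (u j * x ^+ j)%:E = (psum u x)%:E)%E.
Proof.
move=> cx; apply: cvg_lim => //.
rewrite [X in X @ _ --> _](_ : _ = EFin \o pseries u x); first by apply: cvg_EFin => //; exact: nearW.
by apply/funext => k; rewrite /= /pseries /series /= sumEFin.
Qed.

(** Induction on [j]. The step divides the beta function by [(a + 2j)(a + 2j + 1) = 4 (a/2 + j)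
    ((a+1)/2 + j)]; the first two factors are those gained by [4^j] and by the Pochhammer symbol of
    [a/2], and the last one builds the denominator parameter [(a+1)/2]. *)
Lemma beta_coef (k a : R) j : 0 < k -> k < a ->
  pochhammer (a / 2) j / j`!%:R * 4 ^+ j * Beta (k + j%:R) (a - k + j%:R) =
  Beta k (a - k) * hyp k (a - k) ((a + 1) / 2) j.
Proof.
move=> k0 ka; have ak : 0 < a - k by rewrite subr_gt0.
have c0 : 0 < (a + 1) / 2 by lra.
elim: j => [|j IH].
  by rewrite hyp0 pochhammer0 fact0 expr0 !addr0 divr1 !mul1r mulr1.
have x0 : 0 < k + j%:R by rewrite ltr_wpDr.
have y0 : 0 < a - k + j%:R by rewrite ltr_wpDr.
have b := Beta_add1 x0 y0; have h := hypS k (a - k) j c0.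
have j0 : (0 : R) <= j%:R by [].
have [e1 e2] : k + j.+1%:R = k + j%:R + 1 /\ a - k + j.+1%:R = a - k + j%:R + 1.
  by rewrite -natr1 !addrA.
have uS := binomialS (a / 2) j; rewrite exprS e1 e2.
move: (pochhammer _ j.+1 / _) (pochhammer _ j / _) uS IH => u' u uS IH.
move: (Beta (k + j%:R + 1) _) (Beta (k + j%:R) _) b IH => B' B1 b IH.
move: (hyp _ _ _ j.+1) (hyp _ _ _ j) h IH => h' h0 h IH.
have J0 : (0 : R) <= j%:R by [].
move: (j%:R : R) x0 y0 uS b h J0 => J x0 y0 uS b h J0.
have c1 : (1 + J) * (((a + 1) / 2 + J) * ((a / 2 + J) * 4)) != 0.
  by rewrite gt_eqF//; repeat apply: mulr_gt0 => //; lra.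
apply: (mulIf c1).
transitivity (((1 + J) * u') * 4 ^+ j * 4 *
  (B' * ((k + J + (a - k + J)) * (k + J + (a - k + J) + 1)))); first by field.
rewrite uS b.
transitivity ((a / 2 + J) * 4 * ((k + J) * (a - k + J)) * (u * 4 ^+ j * B1)); first by ring.
rewrite IH; transitivity (Beta k (a - k) * (a / 2 + J) * 4 * ((1 + J) * ((a + 1) / 2 + J) * h')).
  by rewrite h; ring.
by ring.
Qed.

(** Since [w >= 0], every term of the binomial expansion is nonnegative, and the series may be
    integrated term by term in the extended reals with no convergence argument. Each term is a
    half-line beta integral. *)
Lemma ipos_angular (k a w : R) : 0 < k -> k < a -> 0 <= w < 1 ->
  ipos (fun t => ((1 + t) ^+ 2 - 4 * w * t) `^ (- (a / 2)) * t `^ (k - 1)) =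
  (Beta k (a - k) * psum (hyp k (a - k) ((a + 1) / 2)) w)%:E.
Proof.
move=> k0 ka /andP[w0 w1]; have ak : 0 < a - k by rewrite subr_gt0.
have c0 : 0 < (a + 1) / 2 by lra.
pose u j := pochhammer (a / 2) j / j`!%:R.
have u0 j : 0 <= u j by rewrite divr_ge0// ltW// pochhammer_gt0//; lra.
pose g j (t : R) : R := u j * (4 * w) ^+ j *
  (t `^ (k + j%:R - 1) * (1 + t) `^ (- (k + j%:R + (a - k + j%:R)))).
have mg1 j : measurable_fun [set: R]
    (fun t : R => t `^ (k + j%:R - 1) * (1 + t) `^ (- (k + j%:R + (a - k + j%:R)))).
  by apply: measurable_funM; [exact: measurable_powR|exact: measurable_shiftR].
have mg j : measurable_fun [set: R] (g j) by exact: measurable_funM.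
have uw0 j : 0 <= u j * (4 * w) ^+ j by rewrite mulr_ge0// exprn_ge0// mulr_ge0.
have g0 j t : 0 <= g j t by rewrite /g mulr_ge0// mulr_ge0// powR_ge0.
transitivity (\sum_(0 <= j <oo) ipos (g j))%E; last first.
  rewrite EFinM -nneseries_psum; last first.
    by apply: ratio1_cvg; [exact: ratio1_hyp|rewrite ger0_norm].
  rewrite -nneseriesZl; last first.
    move=> j _; rewrite lee_fin mulr_ge0 ?exprn_ge0// /hyp divr_ge0// ?mulr_ge0// ltW// pochhammer_gt0//.
  apply: eq_eseriesr => j _.
  have x0 : 0 < k + j%:R by rewrite ltr_wpDr.
  have y0 : 0 < a - k + j%:R by rewrite ltr_wpDr.
  rewrite iposZ//; last by move=> t _; rewrite mulr_ge0 ?powR_ge0.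
  rewrite -/(ibeta (k + j%:R) (a - k + j%:R)) (ibetaE x0 y0) -!EFinM; congr EFin.
  by rewrite [RHS]mulrA -beta_coef// exprMn /u; ring.
rewrite /ipos -integral_nneseries//; last first.
- by move=> j t _; rewrite lee_fin mulr_ge0.
- by move=> j; apply/measurable_EFinP; exact: measurable_posM.
apply: eq_integral => t _.
have [t0|t0] := ltrP 0 t; last first.
  by rewrite mul0r eseries0// => j _ _; rewrite mul0r.
have t1 : 0 < 1 + t by rewrite addr_gt0.
(* [X < 1] because [(1 + t)^2 - 4 w t = (1 - t)^2 + 4 t (1 - w)] is positive for [w < 1]. *)
pose X := 4 * w * t / (1 + t) ^+ 2.
have X0 : 0 <= X by rewrite divr_ge0 ?sqr_ge0// !mulr_ge0// ltW.
have X1 : X < 1.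
  rewrite ltr_pdivrMr ?exprn_gt0// mul1r.
  have h : 4 * t * (1 - w) > 0 by rewrite !mulr_gt0// subr_gt0.
  have h2 : 0 <= (1 - t) ^+ 2 by exact: sqr_ge0.
  by move: h h2; rewrite !expr2; nra.
rewrite mul1r (_ : (1 + t) ^+ 2 - 4 * w * t = (1 + t) ^+ 2 * (1 - X)); last first.
  by rewrite /X; field; rewrite gt_eqF.
rewrite powRM ?sqr_ge0 ?subr_ge0 ?(ltW X1)//.
rewrite -psum_binomial ?X0//.
transitivity ((((1 + t) ^+ 2) `^ (- (a / 2)) * t `^ (k - 1))%:E * (psum u X)%:E)%E.
  by rewrite -EFinM; congr EFin; rewrite /u; ring.
rewrite -nneseries_psum; last first.
  by apply: ratio1_cvg; [exact: ratio1_binomial|rewrite ger0_norm].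
rewrite -nneseriesZl; last by move=> j _; rewrite lee_fin mulr_ge0// exprn_ge0.
apply: eq_eseriesr => j _; rewrite -EFinM mul1r; congr EFin.
rewrite /g -powR_mulrn ?(ltW t1)// -powRrM /X expr_div_n exprMn.
rewrite -[t ^+ j]powR_mulrn ?(ltW t0)// -exprM -[(1 + t) ^+ _]powR_mulrn ?(ltW t1)// -powRN.
have -> : t `^ (k + j%:R - 1) = t `^ (k - 1) * t `^ j%:R.
  by rewrite -powRD ?(gt_eqF t0) ?implybT//; congr (_ `^ _); ring.
have -> : (1 + t) `^ (- (k + j%:R + (a - k + j%:R))) = (1 + t) `^ (2%:R * - (a / 2)) * (1 + t) `^ (- (2 * j)%:R).
  by rewrite -powRD ?(gt_eqF t1) ?implybT//; congr (_ `^ _); rewrite natrM; field.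
by ring.
Qed.

Lemma cos_half (theta : R) : cos theta = cos (theta / 2) ^+ 2 - sin (theta / 2) ^+ 2.
Proof. by rewrite [in LHS](splitr theta) cosD !expr2. Qed.

Lemma cos_lt1 (theta : R) : 0 < theta < 2 * pi -> cos theta < 1.
Proof.
move=> /andP[t0 t1]; have s : 0 < sin (theta / 2) by apply: sin_gt0_pi; lra.
have s2 : 0 < sin (theta / 2) ^+ 2 by exact: exprn_gt0.
by have := cos2Dsin2 (theta / 2); rewrite (cos_half theta); lra.
Qed.

Lemma cos_gtN1 (theta : R) : 0 < theta < 2 * pi -> theta != pi -> -1 < cos theta.
Proof.
move=> /andP[t0 t1] tp.
have c : cos (theta / 2) != 0.
  apply/eqP; rewrite -cos_pihalf => /cos_inj; rewrite !in_itv /= => h.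
  have {}h : theta / 2 = pi / 2 by apply: h; have := pi_gt0 R; lra.
  by move/eqP: tp; apply; lra.
have c2 : 0 < cos (theta / 2) ^+ 2 by rewrite exprn_even_gt0.
by have := cos2Dsin2 (theta / 2); rewrite (cos_half theta); lra.
Qed.

(** Euler's transformation is used with parameters [k], [a - k] and [c = (a+1)/2], whose sum
    condition [k + (a - k) = 2 c - 1] holds. At [theta = pi] the argument is [0] and the series
    equals [1], in agreement with the separate value in [I_m]. *)
Lemma I_mE n (m a theta : R) : let k := n%:R / (2 * m) in
  0 < k -> k < a -> 0 < theta < 2 * pi ->
  I_m n m a theta = Beta k (a - k) * psum (hyp k (a - k) ((a + 1) / 2)) ((1 + cos theta) / 2).
Proof.
move=> k k0 ka ht; rewrite /I_m -/k; have ak : 0 < a - k by rewrite subr_gt0.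
have C1 := cos_lt1 ht.
case: eqVneq => [->|tp].
  by rewrite cospi addrN mul0r psum0 hyp0 mulr1.
have CN1 := cos_gtN1 ht tp.
pose w := (1 + cos theta) / 2; pose c := (a + 1) / 2.
have w0 : 0 < w by rewrite /w; lra.
have w1 : 0 < 1 - w by rewrite /w; lra.
have c0 : 0 < c by rewrite /c; lra.
rewrite -/w -/c (@euler_transformation _ k (a - k) c w)//; first last.
- by rewrite (ltW w0) -subr_gt0.
- by rewrite /c; field.
rewrite /legendreP hyp2F1E.
have -> : 1 - (2^-1 - a / 2) = c by rewrite /c; field.
have -> : - (k - a / 2 - 2^-1) = c - k by rewrite /c; field.
have -> : k - a / 2 - 2^-1 + 1 = c - (a - k) by rewrite /c; field.
have -> : a / 2 - 2^-1 = - (1 - c) by rewrite /c; field.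
have -> : 2^-1 - a / 2 = 1 - c by rewrite /c; field.
have -> : a / 2 + 2^-1 = c by rewrite /c; field.
have -> : (1 - - cos theta) / 2 = w by rewrite /w; field.
have -> : (1 + - cos theta) / (1 - - cos theta) = (1 - w) * w^-1.
  by rewrite /w; field; rewrite !gt_eqF//; lra.
(* With [w = cos^2 (theta/2)] this is the double angle formula, the absolute value covering
   [theta > pi]. *)
have -> : `|sin theta| = 2 * (w * (1 - w)) `^ 2^-1.
  have w4 : w * (1 - w) = (sin theta / 2) ^+ 2.
    by rewrite expr_div_n sin2cos2 /w; field.
  rewrite powR12_sqrt ?mulr_ge0 ?(ltW w0) ?(ltW w1)// w4 sqrtr_sqr normrM.
  by rewrite [`|2^-1|]ger0_norm//; field.
clearbody w c.
have gc := Gamma_gt0 c0.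
move: (Gamma c) (psum _ _) (Beta _ _) gc => G F B gc.
have h2 : (0 : R) < 2 by [].
have w1' := ltW w1; have w0' := ltW w0.
have wV0 : 0 <= w^-1 by rewrite invr_ge0.
have h2' : (0 : R) <= 2 by [].
rewrite (powRM _ h2' (powR_ge0 _ _)) -powRrM (powRM _ w0' w1') (powRM _ w1' wV0).
have e1 : (2 : R) `^ (- (1 - c)) * 2 `^ (1 - c) = 1 by rewrite powRN mulVf// gt_eqF// powR_gt0.
have e2 : w `^ (2^-1 * (1 - c)) * w^-1 `^ ((1 - c) / 2) = 1.
  by rewrite [2^-1 * _]mulrC -powRM ?invr_ge0 ?(ltW w0)// mulfV ?gt_eqF// powR1.
have e3 : (1 - w) `^ (2^-1 * (1 - c)) * (1 - w) `^ ((1 - c) / 2) = (1 - w) `^ (1 - c).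
  by rewrite -powRD ?(gt_eqF w1) ?implybT//; congr (_ `^ _); field.
rewrite -e3.
(* The powers of [2] and of [w] cancel; the powers of [1 - w] from the sine and from the Legendre
   function combine to the factor [(1 - w)^(1-c)] of Euler's transformation. *)
transitivity ((2 `^ (- (1 - c)) * 2 `^ (1 - c)) * (w `^ (2^-1 * (1 - c)) * w^-1 `^ ((1 - c) / 2)) *
  (B * ((1 - w) `^ (2^-1 * (1 - c)) * (1 - w) `^ ((1 - c) / 2) * F))).
  by field; rewrite gt_eqF.
by rewrite e1 e2 !mul1r.
Qed.

End AngularIntegral.

(** * From the half-line integral to the symbol *)

Section SymbolNorm.
Variable R : realType.

Local Opaque Gamma Beta.

Lemma ipos_polar (l theta k a : R) : 0 < l -> 0 < theta < 2 * pi -> 0 < k -> k < a ->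
  ipos (fun u => ((u - l * cos theta) ^+ 2 + (l * sin theta) ^+ 2) `^ (- (a / 2)) * u `^ (k - 1))
  = (l `^ (k - a) * (Beta k (a - k) * psum (hyp k (a - k) ((a + 1) / 2)) ((1 + cos theta) / 2)))%:E.
Proof.
move=> l0 ht k0 ka; have C1 := cos_lt1 ht; have CN := cos_geN1 theta.
have mG : measurable_fun [set: R] (fun u : R =>
    ((u - l * cos theta) ^+ 2 + (l * sin theta) ^+ 2) `^ (- (a / 2)) * u `^ (k - 1)).
  apply: measurable_funM; last exact: measurable_powR.
  apply: (measurableT_comp (@measurable_powR R _)); apply: measurable_funD => //.
  by apply: measurable_funX; exact: measurable_funB.
rewrite -(ipos_scale l0 mG); last by move=> u _; rewrite mulr_ge0 ?powR_ge0.
pose w := (1 + cos theta) / 2.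
have w01 : 0 <= w < 1 by rewrite /w; lra.
rewrite -/w EFinM -(ipos_angular k0 ka w01).
have mH : measurable_fun [set: R] (fun t : R =>
    ((1 + t) ^+ 2 - 4 * w * t) `^ (- (a / 2)) * t `^ (k - 1)).
  apply: measurable_funM; last exact: measurable_powR.
  apply: (measurableT_comp (@measurable_powR R _)); apply: measurable_funB => //.
    by apply: measurable_funX; exact: measurable_funD.
have mGl : measurable_fun [set: R] (fun t : R =>
    ((l * t - l * cos theta) ^+ 2 + (l * sin theta) ^+ 2) `^ (- (a / 2)) * (l * t) `^ (k - 1)).
  by apply: (measurableT_comp mG); exact: measurable_funM.
rewrite -(iposZ (powR_ge0 l (k - a)) mH); last by move=> t _; rewrite mulr_ge0 ?powR_ge0.
rewrite -(iposZ (ltW l0) mGl); last by move=> t _; rewrite mulr_ge0 ?powR_ge0.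
apply: eq_ipos => t t0.
  have -> : (l * t - l * cos theta) ^+ 2 + (l * sin theta) ^+ 2 = l ^+ 2 * ((1 + t) ^+ 2 - 4 * w * t).
    by rewrite [(l * sin theta) ^+ 2]exprMn sin2cos2 /w; field.
  have q0 : 0 <= (1 + t) ^+ 2 - 4 * w * t.
    have := sqr_ge0 (1 - t); case/andP: w01 => w0 w1 h.
    have : 0 <= 4 * t * (1 - w) by rewrite !mulr_ge0 ?subr_ge0 ?(ltW t0) ?(ltW w1).
    by move: h; rewrite !expr2; lra.
  rewrite (powRM _ (sqr_ge0 _) q0) (powRM _ (ltW l0) (ltW t0)) -[l ^+ 2]powR_mulrn ?(ltW l0)// -powRrM.
  have -> : l `^ (k - a) = l * l `^ (2%:R * - (a / 2)) * l `^ (k - 1).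
    rewrite -[X in X * _ * _]powRr1 ?(ltW l0)// -!powRD ?(gt_eqF l0) ?implybT//.
    by congr (_ `^ _); field.
by ring.
Qed.

Lemma constC_gt0 n (m a theta : R) : (0 < n)%N -> 0 < m -> n%:R / (2 * m) < a ->
  0 < theta < 2 * pi -> 0 < constC n m a theta.
Proof.
move=> n0 m0 ka ht; have nR : (0 : R) < n%:R by rewrite ltr0n.
have k0 : 0 < n%:R / (2 * m) by rewrite divr_gt0// mulr_gt0.
have ak : 0 < a - n%:R / (2 * m) by rewrite subr_gt0.
have C1 := cos_lt1 ht; have CN := cos_geN1 theta.
rewrite /constC (I_mE k0 ka ht); apply: mulr_gt0.
  apply: mulr_gt0; first by apply: powR_gt0; rewrite mulr_gt0// pi_gt0.
  by rewrite invr_gt0 mulr_gt0// Gamma_gt0// divr_gt0.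
apply: mulr_gt0; first exact: Beta_gt0.
have c0 : 0 < (a + 1) / 2 by move: k0 ka; lra.
apply: psum_hyp_gt0 => //; lra.
Qed.

(** The symbol is radial: its modulus to the power [a] is [G (|x|^(2m))] with
    [G u = |u - lam|^(-a)]. The radial formula leaves a half-line integral, and the scaling
    [u = |lam| t] extracts the power of [|lam|]. *)
Lemma integral_symb n (m a theta : R) (lam : R[i]) : (0 < n)%N -> 0 < m ->
  n%:R / (2 * m) < a -> ~ @nonneg_axis R lam -> 0 < theta < 2 * pi ->
  lam = Complex (cmod lam * cos theta) (cmod lam * sin theta) ->
  (\int[lebm (n := n)]_x (cmod (symb m lam x) `^ a)%:E =
   ((2 * pi) `^ n%:R * (cmod lam `^ (n%:R / (2 * m) - a) * constC n m a theta))%:E)%E.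
Proof.
move=> n0 m0 ka hlam ht hpol; have nR : (0 : R) < n%:R by rewrite ltr0n.
have k0 : 0 < n%:R / (2 * m) by rewrite divr_gt0// mulr_gt0.
have l0 : 0 < cmod lam.
  rewrite lt_neqAle cmod_ge0 andbT eq_sym; apply/eqP => l0; apply: hlam.
  by rewrite /nonneg_axis hpol l0 /= !mul0r.
set l := cmod lam in hpol l0 *.
pose G (u : R) := ((u - l * cos theta) ^+ 2 + (l * sin theta) ^+ 2) `^ (- (a / 2)).
have mG : measurable_fun [set: R] G.
  apply: (measurableT_comp (@measurable_powR R _)); apply: measurable_funD => //.
  by apply: measurable_funX; exact: measurable_funB.
have G0 u : 0 <= G u by exact: powR_ge0.
have := integral_radial n0 m0 mG G0; rewrite (ipos_polar l0 ht k0 ka) -(I_mE k0 ka ht).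
have -> : (\int[lebm (n := n)]_x (G (dotp x x `^ m))%:E =
    \int[lebm (n := n)]_x (cmod (symb m lam x) `^ a)%:E)%E.
  apply: eq_integral => x _; congr EFin; rewrite cmod_symb// /G.
  set u := dotp x x `^ m.
  have -> : u%:C%C - lam = Complex (u - l * cos theta) (- (l * sin theta)).
    by rewrite hpol; apply/eqP; rewrite eq_complex /= sub0r !eqxx.
  set D := (u - _) ^+ 2 + _.
  have D0 : 0 <= D by rewrite addr_ge0 ?sqr_ge0.
  rewrite (_ : cmod _ = Num.sqrt D); last by rewrite /cmod sqrrN.
  by rewrite -powR12_sqrt// -powRN -powRrM; congr (_ `^ _); field.
have g : 0 < m * Gamma (n%:R / 2) by rewrite mulr_gt0// Gamma_gt0// divr_gt0.
rewrite /constC; move: (I_m n m a theta) => I.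
(* The radial formula brings [pi^(n/2)]; writing it as [(2 pi)^n (4 pi)^(-n/2)] isolates the factor
   [(2 pi)^n] that cancels against the Fourier constants. *)
have -> : (4 * pi : R) `^ (- (n%:R / 2)) = ((2 * pi) `^ n%:R)^-1 * pi `^ (n%:R / 2).
  have p0 := pi_gt0 R; have p2 : (0 : R) < 2 * pi by rewrite mulr_gt0.
  have p4 : (0 : R) <= 4 * pi by rewrite mulr_ge0// ltW.
  apply: (mulfI (negbT (gt_eqF (powR_gt0 n%:R p2)))); rewrite mulrA mulfV ?gt_eqF ?powR_gt0// mul1r.
  have -> : (2 * pi : R) `^ n%:R = (4 * pi) `^ (n%:R / 2) * pi `^ (n%:R / 2).
    rewrite -(powRM _ p4 (ltW p0)) (_ : 4 * pi * pi = (2 * pi) ^+ 2); last by rewrite expr2; ring.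
    by rewrite -powR_mulrn ?(ltW p2)// -powRrM; congr (_ `^ _); field.
  by rewrite powRN mulrAC mulfV ?mul1r// gt_eqF// powR_gt0// mulr_gt0.
have p2 : (0 : R) < (2 * pi) `^ n%:R by rewrite powR_gt0// mulr_gt0// pi_gt0.
move: (m * Gamma _) (_ `^ n%:R) g p2 => g P g0 P0.
(* The radial identity is multiplied by a positive constant and has a finite right side, so infinite
   values of the integral are contradictory. *)
case: (\int[_]_x _)%E => [x| |].
- rewrite -!EFinM => -[] h; congr EFin; apply: (mulIf (negbT (gt_eqF g0))); rewrite h.
  by field; rewrite !gt_eqF.
- by rewrite mulyr gtr0_sg// mul1e -EFinM.
- by rewrite mulNyr gtr0_sg// mul1e -EFinM.
Qed.

End SymbolNorm.

Theorem theorem5p1 (R : realType) (n : nat) (hn : (0 < n)%N)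
  (p m : R) (hp : 1 < p) (hm : 0 < m)
  (r s : \bar R) (hr : (0 < r)%E) (hs : (0 < s)%E)
  (hr1 : 2^-1 - p^-1 <= einv r) (hr2 : einv r <= 1 - p^-1)
  (hs1 : - 2^-1 + p^-1 <= einv s) (hs2 : einv s <= p^-1)
  (hrs : einv r + einv s < 2 * m / n%:R)
  (alpha : R) (hrs0 : 0 < einv r + einv s)
  (halpha : alpha = (einv r + einv s)^-1)
  (a b q : n.-tuple R -> R[i]) (hq : q = (fun x => a x * b x))
  (ha : Lp r a) (hb : Lp s b)
  (hst : standing_assumptions p m a b q)
  (H : (n.-tuple R -> R[i]) -> (n.-tuple R -> R[i]) -> Prop)
  (hH : associated p m a b H)
  (lam : R[i]) (hlam : ~ @nonneg_axis R lam) (heig : eigenvalue_op H lam)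
  (theta : R) (htheta : 0 < theta < 2 * pi)
  (hpolar : lam = Complex (cmod lam * cos theta) (cmod lam * sin theta)) :
  cmod lam `^ (alpha - n%:R / (2 * m))
  <= constC n m alpha theta
     * fine (cnorm r a) `^ alpha * fine (cnorm s b) `^ alpha.
Proof.
have einv_ge0 (t : \bar R) : (0 < t)%E -> 0 <= einv t.
  by case: t => [t| |] //= t0; rewrite invr_ge0 ltW.
have [Q [isQ eigQ]] := assoc_eig hH hlam.
have {}eigQ := (eigQ.1 heig).
have nR : (0 : R) < n%:R by rewrite ltr0n.
have a0 : 0 < alpha by rewrite halpha invr_gt0.
have aV : alpha^-1 = einv r + einv s by rewrite halpha invrK.
have ka : n%:R / (2 * m) < alpha.
  rewrite -[alpha]invrK aV -[n%:R / _]invrK ltf_pV2 ?posrE ?invr_gt0 ?divr_gt0 ?mulr_gt0//.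
  by rewrite invf_div.
have l0 : 0 < cmod lam.
  rewrite lt_neqAle cmod_ge0 andbT eq_sym; apply/eqP => l0; apply: hlam.
  by rewrite /nonneg_axis hpolar l0 /= !mul0r.
have C0 := constC_gt0 hn hm ka htheta.
have hI := integral_symb hn hm ka hlam htheta hpolar.
set L := cmod lam `^ (n%:R / (2 * m) - alpha) in hI.
have L0 : 0 < L by exact: powR_gt0.
have P0 : (0 : R) < (2 * pi) `^ n%:R by rewrite powR_gt0// mulr_gt0// pi_gt0.
set X := _ * (L * _) in hI.
have X0 : 0 < X := mulr_gt0 P0 (mulr_gt0 L0 C0).
(* The norm of the symbol in [L_alpha], as [X] is the integral of its [alpha]-th power and
   [einv r + einv s = 1/alpha]. *)
pose S := X `^ (einv r + einv s).
have S0 : 0 < S by exact: powR_gt0.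
have hS : bnd (lebm (n := n)) (einv r + einv s) (fun x => cmod (symb m lam x)) S.
  apply/bndP => //; rewrite -halpha hI /S -powRrM -aV mulVf ?gt_eqF// powRr1//.
  exact: ltW.
have na0 : 0 <= fine (cnorm r a) by apply: fine_ge0; exact: cnorm_ge0.
have nb0 : 0 <= fine (cnorm s b) by apply: fine_ge0; exact: cnorm_ge0.
have hna := cnorm_bnd hr ha; have hnb := cnorm_bnd hs hb.
set na := fine (cnorm r a) in na0 hna *; set nb := fine (cnorm s b) in nb0 hnb *.
pose K := (2 * pi) `^ (- (n%:R * (einv r + einv s))) * S * na.
have K0 : 0 <= K by rewrite !mulr_ge0// ?powR_ge0// ltW.
have key : 1 <= K * nb.
  (* [eigenvalue_bound] asks for a positive bound on the norm of [b], whereas [nb] could be [0] at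
     this point; it is enlarged by an amount that costs at most [e]. *)
  apply/ler_addgt0Pr => e e0.
  have d0 : 0 < e / (K + 1) by rewrite divr_gt0// ltr_wpDl.
  have nbd : nb <= nb + e / (K + 1) by rewrite lerDl ltW.
  have h := eigenvalue_bound hn hlam hp ha.1 hb.1 (einv_ge0 _ hr) (einv_ge0 _ hs) hr1 hr2 hs1 hs2
    S0 hS na0 hna (ltr_wpDl nb0 d0) (bnd_le (einv_ge0 _ hs) nb0 nbd hnb) isQ eigQ.
  apply: le_trans h _; rewrite -/K mulrDr lerD2l mulrA ler_pdivrMr ?ltr_wpDl//.
  by rewrite mulrDr mulr1 mulrC lerDl ltW.
have : 1 <= (K * nb) `^ alpha.
  have {1}-> : (1 : R) = 1 `^ alpha by rewrite powR1.
  by apply: (ge0_ler_powR (ltW a0) _ _ key); rewrite nnegrE ?ler01//; exact: mulr_ge0.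
(* Raising to the power [alpha] turns [(2 pi)^(-n/alpha)] into [(2 pi)^(-n)], which cancels the
   factor [(2 pi)^n] contained in [X]. *)
have -> : (K * nb) `^ alpha = ((2 * pi) `^ n%:R)^-1 * X * na `^ alpha * nb `^ alpha.
  have e1 : ((2 * pi) `^ (- (n%:R * (einv r + einv s)))) `^ alpha = ((2 * pi) `^ n%:R)^-1.
    by rewrite -powRrM -aV mulNr -mulrA mulVf ?gt_eqF// mulr1 powRN.
  have e2 : S `^ alpha = X by rewrite /S -powRrM -aV mulVf ?gt_eqF// powRr1// ltW.
  rewrite (powRM _ K0 nb0) (powRM _ (mulr_ge0 (powR_ge0 _ _) (ltW S0)) na0).
  by rewrite (powRM _ (powR_ge0 _ _) (ltW S0)) e1 e2.
have -> : cmod lam `^ (alpha - n%:R / (2 * m)) = L^-1.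
  by rewrite /L -powRN; congr (_ `^ _); ring.
move=> h; rewrite -(ler_pM2l L0) mulfV ?gt_eqF//; apply: le_trans h _.
rewrite /X mulKf ?gt_eqF// le_eqVlt; apply/orP; left; apply/eqP.
by rewrite !mulrA.
Qed.
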